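(* Let $\gamma$ be an admissible function (with parameters $\alpha_0\in(\frac{\pi}{2},\pi]$ and $c>0$) and suppose that \[ \limsup_{\rho\to\infty}\varepsilon(\rho)<2 . \] Then, for every sufficiently small $\delta>0$, \[ zE(z)+\frac1{\gamma(0)}=\bigl(1+o(1)\bigr)\sqrt{2\pi\,\frac{L(s)}{L'(s)}}\,\exp\left(s^2\,\frac{L'(s)}{L(s)}\right)+o(1),\qquad z\to\infty, \] uniformly in $z\in\Omega(\frac{\pi}{2}+\delta)$, and \[ zE(z)+\frac1{\gamma(0)}=o(1),\qquad z\to\infty, \] uniformly in $z\in\mathbb{C}\setminus\Omega(\frac{\pi}{2}+\delta)$. Here $s=s_z$ is the solution of the saddle-point equation corresponding to $z$, and the branch of the square root is the one that is positive on the positive half-line.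
   Context: Let $\frac{\pi}{2}<\alpha_0\le\pi$ and $c>0$. Let $\gamma$ be analytic and non-vanishing in the angle $\{s:|\arg(s+c)|<\alpha_0\}$ and positive on $(-c,+\infty)$. Using the branch of $\log\gamma$ that is real on $(-c,+\infty)$, put $\log L(s)=\frac1s\log\gamma(s)$, i.e. $L(s)=\gamma(s)^{1/s}$, and $\varepsilon(s)=s\,\frac{L'(s)}{L(s)}$. The function $\gamma$ is called admissible if $\varepsilon$ is positive and bounded on $\mathbb{R}_+$ and (A) $\int^\infty \frac{\varepsilon(\rho)}{\rho}\,d\rho=\infty$; (B) $\rho|\varepsilon'(\rho)|=o(\varepsilon(\rho))$ as $\rho\to\infty$; (C) for $s=\rho e^{i\theta}$, $\rho\to\infty$, one has $\varepsilon(s)=(1+o(1))\varepsilon(\rho)$, uniformly in any angle $|\theta|\le\alpha_0-\delta$, $\delta>0$. $E$ is the entire function \[ E(z)=\sum_{n\ge0}\frac{z^n}{\gamma(n+1)} . \] Put $\Phi(s)=\log L(s)+s\,\frac{L'(s)}{L(s)}$. For $0<\alpha<\alpha_0$ and $\rho_0>0$ put $S(\alpha,\rho_0)=\{s:|\arg s|<\alpha,\ |s|>\rho_0\}$. For $\rho_0$ sufficiently large $\Phi$ is univalent in $S(\alpha,\rho_0)$; such a $\rho_0$ is fixed, and $\Omega(\alpha)=\Omega(\alpha,\rho_0)$ denotes the domain on the Riemann surface of $\log z$ consisting of the points $z$ with $\log z=\Phi(s)$, $s\in S(\alpha,\rho_0)$. If $\limsup_{\rho\to\infty}\varepsilon(\rho)<\pi/\alpha$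 and $\rho_0$ is large enough, then $|\operatorname{Im}\Phi|<\pi$ on $S(\alpha,\rho_0)$, and $\Omega(\alpha)$ is regarded as a subdomain of the slit plane $\mathbb{C}\setminus\mathbb{R}_-$; under the assumption $\limsup\varepsilon<2$ this applies to $\alpha=\frac{\pi}{2}+\delta$ with sufficiently small $\delta>0$. For $z\in\Omega(\alpha)$, $s_z\in S(\alpha,\rho_0)$ is the unique solution of the saddle-point equation $\log L(s)+s\frac{L'(s)}{L(s)}=\log z$. *)

(* Defs.v *)
From Stdlib Require Export Reals.
From Coquelicot Require Export Coquelicot.
Open Scope R_scope.

Definition Cexp (z : C) : C := (exp (Re z) * cos (Im z), exp (Re z) * sin (Im z)).

(* Principal argument, with values in (-PI, PI]; irrelevant value at 0. *)
Definition Carg (z : C) : R :=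
  if Rle_dec 0 (Im z) then acos (Re z / Cmod z) else - acos (Re z / Cmod z).

Definition Clog (z : C) : C := (ln (Cmod z), Carg z).

Definition analytic_at (f : C -> C) (z : C) : Prop :=
  exists (a : nat -> C) (r : R), 0 < r /\
    forall h : C, Cmod h < r ->
      is_pseries (K := C_AbsRing) (V := C_NormedModule) a h (f (z + h)%C).

Definition LimSup_p_infty (f : R -> R) : Rbar :=
  Rbar_glb (fun y : Rbar =>
    exists r : R, y = Lub_Rbar (fun v : R => exists x : R, r < x /\ v = f x)).

(* "f(z) = o(1) as z -> infinity, uniformly in z \in A". *)
Definition vanishes_at_infinity_on (A : C -> Prop) (f : C -> C) : Prop :=
  forall eta : R, 0 < eta ->
    exists M : R, forall z : C, A z -> M < Cmod z -> Cmod (f z) < eta.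

Definition angle (alpha0 c : R) (s : C) : Prop :=
  (s + c)%C <> 0%C /\ Rabs (Carg (s + c)%C) < alpha0.

(* [gamma] is analytic and non-vanishing in the angle, positive on (-c, +oo). *)
Record base_function (alpha0 c : R) (gamma : C -> C) : Prop := {
  base_analytic : forall s : C, angle alpha0 c s -> analytic_at gamma s;
  base_nonzero : forall s : C, angle alpha0 c s -> gamma s <> 0%C;
  base_positive : forall x : R, - c < x ->
    Im (gamma (RtoC x)) = 0 /\ 0 < Re (gamma (RtoC x))
}.

(* The angle is connected, so these three properties determine [lg] on it. *)
Record is_real_log_branch (alpha0 c : R) (gamma lg : C -> C) : Prop := {
  log_continuous : forall s : C, angle alpha0 c s ->
    continuous (T := C_UniformSpace) (U := C_UniformSpace) lg s;
  log_exp : forall s : C, angle alpha0 c s -> Cexp (lg s) = gamma s;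
  log_real : forall x : R, - c < x -> Im (lg (RtoC x)) = 0
}.

(* In the following four definitions [lg] stands for log gamma. *)
Definition logL (lg : C -> C) (s : C) : C := (lg s / s)%C.

Definition L (lg : C -> C) (s : C) : C := Cexp (logL lg s).

Definition eps (lg : C -> C) (s : C) : C := (s * (C_derive (L lg) s / L lg s))%C.

Definition Phi (lg : C -> C) (s : C) : C :=
  (logL lg s + s * (C_derive (L lg) s / L lg s))%C.

(* [eps] is real on the positive half-line. *)
Definition epsR (lg : C -> C) (rho : R) : R := Re (eps lg (RtoC rho)).

Record admissible (alpha0 : R) (lg : C -> C) : Prop := {
  adm_positive : forall rho : R, 0 < rho -> 0 < epsR lg rho;
  adm_bounded : exists M : R, forall rho : R, 0 < rho -> epsR lg rho <= M;
  adm_A : is_lim (fun b : R => RInt (fun rho : R => epsR lg rho / rho) 1 b)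
            p_infty p_infty;
  adm_B : is_domin (Rbar_locally p_infty) (epsR lg)
            (fun rho : R => rho * Cmod (C_derive (eps lg) (RtoC rho)));
  adm_C : forall delta : R, 0 < delta ->
    forall eta : R, 0 < eta ->
    exists M : R, forall rho theta : R, M < rho -> 0 < rho ->
      Rabs theta <= alpha0 - delta ->
      Cmod (eps lg (rho * Cexp (Ci * theta))%C - eps lg (RtoC rho))
        <= eta * epsR lg rho
}.

Definition E (gamma : C -> C) (z : C) : C :=
  iota (T := C_CompleteNormedModule) (fun l : C =>
    is_series (K := C_AbsRing) (V := C_NormedModule)
      (fun n : nat => (Cpow z n / gamma (RtoC (INR (n + 1))))%C) l).

Definition sectorS (alpha rho0 : R) (s : C) : Prop :=
  Rabs (Carg s) < alpha /\ rho0 < Cmod s.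

(* Used for [Phi], which is analytic on [A]: only injectivity is left to state. *)
Definition univalent_on (A : C -> Prop) (f : C -> C) : Prop :=
  forall s t : C, A s -> A t -> f s = f t -> s = t.

(* [s] solves the saddle-point equation Phi(s) = log z, for z <> 0. *)
Definition saddle_point (lg : C -> C) (alpha rho0 : R) (z s : C) : Prop :=
  z <> 0%C /\ sectorS alpha rho0 s /\ Phi lg s = Clog z.

(* As a subset of the slit plane: meaningful when |Im Phi| < PI on
   [sectorS alpha rho0], so that the principal logarithm is the right one. *)
Definition Omega (lg : C -> C) (alpha rho0 : R) (z : C) : Prop :=
  exists s : C, saddle_point lg alpha rho0 z s.

(* [sq] is, as a function of s, the branch of sqrt (2 pi L(s) / L'(s)) that is
   positive on the positive half-line. *)
Record is_sqrt_branch (lg : C -> C) (alpha rho0 : R) (sq : C -> C) : Prop := {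
  sq_continuous : forall s : C, sectorS alpha rho0 s ->
    continuous (T := C_UniformSpace) (U := C_UniformSpace) sq s;
  sq_square : forall s : C, sectorS alpha rho0 s ->
    (sq s * sq s)%C = (2 * PI * (L lg s / C_derive (L lg) s))%C;
  sq_positive : forall x : R, rho0 < x ->
    Im (sq (RtoC x)) = 0 /\ 0 < Re (sq (RtoC x))
}.

(* Main.v *)
(** Write f(s) = z^s / gamma(s), so that z E(z) + 1/gamma(0) is the sum of f over the
    nonnegative integers.  Since limsup eps < 2, f times either Abel-Plana kernel
    1/(e^(-+2 pi i s) - 1) decays exponentially along vertical lines, even for
    |arg z| = PI, so the sum equals G(+oo) - G(-c') up to o(1), where G is a
    primitive of f and 0 < c' < c.  In the variable w = log s the exponent
    h = s log z - log gamma(s) satisfies dh/dw = s (log z - Phi(s)), and by (B) and (C)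
    eps(s) is asymptotically constant at bounded logarithmic distance, so near the
    saddle point h is a quadratic with Hessian of size rho eps(rho).  The increment
    of G is computed along rays arg s = const, which pass through the saddle point
    when z lies in Omega: the starting piece is negligible, and two Gaussian halves
    give the main term.  If z has no saddle point in the sector, or one beyond the
    imaginary direction, a path on which Re h is very negative shows that the
    increment is o(1). *)

Require Import Defs.
From Stdlib Require Import Psatz ClassicalEpsilon Ranalysis5.

(** The bound 2 for eps is where the kernel stops winning: on a vertical line z^s costs up to exp(PI
    t), 1/gamma(s) about exp(eps PI t / 2), and the kernel gains exp(-2 PI t). No contour integral
    occurs: f has primitives on star-shaped domains, so path independence is automatic, and residues
    are avoided by subtracting f(m), which makes the pole of the kernel at m removable. In w = log s
    rays become horizontal lines, and (B), (C) say that one function varies slowly on a strip. The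
    obstacle is the neighbourhood of the imaginary directions. There the main term may be bounded,
    so the increment of G from -c' to the start of the path has to be o(1); this forces a start with
    Re s < 0, where z^s is small. But f grows at infinity in that half-plane, so the path must end
    with Re s > 0: it comes in at the angle PI/2 + d1, crosses the imaginary direction near the
    modulus of the saddle and leaves at PI/2 - d1. When the saddle lies well inside the right
    half-plane, the main term exceeds every fixed power of z, any fixed start is good enough, and a
    single ray through the saddle suffices. *)

Lemma Ceq (z w : C) : Re z = Re w -> Im z = Im w -> z = w.
Proof. destruct z, w; simpl; intros; subst; reflexivity. Qed.

Lemma Re_plus (z w : C) : Re (z + w)%C = Re z + Re w. Proof. reflexivity. Qed.
Lemma Im_plus (z w : C) : Im (z + w)%C = Im z + Im w. Proof. reflexivity. Qed.
Lemma Re_opp (z : C) : Re (- z)%C = - Re z. Proof. reflexivity. Qed.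
Lemma Im_opp (z : C) : Im (- z)%C = - Im z. Proof. reflexivity. Qed.
Lemma Re_minus (z w : C) : Re (z - w)%C = Re z - Re w. Proof. reflexivity. Qed.
Lemma Im_minus (z w : C) : Im (z - w)%C = Im z - Im w. Proof. reflexivity. Qed.
Lemma Re_mult (z w : C) : Re (z * w)%C = Re z * Re w - Im z * Im w.
Proof. reflexivity. Qed.
Lemma Im_mult (z w : C) : Im (z * w)%C = Re z * Im w + Im z * Re w.
Proof. reflexivity. Qed.
Lemma Re_RtoC (x : R) : Re (RtoC x) = x. Proof. reflexivity. Qed.
Lemma Im_RtoC (x : R) : Im (RtoC x) = 0. Proof. reflexivity. Qed.

Ltac Csimpl := repeat progress rewrite ?Re_plus, ?Im_plus, ?Re_opp, ?Im_opp, ?Re_minus, ?Im_minus,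
  ?Re_mult, ?Im_mult, ?Re_RtoC, ?Im_RtoC.

Lemma re_le (z : C) : Rabs (Re z) <= Cmod z.
Proof. apply re_le_Cmod. Qed.

Lemma im_le (z : C) : Rabs (Im z) <= Cmod z.
Proof.
  apply Rle_trans with (2 := Rmax_Cmod z). apply Rmax_r.
Qed.

Lemma Re_le_Cmod (z : C) : Re z <= Cmod z.
Proof. generalize (re_le z) (Rle_abs (Re z)); lra. Qed.

Lemma Cmod_le_abs (z : C) : Cmod z <= Rabs (Re z) + Rabs (Im z).
Proof.
  replace z with (RtoC (Re z) + Ci * RtoC (Im z))%C at 1.
  2:{ apply Ceq; simpl; ring. }
  apply Rle_trans with (1 := Cmod_triangle _ _).
  rewrite Cmod_mult, Cmod_Ci, !Cmod_R. lra.
Qed.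

Lemma Cmod_sym (z w : C) : Cmod (z - w)%C = Cmod (w - z)%C.
Proof. rewrite <- Cmod_opp. f_equal. ring. Qed.

Lemma Cmod_minus_le (z w : C) : Cmod z - Cmod w <= Cmod (z - w)%C.
Proof.
  generalize (Cmod_triangle (z - w) w).
  replace (z - w + w)%C with z by ring. lra.
Qed.

Lemma Cmod_plus_ge (z w : C) : Cmod z - Cmod w <= Cmod (z + w)%C.
Proof.
  generalize (Cmod_minus_le z (- w)%C). rewrite Cmod_opp.
  replace (z - - w)%C with (z + w)%C by ring. lra.
Qed.

Lemma Cmod_minus_triangle (z w : C) : Cmod (z - w)%C <= Cmod z + Cmod w.
Proof.
  generalize (Cmod_triangle z (- w)%C). rewrite Cmod_opp. tauto.
Qed.

Lemma Cmod_RtoC_pos (x : R) : 0 <= x -> Cmod (RtoC x) = x.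
Proof. intros. rewrite Cmod_R. apply Rabs_pos_eq; assumption. Qed.

(** * Complex derivatives *)

(* [P] restricts the increments, so that derivatives along the real line and
   complex derivatives share their rules. *)
Definition der (P : C -> Prop) (f : C -> C) (z l : C) : Prop :=
  forall e : R, 0 < e -> exists d : R, 0 < d /\
    forall h : C, P h -> Cmod h < d ->
      Cmod (f (z + h) - f z - h * l)%C <= e * Cmod h.

Definition cont (P : C -> Prop) (f : C -> C) (z : C) : Prop :=
  forall e : R, 0 < e -> exists d : R, 0 < d /\
    forall h : C, P h -> Cmod h < d -> Cmod (f (z + h) - f z)%C < e.

Definition cder : (C -> C) -> C -> C -> Prop := der (fun _ => True).
Definition ccont : (C -> C) -> C -> Prop := cont (fun _ => True).
Definition rder (u : R -> C) (t : R) (l : C) : Prop :=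
  der (fun h => Im h = 0) (fun z => u (Re z)) (RtoC t) l.
Definition rcont (u : R -> C) (t : R) : Prop :=
  cont (fun h => Im h = 0) (fun z => u (Re z)) (RtoC t).

Section DerRules.
Context (P : C -> Prop).

Lemma der_cont (f : C -> C) (z l : C) : der P f z l -> cont P f z.
Proof.
  intros H e He. destruct (H 1 Rlt_0_1) as [d [Hd K]].
  set (M := 1 + Cmod l). assert (HM : 0 < M) by (generalize (Cmod_ge_0 l); unfold M; lra).
  exists (Rmin d (e / (2 * M))). split.
  - apply Rmin_pos; auto. apply Rdiv_lt_0_compat; lra.
  - intros h Ph Hh.
    assert (h1 : Cmod h < d) by (apply Rlt_le_trans with (1 := Hh); apply Rmin_l).
    assert (h2 : Cmod h < e / (2 * M)) by (apply Rlt_le_trans with (1 := Hh); apply Rmin_r).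
    specialize (K h Ph h1).
    replace (f (z + h) - f z)%C with ((f (z + h) - f z - h * l) + h * l)%C by ring.
    apply Rle_lt_trans with (1 := Cmod_triangle _ _). rewrite Cmod_mult.
    apply Rle_lt_trans with (M * Cmod h). unfold M; lra.
    apply Rlt_le_trans with (M * (e / (2 * M))). apply Rmult_lt_compat_l; auto.
    apply Rle_trans with (e / 2); [right; field; lra | lra].
Qed.

Lemma der_ext (f g : C -> C) (z l : C) :
  (forall w, f w = g w) -> der P f z l -> der P g z l.
Proof.
  intros E H e He. destruct (H e He) as [d [Hd K]]. exists d; split; auto.
  intros h Ph Hh. rewrite <- !E. auto.
Qed.

Lemma der_eq (f : C -> C) (z l m : C) : der P f z l -> l = m -> der P f z m.
Proof. intros H <-; exact H. Qed.

Lemma der_ext_loc (f g : C -> C) (z l : C) (r : R) : 0 < r ->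
  (forall h, P h -> Cmod h < r -> f (z + h)%C = g (z + h)%C) -> f z = g z ->
  der P f z l -> der P g z l.
Proof.
  intros Hr E E0 H e He. destruct (H e He) as [d [Hd K]]. exists (Rmin d r); split.
  apply Rmin_pos; auto.
  intros h Ph Hh. rewrite <- E, <- E0. apply K; auto.
  apply Rlt_le_trans with (1 := Hh); apply Rmin_l. auto.
  apply Rlt_le_trans with (1 := Hh); apply Rmin_r.
Qed.

Lemma der_const (c z : C) : der P (fun _ => c) z 0%C.
Proof.
  intros e He. exists 1; split; [lra|]. intros h _ _.
  replace (c - c - h * 0)%C with (RtoC 0) by ring. rewrite Cmod_0.
  apply Rmult_le_pos; [lra | apply Cmod_ge_0].
Qed.

Lemma der_id (z : C) : der P (fun w => w) z 1%C.
Proof.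
  intros e He. exists 1; split; [lra|]. intros h _ _.
  replace (z + h - z - h * 1)%C with (RtoC 0) by ring. rewrite Cmod_0.
  apply Rmult_le_pos; [lra | apply Cmod_ge_0].
Qed.

Lemma der_plus (f g : C -> C) (z l m : C) :
  der P f z l -> der P g z m -> der P (fun w => f w + g w)%C z (l + m)%C.
Proof.
  intros Hf Hg e He.
  destruct (Hf (e / 2)) as [d1 [H1 K1]]; [lra|].
  destruct (Hg (e / 2)) as [d2 [H2 K2]]; [lra|].
  exists (Rmin d1 d2); split; [apply Rmin_pos; auto|]. intros h Ph Hh.
  specialize (K1 h Ph (Rlt_le_trans _ _ _ Hh (Rmin_l _ _))).
  specialize (K2 h Ph (Rlt_le_trans _ _ _ Hh (Rmin_r _ _))).
  replace (f (z + h) + g (z + h) - (f z + g z) - h * (l + m))%C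
    with ((f (z + h) - f z - h * l) + (g (z + h) - g z - h * m))%C by ring.
  apply Rle_trans with (1 := Cmod_triangle _ _). lra.
Qed.

Lemma der_mult (f g : C -> C) (z l m : C) :
  der P f z l -> der P g z m ->
  der P (fun w => f w * g w)%C z (l * g z + f z * m)%C.
Proof.
  intros Hf Hg e He.
  destruct (der_cont g z m Hg 1 Rlt_0_1) as [d0 [H0 K0]].
  set (A := 1 + Cmod (g z)). assert (HA : 0 < A) by (generalize (Cmod_ge_0 (g z)); unfold A; lra).
  set (B := 1 + Cmod (f z)). assert (HB : 0 < B) by (generalize (Cmod_ge_0 (f z)); unfold B; lra).
  set (D := 1 + Cmod l). assert (HD : 0 < D) by (generalize (Cmod_ge_0 l); unfold D; lra).
  destruct (Hf (e / (3 * A))) as [d1 [H1 K1]]; [apply Rdiv_lt_0_compat; lra|].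
  destruct (Hg (e / (3 * B))) as [d2 [H2 K2]]; [apply Rdiv_lt_0_compat; lra|].
  destruct (der_cont g z m Hg (e / (3 * D))) as [d3 [H3 K3]]; [apply Rdiv_lt_0_compat; lra|].
  exists (Rmin (Rmin d0 d1) (Rmin d2 d3)); split; [repeat apply Rmin_pos; auto|].
  intros h Ph Hh.
  assert (h01 := Rlt_le_trans _ _ _ Hh (Rmin_l _ _)).
  assert (h23 := Rlt_le_trans _ _ _ Hh (Rmin_r _ _)).
  specialize (K0 h Ph (Rlt_le_trans _ _ _ h01 (Rmin_l _ _))).
  specialize (K1 h Ph (Rlt_le_trans _ _ _ h01 (Rmin_r _ _))).
  specialize (K2 h Ph (Rlt_le_trans _ _ _ h23 (Rmin_l _ _))).
  specialize (K3 h Ph (Rlt_le_trans _ _ _ h23 (Rmin_r _ _))).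
  replace (f (z + h) * g (z + h) - (f z * g z) - h * (l * g z + f z * m))%C
    with ((f (z + h) - f z - h * l) * g (z + h) + (h * l * (g (z + h) - g z)
           + f z * (g (z + h) - g z - h * m)))%C by ring.
  assert (gb : Cmod (g (z + h)%C) <= A).
  { unfold A. generalize (Cmod_minus_le (g (z + h)%C) (g z)). lra. }
  assert (Hge := Cmod_ge_0 h).
  apply Rle_trans with (1 := Cmod_triangle _ _).
  apply Rle_trans with (e * Cmod h / 3 + (e * Cmod h / 3 + e * Cmod h / 3)); [|lra].
  apply Rplus_le_compat; [|apply Rle_trans with (1 := Cmod_triangle _ _); apply Rplus_le_compat].
  - rewrite Cmod_mult.
    apply Rle_trans with (e / (3 * A) * Cmod h * A).
    apply Rmult_le_compat; auto; apply Cmod_ge_0. right; field; lra.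
  - rewrite !Cmod_mult.
    apply Rle_trans with (Cmod h * D * (e / (3 * D))).
    apply Rmult_le_compat; try apply Rmult_le_pos; try apply Cmod_ge_0; [|lra].
    apply Rmult_le_compat_l; auto; unfold D; lra. right; field; lra.
  - rewrite !Cmod_mult.
    apply Rle_trans with (B * (e / (3 * B) * Cmod h)).
    apply Rmult_le_compat; try apply Cmod_ge_0; auto. unfold B; lra. right; field; lra.
Qed.

Lemma der_scal (c : C) (f : C -> C) (z l : C) :
  der P f z l -> der P (fun w => c * f w)%C z (c * l)%C.
Proof.
  intros H. replace (c * l)%C with (0 * f z + c * l)%C by ring.
  apply (der_mult (fun _ => c)); auto. apply der_const.
Qed.

Lemma der_opp (f : C -> C) (z l : C) :
  der P f z l -> der P (fun w => - f w)%C z (- l)%C.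
Proof.
  intros H. apply der_ext with (fun w => - (1) * f w)%C. intros; ring.
  replace (- l)%C with (- (1) * l)%C by ring. apply der_scal; auto.
Qed.

Lemma der_minus (f g : C -> C) (z l m : C) :
  der P f z l -> der P g z m -> der P (fun w => f w - g w)%C z (l - m)%C.
Proof. intros. apply (der_plus f (fun w => - g w)%C); auto. apply der_opp; auto. Qed.

(** The outer function needs a full complex derivative, since the increments of the inner one are
    not confined to [P]. A complex function along a real-variable curve is thereby covered as
    well. *)
Lemma der_comp (f g : C -> C) (z l m : C) :
  cder g (f z) m -> der P f z l -> der P (fun w => g (f w)) z (l * m)%C.
Proof.
  intros Hg Hf e He.
  set (D := 1 + Cmod l). assert (HD : 0 < D) by (generalize (Cmod_ge_0 l); unfold D; lra).
  set (B := 1 + Cmod m). assert (HB : 0 < B) by (generalize (Cmod_ge_0 m); unfold B; lra).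
  destruct (Hg (e / (2 * D))) as [d1 [H1 K1]]; [apply Rdiv_lt_0_compat; lra|].
  destruct (Hf 1 Rlt_0_1) as [d2 [H2 K2]].
  destruct (Hf (e / (2 * B))) as [d3 [H3 K3]]; [apply Rdiv_lt_0_compat; lra|].
  destruct (der_cont f z l Hf d1 H1) as [d4 [H4 K4]].
  exists (Rmin d2 (Rmin d3 d4)); split; [repeat apply Rmin_pos; auto|].
  intros h Ph Hh.
  specialize (K2 h Ph (Rlt_le_trans _ _ _ Hh (Rmin_l _ _))).
  assert (h34 := Rlt_le_trans _ _ _ Hh (Rmin_r _ _)).
  specialize (K3 h Ph (Rlt_le_trans _ _ _ h34 (Rmin_l _ _))).
  specialize (K4 h Ph (Rlt_le_trans _ _ _ h34 (Rmin_r _ _))).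
  set (k := (f (z + h) - f z)%C) in *.
  specialize (K1 k I K4). replace (f z + k)%C with (f (z + h)%C) in K1 by (unfold k; ring).
  assert (Hge := Cmod_ge_0 h).
  assert (kb : Cmod k <= D * Cmod h).
  { replace k with ((k - h * l) + h * l)%C by ring.
    apply Rle_trans with (1 := Cmod_triangle _ _). rewrite Cmod_mult. unfold D. lra. }
  replace (g (f (z + h)) - g (f z) - h * (l * m))%C with
    ((g (f (z + h)) - g (f z) - k * m) + (k - h * l) * m)%C by ring.
  apply Rle_trans with (1 := Cmod_triangle _ _).
  apply Rle_trans with (e * Cmod h / 2 + e * Cmod h / 2); [|lra].
  apply Rplus_le_compat.
  - apply Rle_trans with (1 := K1).
    apply Rle_trans with (e / (2 * D) * (D * Cmod h)).
    apply Rmult_le_compat_l; auto. apply Rlt_le, Rdiv_lt_0_compat; lra. right; field; lra.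
  - rewrite Cmod_mult. apply Rle_trans with (e / (2 * B) * Cmod h * B).
    apply Rmult_le_compat; auto; try apply Cmod_ge_0. unfold B; lra. right; field; lra.
Qed.

End DerRules.

Lemma cder_inv (z : C) : z <> 0%C -> cder Cinv z (- / (z * z))%C.
Proof.
  intros Hz e He.
  assert (Hm : 0 < Cmod z) by (apply Cmod_gt_0; auto).
  set (m := Cmod z) in *.
  exists (Rmin (m / 2) (e * m * m * m / 2)). split.
  - apply Rmin_pos; [lra|]. assert (0 < e * m * m * m) by (repeat apply Rmult_lt_0_compat; auto). lra.
  - intros h _ Hh.
    assert (h1 := Rlt_le_trans _ _ _ Hh (Rmin_l _ _)).
    assert (h2 := Rlt_le_trans _ _ _ Hh (Rmin_r _ _)).
    assert (hz : m / 2 < Cmod (z + h)%C) by (generalize (Cmod_plus_ge z h); fold m; lra).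
    assert (hz0 : (z + h)%C <> 0%C) by (intro E; rewrite E, Cmod_0 in hz; lra).
    replace (/ (z + h) - / z - h * - / (z * z))%C with (h * h * / (z * z * (z + h)))%C
      by (field; auto).
    assert (Hge := Cmod_ge_0 h).
    rewrite Cmod_mult, Cmod_inv, !Cmod_mult. fold m.
    2:{ repeat apply Cmult_neq_0; auto. }
    apply Rle_trans with (Cmod h * (e * m * m * m / 2) * / (m * m * (m / 2))).
    + apply Rmult_le_compat.
      * apply Rmult_le_pos; auto.
      * apply Rlt_le, Rinv_0_lt_compat. repeat apply Rmult_lt_0_compat; lra.
      * apply Rmult_le_compat_l; lra.
      * apply Rinv_le_contravar. repeat apply Rmult_lt_0_compat; lra.
        apply Rmult_le_compat_l. apply Rlt_le, Rmult_lt_0_compat; auto. lra.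
    + right. field. lra.
Qed.

Lemma der_unique (f : C -> C) (z l m : C) : cder f z l -> cder f z m -> l = m.
Proof.
  intros H1 H2.
  destruct (Req_dec (Cmod (l - m)%C) 0) as [E|N].
  - apply Cmod_eq_0 in E. replace l with (l - m + m)%C by ring. rewrite E. ring.
  - exfalso. assert (Hp : 0 < Cmod (l - m)%C) by (generalize (Cmod_ge_0 (l - m)%C); lra).
    set (q := Cmod (l - m)%C) in *.
    destruct (H1 (q / 4)) as [d1 [D1 K1]]; [lra|].
    destruct (H2 (q / 4)) as [d2 [D2 K2]]; [lra|].
    set (d := Rmin d1 d2 / 2).
    assert (0 < Rmin d1 d2) by (apply Rmin_pos; auto).
    assert (Hd : 0 < d) by (unfold d; lra).
    assert (A1 : Cmod (RtoC d) < d1) by (rewrite Cmod_RtoC_pos by lra; generalize (Rmin_l d1 d2); unfold d; lra).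
    assert (A2 : Cmod (RtoC d) < d2) by (rewrite Cmod_RtoC_pos by lra; generalize (Rmin_r d1 d2); unfold d; lra).
    specialize (K1 _ I A1). specialize (K2 _ I A2).
    assert (K : Cmod (d * (l - m))%C <= q / 2 * d).
    { replace (d * (l - m))%C with ((f (z + d) - f z - d * m) - (f (z + d) - f z - d * l))%C by ring.
      apply Rle_trans with (1 := Cmod_minus_triangle _ _).
      rewrite Cmod_RtoC_pos in K1, K2 by lra. lra. }
    rewrite Cmod_mult, Cmod_RtoC_pos in K by lra. fold q in K. nra.
Qed.

Lemma rder_components (u : R -> C) (t : R) (l : C) :
  rder u t l -> is_derive (fun x => Re (u x)) t (Re l) /\ is_derive (fun x => Im (u x)) t (Im l).
Proof.
  intros H. split; apply is_derive_Reals; intros e He;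
  destruct (H (e / 2)) as [d [Hd K]]; try lra; exists (mkposreal d Hd); simpl;
  intros h Hh Hb; specialize (K (RtoC h) eq_refl); rewrite Cmod_R in K; specialize (K Hb);
  simpl in K; assert (0 < Rabs h) by (apply Rabs_pos_lt; auto).
  - apply (Rle_trans _ _ _ (re_le _)) in K.
    replace ((Re (u (t + h)) - Re (u t)) / h - Re l) with
      (Re (u (t + h)%R - u t - h * l)%C / h) by (Csimpl; field; auto).
    unfold Rdiv. rewrite Rabs_mult, Rabs_inv.
    apply Rmult_lt_reg_r with (Rabs h); auto. rewrite Rmult_assoc, Rinv_l by lra. nra.
  - apply (Rle_trans _ _ _ (im_le _)) in K.
    replace ((Im (u (t + h)) - Im (u t)) / h - Im l) with
      (Im (u (t + h)%R - u t - h * l)%C / h) by (Csimpl; field; auto).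
    unfold Rdiv. rewrite Rabs_mult, Rabs_inv.
    apply Rmult_lt_reg_r with (Rabs h); auto. rewrite Rmult_assoc, Rinv_l by lra. nra.
Qed.

Lemma is_derive_eps (f : R -> R) (t l : R) : is_derive f t l ->
  forall e, 0 < e -> exists d, 0 < d /\ forall h, Rabs h < d ->
    Rabs (f (t + h) - f t - h * l) <= e * Rabs h.
Proof.
  intros H e He. apply is_derive_Reals in H. destruct (H e He) as [d K].
  exists d; split; [apply cond_pos|]. intros h Hh.
  destruct (Req_dec h 0) as [->|N].
  - replace (f (t + 0) - f t - 0 * l) with 0 by (rewrite Rplus_0_r; ring).
    rewrite Rabs_R0. lra.
  - specialize (K h N Hh).
    replace (f (t + h) - f t - h * l) with (((f (t + h) - f t) / h - l) * h) by (field; auto).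
    rewrite Rabs_mult. apply Rmult_le_compat_r. apply Rabs_pos. lra.
Qed.

Lemma components_rder (u : R -> C) (t : R) (l : C) :
  is_derive (fun x => Re (u x)) t (Re l) -> is_derive (fun x => Im (u x)) t (Im l) -> rder u t l.
Proof.
  intros H1 H2 e He.
  destruct (is_derive_eps _ _ _ H1 (e / 2)) as [d1 [D1 K1]]; [lra|].
  destruct (is_derive_eps _ _ _ H2 (e / 2)) as [d2 [D2 K2]]; [lra|].
  exists (Rmin d1 d2); split; [apply Rmin_pos; auto|]. intros h Ph Hh.
  replace h with (RtoC (Re h)) in * by (apply Ceq; simpl; auto).
  set (k := Re h) in *. rewrite Cmod_R in *.
  specialize (K1 k (Rlt_le_trans _ _ _ Hh (Rmin_l _ _))).
  specialize (K2 k (Rlt_le_trans _ _ _ Hh (Rmin_r _ _))).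
  apply Rle_trans with (1 := Cmod_le_abs _). Csimpl.
  replace (Re (u (t + k)%R) - Re (u t) - (k * Re l - 0 * Im l)) with
    (Re (u (t + k)%R) - Re (u t) - k * Re l) by ring.
  replace (Im (u (t + k)%R) - Im (u t) - (k * Im l + 0 * Re l)) with
    (Im (u (t + k)%R) - Im (u t) - k * Im l) by ring.
 lra.
Qed.

Lemma rder_comp (g : C -> C) (u : R -> C) (t : R) (l m : C) :
  cder g (u t) m -> rder u t l -> rder (fun x => g (u x)) t (l * m)%C.
Proof. intros Hg Hu. apply (der_comp _ (fun z => u (Re z)) g); auto. Qed.

Lemma cder_comp (g f : C -> C) (z l m : C) :
  cder g (f z) m -> cder f z l -> cder (fun w => g (f w)) z (l * m)%C.
Proof. intros; apply der_comp; auto. Qed.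

Lemma rder_RtoC (f : R -> R) (t l : R) : is_derive f t l -> rder (fun x => RtoC (f x)) t (RtoC l).
Proof. intros H. apply components_rder; simpl; auto. apply @is_derive_const. Qed.

Lemma rder_affine (a b : C) (t : R) : rder (fun x => a + x * b)%C t b.
Proof.
  eapply der_eq.
  { apply (der_plus _ (fun _ => a) (fun z => (RtoC (Re z)) * b)%C).
    apply der_const. apply (der_mult _ (fun z => RtoC (Re z)) (fun _ => b)).
    apply (rder_RtoC (fun x => x)). apply @is_derive_id. apply der_const. }
  change (@one R_AbsRing) with 1. ring.
Qed.

Lemma Rder_plus (f g : R -> R) (t l m : R) :
  is_derive f t l -> is_derive g t m -> is_derive (fun x => f x + g x) t (l + m).
Proof. intros H K. exact (is_derive_plus f g t l m H K). Qed.

Lemma Rder_minus (f g : R -> R) (t l m : R) :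
  is_derive f t l -> is_derive g t m -> is_derive (fun x => f x - g x) t (l - m).
Proof. intros H K. exact (is_derive_minus f g t l m H K). Qed.

Lemma Rder_scal (c : R) (f : R -> R) (t l : R) :
  is_derive f t l -> is_derive (fun x => c * f x) t (c * l).
Proof. intros H. exact (is_derive_scal f t c l H). Qed.

Lemma Rder_id (t : R) : is_derive (fun x : R => x) t 1.
Proof. exact (is_derive_id t). Qed.

Lemma Rder_eq (f : R -> R) (t l m : R) : is_derive f t l -> l = m -> is_derive f t m.
Proof. intros H <-; exact H. Qed.

(** * The mean value inequality *)

Lemma monotone_of_derive (f f' : R -> R) (a b : R) : a <= b ->
  (forall t, a <= t <= b -> is_derive f t (f' t)) -> (forall t, a <= t <= b -> 0 <= f' t) ->
  f a <= f b.
Proof.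
  intros Hab D Hp.
  destruct (MVT_gen f a b f') as [x [Hx E]]; rewrite ?Rmin_left, ?Rmax_right in * by lra.
  - intros; apply D; lra.
  - intros x Hx. apply continuity_pt_filterlim, @ex_derive_continuous. eexists; apply D; auto.
  - specialize (Hp x Hx). nra.
Qed.

(** The real mean value theorem, applied to the component of [u] in the direction [u b - u a]. The
    majorant is given through its primitive [B], so that this lemma replaces the estimate of one
    integral by another in all path estimates. *)
Lemma mean_value_le (u : R -> C) (u' : R -> C) (B B' : R -> R) (a b : R) : a <= b ->
  (forall t, a <= t <= b -> rder u t (u' t)) ->
  (forall t, a <= t <= b -> is_derive B t (B' t)) ->
  (forall t, a <= t <= b -> Cmod (u' t) <= B' t) ->
  Cmod (u b - u a)%C <= B b - B a.
Proof.
  intros Hab Du DB Hle.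
  set (v := (u b - u a)%C).
  destruct (Req_dec (Cmod v) 0) as [E|N].
  - rewrite E.
    assert (B a <= B b); [|lra]. apply monotone_of_derive with B'; auto.
    intros t Ht. apply Rle_trans with (2 := Hle t Ht). apply Cmod_ge_0.
  - set (m := Cmod v) in *. assert (Hm : 0 < m) by (generalize (Cmod_ge_0 v); fold m; lra).
    set (g := fun t => m * B t - (Re v * Re (u t) + Im v * Im (u t))).
    assert (G : g a <= g b).
    { apply monotone_of_derive with (fun t => m * B' t - (Re v * Re (u' t) + Im v * Im (u' t))); auto.
      - intros t Ht. destruct (rder_components _ _ _ (Du t Ht)) as [D1 D2].
        apply Rder_minus; [|apply Rder_plus]; apply Rder_scal; auto.
      - intros t Ht. specialize (Hle t Ht).
        assert (K : Re (Cconj v * u' t)%C <= m * Cmod (u' t)).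
        { apply Rle_trans with (1 := Re_le_Cmod _). rewrite Cmod_mult, Cmod_conj. fold m; lra. }
        assert (Re (Cconj v * u' t)%C = Re v * Re (u' t) + Im v * Im (u' t)) by (Csimpl; change (Re (Cconj v)) with (Re v); change (Im (Cconj v)) with (- Im v); ring).
        nra. }
    assert (E2 : m * m = Re v * Re v + Im v * Im v).
    { generalize (Cmod2_alt v). fold m. lra. }
    unfold g in G.
    assert (R1 : Re v = Re (u b) - Re (u a)) by reflexivity.
    assert (R2 : Im v = Im (u b) - Im (u a)) by reflexivity.
    assert (E3 : m * m = Re v * (Re (u b) - Re (u a)) + Im v * (Im (u b) - Im (u a)))
      by (rewrite <- R1, <- R2; exact E2).
    assert (m * m <= m * (B b - B a)) by lra.
    apply Rmult_le_reg_l with m; auto.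
Qed.

Lemma mean_value_lipschitz (u : R -> C) (u' : R -> C) (M a b : R) : a <= b ->
  (forall t, a <= t <= b -> rder u t (u' t)) ->
  (forall t, a <= t <= b -> Cmod (u' t) <= M) ->
  Cmod (u b - u a)%C <= M * (b - a).
Proof.
  intros Hab D H.
  replace (M * (b - a)) with (M * b - M * a) by ring.
  apply (mean_value_le u u' (fun t => M * t) (fun _ => M)); auto.
  intros. apply Rder_eq with (M * 1); [|ring]. apply Rder_scal, Rder_id.
Qed.

(** The mean value inequality for [f] minus the linear function of slope [l]. With [l = 0] it bounds
    an increment; with an approximate derivative it is a first-order expansion. *)
Lemma segment_increment (f f' : C -> C) (z h l : C) (M : R) :
  (forall t, 0 <= t <= 1 -> cder f (z + t * h)%C (f' (z + t * h)%C)) ->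
  (forall t, 0 <= t <= 1 -> Cmod (f' (z + t * h) - l)%C <= M) ->
  Cmod (f (z + h) - f z - h * l)%C <= M * Cmod h.
Proof.
  intros D H.
  replace (f (z + h) - f z - h * l)%C with
    ((f (z + 1 * h) - (1 * (h * l))) - (f (z + 0 * h) - (0 * (h * l))))%C.
  2:{ replace (z + 1 * h)%C with (z + h)%C by ring.
      replace (z + 0 * h)%C with z by ring. ring. }
  replace (M * Cmod h) with (M * Cmod h * (1 - 0)) by ring.
  apply (mean_value_lipschitz (fun t => f (z + t * h) - t * (h * l))%C
    (fun t => h * f' (z + t * h) - h * l)%C); [lra| |].
  - intros t Ht. apply (der_minus _ (fun x => f (z + Re x * h)%C) (fun x => Re x * (h * l))%C).
    apply (rder_comp f (fun x => z + x * h)%C); auto. apply rder_affine.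
    apply (der_ext _ (fun x => 0 + Re x * (h * l))%C). intros; ring.
    apply (rder_affine 0 (h * l)).
  - intros t Ht. replace (h * f' (z + t * h) - h * l)%C with (h * (f' (z + t * h) - l))%C by ring.
    rewrite Cmod_mult, Rmult_comm. apply Rmult_le_compat_r. apply Cmod_ge_0. auto.
Qed.

(** * The complex exponential *)

Lemma Cexp_plus (z w : C) : Cexp (z + w)%C = (Cexp z * Cexp w)%C.
Proof.
  unfold Cexp. Csimpl. rewrite exp_plus, cos_plus, sin_plus. apply Ceq; simpl; ring.
Qed.

Lemma Cexp_0 : Cexp 0%C = 1%C.
Proof. unfold Cexp. simpl. rewrite exp_0, cos_0, sin_0. apply Ceq; simpl; ring. Qed.

Lemma Cmod_Cexp (z : C) : Cmod (Cexp z) = exp (Re z).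
Proof.
  unfold Cmod, Cexp; simpl.
  replace (exp (Re z) * cos (Im z) * (exp (Re z) * cos (Im z) * 1) +
    exp (Re z) * sin (Im z) * (exp (Re z) * sin (Im z) * 1)) with
    (exp (Re z) * exp (Re z) * (Rsqr (sin (Im z)) + Rsqr (cos (Im z)))) by (unfold Rsqr; ring).
  rewrite sin2_cos2, Rmult_1_r. apply sqrt_square. left; apply exp_pos.
Qed.

Lemma Cexp_neq_0 (z : C) : Cexp z <> 0%C.
Proof. apply Cmod_gt_0. rewrite Cmod_Cexp. apply exp_pos. Qed.

Lemma Cexp_opp (z : C) : Cexp (- z)%C = (/ Cexp z)%C.
Proof.
  assert (E : (Cexp (- z) * Cexp z)%C = 1%C).
  { rewrite <- Cexp_plus. replace (- z + z)%C with (RtoC 0) by ring. apply Cexp_0. }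
  replace (Cexp (- z)%C) with (Cexp (- z) * Cexp z * / Cexp z)%C.
  rewrite E. ring. field. apply Cexp_neq_0.
Qed.

Lemma Cexp_minus (z w : C) : Cexp (z - w)%C = (Cexp z / Cexp w)%C.
Proof. unfold Cminus. rewrite Cexp_plus, Cexp_opp. reflexivity. Qed.

Lemma Cexp_RtoC (x : R) : Cexp (RtoC x) = RtoC (exp x).
Proof. unfold Cexp; simpl. rewrite cos_0, sin_0. apply Ceq; simpl; ring. Qed.

Lemma Cexp_polar (x b : R) : Cexp (x, b) = (exp x * Cexp (Ci * b))%C.
Proof.
  replace (x, b) with (RtoC x + Ci * b)%C. rewrite Cexp_plus, Cexp_RtoC; auto.
  apply Ceq; simpl; ring.
Qed.

Lemma rder_Cexp_line (a b : C) (t : R) :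
  rder (fun x => Cexp (a + x * b)%C) t (b * Cexp (a + t * b))%C.
Proof.
  destruct a as [a1 a2], b as [b1 b2].
  assert (E : forall x : R, ((a1, a2) + x * (b1, b2))%C = (a1 + x * b1, a2 + x * b2))
    by (intros; apply Ceq; simpl; ring).
  apply components_rder; [eapply is_derive_ext; [intros x; rewrite E; reflexivity|]
    | eapply is_derive_ext; [intros x; rewrite E; reflexivity|]];
    rewrite E; unfold Cexp; cbn [Re Im fst snd Cmult]; auto_derive; auto; ring.
Qed.

Lemma exp_le_compat (x y : R) : x <= y -> exp x <= exp y.
Proof.
  intros H. destruct (Rle_lt_or_eq_dec _ _ H) as [L|E]. left; apply exp_increasing; auto.
  rewrite E; lra.
Qed.

Lemma Cexp_bound (w : C) : Cmod (Cexp w - 1)%C <= Cmod w * exp (Cmod w).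
Proof.
  replace (Cexp w - 1)%C with (Cexp (0 + 1 * w) - Cexp (0 + 0 * w))%C.
  2:{ replace (0 + 1 * w)%C with w by ring. replace (0 + 0 * w)%C with (RtoC 0) by ring.
      rewrite Cexp_0. ring. }
  replace (Cmod w * exp (Cmod w)) with (Cmod w * exp (Cmod w) * (1 - 0)) by ring.
  apply (mean_value_lipschitz (fun t => Cexp (0 + t * w)%C) (fun t => w * Cexp (0 + t * w))%C);
    [lra| |].
  - intros; apply rder_Cexp_line.
  - intros t Ht. rewrite Cmod_mult, Cmod_Cexp. apply Rmult_le_compat_l. apply Cmod_ge_0.
    apply exp_le_compat.
    replace (Re (0 + t * w)%C) with (t * Re w) by (Csimpl; ring).
    generalize (Re_le_Cmod w) (Cmod_ge_0 w); intros. nra.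
Qed.

Lemma Cexp_bound2 (w : C) : Cmod (Cexp w - 1 - w)%C <= Cmod w * Cmod w * exp (Cmod w).
Proof.
  replace (Cexp w - 1 - w)%C with
    ((Cexp (0 + 1 * w) - 1 * w) - (Cexp (0 + 0 * w) - 0 * w))%C.
  2:{ replace (0 + 1 * w)%C with w by ring. replace (0 + 0 * w)%C with (RtoC 0) by ring.
      rewrite Cexp_0. ring. }
  replace (Cmod w * Cmod w * exp (Cmod w)) with (Cmod w * Cmod w * exp (Cmod w) * (1 - 0)) by ring.
  apply (mean_value_lipschitz (fun t => Cexp (0 + t * w) - t * w)%C
    (fun t => w * Cexp (0 + t * w) - w)%C); [lra| |].
  - intros t _. apply (der_minus _ (fun x => Cexp (0 + Re x * w)%C) (fun x => Re x * w)%C).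
    apply (rder_Cexp_line 0 w).
    apply (der_ext _ (fun x => 0 + Re x * w)%C). intros; ring. apply (rder_affine 0 w).
  - intros t Ht. replace (w * Cexp (0 + t * w) - w)%C with (w * (Cexp (t * w) - 1))%C.
    2:{ replace (0 + t * w)%C with (t * w)%C by ring. ring. }
    rewrite Cmod_mult, Rmult_assoc. apply Rmult_le_compat_l. apply Cmod_ge_0.
    apply Rle_trans with (1 := Cexp_bound _). rewrite Cmod_mult, Cmod_RtoC_pos by lra.
    assert (H := Cmod_ge_0 w). apply Rmult_le_compat; auto; try nra.
    left; apply exp_pos. apply exp_le_compat; nra.
Qed.

Lemma cder_Cexp (z : C) : cder Cexp z (Cexp z).
Proof.
  intros e He.
  set (m := Cmod (Cexp z)). assert (Hm : 0 < m) by (unfold m; rewrite Cmod_Cexp; apply exp_pos).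
  exists (Rmin 1 (e / (m * exp 1))). split.
  - apply Rmin_pos; [lra|]. apply Rdiv_lt_0_compat; auto. apply Rmult_lt_0_compat; auto; apply exp_pos.
  - intros h _ Hh.
    assert (h1 := Rlt_le_trans _ _ _ Hh (Rmin_l _ _)).
    assert (h2 := Rlt_le_trans _ _ _ Hh (Rmin_r _ _)).
    replace (Cexp (z + h) - Cexp z - h * Cexp z)%C with (Cexp z * (Cexp h - 1 - h))%C
      by (rewrite Cexp_plus; ring).
    rewrite Cmod_mult. fold m.
    assert (Hge := Cmod_ge_0 h). assert (E1 := exp_pos 1).
    apply Rle_trans with (m * (Cmod h * Cmod h * exp 1)).
    + apply Rmult_le_compat_l; [lra|]. apply Rle_trans with (1 := Cexp_bound2 h).
      apply Rmult_le_compat_l. apply Rmult_le_pos; auto. apply exp_le_compat; lra.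
    + apply Rle_trans with (m * (Cmod h * (e / (m * exp 1)) * exp 1)).
      apply Rmult_le_compat_l; [lra|]. apply Rmult_le_compat_r; [lra|].
      apply Rmult_le_compat_l; lra. right. field. lra.
Qed.

Lemma der_Cexp (P : C -> Prop) (f : C -> C) (z l : C) :
  der P f z l -> der P (fun w => Cexp (f w)) z (l * Cexp (f z))%C.
Proof. intros H. apply der_comp; auto. apply cder_Cexp. Qed.

Lemma der_inv (P : C -> Prop) (f : C -> C) (z l : C) : f z <> 0%C ->
  der P f z l -> der P (fun w => / f w)%C z (l * - / (f z * f z))%C.
Proof. intros N H. apply (der_comp P f Cinv); auto. apply cder_inv; auto. Qed.

Lemma cder_is_derive (f : C -> C) (z l : C) :
  cder f z l -> is_derive (K := C_AbsRing) (V := C_NormedModule) f z l.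
Proof.
  intros H. split.
  - exact (is_linear_scal_l l).
  - intros x Hx.
    assert (E : z = x) by exact (is_filter_lim_locally_unique _ _ Hx). subst x.
    intros e. destruct (H e (cond_pos e)) as [d [Hd K]].
    exists (mkposreal d Hd). refine (fun (y : C) Hy => _).
    change (Cmod (f y - f z - (y - z) * l)%C <= e * Cmod (y - z)%C).
    assert (Hb : Cmod (y - z)%C < d) by exact Hy.
    specialize (K _ I Hb). replace (z + (y - z))%C with y in K by ring. exact K.
Qed.

Lemma C_derive_eq (f : C -> C) (z l : C) : cder f z l -> C_derive f z = l.
Proof. intros H. apply is_C_derive_unique. apply cder_is_derive; auto. Qed.

Lemma continuous_ccont (f : C -> C) (z : C) :
  continuous (T := C_UniformSpace) (U := C_UniformSpace) f z -> ccont f z.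
Proof.
  intros H e He.
  assert (He2 : 0 < e / 2) by lra.
  destruct (H (fun w => ball (f z) (mkposreal _ He2) w)) as [d K].
  { exists (mkposreal _ He2). auto. }
  exists d; split; [apply cond_pos|]. intros h _ Hh.
  assert (B : ball z d (z + h)%C).
  { split.
    - change (Rabs (Re (z + h)%C - Re z) < d). replace (Re (z + h)%C - Re z) with (Re h) by (Csimpl; ring).
      apply Rle_lt_trans with (1 := re_le h); auto.
    - change (Rabs (Im (z + h)%C - Im z) < d). replace (Im (z + h)%C - Im z) with (Im h) by (Csimpl; ring).
      apply Rle_lt_trans with (1 := im_le h); auto. }
  destruct (K _ B) as [K1 K2].
  change (Rabs (Re (f (z + h)%C) - Re (f z)) < e / 2) in K1.
  change (Rabs (Im (f (z + h)%C) - Im (f z)) < e / 2) in K2.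
  apply Rle_lt_trans with (1 := Cmod_le_abs _). Csimpl. lra.
Qed.

(** * Complex series *)

Definition cser (a : nat -> C) (l : C) : Prop :=
  is_series (K := C_AbsRing) (V := C_NormedModule) a l.

Definition csum (a : nat -> C) (n : nat) : C := sum_n (G := C_AbelianGroup) a n.

Lemma csum_0 (a : nat -> C) : csum a 0 = a 0%nat.
Proof. apply sum_O. Qed.

Lemma csum_S (a : nat -> C) (n : nat) : csum a (S n) = (csum a n + a (S n))%C.
Proof. unfold csum. rewrite sum_Sn. reflexivity. Qed.

Lemma cser_eps (a : nat -> C) (l : C) : cser a l <->
  forall e, 0 < e -> exists N, forall n, (N <= n)%nat -> Cmod (csum a n - l)%C < e.
Proof.
  split.
  - intros H e He. assert (He2 : 0 < e / 2) by lra.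
    destruct (H (fun w => ball l (mkposreal _ He2) w)) as [N K].
    { exists (mkposreal _ He2); auto. }
    exists N. intros n Hn. destruct (K n Hn) as [K1 K2].
    change (Rabs (Re (csum a n) - Re l) < e / 2) in K1.
    change (Rabs (Im (csum a n) - Im l) < e / 2) in K2.
    apply Rle_lt_trans with (1 := Cmod_le_abs _). Csimpl. lra.
  - intros H Q [e He]. destruct (H e (cond_pos e)) as [N K].
    exists N. intros n Hn. apply He. specialize (K n Hn). split.
    + change (Rabs (Re (csum a n) - Re l) < e). rewrite <- Re_minus.
      apply Rle_lt_trans with (1 := re_le _); auto.
    + change (Rabs (Im (csum a n) - Im l) < e). rewrite <- Im_minus.
      apply Rle_lt_trans with (1 := im_le _); auto.
Qed.

Lemma cser_unique (a : nat -> C) (l m : C) : cser a l -> cser a m -> l = m.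
Proof.
  rewrite !cser_eps. intros H1 H2.
  destruct (Req_dec (Cmod (l - m)%C) 0) as [E|N].
  - apply Cmod_eq_0 in E. replace l with (l - m + m)%C by ring. rewrite E. ring.
  - exfalso. assert (Hp : 0 < Cmod (l - m)%C) by (generalize (Cmod_ge_0 (l - m)%C); lra).
    destruct (H1 (Cmod (l - m)%C / 2)) as [N1 K1]; [lra|].
    destruct (H2 (Cmod (l - m)%C / 2)) as [N2 K2]; [lra|].
    specialize (K1 (N1 + N2)%nat ltac:(lia)). specialize (K2 (N1 + N2)%nat ltac:(lia)).
    generalize (Cmod_minus_triangle (csum a (N1 + N2) - m) (csum a (N1 + N2) - l)).
    replace (csum a (N1 + N2) - m - (csum a (N1 + N2) - l))%C with (l - m)%C by ring. lra.
Qed.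

Lemma cser_terms_bounded (a : nat -> C) (l : C) : cser a l ->
  exists K, forall n, Cmod (a n) <= K.
Proof.
  rewrite cser_eps. intros H. destruct (H 1 Rlt_0_1) as [N K].
  assert (T : forall n, (N < n)%nat -> Cmod (a n) <= 2).
  { intros n Hn. destruct n as [|n]; [lia|].
    assert (K1 := K n ltac:(lia)). assert (K2 := K (S n) ltac:(lia)).
    rewrite csum_S in K2.
    replace (a (S n)) with ((csum a n + a (S n) - l) - (csum a n - l))%C by ring.
    apply Rle_trans with (1 := Cmod_minus_triangle _ _). lra. }
  assert (F : forall m, exists K, forall n, (n <= m)%nat -> Cmod (a n) <= K).
  { induction m as [|m [K1 I1]].
    - exists (Cmod (a 0%nat)). intros n Hn. replace n with 0%nat by lia. lra.
    - exists (Rmax K1 (Cmod (a (S m)))). intros n Hn.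
      destruct (Nat.eq_dec n (S m)) as [->|N1]. apply Rmax_r.
      apply Rle_trans with K1. apply I1; lia. apply Rmax_l. }
  destruct (F N) as [K1 I1]. exists (Rmax K1 2). intros n.
  destruct (Nat.le_gt_cases n N).
  apply Rle_trans with K1; auto. apply Rmax_l.
  apply Rle_trans with 2; auto. apply Rmax_r.
Qed.

Lemma ex_cser_le (a : nat -> C) (b : nat -> R) :
  (forall n, Cmod (a n) <= b n) -> ex_series b -> exists l, cser a l.
Proof.
  intros H Hb.
  destruct (ex_series_le (K := C_AbsRing) (V := C_CompleteNormedModule) a b H Hb) as [l Hl].
  exists l. exact Hl.
Qed.

Lemma Cmod_csum_le (a : nat -> C) (b : nat -> R) (n : nat) :
  (forall k, Cmod (a k) <= b k) -> Cmod (csum a n) <= sum_n b n.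
Proof.
  intros H. induction n.
  - rewrite csum_0, sum_O. auto.
  - rewrite csum_S, sum_Sn. apply Rle_trans with (1 := Cmod_triangle _ _).
    apply Rplus_le_compat; auto.
Qed.

Lemma sum_n_le_Series (b : nat -> R) (n : nat) : (forall k, 0 <= b k) -> ex_series b ->
  sum_n b n <= Series b.
Proof.
  intros H Hb.
  assert (L : is_lim_seq (sum_n b) (Series b)) by exact (Series_correct b Hb).
  refine (is_lim_seq_incr_compare _ _ L _ n).
  intros m. rewrite sum_Sn. change (sum_n b m <= sum_n b m + b (S m)). generalize (H (S m)); lra.
Qed.

(** * Power series *)

Lemma pow_n_Cpow (x : C) (n : nat) : pow_n (K := C_AbsRing) x n = Cpow x n.
Proof. induction n; [reflexivity|]. simpl. rewrite IHn. reflexivity. Qed.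

Lemma is_pseries_cser (a : nat -> C) (h l : C) :
  is_pseries (K := C_AbsRing) (V := C_NormedModule) a h l <-> cser (fun n => Cpow h n * a n)%C l.
Proof.
  unfold is_pseries, cser.
  assert (E : forall n, (Cpow h n * a n)%C = scal (pow_n (K := C_AbsRing) h n) (a n))
    by (intros n; rewrite <- pow_n_Cpow; reflexivity).
  split; apply is_series_ext; intros n; rewrite E; reflexivity.
Qed.

(** The coefficient of the bound is that of the twice differentiated series, whose convergence then
    controls the remainders of all partial sums at once. *)
Lemma power_increment (h k : C) (q : R) (n : nat) : Cmod h <= q -> Cmod (h + k)%C <= q ->
  Cmod (Cpow (h + k) (S (S n)) - Cpow h (S (S n)) - k * (INR (S (S n)) * Cpow h (S n)))%C
  <= Cmod k * Cmod k * (INR (S (S n)) * INR (S n) * q ^ n).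
Proof.
  intros Hh Hhk. assert (Hq : 0 <= q) by (generalize (Cmod_ge_0 h); lra).
  assert (Kp := Cmod_ge_0 k).
  induction n.
  - replace (Cpow (h + k) 2 - Cpow h 2 - k * (INR 2 * Cpow h 1))%C with (k * k)%C.
    2:{ simpl. rewrite RtoC_plus. ring. }
    rewrite Cmod_mult. simpl. nra.
  - replace (Cpow (h + k) (S (S (S n))) - Cpow h (S (S (S n)))
             - k * (INR (S (S (S n))) * Cpow h (S (S n))))%C with
      ((h + k) * (Cpow (h + k) (S (S n)) - Cpow h (S (S n)) - k * (INR (S (S n)) * Cpow h (S n)))
       + INR (S (S n)) * (k * k * Cpow h (S n)))%C.
    2:{ rewrite (S_INR (S (S n))), RtoC_plus. rewrite (Cpow_S h (S (S n))), (Cpow_S (h + k) (S (S n))).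
        rewrite (Cpow_S h (S n)). ring. }
    apply Rle_trans with (1 := Cmod_triangle _ _).
    rewrite Cmod_mult.
    apply Rle_trans with (q * (Cmod k * Cmod k * (INR (S (S n)) * INR (S n) * q ^ n)) +
       INR (S (S n)) * (Cmod k * Cmod k * q ^ S n)).
    + apply Rplus_le_compat.
      * apply Rmult_le_compat; auto; apply Cmod_ge_0.
      * rewrite !Cmod_mult, Cmod_pow, Cmod_RtoC_pos by apply pos_INR.
        apply Rmult_le_compat_l. apply pos_INR. apply Rmult_le_compat_l. nra.
        apply pow_incr. split; auto. apply Cmod_ge_0.
    + rewrite (S_INR (S (S n))), !(S_INR (S n)). simpl pow.
      assert (P : 0 <= Cmod k * Cmod k * (q * q ^ n)).
      { repeat apply Rmult_le_pos; auto. apply pow_le; auto. }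
      assert (I := pos_INR (S n)).
      assert (T := Rmult_le_pos _ _ P (Rplus_le_le_0_compat _ _ I Rle_0_1)). lra.
Qed.

(** Convergence at the real point p = (q + r) / 2 bounds |a_n| p^n, so the radius is at least p. *)
Lemma power_series_majorant (a : nat -> C) (r : R) :
  (forall h : C, Cmod h < r -> exists l, cser (fun n => Cpow h n * a n)%C l) ->
  forall q, 0 <= q < r -> Rbar_lt q (CV_radius (fun n => Cmod (a n))).
Proof.
  intros H q Hq.
  set (p := (q + r) / 2).
  destruct (H (RtoC p) ltac:(rewrite Cmod_RtoC_pos; unfold p; lra)) as [l Hl].
  destruct (cser_terms_bounded _ _ Hl) as [K HK].
  apply Rbar_lt_le_trans with p; [unfold p; simpl; lra|].
  apply (proj1 (CV_radius_bounded _)). exists K. intros n.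
  specialize (HK n). rewrite Cmod_mult, Cmod_pow, Cmod_RtoC_pos in HK by (unfold p; lra).
  rewrite Rabs_mult, Rabs_pos_eq by apply Cmod_ge_0. rewrite Rabs_pos_eq. lra.
  apply pow_le; unfold p; lra.
Qed.

Lemma power_series_derive (a : nat -> C) (f : C -> C) (r : R) :
  (forall h : C, Cmod h < r -> cser (fun n => Cpow h n * a n)%C (f h)) ->
  exists g : C -> C, forall h : C, Cmod h < r ->
    cser (fun n => Cpow h n * (INR (S n) * a (S n)))%C (g h) /\ cder f h (g h).
Proof.
  intros H.
  set (c := fun n => Cmod (a n)).
  assert (R0 : forall q, 0 <= q < r -> Rbar_lt q (CV_radius c)).
  { apply power_series_majorant. eauto. }
  assert (R1 : forall q, 0 <= q < r -> ex_series (fun n => INR (S n) * c (S n) * q ^ n)).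
  { intros q Hq. apply ex_series_ext with (fun n => Rabs (PS_derive c n * q ^ n)).
    - intros n. unfold PS_derive. apply Rabs_pos_eq. repeat apply Rmult_le_pos.
      apply pos_INR. apply Cmod_ge_0. apply pow_le; lra.
    - apply CV_disk_inside. rewrite CV_radius_derive, Rabs_pos_eq by lra. auto. }
  assert (R2 : forall q, 0 <= q < r -> ex_series (fun n => INR (S (S n)) * INR (S n) * c (S (S n)) * q ^ n)).
  { intros q Hq. apply ex_series_ext with (fun n => Rabs (PS_derive (PS_derive c) n * q ^ n)).
    - intros n. unfold PS_derive. rewrite Rabs_pos_eq. simpl; ring. repeat apply Rmult_le_pos.
      apply pos_INR. apply pos_INR. apply Cmod_ge_0. apply pow_le; lra.
    - apply CV_disk_inside. rewrite !CV_radius_derive, Rabs_pos_eq by lra. auto. }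
  assert (G : forall h : C, exists l, Cmod h < r -> cser (fun n => Cpow h n * (INR (S n) * a (S n)))%C l).
  { intros h. destruct (Rlt_dec (Cmod h) r) as [L|N].
    - destruct (ex_cser_le (fun n => Cpow h n * (INR (S n) * a (S n)))%C
        (fun n => INR (S n) * c (S n) * Cmod h ^ n)) as [l Hl].
      + intros n. rewrite !Cmod_mult, Cmod_pow, Cmod_RtoC_pos by apply pos_INR.
        right. unfold c. ring.
      + apply R1. split; auto. apply Cmod_ge_0.
      + exists l; auto.
    - exists 0%C. intros; contradiction. }
  destruct (choice _ G) as [g Hg]. exists g. intros h Hh. split; [auto|].
  set (q := (Cmod h + r) / 2).
  assert (Hq : 0 <= q < r) by (generalize (Cmod_ge_0 h); unfold q; lra).
  set (M := Series (fun n => INR (S (S n)) * INR (S n) * c (S (S n)) * q ^ n)).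
  assert (HM : 0 <= M).
  { apply Rle_trans with (sum_n (fun n => INR (S (S n)) * INR (S n) * c (S (S n)) * q ^ n) 0).
    rewrite sum_O. unfold c. simpl. generalize (Cmod_ge_0 (a 2%nat)); lra.
    apply sum_n_le_Series; auto. intros k. repeat apply Rmult_le_pos.
    apply pos_INR. apply pos_INR. apply Cmod_ge_0. apply pow_le; lra. }
  assert (Main : forall k, Cmod (h + k)%C <= q -> Cmod (f (h + k) - f h - k * g h)%C <= Cmod k * Cmod k * M).
  { intros k Hk.
    (* The constant and linear terms cancel exactly and the remainder starts with the quadratic one.
       This is why [f] is summed up to [S n] and the derived series up to [n]. *)
    assert (S1 : forall n, (csum (fun n => Cpow (h + k) n * a n) (S n) - csum (fun n => Cpow h n * a n) (S n)
        - k * csum (fun n => Cpow h n * (INR (S n) * a (S n))) n)%C =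
       match n with O => RtoC 0 | S n => csum (fun n => (Cpow (h + k) (S (S n)) - Cpow h (S (S n)) - k * (INR (S (S n)) * Cpow h (S n))) * a (S (S n)))%C n end).
    { induction n as [|n IH].
      - rewrite !csum_S, !csum_0. simpl Cpow. simpl INR. ring.
      - rewrite csum_S. rewrite (csum_S (fun n => Cpow h n * a n)%C (S n)).
        rewrite (csum_S (fun n => Cpow h n * (INR (S n) * a (S n)))%C n).
        destruct n as [|n].
        + rewrite (csum_0 (fun n => (Cpow (h + k) (S (S n)) - Cpow h (S (S n)) - k * (INR (S (S n)) * Cpow h (S n))) * a (S (S n)))%C).
          clear. rewrite !csum_S, !csum_0. simpl. rewrite !RtoC_plus. ring.
        + rewrite (csum_S (fun n => (Cpow (h + k) (S (S n)) - Cpow h (S (S n)) - k * (INR (S (S n)) * Cpow h (S n))) * a (S (S n)))%C n).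
          rewrite <- IH. ring. }
    assert (S2 : forall n, Cmod (csum (fun n => Cpow (h + k) n * a n) (S n) - csum (fun n => Cpow h n * a n) (S n)
        - k * csum (fun n => Cpow h n * (INR (S n) * a (S n))) n)%C <= Cmod k * Cmod k * M).
    { intros n. rewrite S1. destruct n as [|n].
      - rewrite Cmod_0. generalize (Cmod_ge_0 k); intro; repeat apply Rmult_le_pos; auto.
      - apply Rle_trans with (sum_n (fun n => Cmod k * Cmod k * (INR (S (S n)) * INR (S n) * c (S (S n)) * q ^ n)) n).
        + apply Cmod_csum_le. intros j. rewrite Cmod_mult.
          apply Rle_trans with (Cmod k * Cmod k * (INR (S (S j)) * INR (S j) * q ^ j) * c (S (S j))).
          apply Rmult_le_compat_r. apply Cmod_ge_0. apply power_increment; auto. unfold q; lra.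
          right; ring.
        + rewrite (sum_n_mult_l (K := R_AbsRing)). apply Rmult_le_compat_l.
          generalize (Cmod_ge_0 k); intro; nra.
          apply sum_n_le_Series; auto. intros i. repeat apply Rmult_le_pos.
          apply pos_INR. apply pos_INR. apply Cmod_ge_0. apply pow_le; lra. }
    apply Rnot_lt_le. intros Hlt.
    set (e := Cmod (f (h + k) - f h - k * g h)%C - Cmod k * Cmod k * M) in *.
    assert (He : 0 < e) by (unfold e; lra).
    set (D := 1 + Cmod k). assert (HD : 0 < D) by (generalize (Cmod_ge_0 k); unfold D; lra).
    assert (C1 := proj1 (cser_eps _ _) (H (h + k)%C ltac:(lra)) (e / 3) ltac:(lra)).
    assert (C2 := proj1 (cser_eps _ _) (H h Hh) (e / 3) ltac:(lra)).
    assert (C3 := proj1 (cser_eps _ _) (Hg h Hh) (e / (3 * D)) ltac:(apply Rdiv_lt_0_compat; lra)).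
    destruct C1 as [N1 C1], C2 as [N2 C2], C3 as [N3 C3].
    set (n := (N1 + N2 + N3)%nat).
    specialize (C1 (S n) ltac:(unfold n; lia)). specialize (C2 (S n) ltac:(unfold n; lia)).
    specialize (C3 n ltac:(unfold n; lia)). specialize (S2 n).
    set (A := csum (fun n => Cpow (h + k) n * a n)%C (S n)) in *.
    set (B := csum (fun n => Cpow h n * a n)%C (S n)) in *.
    set (E := csum (fun n => Cpow h n * (INR (S n) * a (S n)))%C n) in *.
    assert (T : Cmod (f (h + k) - f h - k * g h)%C <=
       Cmod (A - B - k * E)%C + (Cmod (A - f (h + k))%C + (Cmod (B - f h)%C + Cmod k * Cmod (E - g h)%C))).
    { replace (f (h + k) - f h - k * g h)%C with
       ((A - B - k * E) - ((A - f (h + k)) - ((B - f h) + k * (E - g h))))%C by ring.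
      apply Rle_trans with (1 := Cmod_minus_triangle _ _). apply Rplus_le_compat_l.
      apply Rle_trans with (1 := Cmod_minus_triangle _ _). apply Rplus_le_compat_l.
      apply Rle_trans with (1 := Cmod_triangle _ _). apply Rplus_le_compat_l.
      rewrite Cmod_mult. lra. }
    assert (T2 : Cmod k * Cmod (E - g h)%C < e / 3).
    { apply Rle_lt_trans with ((D - 1) * (e / (3 * D))).
      apply Rmult_le_compat; try apply Cmod_ge_0; unfold D in *; lra.
      apply Rmult_lt_reg_r with D; auto.
      replace ((D - 1) * (e / (3 * D)) * D) with ((D - 1) * (e / 3)) by (field; lra). nra. }
    unfold e in *. lra. }
  intros e He.
  exists (Rmin ((r - Cmod h) / 2) (e / (M + 1))). split.
  - apply Rmin_pos; [lra| apply Rdiv_lt_0_compat; lra].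
  - intros k _ Hk.
    assert (k1 := Rlt_le_trans _ _ _ Hk (Rmin_l _ _)).
    assert (k2 := Rlt_le_trans _ _ _ Hk (Rmin_r _ _)).
    apply Rle_trans with (Cmod k * Cmod k * M).
    + apply Main. apply Rle_trans with (1 := Cmod_triangle _ _). unfold q. lra.
    + assert (Cmod k * (M + 1) <= e).
      { apply Rle_trans with (e / (M + 1) * (M + 1)). apply Rmult_le_compat_r; lra. right; field; lra. }
      assert (Kp := Cmod_ge_0 k). nra.
Qed.

Lemma analytic_at_derive (f : C -> C) (z : C) : analytic_at f z ->
  cder f z (C_derive f z) /\ analytic_at (C_derive f) z.
Proof.
  intros [a [r [Hr H]]].
  destruct (power_series_derive a (fun h => f (z + h)%C) r) as [g Hg].
  { intros h Hh. apply (proj1 (is_pseries_cser _ _ _)), H, Hh. }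
  assert (D : forall h, Cmod h < r -> cder f (z + h)%C (g h)).
  { intros h Hh. destruct (Hg h Hh) as [_ K]. intros e He. destruct (K e He) as [d [Hd L]].
    exists d; split; auto. intros k Pk Hk. specialize (L k Pk Hk).
    replace (z + h + k)%C with (z + (h + k))%C by ring. exact L. }
  split.
  - assert (D0 := D 0%C ltac:(rewrite Cmod_0; auto)).
    replace (z + 0)%C with z in D0 by ring. rewrite (C_derive_eq _ _ _ D0). auto.
  - exists (fun n => INR (S n) * a (S n))%C, r. split; auto. intros h Hh.
    rewrite (C_derive_eq _ _ _ (D h Hh)). apply (proj2 (is_pseries_cser _ _ _)), Hg, Hh.
Qed.

(** * Iterated complex differentiability on a set *)

(** Continuity of the last derivative is part of the notion, because primitives and Cauchy's
    estimate are obtained by differentiation under the integral sign, which asks for it. *)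
Fixpoint smooth (n : nat) (D : C -> Prop) (f : C -> C) : Prop :=
  match n with
  | O => forall z, D z -> ccont f z
  | S n => exists f', (forall z, D z -> cder f z (f' z)) /\ smooth n D f'
  end.

Lemma cont_plus (P : C -> Prop) (f g : C -> C) (z : C) :
  cont P f z -> cont P g z -> cont P (fun w => f w + g w)%C z.
Proof.
  intros Hf Hg e He.
  destruct (Hf (e / 2)) as [d1 [H1 K1]]; [lra|].
  destruct (Hg (e / 2)) as [d2 [H2 K2]]; [lra|].
  exists (Rmin d1 d2); split; [apply Rmin_pos; auto|]. intros h Ph Hh.
  specialize (K1 h Ph (Rlt_le_trans _ _ _ Hh (Rmin_l _ _))).
  specialize (K2 h Ph (Rlt_le_trans _ _ _ Hh (Rmin_r _ _))).
  replace (f (z + h) + g (z + h) - (f z + g z))%C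
    with ((f (z + h) - f z) + (g (z + h) - g z))%C by ring.
  apply Rle_lt_trans with (1 := Cmod_triangle _ _). lra.
Qed.

Lemma cont_mult (P : C -> Prop) (f g : C -> C) (z : C) :
  cont P f z -> cont P g z -> cont P (fun w => f w * g w)%C z.
Proof.
  intros Hf Hg e He.
  set (A := 1 + Cmod (g z)). assert (HA : 0 < A) by (generalize (Cmod_ge_0 (g z)); unfold A; lra).
  set (B := 1 + Cmod (f z)). assert (HB : 0 < B) by (generalize (Cmod_ge_0 (f z)); unfold B; lra).
  destruct (Hg 1 Rlt_0_1) as [d0 [H0 K0]].
  destruct (Hf (e / (2 * A))) as [d1 [H1 K1]]; [apply Rdiv_lt_0_compat; lra|].
  destruct (Hg (e / (2 * B))) as [d2 [H2 K2]]; [apply Rdiv_lt_0_compat; lra|].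
  exists (Rmin d0 (Rmin d1 d2)); split; [repeat apply Rmin_pos; auto|]. intros h Ph Hh.
  assert (h12 := Rlt_le_trans _ _ _ Hh (Rmin_r _ _)).
  specialize (K0 h Ph (Rlt_le_trans _ _ _ Hh (Rmin_l _ _))).
  specialize (K1 h Ph (Rlt_le_trans _ _ _ h12 (Rmin_l _ _))).
  specialize (K2 h Ph (Rlt_le_trans _ _ _ h12 (Rmin_r _ _))).
  replace (f (z + h) * g (z + h) - (f z * g z))%C
    with ((f (z + h) - f z) * g (z + h) + f z * (g (z + h) - g z))%C by ring.
  apply Rle_lt_trans with (1 := Cmod_triangle _ _). rewrite !Cmod_mult.
  assert (gb : Cmod (g (z + h)%C) <= A).
  { unfold A. generalize (Cmod_minus_le (g (z + h)%C) (g z)). lra. }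
  assert (T1 : Cmod (f (z + h) - f z)%C * Cmod (g (z + h)%C) <= Cmod (f (z + h) - f z)%C * A)
    by (apply Rmult_le_compat_l; auto; apply Cmod_ge_0).
  assert (T2 : Cmod (f (z + h) - f z)%C * A < e / (2 * A) * A) by (apply Rmult_lt_compat_r; auto).
  assert (T3 : Cmod (f z) * Cmod (g (z + h) - g z)%C <= B * (e / (2 * B))).
  { apply Rmult_le_compat; try apply Cmod_ge_0. unfold B; lra. lra. }
  replace (e / (2 * A) * A) with (e / 2) in T2 by (field; lra).
  replace (B * (e / (2 * B))) with (e / 2) in T3 by (field; lra). lra.
Qed.

Lemma cont_comp (P : C -> Prop) (f g : C -> C) (z : C) :
  ccont g (f z) -> cont P f z -> cont P (fun w => g (f w)) z.
Proof.
  intros Hg Hf e He. destruct (Hg e He) as [d1 [H1 K1]]. destruct (Hf d1 H1) as [d2 [H2 K2]].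
  exists d2; split; auto. intros h Ph Hh. specialize (K2 h Ph Hh). specialize (K1 _ I K2).
  replace (f z + (f (z + h) - f z))%C with (f (z + h)%C) in K1 by ring. auto.
Qed.

Lemma cont_const (P : C -> Prop) (c z : C) : cont P (fun _ => c) z.
Proof. eapply der_cont, der_const. Qed.

Lemma cont_id (P : C -> Prop) (z : C) : cont P (fun w => w) z.
Proof. eapply der_cont, der_id. Qed.

Lemma smooth_S (n : nat) (D : C -> Prop) (f : C -> C) : smooth (S n) D f -> smooth n D f.
Proof.
  revert f. induction n; intros f [f' [H K]].
  - intros z Hz. apply (der_cont _ _ _ _ (H z Hz)).
  - exists f'; split; auto.
Qed.

Lemma smooth_0 (n : nat) (D : C -> Prop) (f : C -> C) : smooth n D f -> smooth 0 D f.
Proof. induction n; auto. intros H. apply IHn, smooth_S, H. Qed.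

Lemma smooth_const (n : nat) (D : C -> Prop) (c : C) : smooth n D (fun _ => c).
Proof.
  revert c. induction n; intros c. intros z _; apply cont_const.
  exists (fun _ => 0%C). split; auto. intros; apply der_const.
Qed.

Lemma smooth_id (n : nat) (D : C -> Prop) : smooth n D (fun z => z).
Proof.
  destruct n. intros z _; apply cont_id.
  exists (fun _ => 1%C). split. intros; apply der_id. apply smooth_const.
Qed.

Lemma smooth_plus (n : nat) (D : C -> Prop) (f g : C -> C) :
  smooth n D f -> smooth n D g -> smooth n D (fun z => f z + g z)%C.
Proof.
  revert f g. induction n; intros f g Hf Hg.
  - intros z Hz. apply (cont_plus _ f g); [apply Hf|apply Hg]; auto.
  - destruct Hf as [f' [Hf Kf]], Hg as [g' [Hg Kg]].
    exists (fun z => f' z + g' z)%C. split; auto. intros z Hz; apply (der_plus _ f g); [apply Hf|apply Hg]; auto.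
Qed.

Lemma smooth_mult (n : nat) (D : C -> Prop) (f g : C -> C) :
  smooth n D f -> smooth n D g -> smooth n D (fun z => f z * g z)%C.
Proof.
  revert f g. induction n; intros f g Hf Hg.
  - intros z Hz. apply (cont_mult _ f g); [apply Hf|apply Hg]; auto.
  - assert (Sf := smooth_S _ _ _ Hf). assert (Sg := smooth_S _ _ _ Hg).
    destruct Hf as [f' [Hf Kf]], Hg as [g' [Hg Kg]].
    exists (fun z => f' z * g z + f z * g' z)%C. split.
    intros z Hz; apply (der_mult _ f g); [apply Hf|apply Hg]; auto.
    apply smooth_plus; auto.
Qed.

Lemma smooth_ext (n : nat) (D : C -> Prop) (f g : C -> C) : (forall z, f z = g z) ->
  smooth n D f -> smooth n D g.
Proof.
  intros E H. destruct n.
  - intros z Hz e He. destruct (H z Hz e He) as [d [Hd K]]. exists d; split; auto.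
    intros h Ph Hh. rewrite <- !E; auto.
  - destruct H as [f' [H K]]. exists f'; split; auto. intros z Hz. apply (der_ext _ f); auto.
    apply H; auto.
Qed.

Lemma smooth_opp (n : nat) (D : C -> Prop) (f : C -> C) :
  smooth n D f -> smooth n D (fun z => - f z)%C.
Proof.
  intros H. apply smooth_ext with (fun z => - (1) * f z)%C. intros; ring.
  apply smooth_mult; auto. apply smooth_const.
Qed.

Lemma smooth_minus (n : nat) (D : C -> Prop) (f g : C -> C) :
  smooth n D f -> smooth n D g -> smooth n D (fun z => f z - g z)%C.
Proof. intros. apply smooth_plus; auto. apply smooth_opp; auto. Qed.

Lemma smooth_Cexp (n : nat) (D : C -> Prop) : smooth n D Cexp.
Proof.
  induction n. intros z _. apply (der_cont _ _ _ _ (cder_Cexp z)).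
  exists Cexp; split; auto. intros; apply cder_Cexp.
Qed.

Lemma smooth_comp (n : nat) (D D' : C -> Prop) (g f : C -> C) : (forall z, D z -> D' (f z)) ->
  smooth n D' g -> smooth n D f -> smooth n D (fun z => g (f z)).
Proof.
  intros HD. revert g f HD. induction n; intros g f HD Hg Hf.
  - intros z Hz. apply (cont_comp _ f g); [apply Hg|apply Hf]; auto.
  - assert (Sf := smooth_S _ _ _ Hf).
    destruct Hf as [f' [Hf Kf]], Hg as [g' [Hg Kg]].
    exists (fun z => f' z * g' (f z))%C. split.
    intros z Hz; apply (der_comp _ f g); [apply Hg|apply Hf]; auto.
    apply smooth_mult; auto.
Qed.

Lemma smooth_Cinv (n : nat) : smooth n (fun z => z <> 0%C) Cinv.
Proof.
  induction n.
  - intros z Hz. apply (der_cont _ _ _ _ (cder_inv z Hz)).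
  - exists (fun z => - (/ z * / z))%C. split.
    + intros z Hz. eapply der_eq. apply cder_inv; auto. field; auto.
    + apply smooth_opp, smooth_mult; auto.
Qed.

Lemma smooth_inv (n : nat) (D : C -> Prop) (f : C -> C) : (forall z, D z -> f z <> 0%C) ->
  smooth n D f -> smooth n D (fun z => / f z)%C.
Proof. intros H K. apply (smooth_comp n D (fun z : C => z <> 0%C) Cinv f); auto. apply smooth_Cinv. Qed.

Lemma smooth_div (n : nat) (D : C -> Prop) (f g : C -> C) : (forall z, D z -> g z <> 0%C) ->
  smooth n D f -> smooth n D g -> smooth n D (fun z => f z / g z)%C.
Proof. intros H Kf Kg. apply smooth_mult; auto. apply smooth_inv; auto. Qed.

Lemma smooth_sub (n : nat) (D D' : C -> Prop) (f : C -> C) : (forall z, D z -> D' z) ->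
  smooth n D' f -> smooth n D f.
Proof.
  intros H K. apply (smooth_comp n D D' f (fun z => z)); auto. apply smooth_id.
Qed.

Lemma analytic_smooth (n : nat) (D : C -> Prop) (f : C -> C) :
  (forall z, D z -> analytic_at f z) -> smooth n D f.
Proof.
  revert f. induction n; intros f H.
  - intros z Hz. eapply der_cont. apply (analytic_at_derive f z); auto.
  - exists (C_derive f). split. intros z Hz; apply analytic_at_derive; auto.
    apply IHn. intros z Hz; apply analytic_at_derive; auto.
Qed.

(** * Integrals of complex functions of a real variable *)

Definition CInt (u : R -> C) (a b : R) : C :=
  (RInt (fun t => Re (u t)) a b, RInt (fun t => Im (u t)) a b).

Lemma rcont_components (u : R -> C) (t : R) : rcont u t ->
  continuous (fun x => Re (u x)) t /\ continuous (fun x => Im (u x)) t.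
Proof.
  intros H. split; intros P [e He]; destruct (H e (cond_pos e)) as [d [Hd K]];
  exists (mkposreal d Hd); refine (fun (y : R) Hy => _); apply He;
  change (Rabs (y - t) < d) in Hy;
  specialize (K (RtoC (y - t)) eq_refl); rewrite Cmod_R in K; specialize (K Hy);
  replace (Re (t + (y - t)%R)%C) with y in K by (Csimpl; ring); rewrite Re_RtoC in K.
  - change (Rabs (Re (u y) - Re (u t)) < e). rewrite <- Re_minus.
    apply Rle_lt_trans with (1 := re_le _); auto.
  - change (Rabs (Im (u y) - Im (u t)) < e). rewrite <- Im_minus.
    apply Rle_lt_trans with (1 := im_le _); auto.
Qed.

Lemma ex_RInt_components (u : R -> C) (a b : R) : a <= b -> (forall t, a <= t <= b -> rcont u t) ->
  ex_RInt (fun t => Re (u t)) a b /\ ex_RInt (fun t => Im (u t)) a b.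
Proof.
  intros Hab H.
  split; apply (ex_RInt_continuous (V := R_CompleteNormedModule)); intros z Hz;
  rewrite Rmin_left, Rmax_right in Hz by lra.
  exact (proj1 (rcont_components _ _ (H z Hz))). exact (proj2 (rcont_components _ _ (H z Hz))).
Qed.

Lemma CInt_FTC (V v : R -> C) (a b : R) : a <= b ->
  (forall t, a <= t <= b -> rder V t (v t)) -> (forall t, a <= t <= b -> rcont v t) ->
  CInt v a b = (V b - V a)%C.
Proof.
  intros Hab D K. apply Ceq; unfold CInt; cbn [Re Im fst snd].
  - apply is_RInt_unique. apply (is_RInt_derive (fun t => Re (V t))); intros x Hx;
    rewrite Rmin_left, Rmax_right in Hx by lra.
    exact (proj1 (rder_components _ _ _ (D x Hx))). exact (proj1 (rcont_components _ _ (K x Hx))).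
  - apply is_RInt_unique. apply (is_RInt_derive (fun t => Im (V t))); intros x Hx;
    rewrite Rmin_left, Rmax_right in Hx by lra.
    exact (proj2 (rder_components _ _ _ (D x Hx))). exact (proj2 (rcont_components _ _ (K x Hx))).
Qed.

(** Real and imaginary parts are estimated separately, whence the factor 2; only orders of magnitude
    are used later. *)
Lemma CInt_le (u : R -> C) (a b M : R) : a <= b -> (forall t, a <= t <= b -> rcont u t) ->
  (forall t, a <= t <= b -> Cmod (u t) <= M) -> Cmod (CInt u a b) <= 2 * ((b - a) * M).
Proof.
  intros Hab K H. destruct (ex_RInt_components u a b Hab K) as [E1 E2].
  apply Rle_trans with (1 := Cmod_le_abs _). unfold CInt; cbn [Re Im fst snd].
  assert (Rabs (RInt (fun t => Re (u t)) a b) <= (b - a) * M).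
  { apply abs_RInt_le_const; auto. intros t Ht. apply Rle_trans with (1 := re_le _); auto. }
  assert (Rabs (RInt (fun t => Im (u t)) a b) <= (b - a) * M).
  { apply abs_RInt_le_const; auto. intros t Ht. apply Rle_trans with (1 := im_le _); auto. }
  lra.
Qed.

Lemma CInt_ext (u v : R -> C) (a b : R) : a <= b -> (forall t, a <= t <= b -> u t = v t) ->
  CInt u a b = CInt v a b.
Proof.
  intros Hab H. unfold CInt. f_equal; apply RInt_ext; intros x Hx;
  rewrite Rmin_left, Rmax_right in Hx by lra; rewrite H; auto; lra.
Qed.

Lemma CInt_scal (c : C) (u : R -> C) (a b : R) : a <= b -> (forall t, a <= t <= b -> rcont u t) ->
  CInt (fun t => c * u t)%C a b = (c * CInt u a b)%C.
Proof.
  intros Hab K. destruct (ex_RInt_components u a b Hab K) as [E1 E2].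
  apply Ceq; unfold CInt; Csimpl; cbn [Re Im fst snd]; apply is_RInt_unique.
  - exact (is_RInt_minus _ _ _ _ _ _ (is_RInt_scal _ _ _ (Re c) _ (RInt_correct _ _ _ E1))
      (is_RInt_scal _ _ _ (Im c) _ (RInt_correct _ _ _ E2))).
  - exact (is_RInt_plus _ _ _ _ _ _ (is_RInt_scal _ _ _ (Re c) _ (RInt_correct _ _ _ E2))
      (is_RInt_scal _ _ _ (Im c) _ (RInt_correct _ _ _ E1))).
Qed.

(** * Differentiation under the integral sign *)

Definition cont2 (F : R -> R -> C) (u v : R) : Prop :=
  forall e, 0 < e -> exists d, 0 < d /\ forall u' v', Rabs (u' - u) < d -> Rabs (v' - v) < d ->
    Cmod (F u' v' - F u v)%C < e.

Lemma cont2_const (c : C) (u v : R) : cont2 (fun _ _ => c) u v.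
Proof.
  intros e He. exists 1; split; [lra|]. intros.
  replace (c - c)%C with (RtoC 0) by ring. rewrite Cmod_0; auto.
Qed.

Lemma cont2_real (f : R -> R -> R) (u v : R) : continuity_2d_pt f u v ->
  cont2 (fun x y => RtoC (f x y)) u v.
Proof.
  intros H e He. destruct (H (mkposreal e He)) as [d K].
  exists d; split; [apply cond_pos|]. intros u' v' Hu Hv.
  rewrite <- RtoC_minus, Cmod_R. apply K; auto.
Qed.

Lemma cont2_fst (u v : R) : cont2 (fun x y => RtoC x) u v.
Proof. apply cont2_real, continuity_2d_pt_id1. Qed.

Lemma cont2_snd (u v : R) : cont2 (fun x y => RtoC y) u v.
Proof. apply cont2_real, continuity_2d_pt_id2. Qed.

Lemma cont2_comp (g : C -> C) (F : R -> R -> C) (u v : R) :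
  ccont g (F u v) -> cont2 F u v -> cont2 (fun x y => g (F x y)) u v.
Proof.
  intros Hg HF e He. destruct (Hg e He) as [d1 [H1 K1]]. destruct (HF d1 H1) as [d [Hd K]].
  exists d; split; auto. intros u' v' Hu Hv. specialize (K1 _ I (K u' v' Hu Hv)).
  replace (F u v + (F u' v' - F u v))%C with (F u' v') in K1 by ring. auto.
Qed.

Lemma cont2_plus (F G : R -> R -> C) (u v : R) :
  cont2 F u v -> cont2 G u v -> cont2 (fun x y => F x y + G x y)%C u v.
Proof.
  intros HF HG e He.
  destruct (HF (e / 2)) as [d1 [H1 K1]]; [lra|].
  destruct (HG (e / 2)) as [d2 [H2 K2]]; [lra|].
  exists (Rmin d1 d2); split; [apply Rmin_pos; auto|]. intros u' v' Hu Hv.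
  specialize (K1 u' v' (Rlt_le_trans _ _ _ Hu (Rmin_l _ _)) (Rlt_le_trans _ _ _ Hv (Rmin_l _ _))).
  specialize (K2 u' v' (Rlt_le_trans _ _ _ Hu (Rmin_r _ _)) (Rlt_le_trans _ _ _ Hv (Rmin_r _ _))).
  replace (F u' v' + G u' v' - (F u v + G u v))%C
    with ((F u' v' - F u v) + (G u' v' - G u v))%C by ring.
  apply Rle_lt_trans with (1 := Cmod_triangle _ _). lra.
Qed.

Lemma cont2_mult (F G : R -> R -> C) (u v : R) :
  cont2 F u v -> cont2 G u v -> cont2 (fun x y => F x y * G x y)%C u v.
Proof.
  intros Hf Hg e He.
  set (A := 1 + Cmod (G u v)). assert (HA : 0 < A) by (generalize (Cmod_ge_0 (G u v)); unfold A; lra).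
  set (B := 1 + Cmod (F u v)). assert (HB : 0 < B) by (generalize (Cmod_ge_0 (F u v)); unfold B; lra).
  destruct (Hg 1 Rlt_0_1) as [d0 [H0 K0]].
  destruct (Hf (e / (2 * A))) as [d1 [H1 K1]]; [apply Rdiv_lt_0_compat; lra|].
  destruct (Hg (e / (2 * B))) as [d2 [H2 K2]]; [apply Rdiv_lt_0_compat; lra|].
  exists (Rmin d0 (Rmin d1 d2)); split; [repeat apply Rmin_pos; auto|]. intros u' v' Hu Hv.
  assert (hu := Rlt_le_trans _ _ _ Hu (Rmin_r _ _)).
  assert (hv := Rlt_le_trans _ _ _ Hv (Rmin_r _ _)).
  specialize (K0 u' v' (Rlt_le_trans _ _ _ Hu (Rmin_l _ _)) (Rlt_le_trans _ _ _ Hv (Rmin_l _ _))).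
  specialize (K1 u' v' (Rlt_le_trans _ _ _ hu (Rmin_l _ _)) (Rlt_le_trans _ _ _ hv (Rmin_l _ _))).
  specialize (K2 u' v' (Rlt_le_trans _ _ _ hu (Rmin_r _ _)) (Rlt_le_trans _ _ _ hv (Rmin_r _ _))).
  replace (F u' v' * G u' v' - F u v * G u v)%C
    with ((F u' v' - F u v) * G u' v' + F u v * (G u' v' - G u v))%C by ring.
  apply Rle_lt_trans with (1 := Cmod_triangle _ _). rewrite !Cmod_mult.
  assert (gb : Cmod (G u' v') <= A).
  { unfold A. generalize (Cmod_minus_le (G u' v') (G u v)). lra. }
  assert (T1 : Cmod (F u' v' - F u v)%C * Cmod (G u' v') <= Cmod (F u' v' - F u v)%C * A)
    by (apply Rmult_le_compat_l; auto; apply Cmod_ge_0).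
  assert (T2 : Cmod (F u' v' - F u v)%C * A < e / (2 * A) * A) by (apply Rmult_lt_compat_r; auto).
  assert (T3 : Cmod (F u v) * Cmod (G u' v' - G u v)%C <= B * (e / (2 * B))).
  { apply Rmult_le_compat; try apply Cmod_ge_0. unfold B; lra. lra. }
  replace (e / (2 * A) * A) with (e / 2) in T2 by (field; lra).
  replace (B * (e / (2 * B))) with (e / 2) in T3 by (field; lra). lra.
Qed.

Lemma cont2_components (F : R -> R -> C) (u v : R) : cont2 F u v ->
  continuity_2d_pt (fun x y => Re (F x y)) u v /\ continuity_2d_pt (fun x y => Im (F x y)) u v.
Proof.
  intros H. split; intros e; destruct (H e (cond_pos e)) as [d [Hd K]];
  exists (mkposreal d Hd); intros u' v' Hu Hv; specialize (K u' v' Hu Hv).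
  rewrite <- Re_minus. apply Rle_lt_trans with (1 := re_le _); auto.
  rewrite <- Im_minus. apply Rle_lt_trans with (1 := im_le _); auto.
Qed.

Lemma cont2_rcont (F : R -> R -> C) (u v : R) : cont2 F u v -> rcont (F u) v.
Proof.
  intros H e He. destruct (H e He) as [d [Hd K]]. exists d; split; auto. intros h Ph Hh.
  rewrite Re_plus, Re_RtoC. apply K. rewrite Rminus_diag, Rabs_R0; auto.
  replace (v + Re h - v) with (Re h) by ring. apply Rle_lt_trans with (1 := re_le h); auto.
Qed.

(** Joint continuity at the endpoints of the interval concerns a full neighbourhood, so the
    derivative has to be known for [t] slightly outside it; hence the margin [r]. *)
Lemma CInt_param (F F' : R -> R -> C) (a b x r : R) : a <= b -> 0 < r ->
  (forall u t, Rabs (u - x) < r -> a - r < t < b + r -> rder (fun y => F y t) u (F' u t)) ->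
  (forall u t, Rabs (u - x) < r -> a - r < t < b + r -> cont2 F u t) ->
  (forall t, a <= t <= b -> cont2 F' x t) ->
  rder (fun u => CInt (F u) a b) x (CInt (F' x) a b).
Proof.
  intros Hab Hr D C1 C2.
  assert (X0 : Rabs (x - x) < r) by (rewrite Rminus_diag, Rabs_R0; auto).
  assert (Nb : forall u : R, ball (M := R_UniformSpace) x r u -> Rabs (u - x) < r) by (intros u Hu; exact Hu).
  apply components_rder; unfold CInt; cbn [Re Im fst snd].
  - rewrite (RInt_ext _ (fun t => Derive (fun u => Re (F u t)) x)).
    2:{ intros t Ht. rewrite Rmin_left, Rmax_right in Ht by lra. symmetry. apply is_derive_unique.
        exact (proj1 (rder_components _ _ _ (D x t X0 ltac:(lra)))). }
    apply (is_derive_RInt_param (fun u t => Re (F u t))).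
    + exists (mkposreal r Hr). intros u Hu t Ht. rewrite Rmin_left, Rmax_right in Ht by lra.
      eexists. exact (proj1 (rder_components _ _ _ (D u t (Nb u Hu) ltac:(lra)))).
    + intros t Ht. rewrite Rmin_left, Rmax_right in Ht by lra.
      apply continuity_2d_pt_ext_loc with (fun u v => Re (F' u v)).
      * exists (mkposreal r Hr). simpl. intros u v Hu Hv. symmetry. apply is_derive_unique.
        apply Rabs_def2 in Hv. exact (proj1 (rder_components _ _ _ (D u v Hu ltac:(lra)))).
      * apply (proj1 (cont2_components _ _ _ (C2 t Ht))).
    + exists (mkposreal r Hr). intros u Hu. apply (fun H => proj1 (ex_RInt_components (F u) a b Hab H)).
      intros t Ht. apply cont2_rcont. apply C1. apply Nb; auto. lra.
  - rewrite (RInt_ext _ (fun t => Derive (fun u => Im (F u t)) x)).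
    2:{ intros t Ht. rewrite Rmin_left, Rmax_right in Ht by lra. symmetry. apply is_derive_unique.
        exact (proj2 (rder_components _ _ _ (D x t X0 ltac:(lra)))). }
    apply (is_derive_RInt_param (fun u t => Im (F u t))).
    + exists (mkposreal r Hr). intros u Hu t Ht. rewrite Rmin_left, Rmax_right in Ht by lra.
      eexists. exact (proj2 (rder_components _ _ _ (D u t (Nb u Hu) ltac:(lra)))).
    + intros t Ht. rewrite Rmin_left, Rmax_right in Ht by lra.
      apply continuity_2d_pt_ext_loc with (fun u v => Im (F' u v)).
      * exists (mkposreal r Hr). simpl. intros u v Hu Hv. symmetry. apply is_derive_unique.
        apply Rabs_def2 in Hv. exact (proj2 (rder_components _ _ _ (D u v Hu ltac:(lra)))).
      * apply (proj2 (cont2_components _ _ _ (C2 t Ht))).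
    + exists (mkposreal r Hr). intros u Hu. apply (fun H => proj2 (ex_RInt_components (F u) a b Hab H)).
      intros t Ht. apply cont2_rcont. apply C1. apply Nb; auto. lra.
Qed.

(** * Primitives on star-shaped domains *)

Definition copen (D : C -> Prop) : Prop :=
  forall z, D z -> exists r, 0 < r /\ forall h, Cmod h < r -> D (z + h)%C.

Definition star (D : C -> Prop) (a : C) : Prop :=
  forall z t, D z -> 0 <= t <= 1 -> D (a + t * (z - a))%C.

Lemma constant_of_derive (u : R -> C) (a b : R) : a <= b ->
  (forall t, a <= t <= b -> rder u t 0%C) -> u b = u a.
Proof.
  intros Hab H.
  assert (K : Cmod (u b - u a)%C <= 0 * (b - a)).
  { apply (mean_value_lipschitz u (fun _ => 0%C)); auto. intros. rewrite Cmod_0. lra. }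
  assert (E : Cmod (u b - u a)%C = 0) by (generalize (Cmod_ge_0 (u b - u a)%C); lra).
  apply Cmod_eq_0 in E. replace (u b) with (u b - u a + u a)%C by ring. rewrite E. ring.
Qed.

(** With p = s + u h - a, the derivative of f(a + t p) p in u equals h times the derivative of t f(a
    + t p) in t. The differentiated integral is therefore evaluated by the fundamental theorem. *)
Lemma star_integral_derive (D : C -> Prop) (a : C) (f f' : C -> C) (s h : C) (x : R) :
  copen D -> star D a -> D a -> D (s + x * h)%C ->
  (forall z, D z -> cder f z (f' z)) -> (forall z, D z -> ccont f' z) ->
  rder (fun u => CInt (fun t => f (a + t * (s + u * h - a)) * (s + u * h - a))%C 0 1) x
    (h * f (s + x * h))%C.
Proof.
  intros Op St Da Ds Df Cf'.
  set (p := fun u : R => (s + u * h - a)%C).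
  set (Q := fun u t : R => (a + t * p u)%C).
  destruct (Op a Da) as [r0 [Hr0 K0]]. destruct (Op _ Ds) as [r1 [Hr1 K1]].
  set (N := 1 + Cmod (s - a)%C + (Rabs x + 1) * Cmod h).
  assert (HN : 1 <= N). { unfold N. assert (A1 := Cmod_ge_0 (s - a)%C). assert (A2 := Cmod_ge_0 h).
    assert (A3 := Rabs_pos x). nra. }
  assert (HNh : Cmod h <= N). { unfold N. assert (A1 := Cmod_ge_0 (s - a)%C). assert (A2 := Cmod_ge_0 h).
    assert (A3 := Rabs_pos x). nra. }
  (* So small that moving [u] by [r] and letting [t] leave [0, 1] by [r] displaces the point by less
     than [r0] from [a], or by less than [r1] from the end point. *)
  set (r := Rmin 1 (Rmin (r0 / (2 * N)) (r1 / (4 * N)))).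
  assert (Hr : 0 < r). { unfold r. repeat apply Rmin_pos; try apply Rdiv_lt_0_compat; lra. }
  assert (r_1 : r <= 1) by apply Rmin_l.
  assert (r_0 : r * (2 * N) <= r0).
  { apply Rle_trans with (r0 / (2 * N) * (2 * N)). apply Rmult_le_compat_r; [lra|].
    unfold r. apply Rle_trans with (1 := Rmin_r _ _). apply Rmin_l. right; field; lra. }
  assert (r_2 : r * (4 * N) <= r1).
  { apply Rle_trans with (r1 / (4 * N) * (4 * N)). apply Rmult_le_compat_r; [lra|].
    unfold r. apply Rle_trans with (1 := Rmin_r _ _). apply Rmin_r. right; field; lra. }
  assert (Hp : forall u, Rabs (u - x) < r -> Cmod (p u) <= N).
  { intros u Hu. unfold p. replace (s + u * h - a)%C with ((s - a) + u * h)%C by ring.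
    apply Rle_trans with (1 := Cmod_triangle _ _). rewrite Cmod_mult, Cmod_R.
    assert (Rabs u <= Rabs x + 1).
    { replace u with ((u - x) + x) by ring. apply Rle_trans with (1 := Rabs_triang _ _). lra. }
    assert (A2 := Cmod_ge_0 h). unfold N. nra. }
  assert (HD : forall u t, Rabs (u - x) < r -> 0 - r < t < 1 + r -> D (Q u t)).
  { intros u t Hu Ht. specialize (Hp u Hu).
    assert (Du : D (s + u * h)%C).
    { replace (s + u * h)%C with (s + x * h + (u - x)%R * h)%C by (rewrite RtoC_minus; ring).
      apply K1. rewrite Cmod_mult, Cmod_R.
      apply Rle_lt_trans with (r * N). apply Rmult_le_compat; try apply Cmod_ge_0; try apply Rabs_pos; lra.
      nra. }
    destruct (Rle_dec t 0) as [T0|T0]; [|destruct (Rle_dec t 1) as [T1|T1]].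
    - unfold Q. apply K0. rewrite Cmod_mult, Cmod_R.
      apply Rle_lt_trans with (r * N). apply Rmult_le_compat; try apply Cmod_ge_0; try apply Rabs_pos; auto.
      rewrite Rabs_left1; lra. nra.
    - unfold Q, p. apply St; auto. lra.
    - unfold Q. replace (a + t * p u)%C with (s + x * h + ((u - x)%R * h + (t - 1)%R * p u))%C
        by (unfold p; rewrite !RtoC_minus; ring).
      apply K1. apply Rle_lt_trans with (1 := Cmod_triangle _ _). rewrite !Cmod_mult, !Cmod_R.
      apply Rle_lt_trans with (r * N + r * N); [|nra].
      apply Rplus_le_compat; apply Rmult_le_compat; try apply Cmod_ge_0; try apply Rabs_pos; try lra.
      rewrite Rabs_pos_eq; lra. }
  assert (X0 : Rabs (x - x) < r) by (rewrite Rminus_diag, Rabs_R0; auto).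
  assert (cp : forall u t, cont2 (fun u _ => p u) u t).
  { intros u t. unfold p. apply (cont2_plus (fun u _ => s + u * h)%C (fun _ _ => - a)%C).
    apply (cont2_plus (fun u _ => s)%C (fun u _ => u * h)%C). apply cont2_const.
    apply (cont2_mult (fun u _ => RtoC u)%C (fun u _ => h)%C). apply cont2_fst.
    apply cont2_const. apply cont2_const. }
  assert (cQ : forall u t, cont2 Q u t).
  { intros u t. unfold Q. apply (cont2_plus (fun _ _ => a) (fun u t => t * p u)%C). apply cont2_const.
    apply (cont2_mult (fun _ t => RtoC t) (fun u _ => p u)). apply cont2_snd. apply cp. }
  set (F' := fun u t : R => (t * h * f' (Q u t) * p u + f (Q u t) * h)%C).
  assert (dp : forall u, rder p u h).
  { intros u. unfold p. eapply der_eq.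
    apply (der_minus _ (fun z => s + Re z * h)%C (fun _ => a)). apply rder_affine. apply der_const. ring. }
  assert (E : CInt (F' x) 0 1 = (h * f (s + x * h))%C).
  { rewrite (CInt_FTC (fun t => h * (t * f (Q x t)))%C); [| lra | |].
    - unfold Q. replace (a + 1 * p x)%C with (s + x * h)%C by (unfold p; ring). ring.
    - intros t Ht. unfold F'.
      eapply der_eq.
      { apply (der_scal _ h (fun z => Re z * f (Q x (Re z)))%C).
        apply (der_mult _ (fun z => RtoC (Re z)) (fun z => f (Q x (Re z)))).
        apply (rder_RtoC (fun x => x)). apply Rder_id.
        apply (rder_comp f (Q x)). apply Df. apply HD; auto; lra. apply rder_affine. }
      rewrite Re_RtoC. ring.
    - intros t Ht. apply cont2_rcont. unfold F'.
      apply (cont2_plus (fun u t => t * h * f' (Q u t) * p u)%C (fun u t => f (Q u t) * h)%C).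
      + apply (cont2_mult (fun u t => t * h * f' (Q u t))%C (fun u t => p u)%C); [|apply cp].
        apply (cont2_mult (fun u t => t * h)%C (fun u t => f' (Q u t))%C).
        apply (cont2_mult (fun u t => RtoC t)%C (fun u t => h)%C). apply cont2_snd. apply cont2_const.
        apply (cont2_comp f' Q). apply Cf', HD; auto; lra. apply cQ.
      + apply (cont2_mult (fun u t => f (Q u t))%C (fun u t => h)%C); [|apply cont2_const].
        apply (cont2_comp f Q). eapply der_cont. apply Df, HD; auto; lra. apply cQ. }
  rewrite <- E.
  apply (CInt_param (fun u t => f (Q u t) * p u)%C F' 0 1 x r); auto; [lra| | |].
  - intros u t Hu Ht. unfold F'. eapply der_eq.
    { apply (der_mult _ (fun z => f (Q (Re z) t)) (fun z => p (Re z))).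
      apply (rder_comp f (fun u => Q u t)). apply Df, HD; auto.
      apply (der_plus _ (fun _ => a) (fun z => t * p (Re z))%C). apply der_const.
      apply (der_scal _ t (fun z => p (Re z))). apply dp. apply dp. }
    cbv beta. rewrite ?Re_RtoC. ring.
  - intros u t Hu Ht. apply (cont2_mult (fun u t => f (Q u t)) (fun u t => p u)); [|apply cp].
    apply (cont2_comp f Q). eapply der_cont. apply Df, HD; auto; lra. apply cQ.
  - intros t Ht. unfold F'.
      apply (cont2_plus (fun u t => t * h * f' (Q u t) * p u)%C (fun u t => f (Q u t) * h)%C).
      + apply (cont2_mult (fun u t => t * h * f' (Q u t))%C (fun u t => p u)%C); [|apply cp].
        apply (cont2_mult (fun u t => t * h)%C (fun u t => f' (Q u t))%C).
        apply (cont2_mult (fun u t => RtoC t)%C (fun u t => h)%C). apply cont2_snd. apply cont2_const.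
        apply (cont2_comp f' Q). apply Cf', HD; auto; lra. apply cQ.
      + apply (cont2_mult (fun u t => f (Q u t))%C (fun u t => h)%C); [|apply cont2_const].
        apply (cont2_comp f Q). eapply der_cont. apply Df, HD; auto; lra. apply cQ.
Qed.

(** The integral along segments from [a] has derivative h f(s + x h) in every real direction h;
    continuity of f and the mean value inequality turn this into a complex derivative. *)
Lemma primitive_star (D : C -> Prop) (a : C) (f : C -> C) :
  copen D -> star D a -> D a -> smooth 1 D f -> exists G, forall s, D s -> cder G s (f s).
Proof.
  intros Op St Da [f' [Df Cf']].
  exists (fun s => CInt (fun t => f (a + t * (s - a)) * (s - a))%C 0 1).
  intros s Ds e He.
  destruct (Op s Ds) as [r [Hr K]].
  destruct (der_cont _ _ _ _ (Df s Ds) e He) as [d [Hd Kd]].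
  exists (Rmin r d); split; [apply Rmin_pos; auto|]. intros h _ Hh.
  assert (h1 := Rlt_le_trans _ _ _ Hh (Rmin_l _ _)).
  assert (h2 := Rlt_le_trans _ _ _ Hh (Rmin_r _ _)).
  assert (B : forall t, 0 <= t <= 1 -> Cmod (t * h)%C <= Cmod h).
  { intros t Ht. rewrite Cmod_mult, Cmod_RtoC_pos by lra. generalize (Cmod_ge_0 h); nra. }
  set (v := fun u : R => CInt (fun t => f (a + t * (s + u * h - a)) * (s + u * h - a))%C 0 1).
  replace (CInt _ 0 1) with (v 1) at 1.
  2:{ unfold v. apply CInt_ext; [lra|]. intros t _. replace (s + 1 * h)%C with (s + h)%C by ring. auto. }
  replace (CInt _ 0 1) with (v 0) at 1.
  2:{ unfold v. apply CInt_ext; [lra|]. intros t _. replace (s + 0 * h)%C with s by ring. auto. }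
  replace (v 1 - v 0 - h * f s)%C with ((v 1 - 1 * (h * f s)) - (v 0 - 0 * (h * f s)))%C by ring.
  replace (e * Cmod h) with (e * Cmod h * (1 - 0)) by ring.
  apply (mean_value_lipschitz (fun t => v t - t * (h * f s))%C
    (fun t => h * f (s + t * h) - h * f s)%C); [lra| |].
  - intros t Ht. apply (der_minus _ (fun x => v (Re x)) (fun x => Re x * (h * f s))%C).
    { change (rder v t (h * f (s + t * h)%C)%C). unfold v.
      apply (star_integral_derive D a f f' s h t); auto. apply K. specialize (B t Ht); lra. }
    apply (der_ext _ (fun x => 0 + Re x * (h * f s))%C). intros; ring. apply (rder_affine 0 (h * f s)).
  - intros t Ht. replace (h * f (s + t * h) - h * f s)%C with (h * (f (s + t * h) - f s))%C by ring.
    rewrite Cmod_mult, Rmult_comm. apply Rmult_le_compat_r. apply Cmod_ge_0.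
    left. apply Kd; auto. specialize (B t Ht); lra.
Qed.

(** * Cauchy's estimate *)

Lemma cexp_circle (t : R) : rder (fun x => Cexp (Ci * x)) t (Ci * Cexp (Ci * t))%C.
Proof.
  apply (der_ext _ (fun x => Cexp (0 + Re x * Ci))%C). intros; f_equal; ring.
  eapply der_eq. apply (rder_Cexp_line 0 Ci). f_equal. f_equal. ring.
Qed.

Lemma Cexp_2PI : Cexp (Ci * (2 * PI)%R)%C = 1%C.
Proof.
  unfold Cexp. Csimpl. replace (Re Ci * 0 + Im Ci * (2 * PI)) with (2 * PI) by (simpl; ring).
  rewrite cos_2PI, sin_2PI. replace (Re Ci * (2 * PI) - Im Ci * 0) with 0 by (simpl; ring).
  rewrite exp_0. apply Ceq; simpl; ring.
Qed.

Lemma Cmod_Cexp_i (t : R) : Cmod (Cexp (Ci * t)) = 1.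
Proof.
  rewrite Cmod_Cexp. replace (Re (Ci * t)%C) with 0 by (simpl; ring). apply exp_0.
Qed.

Lemma cont2_circle (s : C) (u t : R) : cont2 (fun r t => s + r * Cexp (Ci * t))%C u t.
Proof.
  apply (cont2_plus (fun _ _ => s) (fun r t => r * Cexp (Ci * t))%C). apply cont2_const.
  apply (cont2_mult (fun r _ => RtoC r) (fun r t => Cexp (Ci * t))%C). apply cont2_fst.
  apply (cont2_comp Cexp (fun _ t => Ci * t)%C). eapply der_cont, cder_Cexp.
  apply (cont2_mult (fun r _ => Ci) (fun r t => RtoC t)%C). apply cont2_const. apply cont2_snd.
Qed.

Lemma mean_value_circle (k k' : C -> C) (s : C) (R0 r : R) : 0 <= r < R0 ->
  (forall z, Cmod (z - s)%C < R0 -> cder k z (k' z)) ->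
  (forall z, Cmod (z - s)%C < R0 -> ccont k' z) ->
  CInt (fun t => k (s + r * Cexp (Ci * t))%C) 0 (2 * PI) = (2 * PI * k s)%C.
Proof.
  intros Hr Dk Ck. assert (HPI := PI_RGT_0).
  set (Q := fun r t : R => (s + r * Cexp (Ci * t))%C).
  assert (HQ : forall r t, Rabs r < R0 -> Cmod (Q r t - s)%C < R0).
  { intros r' t H. unfold Q. replace (s + r' * Cexp (Ci * t) - s)%C with (r' * Cexp (Ci * t))%C by ring.
    rewrite Cmod_mult, Cmod_Cexp_i, Cmod_R. lra. }
  assert (cQ : forall u t, cont2 Q u t) by (intros; apply cont2_circle).
  assert (cE : forall u t, cont2 (fun _ t => Cexp (Ci * t))%C u t).
  { intros. apply (cont2_comp Cexp (fun _ t => Ci * t)%C). eapply der_cont, cder_Cexp.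
    apply (cont2_mult (fun r _ => Ci) (fun r t => RtoC t)%C). apply cont2_const. apply cont2_snd. }
  set (m := fun r : R => CInt (fun t => k (Q r t)) 0 (2 * PI)).
  assert (T : forall u t, Rabs u < R0 ->
    rder (fun t => k (Q u t)) t (Ci * u * (Cexp (Ci * t) * k' (Q u t)))%C).
  { intros u t Hu. eapply der_eq. apply (rder_comp k (Q u)). apply Dk, HQ; auto.
    apply (der_plus _ (fun _ => s) (fun z => u * Cexp (Ci * Re z))%C). apply der_const.
    apply (der_scal _ u (fun z => Cexp (Ci * Re z))%C). apply cexp_circle. ring. }
  assert (cK : forall u t, Rabs u < R0 -> cont2 (fun u t => Cexp (Ci * t) * k' (Q u t))%C u t).
  { intros u t Hu. apply (cont2_mult (fun u t => Cexp (Ci * t)) (fun u t => k' (Q u t)))%C. apply cE.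
    apply (cont2_comp k' Q). apply Ck, HQ; auto. apply cQ. }
  assert (Z : forall u, Rabs u < R0 -> CInt (fun t => Cexp (Ci * t) * k' (Q u t))%C 0 (2 * PI) = 0%C).
  { intros u Hu. destruct (Req_dec u 0) as [->|N].
    - rewrite (CInt_ext _ (fun t => k' s * Cexp (Ci * t))%C).
      2: lra. 2:{ intros t _. unfold Q. replace (s + 0 * Cexp (Ci * t))%C with s by ring. ring. }
      rewrite (CInt_FTC (fun t => k' s * (- Ci * Cexp (Ci * t)))%C).
      + rewrite Cexp_2PI. replace (Ci * 0)%C with (RtoC 0) by ring. rewrite Cexp_0. ring.
      + lra.
      + intros t _. eapply der_eq.
        apply (der_scal _ (k' s) (fun z => - Ci * Cexp (Ci * Re z))%C).
        apply (der_scal _ (- Ci)%C (fun z => Cexp (Ci * Re z))%C). apply cexp_circle.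
        replace (- Ci * (Ci * Cexp (Ci * t)))%C with (- (Ci * Ci) * Cexp (Ci * t))%C by ring.
        replace (Ci * Ci)%C with (- (1))%C by (apply Ceq; simpl; ring). ring.
      + intros t _. apply (cont2_rcont (fun _ t => k' s * Cexp (Ci * t))%C 0).
        apply (cont2_mult (fun _ _ => k' s) (fun r t => Cexp (Ci * t))%C). apply cont2_const. apply cE.
    - assert (K : (Ci * u * CInt (fun t => Cexp (Ci * t) * k' (Q u t)) 0 (2 * PI))%C = 0%C).
      { rewrite <- CInt_scal.
        rewrite (CInt_FTC (fun t => k (Q u t))).
        + unfold Q. rewrite Cexp_2PI. replace (Ci * 0)%C with (RtoC 0) by ring. rewrite Cexp_0. ring.
        + lra.
        + intros; apply T; auto.
        + intros t _. apply (cont2_rcont (fun u t => Ci * u * (Cexp (Ci * t) * k' (Q u t)))%C u).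
          apply (cont2_mult (fun u t => Ci * u) (fun u t => Cexp (Ci * t) * k' (Q u t)))%C.
          apply (cont2_mult (fun r _ => Ci) (fun r t => RtoC r)%C). apply cont2_const. apply cont2_fst.
          apply cK; auto.
        + lra.
        + intros t _. apply (cont2_rcont (fun u t => (Cexp (Ci * t) * k' (Q u t)))%C u). apply cK; auto. }
      assert (NZ : (Ci * u)%C <> 0%C).
      { apply Cmod_gt_0. rewrite Cmod_mult, Cmod_Ci, Cmod_R, Rmult_1_l. apply Rabs_pos_lt; auto. }
      apply (f_equal (fun z => / (Ci * u) * z)%C) in K. revert K.
      generalize (CInt (fun t => Cexp (Ci * t) * k' (Q u t))%C 0 (2 * PI)). intros c K.
      replace c with (/ (Ci * u) * (Ci * u * c))%C by (field; split; auto;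
        intro A; apply NZ; rewrite A; ring). rewrite K. ring. }
  assert (Dm : forall u, 0 <= u <= r -> rder m u 0%C).
  { intros u Hu. rewrite <- (Z u) by (rewrite Rabs_pos_eq; lra).
    assert (NB : forall u', Rabs (u' - u) < R0 - r -> Rabs u' < R0).
    { intros u' H. replace u' with ((u' - u) + u) by ring. apply Rle_lt_trans with (1 := Rabs_triang _ _).
      rewrite (Rabs_pos_eq u); lra. }
    apply (CInt_param (fun u t => k (Q u t)) (fun u t => Cexp (Ci * t) * k' (Q u t))%C 0 (2 * PI) u (R0 - r)).
    - lra.
    - lra.
    - intros u' t H _. eapply der_eq. apply (rder_comp k (fun u => Q u t)). apply Dk, HQ; auto.
      apply rder_affine. ring.
    - intros u' t H _. apply (cont2_comp k Q). eapply der_cont. apply Dk, HQ; auto. apply cQ.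
    - intros t _. apply cK. rewrite Rabs_pos_eq; lra. }
  assert (E := constant_of_derive m 0 r ltac:(lra) Dm).
  unfold m in E. change (CInt (fun t => k (Q r t)) 0 (2 * PI) = (2 * PI * k s)%C).
  rewrite E.
  rewrite (CInt_FTC (fun t => t * k s)%C).
  - rewrite RtoC_mult. ring.
  - lra.
  - intros t _. unfold Q. replace (s + 0 * Cexp (Ci * t))%C with s by ring.
    apply (der_ext _ (fun x => 0 + Re x * (k s))%C). intros; ring. apply (rder_affine 0 (k s)).
  - intros t _. apply (cont2_rcont (fun u t => k (Q 0 t)) 0).
    apply (cont2_comp k (fun _ t => Q 0 t)). eapply der_cont. apply Dk, HQ. rewrite Rabs_R0; lra.
    unfold Q. apply (cont2_plus (fun _ _ => s) (fun r t => 0 * Cexp (Ci * t))%C). apply cont2_const.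
    apply (cont2_mult (fun r _ => 0%C) (fun r t => Cexp (Ci * t))%C). apply cont2_const. apply cE.
Qed.

(** The derivative in u of the integral of (g(s + u e^(it)) - g(s)) e^(-it) over a period is the
    integral of g' over the circle, that is 2 PI g'(s). Integration from 0 to [r] gives Cauchy's
    formula for g'(s); the factor 2 is the one of [CInt_le]. *)
Lemma cauchy_estimate (g g' : C -> C) (s : C) (R0 r M : R) : 0 < r < R0 ->
  (forall z, Cmod (z - s)%C < R0 -> cder g z (g' z)) ->
  smooth 1 (fun z => Cmod (z - s)%C < R0) g' ->
  (forall z, Cmod (z - s)%C = r -> Cmod (g z - g s)%C <= M) ->
  Cmod (g' s) <= 2 * M / r.
Proof.
  intros Hr Dg Sg HM. assert (HPI := PI_RGT_0).
  set (Q := fun r t : R => (s + r * Cexp (Ci * t))%C).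
  assert (HQ : forall r t, Rabs r < R0 -> Cmod (Q r t - s)%C < R0).
  { intros r' t H. unfold Q. replace (s + r' * Cexp (Ci * t) - s)%C with (r' * Cexp (Ci * t))%C by ring.
    rewrite Cmod_mult, Cmod_Cexp_i, Cmod_R. lra. }
  assert (cQ : forall u t, cont2 Q u t) by (intros; apply cont2_circle).
  assert (cE : forall u t, cont2 (fun _ t => Cexp (Ci * (- t)%R))%C u t).
  { intros. apply (cont2_comp Cexp (fun _ t => Ci * (- t)%R)%C). eapply der_cont, cder_Cexp.
    apply (cont2_mult (fun r _ => Ci) (fun r t => RtoC (- t))%C). apply cont2_const.
    apply cont2_real. apply continuity_2d_pt_opp, continuity_2d_pt_id2. }
  assert (Sg0 := smooth_0 1 _ _ Sg). destruct Sg as [g'' [Dg' Cg'']].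
  set (w := fun u t : R => ((g (Q u t) - g s) * Cexp (Ci * (- t)%R))%C).
  assert (cw : forall u t, Rabs u < R0 -> cont2 w u t).
  { intros u t Hu. apply (cont2_mult (fun u t => g (Q u t) - g s) (fun u t => Cexp (Ci * (- t)%R)))%C; [|apply cE].
    apply (cont2_plus (fun u t => g (Q u t)) (fun _ _ => - g s))%C; [|apply cont2_const].
    apply (cont2_comp g Q). eapply der_cont. apply Dg, HQ; auto. apply cQ. }
  assert (EE : forall t : R, (Cexp (Ci * t) * Cexp (Ci * (- t)%R))%C = 1%C).
  { intros t. rewrite <- Cexp_plus. replace (Ci * t + Ci * (- t)%R)%C with (RtoC 0).
    apply Cexp_0. rewrite RtoC_opp. ring. }
  set (n := fun u : R => (CInt (w u) 0 (2 * PI) - u * (2 * PI * g' s))%C).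
  assert (Dn : forall u, 0 <= u <= r -> rder n u 0%C).
  { intros u Hu. eapply der_eq.
    { apply (der_minus _ (fun z => CInt (w (Re z)) 0 (2 * PI)) (fun z => Re z * (2 * PI * g' s)))%C.
      2:{ apply (der_ext _ (fun x => 0 + Re x * (2 * PI * g' s))%C). intros; ring. apply (rder_affine 0). }
      apply (CInt_param w (fun u t => g' (Q u t)) 0 (2 * PI) u (R0 - r)).
      - lra.
      - lra.
      - intros u' t H _. unfold w. eapply der_eq.
        apply (der_mult _ (fun z => g (Q (Re z) t) - g s)%C (fun z => Cexp (Ci * (- t)%R))).
        apply (der_minus _ (fun z => g (Q (Re z) t))%C (fun z => g s)).
        apply (rder_comp g (fun u => Q u t)). apply Dg, HQ.
        replace u' with ((u' - u) + u) by ring. apply Rle_lt_trans with (1 := Rabs_triang _ _).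
        rewrite (Rabs_pos_eq u); lra.
        apply rder_affine. apply der_const. apply der_const.
        cbv beta. rewrite Re_RtoC.
        transitivity ((Cexp (Ci * t) * Cexp (Ci * (- t)%R)) * g' (Q u' t))%C; [ring|]. rewrite EE; ring.
      - intros u' t H _. apply cw.
        replace u' with ((u' - u) + u) by ring. apply Rle_lt_trans with (1 := Rabs_triang _ _).
        rewrite (Rabs_pos_eq u); lra.
      - intros t _. apply (cont2_comp g' Q). apply Sg0, HQ. rewrite Rabs_pos_eq; lra. apply cQ. }
    assert (MV := mean_value_circle g' g'' s R0 u ltac:(lra) Dg' Cg'').
    unfold Q. rewrite MV. ring. }
  assert (E := constant_of_derive n 0 r ltac:(lra) Dn). unfold n in E.
  assert (E0 : CInt (w 0) 0 (2 * PI) = 0%C).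
  { rewrite (CInt_FTC (fun _ => 0%C)). ring. lra.
    intros t _. unfold w, Q. replace (s + 0 * Cexp (Ci * t))%C with s by ring.
    replace ((g s - g s) * Cexp (Ci * (- t)%R))%C with (RtoC 0) by ring.
    exact (der_const _ (RtoC 0) (RtoC t)).
    intros t _. apply cont2_rcont. apply cw. rewrite Rabs_R0; lra. }
  rewrite E0 in E.
  assert (E2 : CInt (w r) 0 (2 * PI) = (r * (2 * PI * g' s))%C).
  { transitivity ((CInt (w r) 0 (2 * PI) - r * (2 * PI * g' s)) + r * (2 * PI * g' s))%C; [ring|]. rewrite E. ring. }
  assert (B : Cmod (CInt (w r) 0 (2 * PI)) <= 2 * ((2 * PI - 0) * M)).
  { apply CInt_le. lra. intros; apply cont2_rcont, cw. rewrite Rabs_pos_eq; lra.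
    intros t _. unfold w. rewrite Cmod_mult, Cmod_Cexp_i, Rmult_1_r. apply HM.
    unfold Q. replace (s + r * Cexp (Ci * t) - s)%C with (r * Cexp (Ci * t))%C by ring.
    rewrite Cmod_mult, Cmod_Cexp_i, Cmod_RtoC_pos; lra. }
  rewrite E2, !Cmod_mult, !Cmod_RtoC_pos in B by lra.
  apply Rmult_le_reg_r with (r * (2 * PI)). nra.
  replace (2 * M / r * (r * (2 * PI))) with (2 * (2 * PI * M)) by (field; lra). lra.
Qed.

(** * The angle *)

Lemma Rabs_Carg (z : C) : Rabs (Carg z) = acos (Re z / Cmod z).
Proof.
  unfold Carg. assert (H := acos_bound (Re z / Cmod z)).
  destruct (Rle_dec 0 (Im z)). apply Rabs_pos_eq; lra. rewrite Rabs_left1; lra.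
Qed.

Lemma Re_div_Cmod_bound (z : C) : z <> 0%C -> -1 <= Re z / Cmod z <= 1.
Proof.
  intros Hz. assert (Hm := proj1 (Cmod_gt_0 z) Hz). assert (H := re_le z).
  apply Rabs_le_between in H. split.
  apply Rmult_le_reg_r with (Cmod z); auto. unfold Rdiv. rewrite Rmult_assoc, Rinv_l; lra.
  apply Rmult_le_reg_r with (Cmod z); auto. unfold Rdiv. rewrite Rmult_assoc, Rinv_l; lra.
Qed.

Lemma Rabs_Carg_lt (z : C) (b : R) : z <> 0%C -> 0 <= b <= PI ->
  (Rabs (Carg z) < b <-> Cmod z * cos b < Re z).
Proof.
  intros Hz Hb. assert (Hm := proj1 (Cmod_gt_0 z) Hz).
  assert (B := Re_div_Cmod_bound z Hz).
  rewrite Rabs_Carg. assert (A := acos_bound (Re z / Cmod z)).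
  assert (E : Re z = Cmod z * cos (acos (Re z / Cmod z))).
  { rewrite cos_acos by lra. field. lra. }
  split; intros H.
  - rewrite E. apply Rmult_lt_compat_l; auto. apply cos_decreasing_1; lra.
  - apply Rnot_le_lt. intros K.
    assert (cos (acos (Re z / Cmod z)) <= cos b) by (apply cos_decr_1; lra). nra.
Qed.

Section Angle.
Context (alpha0 c : R) (halpha0 : PI / 2 < alpha0 <= PI) (hc : 0 < c).

(** The condition |arg(s + c)| < alpha0 as a single inequality without the argument, which suits
    openness and star shape. The vertex is excluded because both sides vanish there. *)
Definition wedge (s : C) : Prop := Cmod (s + c)%C * cos alpha0 < Re s + c.

Lemma cos_alpha0 : -1 <= cos alpha0 < 0.
Proof.
  split. apply COS_bound. apply cos_lt_0; lra.
Qed.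

Lemma angle_wedge (s : C) : angle alpha0 c s <-> wedge s.
Proof.
  assert (Ca := cos_alpha0).
  unfold angle, wedge. split.
  - intros [H K]. apply Rabs_Carg_lt in K; auto. assert (P := PI_RGT_0); lra.
  - intros H. assert (N : (s + c)%C <> 0%C).
    { intros E. assert (E2 : Re (s + c)%C = 0) by (rewrite E; auto). rewrite E, Cmod_0 in H.
      revert E2; Csimpl. lra. }
    split; auto. apply Rabs_Carg_lt; auto. assert (P := PI_RGT_0); lra.
Qed.

Lemma wedge_open : copen wedge.
Proof.
  assert (Ca := cos_alpha0).
  intros s Hs. unfold wedge in *. set (q := Re s + c - Cmod (s + c)%C * cos alpha0).
  exists (q / 2). split; [unfold q; lra|]. intros h Hh.
  assert (H1 := re_le h). apply Rabs_le_between in H1.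
  assert (H2 : Cmod (s + c)%C - Cmod h <= Cmod (s + h + c)%C).
  { replace (s + h + c)%C with ((s + c) + h)%C by ring. apply Cmod_plus_ge. }
  rewrite Re_plus. unfold q in *. nra.
Qed.

Lemma wedge_halfplane (s : C) : - c < Re s -> wedge s.
Proof.
  intros H. unfold wedge. assert (Ca := cos_alpha0). assert (K := Cmod_ge_0 (s + c)%C). nra.
Qed.

(** The angle is not convex, its opening exceeding PI. Star shape about a real point follows from
    the reverse triangle inequality, the loss (1 - t)(a + c) being paid for by cos alpha0 >= -1. *)
Lemma wedge_star (a : R) : - c < a -> star wedge (RtoC a).
Proof.
  intros Ha. assert (Ca := cos_alpha0).
  intros z t Hz Ht. unfold wedge in *.
  replace (a + t * (z - a) + c)%C with ((1 - t)%R * (a + c) + t * (z + c))%C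
    by (rewrite RtoC_minus; ring).
  assert (H : t * Cmod (z + c)%C - (1 - t) * (a + c) <= Cmod ((1 - t)%R * (a + c) + t * (z + c))%C).
  { generalize (Cmod_plus_ge (t * (z + c))%C ((1 - t)%R * (a + c))%C).
    rewrite !Cmod_mult, <- (RtoC_plus a c), !Cmod_RtoC_pos by lra.
    replace (t * (z + c) + (1 - t)%R * (a + c)%R)%C with ((1 - t)%R * (a + c)%R + t * (z + c))%C by ring. tauto. }
  replace (Re (a + t * (z - a))%C + c) with ((1 - t) * (a + c) + t * (Re z + c)) by (Csimpl; ring).
  destruct (Req_dec t 0) as [->|N].
  - rewrite <- RtoC_plus. replace ((1 - 0)%R * (a + c)%R + 0 * (z + c))%C with (RtoC (a + c)).
    rewrite Cmod_RtoC_pos by lra. nra. rewrite Rminus_0_r. ring.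
  - assert (0 < t) by lra.
    assert (Cmod ((1 - t)%R * (a + c) + t * (z + c))%C * cos alpha0 <=
      (t * Cmod (z + c)%C - (1 - t) * (a + c)) * cos alpha0) by nra.
    assert (0 <= (1 - t) * (a + c) * (1 + cos alpha0)) by (repeat apply Rmult_le_pos; lra).
    assert (t * (Cmod (z + c)%C * cos alpha0) < t * (Re z + c)) by (apply Rmult_lt_compat_l; auto).
    nra.
Qed.

Lemma wedge_Cexp (w : C) : Rabs (Im w) < alpha0 -> wedge (Cexp w).
Proof.
  intros H. assert (Ca := cos_alpha0). unfold wedge.
  assert (H1 : Re (Cexp w) = exp (Re w) * cos (Im w)) by reflexivity.
  assert (H2 : Cmod (Cexp w) - c <= Cmod (Cexp w + c)%C).
  { generalize (Cmod_plus_ge (Cexp w) c). rewrite Cmod_RtoC_pos by lra. tauto. }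
  rewrite Cmod_Cexp in H2.
  assert (H3 : cos alpha0 < cos (Im w)).
  { assert (E : cos (Im w) = cos (Rabs (Im w))).
    { unfold Rabs. destruct (Rcase_abs (Im w)); auto. rewrite cos_neg; auto. }
    rewrite E. apply cos_decreasing_1; try lra. apply Rabs_pos. }
  assert (H4 := exp_pos (Re w)). rewrite H1. nra.
Qed.

End Angle.

(** * Derivative of a logarithm *)

(** Only continuity of [lg] is available at first. It makes the increment k small enough for |m - k|
    <= |k| / 2 with m = e^k - 1, whence k = O(h), and then m - k = O(h^2). *)
Lemma cder_log (lg gam : C -> C) (s g1 : C) (r : R) : 0 < r ->
  (forall h, Cmod h < r -> Cexp (lg (s + h)%C) = gam (s + h)%C) ->
  ccont lg s -> cder gam s g1 -> cder lg s (g1 / gam s)%C.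
Proof.
  intros Hr HE Hc Hg.
  assert (Es : Cexp (lg s) = gam s).
  { generalize (HE 0%C). rewrite Cmod_0. replace (s + 0)%C with s by ring. auto. }
  set (g0 := gam s) in *. assert (N0 : g0 <> 0%C) by (rewrite <- Es; apply Cexp_neq_0).
  set (D := (g1 / g0)%C).
  assert (Hq : cder (fun z => gam z / g0)%C s D).
  { eapply der_eq. apply (der_mult _ gam (fun _ => / g0)%C); eauto. apply der_const. unfold D. field; auto. }
  set (B := 2 * (1 + Cmod D)). assert (HB : 2 <= B) by (generalize (Cmod_ge_0 D); unfold B; lra).
  intros e He.
  destruct (Hq 1 Rlt_0_1) as [d1 [Hd1 K1]].
  destruct (Hq (e / 2)) as [d2 [Hd2 K2]]; [lra|].
  assert (E1 := exp_pos 1).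
  destruct (Hc (/ (2 * exp 1))) as [d3 [Hd3 K3]]; [apply Rinv_0_lt_compat; lra|].
  set (d4 := e / (2 * (B * B * exp 1))).
  assert (Hd4 : 0 < d4). { apply Rdiv_lt_0_compat; auto. assert (0 < B * B) by nra. nra. }
  exists (Rmin (Rmin r d1) (Rmin (Rmin d2 d3) d4)). split; [repeat apply Rmin_pos; auto|].
  intros h _ Hh.
  assert (a1 := Rlt_le_trans _ _ _ Hh (Rmin_l _ _)). assert (a2 := Rlt_le_trans _ _ _ Hh (Rmin_r _ _)).
  assert (a11 := Rlt_le_trans _ _ _ a1 (Rmin_l _ _)). assert (a12 := Rlt_le_trans _ _ _ a1 (Rmin_r _ _)).
  assert (a21 := Rlt_le_trans _ _ _ a2 (Rmin_l _ _)). assert (b4 := Rlt_le_trans _ _ _ a2 (Rmin_r _ _)).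
  assert (b2 := Rlt_le_trans _ _ _ a21 (Rmin_l _ _)). assert (b3 := Rlt_le_trans _ _ _ a21 (Rmin_r _ _)).
  specialize (K1 h I a12). specialize (K2 h I b2). specialize (K3 h I b3).
  specialize (HE h a11).
  set (k := (lg (s + h) - lg s)%C) in *.
  set (m := (gam (s + h) / g0 - 1)%C).
  assert (Ek : Cexp k = (m + 1)%C).
  { unfold k. rewrite Cexp_minus, HE, Es. unfold m. ring. }
  replace (gam (s + h) / g0 - g0 / g0)%C with m in K1, K2 by (unfold m; field; auto).
  replace (gam s / g0)%C with (RtoC 1) in K1, K2 by (unfold g0; field; auto).
  fold m in K1, K2.
  assert (Hp := Cmod_ge_0 h). assert (Kp := Cmod_ge_0 k).
  assert (Hm : Cmod m <= (1 + Cmod D) * Cmod h).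
  { replace m with ((m - h * D) + h * D)%C by ring. apply Rle_trans with (1 := Cmod_triangle _ _).
    rewrite Cmod_mult. lra. }
  assert (ke : Cmod k * exp 1 <= / 2).
  { apply Rle_trans with (/ (2 * exp 1) * exp 1). apply Rmult_le_compat_r; lra. right; field; lra. }
  assert (k1 : Cmod k <= 1).
  { assert (2 < exp 1) by (generalize (exp_ineq1 1 ltac:(lra)); lra). nra. }
  assert (Q : Cmod (m - k)%C <= Cmod k * Cmod k * exp 1).
  { replace (m - k)%C with (Cexp k - 1 - k)%C by (rewrite Ek; ring).
    apply Rle_trans with (1 := Cexp_bound2 k). apply Rmult_le_compat_l. nra. apply exp_le_compat; auto. }
  assert (Hk : Cmod k <= B * Cmod h).
  { assert (Cmod k <= Cmod m + Cmod (m - k)%C).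
    { replace k with (m - (m - k))%C at 1 by ring. apply Cmod_minus_triangle. }
    unfold B. nra. }
  replace (k - h * D)%C with ((m - h * D) - (m - k))%C by ring.
  apply Rle_trans with (1 := Cmod_minus_triangle _ _).
  assert (Q2 : Cmod k * Cmod k * exp 1 <= e / 2 * Cmod h).
  { apply Rle_trans with ((B * Cmod h) * (B * d4) * exp 1).
    apply Rmult_le_compat_r; [lra|]. apply Rmult_le_compat; auto. nra.
    right. unfold d4. field. lra. }
  lra.
Qed.

(** * The logarithmic plane *)

(* [Ps], [Ep], [Ep'] are log L, epsilon and its derivative as functions of
   w = log s; [La], [e], [e'] are their restrictions to the real line. *)
Record frame (a0 : R) (Ps Ep Ep' : C -> C) (La e e' : R -> R) : Prop := {
  fr_a0 : PI / 2 < a0;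
  fr_Ps : forall w, Rabs (Im w) < a0 -> cder Ps w (Ep w);
  fr_Ep : forall w, Rabs (Im w) < a0 -> cder Ep w (Ep' w);
  fr_Ep' : smooth 1 (fun w => Rabs (Im w) < a0) Ep';
  fr_Ps_real : forall x : R, Ps (RtoC x) = RtoC (La x);
  fr_Ep_real : forall x : R, Ep (RtoC x) = RtoC (e x);
  fr_Ep'_real : forall x : R, Ep' (RtoC x) = RtoC (e' x);
  fr_pos : forall x, 0 < e x;
  fr_bounded : exists M, forall x, e x <= M;
  fr_div : forall K, exists X, forall x, X <= x -> K <= La x;
  fr_slow : forall eta, 0 < eta -> exists X, forall x, X <= x -> Rabs (e' x) <= eta * e x;
  fr_uniform : forall delta eta, 0 < delta -> 0 < eta -> exists X, forall x b, X <= x ->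
    Rabs b <= a0 - delta -> Cmod (Ep (x, b) - e x)%C <= eta * e x
}.

Lemma real_derivative (f : C -> C) (x : R) (l : C) (r : R) : 0 < r ->
  (forall y, Rabs (y - x) < r -> Im (f (RtoC y)) = 0) -> cder f (RtoC x) l ->
  Im l = 0 /\ is_derive (fun y => Re (f (RtoC y))) x (Re l).
Proof.
  intros Hr Hf D.
  assert (T : rder (fun y => f (RtoC y)) x l).
  { eapply der_eq. apply (rder_comp f RtoC). exact D. apply (rder_RtoC (fun x => x)). apply Rder_id. ring. }
  destruct (rder_components _ _ _ T) as [T1 T2]. split; auto.
  rewrite <- (is_derive_unique _ _ _ T2). rewrite (Derive_ext_loc _ (fun _ => 0)). apply Derive_const.
  exists (mkposreal r Hr). intros y Hy. apply Hf. exact Hy.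
Qed.

(** * The hypotheses on gamma, carried over to the logarithmic plane *)

Section Setup.
Context (alpha0 c : R) (gamma lg : C -> C)
  (halpha0 : PI / 2 < alpha0 <= PI) (hc : 0 < c)
  (hgamma : base_function alpha0 c gamma)
  (hlg : is_real_log_branch alpha0 c gamma lg).

Let W := wedge alpha0 c.

Lemma lg_derivative : exists phi : C -> C, (forall s, W s -> cder lg s (phi s)) /\
  forall n, smooth n W phi.
Proof.
  assert (A : forall s, W s -> angle alpha0 c s) by (intros; apply angle_wedge; auto).
  assert (S0 : forall n, smooth n W gamma).
  { intros n. apply analytic_smooth. intros z Hz. apply (base_analytic _ _ _ hgamma); auto. }
  assert (D : forall s, W s -> cder gamma s (C_derive gamma s)).
  { intros s Hs. apply analytic_at_derive. apply (base_analytic _ _ _ hgamma); auto. }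
  exists (fun s => C_derive gamma s / gamma s)%C. split.
  - intros s Hs. destruct (wedge_open alpha0 c halpha0 s Hs) as [r [Hr K]].
    apply cder_log with r; auto.
    + intros h Hh. apply (log_exp _ _ _ _ hlg). apply A, K; auto.
    + apply continuous_ccont, (log_continuous _ _ _ _ hlg); auto.
  - intros n. apply smooth_div; auto.
    + intros z Hz. apply (base_nonzero _ _ _ hgamma); auto.
    + apply analytic_smooth. intros z Hz. apply analytic_at_derive. apply (base_analytic _ _ _ hgamma); auto.
Qed.

(** Since s log L(s) = log gamma(s), Phi is the logarithmic derivative of gamma, and eps is its
    difference from log L. *)
Lemma L_log_derivative (phi : C -> C) (s : C) : (forall s, W s -> cder lg s (phi s)) ->
  W s -> s <> 0%C ->
  (C_derive (L lg) s / L lg s)%C = ((phi s - lg s / s) / s)%C /\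
  eps lg s = (phi s - lg s / s)%C /\ Phi lg s = phi s.
Proof.
  intros H Hs N.
  assert (E : (C_derive (L lg) s / L lg s)%C = ((phi s - lg s / s) / s)%C).
  { unfold L, logL. rewrite (C_derive_eq _ s ((phi s * / s + lg s * - / (s * s)) * Cexp (lg s / s))%C).
    - field. split; auto. apply Cexp_neq_0.
    - eapply der_eq. apply (der_Cexp _ (fun s => lg s / s)%C).
      apply (der_mult _ lg (fun s => / s)%C). apply H; auto. apply cder_inv; auto. ring. }
  split; auto. unfold eps, Phi, logL. rewrite E. split; field; auto.
Qed.

Lemma wedge_real (x : R) : - c < x -> W (RtoC x).
Proof. intros; apply wedge_halfplane; auto. Qed.

(** In w = log s the derivative of log L is eps, so the integral in (A) is a difference of values of
    log L; s eps'(s) is the derivative of eps in w, which makes (B) a comparison of [e'] with [e];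
    and (C) becomes uniformity on horizontal strips. *)
Lemma setup_frame (phi : C -> C) (Ps Ep : C -> C) (hadm : admissible alpha0 lg) :
  (forall s, W s -> cder lg s (phi s)) -> (forall n, smooth n W phi) ->
  (forall w, Ps w = lg (Cexp w) * Cexp (- w))%C ->
  (forall w, Ep w = phi (Cexp w) - Ps w)%C ->
  exists Ep', frame alpha0 Ps Ep Ep' (fun x => Re (Ps (RtoC x))) (fun x => Re (Ep (RtoC x)))
    (fun x => Re (Ep' (RtoC x))).
Proof.
  intros Hphi Sphi EPs EEp.
  set (U := fun w : C => Rabs (Im w) < alpha0).
  assert (UW : forall w, U w -> W (Cexp w)) by (intros; apply wedge_Cexp; auto).
  assert (DPs : forall w, U w -> cder Ps w (Ep w)).
  { intros w Hw. apply (der_ext _ (fun w => lg (Cexp w) * Cexp (- w))%C). intros; rewrite EPs; auto.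
    eapply der_eq. apply (der_mult _ (fun w => lg (Cexp w)) (fun w => Cexp (- w))%C).
    apply cder_comp. apply Hphi; auto. apply cder_Cexp.
    apply (der_Cexp _ (fun w => - w)%C). apply der_opp, der_id.
    rewrite EEp, EPs, Cexp_opp. field. apply Cexp_neq_0. }
  assert (SPs : forall n, smooth n U Ps).
  { induction n.
    - intros w Hw. eapply der_cont. apply DPs; auto.
    - exists Ep. split; auto. apply (smooth_ext _ _ (fun w => phi (Cexp w) - Ps w)%C).
      intros; rewrite EEp; auto. apply smooth_minus; auto.
      apply smooth_comp with W; auto. apply smooth_Cexp. }
  assert (SEp : forall n, smooth n U Ep).
  { intros n. apply (smooth_ext _ _ (fun w => phi (Cexp w) - Ps w)%C).
    intros; rewrite EEp; auto. apply smooth_minus; auto.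
    apply smooth_comp with W; auto. apply smooth_Cexp. }
  assert (U0 : forall x : R, U (RtoC x)).
  { intros x. unfold U. rewrite Im_RtoC, Rabs_R0. assert (P := PI_RGT_0). lra. }
  destruct (SEp 2%nat) as [Ep' [DEp SEp']].
  exists Ep'.
  assert (Ilg : forall x : R, - c < x -> Im (lg (RtoC x)) = 0) by (apply (log_real _ _ _ _ hlg)).
  assert (IPs : forall x : R, Im (Ps (RtoC x)) = 0).
  { intros x. rewrite EPs, <- RtoC_opp, !Cexp_RtoC. Csimpl. rewrite Ilg. ring.
    generalize (exp_pos x); lra. }
  assert (IEp : forall x : R, Im (Ep (RtoC x)) = 0 /\ is_derive (fun y => Re (Ps (RtoC y))) x (Re (Ep (RtoC x)))).
  { intros x. apply real_derivative with 1; auto. lra. }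
  assert (IEp' : forall x : R, Im (Ep' (RtoC x)) = 0 /\ is_derive (fun y => Re (Ep (RtoC y))) x (Re (Ep' (RtoC x)))).
  { intros x. apply real_derivative with 1; auto. lra. intros; apply IEp. }
  assert (Ee : forall w, U w -> eps lg (Cexp w) = Ep w).
  { intros w Hw. destruct (L_log_derivative phi (Cexp w) Hphi (UW w Hw) (Cexp_neq_0 w)) as [_ [E _]].
    rewrite E, EEp, EPs, Cexp_opp. reflexivity. }
  assert (eR : forall x : R, epsR lg (exp x) = Re (Ep (RtoC x))).
  { intros x. unfold epsR. rewrite <- Cexp_RtoC, Ee; auto. }
  assert (Ereal : forall f : C -> C, forall x : R, Im (f (RtoC x)) = 0 -> f (RtoC x) = RtoC (Re (f (RtoC x)))).
  { intros f x H. apply Ceq; auto. }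
  constructor; auto.
  - lra.
  - intros x; apply Ereal, IEp.
  - intros x; apply Ereal, IEp'.
  - intros x. rewrite <- eR. apply (adm_positive _ _ hadm), exp_pos.
  - destruct (adm_bounded _ _ hadm) as [M HM]. exists M. intros x. rewrite <- eR. apply HM, exp_pos.
  - intros K.
    set (P := fun x => Re (Ps (RtoC x))).
    assert (A := adm_A _ _ hadm).
    assert (E : forall b, 1 <= b -> RInt (fun rho => epsR lg rho / rho) 1 b = P (ln b) - P (ln 1)).
    { intros b Hb. apply is_RInt_unique.
      apply (is_RInt_derive (fun y => P (ln y))); intros y Hy; rewrite Rmin_left, Rmax_right in Hy by lra.
      - eapply Rder_eq. apply (is_derive_comp P ln). apply IEp. apply is_derive_ln; lra.
        change (/ y * Re (Ep (RtoC (ln y))) = epsR lg y / y).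
        rewrite <- eR, exp_ln by lra. unfold Rdiv. ring.
      - apply (continuous_ext_loc _ (fun y => Re (Ep (RtoC (ln y))) * / y)).
        + exists (mkposreal (1 / 2) ltac:(lra)). intros z Hz.
          assert (Hz' : Rabs (z - y) < 1 / 2) by exact Hz. apply Rabs_def2 in Hz'.
          rewrite <- eR, exp_ln by lra. reflexivity.
        + apply (continuous_mult (K := R_AbsRing)).
          * apply (ex_derive_continuous (K := R_AbsRing) (V := R_NormedModule)). eexists.
            apply (is_derive_comp (fun x => Re (Ep (RtoC x))) ln). apply IEp'. apply is_derive_ln; lra.
          * apply (ex_derive_continuous (K := R_AbsRing) (V := R_NormedModule)). auto_derive. lra. }
    destruct (A (fun y => K - P (ln 1) < y)) as [B HB].
    { exists (K - P (ln 1)). auto. }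
    exists (Rmax 0 (ln (Rmax 1 B) + 1)). intros x Hx.
    assert (x0 : 0 <= x) by (apply Rle_trans with (2 := Hx); apply Rmax_l).
    assert (x1 : ln (Rmax 1 B) + 1 <= x) by (apply Rle_trans with (2 := Hx); apply Rmax_r).
    assert (Rm : 1 <= Rmax 1 B) by apply Rmax_l.
    assert (Bx : Rmax 1 B < exp x).
    { rewrite <- (exp_ln (Rmax 1 B)) by lra. apply exp_increasing. lra. }
    assert (B1 : B < exp x) by (apply Rle_lt_trans with (2 := Bx); apply Rmax_r).
    specialize (HB (exp x) B1). rewrite E, ln_exp in HB by lra. unfold P in HB |- *. lra.
  - intros eta Heta. destruct (adm_B _ _ hadm (mkposreal eta Heta)) as [X HX].
    assert (HX' : forall x, X < x -> Rabs (x * Cmod (C_derive (eps lg) (RtoC x))) <= eta * Rabs (epsR lg x))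
      by exact HX. clear HX.
    exists (Rmax 0 (ln (Rmax 1 X) + 1)). intros x Hx.
    assert (x1 : ln (Rmax 1 X) + 1 <= x) by (apply Rle_trans with (2 := Hx); apply Rmax_r).
    assert (Rm : 1 <= Rmax 1 X) by apply Rmax_l.
    assert (Bx : Rmax 1 X < exp x).
    { rewrite <- (exp_ln (Rmax 1 X)) by lra. apply exp_increasing. lra. }
    assert (B1 : X < exp x) by (apply Rle_lt_trans with (2 := Bx); apply Rmax_r).
    specialize (HX' (exp x) B1). rewrite eR in HX'.
    assert (Hpos : 0 < Re (Ep (RtoC x))) by (rewrite <- eR; apply (adm_positive _ _ hadm), exp_pos).
    rewrite (Rabs_pos_eq (Re (Ep (RtoC x)))) in HX' by lra.
    apply Rle_trans with (2 := HX').
    assert (Wx : W (RtoC (exp x))) by (rewrite <- Cexp_RtoC; auto).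
    destruct (Sphi 1%nat) as [phi' [Dphi' _]].
    assert (Nz : RtoC (exp x) <> 0%C) by (rewrite <- Cexp_RtoC; apply Cexp_neq_0).
    set (s := RtoC (exp x)) in *.
    set (d := (phi' s - (phi s * / s + lg s * - / (s * s)))%C).
    assert (De : cder (eps lg) s d).
    { destruct (wedge_open alpha0 c halpha0 s Wx) as [r [Hr Kr]].
      (* The formula for [eps] holds away from 0, so increments are kept below |s| = exp x. *)
      apply (der_ext_loc _ (fun s => phi s - lg s / s)%C (eps lg) s d (Rmin r (exp x))).
      - apply Rmin_pos; auto. apply exp_pos.
      - intros h _ Hh. symmetry. apply (L_log_derivative phi); auto.
        apply Kr. apply Rlt_le_trans with (1 := Hh). apply Rmin_l.
        apply Cmod_gt_0. generalize (Cmod_plus_ge s h). unfold s at 1. rewrite Cmod_RtoC_pos by (left; apply exp_pos).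
        generalize (Rlt_le_trans _ _ _ Hh (Rmin_r _ _)). lra.
      - symmetry. apply (L_log_derivative phi); auto.
      - unfold d. apply (der_minus _ phi (fun s => lg s / s)%C). apply Dphi'; auto.
        apply (der_mult _ lg (fun s => / s)%C). apply Hphi; auto. apply cder_inv; auto. }
    rewrite (C_derive_eq _ _ _ De).
    assert (E : Ep' (RtoC x) = (s * d)%C).
    { apply (der_unique Ep (RtoC x)). apply DEp; auto.
      apply (der_ext_loc _ (fun w => eps lg (Cexp w)) Ep _ _ alpha0). lra.
      - intros h _ Hh. apply Ee. unfold U. Csimpl. rewrite Rplus_0_l.
        apply Rle_lt_trans with (1 := im_le h); auto.
      - apply Ee; auto.
      - assert (Es : s = Cexp (RtoC x)) by (unfold s; rewrite Cexp_RtoC; auto).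
        rewrite Es. apply cder_comp. rewrite <- Es; auto. apply cder_Cexp. }
    rewrite E. apply Rle_trans with (1 := re_le _). rewrite Cmod_mult. unfold s at 1.
    rewrite Cmod_RtoC_pos by (left; apply exp_pos). apply Rle_abs.
  - intros delta eta Hd He. destruct (adm_C _ _ hadm delta Hd eta He) as [M HM].
    exists (Rmax 0 (ln (Rmax 1 M) + 1)). intros x b Hx Hb.
    assert (x1 : ln (Rmax 1 M) + 1 <= x) by (apply Rle_trans with (2 := Hx); apply Rmax_r).
    assert (Rm : 1 <= Rmax 1 M) by apply Rmax_l.
    assert (Bx : Rmax 1 M < exp x).
    { rewrite <- (exp_ln (Rmax 1 M)) by lra. apply exp_increasing. lra. }
    assert (B1 : M < exp x) by (apply Rle_lt_trans with (2 := Bx); apply Rmax_r).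
    specialize (HM (exp x) b B1 (exp_pos x) Hb).
    rewrite <- Cexp_polar, Ee, <- Cexp_RtoC, Ee, eR in HM; auto.
    + rewrite (Ereal Ep x) in HM; auto. apply IEp.
    + unfold U. simpl. lra.
Qed.

End Setup.

(** * Slow variation of epsilon and the local behaviour of log L and Phi *)

Section Frame.
Context (a0 : R) (Ps Ep Ep' : C -> C) (La e e' : R -> R) (Fr : frame a0 Ps Ep Ep' La e e').

Lemma La_derive (x : R) : is_derive La x (e x).
Proof.
  destruct (real_derivative Ps x (Ep (RtoC x)) 1 Rlt_0_1) as [_ D].
  - intros y _. rewrite (fr_Ps_real _ _ _ _ _ _ _ Fr). apply Im_RtoC.
  - apply (fr_Ps _ _ _ _ _ _ _ Fr). rewrite Im_RtoC, Rabs_R0.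
    assert (H := fr_a0 _ _ _ _ _ _ _ Fr). assert (P := PI_RGT_0). lra.
  - rewrite (fr_Ep_real _ _ _ _ _ _ _ Fr), Re_RtoC in D.
    revert D. apply is_derive_ext. intros y. rewrite (fr_Ps_real _ _ _ _ _ _ _ Fr). apply Re_RtoC.
Qed.

Lemma e_derive (x : R) : is_derive e x (e' x).
Proof.
  destruct (real_derivative Ep x (Ep' (RtoC x)) 1 Rlt_0_1) as [_ D].
  - intros y _. rewrite (fr_Ep_real _ _ _ _ _ _ _ Fr). apply Im_RtoC.
  - apply (fr_Ep _ _ _ _ _ _ _ Fr). rewrite Im_RtoC, Rabs_R0.
    assert (H := fr_a0 _ _ _ _ _ _ _ Fr). assert (P := PI_RGT_0). lra.
  - rewrite (fr_Ep'_real _ _ _ _ _ _ _ Fr), Re_RtoC in D.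
    revert D. apply is_derive_ext. intros y. rewrite (fr_Ep_real _ _ _ _ _ _ _ Fr). apply Re_RtoC.
Qed.

Lemma e_pos (x : R) : 0 < e x.
Proof. apply (fr_pos _ _ _ _ _ _ _ Fr). Qed.

Lemma La_mono (x y : R) : x <= y -> La x <= La y.
Proof.
  intros H. apply monotone_of_derive with e; auto. intros; apply La_derive.
  intros; left; apply e_pos.
Qed.

(** By (B) both eta La - e and eta La + e are eventually increasing, because e is the derivative of
    La. *)
Lemma e_slow (eta : R) : 0 < eta -> exists X, forall x y, X <= x -> x <= y ->
  Rabs (e y - e x) <= eta * (La y - La x).
Proof.
  intros He. destruct (fr_slow _ _ _ _ _ _ _ Fr eta He) as [X HX]. exists X. intros x y Hx Hy.
  assert (A : eta * La x - e x <= eta * La y - e y).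
  { apply (monotone_of_derive (fun t => eta * La t - e t) (fun t => eta * e t - e' t)); auto.
    intros. apply Rder_minus. apply Rder_scal, La_derive. apply e_derive.
    intros t Ht. generalize (HX t ltac:(lra)) (Rle_abs (e' t)). lra. }
  assert (B : eta * La x + e x <= eta * La y + e y).
  { apply (monotone_of_derive (fun t => eta * La t + e t) (fun t => eta * e t + e' t)); auto.
    intros. apply Rder_plus. apply Rder_scal, La_derive. apply e_derive.
    intros t Ht. generalize (HX t ltac:(lra)) (Rle_abs (- e' t)). rewrite Rabs_Ropp. lra. }
  apply Rabs_le. lra.
Qed.

(** By (B), e(t) exp(-eta t) eventually decreases and e(t) exp(eta t) eventually increases. *)
Lemma e_slow_exp (eta : R) : 0 < eta -> exists X, forall x y, X <= x -> x <= y ->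
  e y <= e x * exp (eta * (y - x)) /\ e x <= e y * exp (eta * (y - x)).
Proof.
  intros He. destruct (fr_slow _ _ _ _ _ _ _ Fr eta He) as [X HX]. exists X. intros x y Hx Hy.
  assert (D : forall k t, is_derive (fun t => exp (k * t)) t (k * exp (k * t))).
  { intros. auto_derive; auto. ring. }
  split.
  - assert (A : - (e x * exp (- eta * x)) <= - (e y * exp (- eta * y))).
    { apply (monotone_of_derive (fun t => - (e t * exp (- eta * t)))
        (fun t => - (e' t * exp (- eta * t) + e t * (- eta * exp (- eta * t))))); auto.
      - intros t _. apply (is_derive_opp (fun t => e t * exp (- eta * t))).
        apply (is_derive_mult e (fun t => exp (- eta * t))). apply e_derive. apply D. intros; apply Rmult_comm.
      - intros t Ht. assert (P := exp_pos (- eta * t)).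
        generalize (HX t ltac:(lra)) (Rle_abs (e' t)). intros. nra. }
    apply Rmult_le_reg_r with (exp (- eta * y)). apply exp_pos.
    rewrite Rmult_assoc, <- exp_plus.
    replace (eta * (y - x) + - eta * y) with (- eta * x) by ring. lra.
  - assert (A : e x * exp (eta * x) <= e y * exp (eta * y)).
    { apply (monotone_of_derive (fun t => e t * exp (eta * t))
        (fun t => e' t * exp (eta * t) + e t * (eta * exp (eta * t)))); auto.
      - intros t _.
        apply (is_derive_mult e (fun t => exp (eta * t))). apply e_derive. apply D. intros; apply Rmult_comm.
      - intros t Ht. assert (P := exp_pos (eta * t)).
        generalize (HX t ltac:(lra)) (Rle_abs (- e' t)). rewrite Rabs_Ropp. intros. nra. }
    apply Rmult_le_reg_r with (exp (eta * x)). apply exp_pos.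
    rewrite Rmult_assoc, <- exp_plus.
    replace (eta * (y - x) + eta * x) with (eta * y) by ring. lra.
Qed.

Lemma e_local (T eta : R) : 0 < T -> 0 < eta -> exists X, forall x y, X <= x -> X <= y ->
  Rabs (y - x) <= T -> Rabs (e y - e x) <= eta * e x.
Proof.
  intros HT He.
  set (q := ln (1 + Rmin eta (1 / 2)) / T).
  assert (Hm : 0 < Rmin eta (1 / 2)) by (apply Rmin_pos; lra).
  assert (Hm2 : Rmin eta (1 / 2) <= 1 / 2) by apply Rmin_r.
  assert (Hm1 : Rmin eta (1 / 2) <= eta) by apply Rmin_l.
  set (m := Rmin eta (1 / 2)) in *.
  assert (Hl : 0 < ln (1 + m)) by (rewrite <- ln_1; apply ln_increasing; lra).
  assert (Hq : 0 < q) by (apply Rdiv_lt_0_compat; auto).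
  destruct (e_slow_exp q Hq) as [X HX]. exists X.
  assert (K : forall z, 0 <= z <= T -> exp (q * z) <= 1 + m).
  { intros z Hz. rewrite <- (exp_ln (1 + m)) by lra. apply exp_le_compat.
    replace (ln (1 + m)) with (q * T) by (unfold q; field; lra). apply Rmult_le_compat_l; lra. }
  intros x y Hx Hy Hxy. apply Rabs_le_between in Hxy.
  assert (Ex := e_pos x). assert (Ey := e_pos y).
  apply Rabs_le.
  destruct (Rle_dec x y) as [L|L].
  - destruct (HX x y Hx L) as [H1 H2]. specialize (K (y - x) ltac:(lra)).
    assert (e y <= e x * (1 + m)) by (apply Rle_trans with (1 := H1); apply Rmult_le_compat_l; lra).
    assert (e x <= e y * (1 + m)) by (apply Rle_trans with (1 := H2); apply Rmult_le_compat_l; lra).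
    split; nra.
  - destruct (HX y x Hy ltac:(lra)) as [H1 H2]. specialize (K (x - y) ltac:(lra)).
    assert (e x <= e y * (1 + m)) by (apply Rle_trans with (1 := H1); apply Rmult_le_compat_l; lra).
    assert (e y <= e x * (1 + m)) by (apply Rle_trans with (1 := H2); apply Rmult_le_compat_l; lra).
    split; nra.
Qed.

Lemma La_local (T eta : R) : 0 < T -> 0 < eta -> exists X, forall x y, X <= x -> X <= y ->
  Rabs (y - x) <= T -> Rabs (La y - La x - (y - x) * e x) <= eta * e x * Rabs (y - x).
Proof.
  intros HT He. destruct (e_local T eta HT He) as [X HX]. exists X. intros x y Hx Hy Hxy.
  destruct (MVT_gen La x y e) as [z [Hz E]].
  - intros; apply La_derive.
  - intros w _. apply continuity_pt_filterlim, @ex_derive_continuous. eexists; apply La_derive.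
  - rewrite E. replace (e z * (y - x) - (y - x) * e x) with ((e z - e x) * (y - x)) by ring.
    rewrite Rabs_mult. apply Rmult_le_compat_r. apply Rabs_pos.
    apply Rabs_le_between in Hxy.
    apply HX; auto.
    revert Hz. unfold Rmin, Rmax. destruct (Rle_dec x y); lra.
    apply Rabs_le. revert Hz. unfold Rmin, Rmax. destruct (Rle_dec x y); lra.
Qed.

(** Any rate below 1 would serve in place of 1/2: what matters is that exp x * e x still grows
    exponentially. *)
Lemma e_lower : exists k X, 0 < k /\ 0 <= X /\ forall x, X <= x -> k * exp (- x / 2) <= e x.
Proof.
  destruct (e_slow_exp (1 / 2) ltac:(lra)) as [X0 HX].
  set (X := Rmax 0 X0). assert (H0 : 0 <= X) by apply Rmax_l. assert (H1 : X0 <= X) by apply Rmax_r.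
  exists (e X * exp (X / 2)), X. repeat split; auto.
  apply Rmult_lt_0_compat. apply e_pos. apply exp_pos.
  intros x Hx. destruct (HX X x H1 Hx) as [_ H].
  rewrite Rmult_assoc, <- exp_plus.
  apply Rmult_le_reg_r with (exp (1 / 2 * (x - X))). apply exp_pos.
  rewrite Rmult_assoc, <- exp_plus.
  replace (X / 2 + - x / 2 + 1 / 2 * (x - X)) with 0 by field. rewrite exp_0. lra.
Qed.

Lemma exp_ge_quadratic (y : R) : 0 <= y -> y * y / 2 <= exp y.
Proof.
  intros Hy.
  assert (H : exp 0 - 0 * 0 / 2 - 0 <= exp y - y * y / 2 - y).
  { apply (monotone_of_derive (fun t => exp t - t * t / 2 - t) (fun t => exp t - t - 1)); auto.
    - intros. auto_derive; auto. field.
    - intros t Ht. generalize (exp_ineq1_le t). lra. }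
  rewrite exp_0 in H. lra.
Qed.

(** The quantity exp x * e x is the scale of every exponential decay below. Beating [M * x] with M =
    2 absorbs the factor ds = e^w dw and leaves the integrable tail exp(K - x). *)
Lemma growth_linear (k M : R) : 0 < k -> exists K X, 0 <= X /\ forall x, X <= x ->
  M * x - k * (exp x * e x) <= K.
Proof.
  intros Hk. destruct e_lower as [k1 [X [Hk1 [HX H]]]].
  set (q := k * k1). assert (Hq : 0 < q) by (apply Rmult_lt_0_compat; auto).
  (* The maximum of M x - q x^2 / 8. *)
  exists (2 * (M * M) / q), X. split; auto. intros x Hx. specialize (H x Hx).
  assert (A : k1 * exp (x / 2) <= exp x * e x).
  { replace (k1 * exp (x / 2)) with (exp x * (k1 * exp (- x / 2))).
    apply Rmult_le_compat_l; auto. left; apply exp_pos.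
    replace (x / 2) with (x + - x / 2) by field. rewrite exp_plus. ring. }
  assert (B := exp_ge_quadratic (x / 2) ltac:(lra)).
  assert (P : q * (x * x / 8) <= k * (exp x * e x)).
  { apply Rle_trans with (k * (k1 * exp (x / 2))).
    unfold q. rewrite Rmult_assoc. apply Rmult_le_compat_l; [lra|]. apply Rmult_le_compat_l; lra.
    apply Rmult_le_compat_l; lra. }
  apply Rle_trans with (M * x - q * (x * x / 8)). lra.
  apply Rmult_le_reg_r with q; auto.
  replace (2 * (M * M) / q * q) with (2 * (M * M)) by (field; lra).
  assert (0 <= (q * x / 4 - M) * (q * x / 4 - M)) by apply Rle_0_sqr. nra.
Qed.

Lemma N_large (K : R) : exists X, forall x, X <= x -> K <= exp x * e x.
Proof.
  destruct (growth_linear 1 1 Rlt_0_1) as [K1 [X [HX H]]].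
  exists (Rmax X (K + K1)). intros x Hx.
  assert (X <= x) by (apply Rle_trans with (2 := Hx); apply Rmax_l).
  assert (K + K1 <= x) by (apply Rle_trans with (2 := Hx); apply Rmax_r).
  specialize (H x H0). lra.
Qed.

Lemma La_upper : exists M, 0 < M /\ forall x, 0 <= x -> La x <= La 0 + M * x /\ e x <= M.
Proof.
  destruct (fr_bounded _ _ _ _ _ _ _ Fr) as [M HM]. exists M. split.
  apply Rlt_le_trans with (1 := e_pos 0); auto.
  intros x Hx. split; auto.
  assert (M * 0 - La 0 <= M * x - La x); [|lra].
  apply (monotone_of_derive (fun t => M * t - La t) (fun t => M - e t)); auto.
  intros. apply Rder_minus. apply Rder_eq with (M * 1). apply Rder_scal, Rder_id. ring. apply La_derive.
  intros t _. specialize (HM t). lra.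
Qed.

(** An angle strictly between PI/2 and [a0]: (C) is uniform only on smaller angles, and Cauchy's
    estimate needs a margin for its discs. *)
Definition B0 : R := PI / 2 + (a0 - PI / 2) / 2.

Lemma B0_bounds : PI / 2 < B0 < a0.
Proof. assert (H := fr_a0 _ _ _ _ _ _ _ Fr). unfold B0. lra. Qed.

Lemma strip_of_B0 (x b : R) : Rabs b <= B0 -> Rabs (Im (x, b)) < a0.
Proof. intros H. simpl. generalize B0_bounds. lra. Qed.

Lemma Ep_uniform (eta : R) : 0 < eta -> exists X, forall x b, X <= x -> Rabs b <= B0 ->
  Cmod (Ep (x, b) - e x)%C <= eta * e x.
Proof.
  intros He. destruct (fr_uniform _ _ _ _ _ _ _ Fr (a0 - B0) eta) as [X HX]; auto.
  generalize B0_bounds; lra. exists X. intros. apply HX; auto. lra.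
Qed.

(** By (C) and [e_local], [Ep] oscillates by a small multiple of e(x) on discs of fixed radius, so
    Cauchy's estimate makes its derivative small. Thus the smallness that (B) gives on the real line
    extends to the strip. *)
Lemma Ep'_uniform (eta : R) : 0 < eta -> exists X, forall x b, X <= x -> Rabs b <= B0 ->
  Cmod (Ep' (x, b)) <= eta * e x.
Proof.
  intros He. assert (Ha := fr_a0 _ _ _ _ _ _ _ Fr).
  set (a := a0 - PI / 2). assert (Pa : 0 < a) by (unfold a; lra).
  set (R0 := Rmin 1 (a / 4)). assert (HR : 0 < R0) by (apply Rmin_pos; lra).
  assert (HR1 : R0 <= 1) by apply Rmin_l. assert (HR2 : R0 <= a / 4) by apply Rmin_r.
  (* The oscillation 4 q e(x) on the radius R0 / 2 yields 16 q e(x) / R0 = eta e(x) in Cauchy's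
     estimate. *)
  set (q := eta * R0 / 16). assert (Hq : 0 < q).
  { unfold q. assert (0 < eta * R0) by (apply Rmult_lt_0_compat; auto). lra. }
  destruct (fr_uniform _ _ _ _ _ _ _ Fr (a / 4) (Rmin q 1)) as [X1 H1]; [lra|apply Rmin_pos; lra|].
  destruct (e_local 1 (Rmin q 1) Rlt_0_1 ltac:(apply Rmin_pos; lra)) as [X2 H2].
  assert (q1 : Rmin q 1 <= q) by apply Rmin_l. assert (q2 : Rmin q 1 <= 1) by apply Rmin_r.
  exists (Rmax X1 X2 + 1). intros x b Hx Hb.
  assert (x1 : X1 + 1 <= x) by (apply Rle_trans with (2 := Hx); apply Rplus_le_compat_r, Rmax_l).
  assert (x2 : X2 + 1 <= x) by (apply Rle_trans with (2 := Hx); apply Rplus_le_compat_r, Rmax_r).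
  assert (St : forall z : C, Cmod (z - (x, b))%C < R0 -> Rabs (Im z) <= a0 - a / 4 /\ Rabs (Re z - x) <= 1).
  { intros z Hz. assert (I := im_le (z - (x, b))%C). assert (J := re_le (z - (x, b))%C).
    rewrite Im_minus in I. rewrite Re_minus in J. cbn [Im Re fst snd] in I, J.
    split; [|lra]. replace (Im z) with ((Im z - b) + b) by ring.
    apply Rle_trans with (1 := Rabs_triang _ _). unfold B0, a in *. lra. }
  assert (K := cauchy_estimate Ep Ep' (x, b) R0 (R0 / 2) (4 * q * e x)).
  apply Rle_trans with (2 * (4 * q * e x) / (R0 / 2)).
  - apply K.
    + lra.
    + intros z Hz. apply (fr_Ep _ _ _ _ _ _ _ Fr). generalize (proj1 (St z Hz)). lra.
    + apply smooth_sub with (2 := fr_Ep' _ _ _ _ _ _ _ Fr). intros z Hz.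
      generalize (proj1 (St z Hz)). lra.
    + intros z Hz. destruct (St z ltac:(lra)) as [S1 S2].
      assert (Ez : z = (Re z, Im z)) by (destruct z; auto).
      set (y := Re z) in *.
      assert (y1 : X1 <= y) by (apply Rabs_le_between in S2; lra).
      assert (y2 : X2 <= y) by (apply Rabs_le_between in S2; lra).
      assert (A1 := H1 y (Im z) y1 S1). rewrite <- Ez in A1.
      assert (A2 := H1 x b ltac:(lra) ltac:(unfold B0, a in *; lra)).
      assert (A3 := H2 x y ltac:(lra) y2 S2).
      assert (Px := e_pos x). assert (Py := e_pos y).
      assert (A4 : e y <= 2 * e x) by (apply Rabs_le_between in A3; nra).
      replace (Ep z - Ep (x, b))%C with ((Ep z - e y) + ((e y - e x)%R - (Ep (x, b) - e x)))%C
        by (rewrite RtoC_minus; ring).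
      apply Rle_trans with (1 := Cmod_triangle _ _).
      apply Rle_trans with (Cmod (Ep z - e y)%C + (Cmod (e y - e x)%R + Cmod (Ep (x, b) - e x)%C)).
      apply Rplus_le_compat_l, Cmod_minus_triangle. rewrite Cmod_R.
      assert (Rmin q 1 * e y <= q * (2 * e x)) by (apply Rmult_le_compat; try lra; apply Rlt_le, Rmin_pos; lra).
      assert (Rmin q 1 * e x <= q * e x) by (apply Rmult_le_compat_r; lra). lra.
  - right. unfold q. field. lra.
Qed.

(** The derivative [Ep] of [Ps] is nearly the constant e(x) on the vertical segment, and it is
    integrated from the real point x. *)
Lemma Ps_vertical (eta : R) : 0 < eta -> exists X, forall x b, X <= x -> Rabs b <= B0 ->
  Cmod (Ps (x, b) - (La x, (b * e x)%R))%C <= eta * e x.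
Proof.
  intros He. assert (HB := B0_bounds). assert (P := PI_RGT_0).
  destruct (Ep_uniform (eta / B0)) as [X HX]. apply Rdiv_lt_0_compat; lra.
  exists X. intros x b Hx Hb.
  assert (Ex := e_pos x).
  replace (Ps (x, b) - (La x, (b * e x)%R))%C with
    (Ps (x + (0, b)) - Ps x - (0, b) * e x)%C.
  2:{ rewrite (fr_Ps_real _ _ _ _ _ _ _ Fr). replace (x + (0, b))%C with ((x, b) : C).
      generalize (Ps (x, b)). intros [u v]. apply Ceq; simpl; ring.
      apply Ceq; simpl; ring. }
  assert (Q : forall t, 0 <= t <= 1 -> (x + t * (0, b))%C = (x, (t * b)%R) /\ Rabs (t * b) <= B0).
  { intros t Ht. split. apply Ceq; simpl; ring. rewrite Rabs_mult, Rabs_pos_eq by lra.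
    generalize (Rabs_pos b). nra. }
  apply Rle_trans with (eta / B0 * e x * Cmod (0, b)).
  - apply segment_increment with Ep.
    + intros t Ht. apply (fr_Ps _ _ _ _ _ _ _ Fr). destruct (Q t Ht) as [-> H]. apply strip_of_B0; auto.
    + intros t Ht. destruct (Q t Ht) as [-> H]. apply HX; auto.
  - replace (Cmod (0, b)) with (Rabs b).
    2:{ replace ((0, b) : C) with (Ci * b)%C by (apply Ceq; simpl; ring).
        rewrite Cmod_mult, Cmod_Ci, Cmod_R. ring. }
    apply Rle_trans with (eta / B0 * e x * B0).
    apply Rmult_le_compat_l; auto. apply Rmult_le_pos; [|lra]. apply Rlt_le, Rdiv_lt_0_compat; lra.
    right. field. lra.
Qed.

(* Phi(e^w). *)
Definition Ph (w : C) : C := (Ps w + Ep w)%C.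

Lemma Ph_derive (w : C) : Rabs (Im w) < a0 -> cder Ph w (Ep w + Ep' w)%C.
Proof.
  intros H. apply der_plus. apply (fr_Ps _ _ _ _ _ _ _ Fr); auto. apply (fr_Ep _ _ _ _ _ _ _ Fr); auto.
Qed.

Lemma Ph_uniform (eta : R) : 0 < eta -> exists X, forall x b, X <= x -> Rabs b <= B0 ->
  Cmod (Ep (x, b) + Ep' (x, b) - e x)%C <= eta * e x.
Proof.
  intros He. destruct (Ep_uniform (eta / 2)) as [X1 H1]; [lra|].
  destruct (Ep'_uniform (eta / 2)) as [X2 H2]; [lra|].
  exists (Rmax X1 X2). intros x b Hx Hb.
  specialize (H1 x b (Rle_trans _ _ _ (Rmax_l _ _) Hx) Hb).
  specialize (H2 x b (Rle_trans _ _ _ (Rmax_r _ _) Hx) Hb).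
  replace (Ep (x, b) + Ep' (x, b) - e x)%C with ((Ep (x, b) - e x) + Ep' (x, b))%C by ring.
  apply Rle_trans with (1 := Cmod_triangle _ _). lra.
Qed.

(** The slope is frozen at a reference abscissa p rather than at Re w, so that all points near one
    saddle share the same linear model. *)
Lemma Ph_local (T eta : R) : 0 < T -> 0 < eta -> exists X, forall (p : R) (w h : C), X <= p ->
  Rabs (Re w - p) <= T -> Rabs (Re h) <= T -> Rabs (Im w) <= B0 -> Rabs (Im (w + h)%C) <= B0 ->
  Cmod (Ph (w + h) - Ph w - h * e p)%C <= eta * e p * Cmod h.
Proof.
  intros HT He. set (q := Rmin (eta / 3) 1). assert (Hq : 0 < q) by (apply Rmin_pos; lra).
  assert (q1 : q <= eta / 3) by apply Rmin_l. assert (q2 : q <= 1) by apply Rmin_r.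
  destruct (Ph_uniform q Hq) as [X1 H1]. destruct (e_local (2 * T) q ltac:(lra) Hq) as [X2 H2].
  exists (Rmax X1 X2 + 2 * T). intros p w h Hp Hw Hh Iw Iwh.
  assert (p1 : X1 + 2 * T <= p) by (apply Rle_trans with (2 := Hp); apply Rplus_le_compat_r, Rmax_l).
  assert (p2 : X2 + 2 * T <= p) by (apply Rle_trans with (2 := Hp); apply Rplus_le_compat_r, Rmax_r).
  assert (S : forall t, 0 <= t <= 1 -> Rabs (Re (w + t * h)%C - p) <= 2 * T /\ Rabs (Im (w + t * h)%C) <= B0).
  { intros t Ht. split.
    - Csimpl. replace (Re w + (t * Re h - 0 * Im h) - p) with ((Re w - p) + t * Re h) by ring.
      apply Rle_trans with (1 := Rabs_triang _ _). rewrite Rabs_mult, (Rabs_pos_eq t) by lra.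
      generalize (Rabs_pos (Re h)). nra.
    - revert Iwh. Csimpl. intros Iwh. replace (Im w + (t * Im h + 0 * Re h)) with ((1 - t) * Im w + t * (Im w + Im h)) by ring.
      apply Rle_trans with (1 := Rabs_triang _ _). rewrite !Rabs_mult, (Rabs_pos_eq t), (Rabs_pos_eq (1 - t)) by lra.
      nra. }
  apply segment_increment with (fun w => Ep w + Ep' w)%C.
  - intros t Ht. apply Ph_derive. generalize (proj2 (S t Ht)) B0_bounds. lra.
  - intros t Ht. destruct (S t Ht) as [S1 S2]. set (v := (w + t * h)%C) in *.
    assert (Ev : v = (Re v, Im v)) by (destruct v; auto).
    assert (A1 := H1 (Re v) (Im v) ltac:(apply Rabs_le_between in S1; lra) S2). rewrite <- Ev in A1.
    assert (A2 := H2 p (Re v) ltac:(lra) ltac:(apply Rabs_le_between in S1; lra) S1).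
    assert (Px := e_pos p).
    assert (A4 : e (Re v) <= 2 * e p) by (apply Rabs_le_between in A2; nra).
    replace (Ep v + Ep' v - e p)%C with ((Ep v + Ep' v - e (Re v)) + (e (Re v) - e p)%R)%C
      by (rewrite RtoC_minus; ring).
    apply Rle_trans with (1 := Cmod_triangle _ _). rewrite Cmod_R. nra.
Qed.

(** Unlike in [Ph_local] the distance y - x is unrestricted: this controls the sign of zeta - Phi on
    a whole ray. *)
Lemma Ph_horizontal (eta : R) : 0 < eta -> exists X, forall x y b, X <= x -> x <= y -> Rabs b <= B0 ->
  Cmod (Ph (y, b) - Ph (x, b) - (La y - La x)%R)%C <= eta * (La y - La x).
Proof.
  intros He. destruct (Ph_uniform eta He) as [X HX]. exists X. intros x y b Hx Hy Hb.
  replace (Ph (y, b) - Ph (x, b) - (La y - La x)%R)%C with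
    ((Ph (y, b) - La y) - (Ph (x, b) - La x))%C by (rewrite RtoC_minus; ring).
  replace (eta * (La y - La x)) with (eta * La y - eta * La x) by ring.
  apply (mean_value_le (fun t => Ph (t, b) - La t)%C (fun t => (Ep (t, b) + Ep' (t, b)) - e t)%C
    (fun t => eta * La t) (fun t => eta * e t)); auto.
  - intros t Ht. apply (der_minus _ (fun z => Ph (Re z, b)) (fun z => RtoC (La (Re z)))).
    + apply (der_ext _ (fun z => Ph ((0, b) + Re z * 1)%C)).
      intros z. f_equal. apply Ceq; simpl; ring.
      eapply der_eq. apply (rder_comp Ph (fun t => (0, b) + t * 1)%C). apply Ph_derive.
      replace (Im ((0, b) + t * 1)%C) with b by (simpl; ring). generalize B0_bounds; lra.
      apply rder_affine. replace ((0, b) + t * 1)%C with ((t, b) : C) by (apply Ceq; simpl; ring). ring.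
    + apply (rder_RtoC La). apply La_derive.
  - intros; apply Rder_scal, La_derive.
  - intros t Ht. apply HX; auto; lra.
Qed.

(* The logarithm of z^s / gamma(s) at s = e^w, with zeta = log z. *)
Definition hz (zeta w : C) : C := (Cexp w * (zeta - Ps w))%C.

Lemma hz_derive (zeta w : C) : Rabs (Im w) < a0 -> cder (hz zeta) w (Cexp w * (zeta - Ph w))%C.
Proof.
  intros H. eapply der_eq. apply (der_mult _ Cexp (fun w => zeta - Ps w)%C). apply cder_Cexp.
  apply der_minus. apply der_const. apply (fr_Ps _ _ _ _ _ _ _ Fr); auto.
  unfold Ph. ring.
Qed.

(** The upper bound behind every estimate away from the saddle: log L is replaced by La x + i b
    e(x), and the error is charged to the term with eta. *)
Lemma Re_hz (eta : R) : 0 < eta -> exists X, forall zeta x b, X <= x -> Rabs b <= B0 ->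
  Re (hz zeta (x, b)) <=
    exp x * (cos b * (Re zeta - La x) - sin b * (Im zeta - b * e x) + eta * e x).
Proof.
  intros He. destruct (Ps_vertical eta He) as [X HX]. exists X. intros zeta x b Hx Hb.
  specialize (HX x b Hx Hb).
  set (r := (Ps (x, b) - (La x, (b * e x)%R))%C) in *.
  assert (E : hz zeta (x, b) = (Cexp (x, b) * (zeta - (La x, (b * e x)%R)) - Cexp (x, b) * r)%C).
  { unfold hz, r. ring. }
  rewrite E, Re_minus.
  assert (K : - Re (Cexp (x, b) * r)%C <= exp x * (eta * e x)).
  { rewrite <- Re_opp. apply Rle_trans with (1 := Re_le_Cmod _). rewrite Cmod_opp, Cmod_mult, Cmod_Cexp.
    apply Rmult_le_compat_l; auto. left; apply exp_pos. }
  replace (Re (Cexp (x, b) * (zeta - (La x, (b * e x)%R)))%C) with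
    (exp x * (cos b * (Re zeta - La x) - sin b * (Im zeta - b * e x))).
  lra. Csimpl. unfold Cexp. cbn [Re Im fst snd]. ring.
Qed.

(* [F w] stands for G(e^w), where G is a primitive of z^s / gamma(s). *)
Definition log_primitive (zeta : C) (F : C -> C) : Prop :=
  forall w, Rabs (Im w) < a0 -> cder F w (Cexp (w + hz zeta w)%C).

Lemma F_line (zeta : C) (F : C -> C) (w h : C) (t : R) : log_primitive zeta F ->
  Rabs (Im (w + t * h)%C) < a0 ->
  rder (fun t => F (w + t * h)%C) t (h * Cexp (w + t * h + hz zeta (w + t * h)))%C.
Proof.
  intros HF H. apply (rder_comp F (fun t => w + t * h)%C). apply HF; auto. apply rder_affine.
Qed.

(** The summand t in the exponent is the Jacobian of s = e^w. *)
Lemma F_horizontal (zeta : C) (F : C -> C) (b x y : R) (B B' : R -> R) : log_primitive zeta F ->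
  Rabs b <= B0 -> x <= y ->
  (forall t, x <= t <= y -> is_derive B t (B' t)) ->
  (forall t, x <= t <= y -> exp (t + Re (hz zeta (t, b))) <= B' t) ->
  Cmod (F (y, b) - F (x, b))%C <= B y - B x.
Proof.
  intros HF Hb Hxy DB HB.
  assert (Q : forall t : R, ((0, b) + t * 1)%C = (t, b)) by (intros; apply Ceq; simpl; ring).
  rewrite <- (Q y), <- (Q x).
  apply (mean_value_le (fun t => F ((0, b) + t * 1)%C)
    (fun t => 1 * Cexp ((0, b) + t * 1 + hz zeta ((0, b) + t * 1)))%C B B'); auto.
  - intros t Ht. apply F_line; auto. rewrite Q. apply strip_of_B0; auto.
  - intros t Ht. rewrite Cmod_mult, Cmod_1, Cmod_Cexp, Rmult_1_l, Q, Re_plus. apply HB; auto.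
Qed.

Lemma F_segment (zeta : C) (F : C -> C) (w h : C) (M : R) : log_primitive zeta F ->
  (forall t, 0 <= t <= 1 -> Rabs (Im (w + t * h)%C) < a0) ->
  (forall t, 0 <= t <= 1 -> Re (w + t * h)%C + Re (hz zeta (w + t * h)%C) <= M) ->
  Cmod (F (w + h) - F w)%C <= Cmod h * exp M.
Proof.
  intros HF Hi HM.
  replace (F (w + h) - F w)%C with (F (w + 1 * h) - F (w + 0 * h))%C.
  2:{ replace (w + 1 * h)%C with (w + h)%C by ring. replace (w + 0 * h)%C with w by ring. auto. }
  replace (Cmod h * exp M) with (Cmod h * exp M * (1 - 0)) by ring.
  apply (mean_value_lipschitz (fun t => F (w + t * h)%C)
    (fun t => h * Cexp (w + t * h + hz zeta (w + t * h)))%C); [lra| |].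
  - intros t Ht. apply F_line; auto.
  - intros t Ht. rewrite Cmod_mult, Cmod_Cexp, Re_plus. apply Rmult_le_compat_l. apply Cmod_ge_0.
    apply exp_le_compat; auto.
Qed.

End Frame.

(** * Taylor bounds *)

Lemma one_minus_cos_le (t : R) : 0 <= t -> 1 - cos t <= t * t / 2.
Proof.
  intros H.
  assert (K : 0 * 0 / 2 + cos 0 <= t * t / 2 + cos t).
  { apply (monotone_of_derive (fun t => t * t / 2 + cos t) (fun t => t - sin t)); auto.
    intros; auto_derive; auto; field.
    intros x Hx. destruct (Req_dec x 0) as [->|N]. rewrite sin_0; lra.
    generalize (sin_lt_x x ltac:(lra)); lra. }
  rewrite cos_0 in K. lra.
Qed.

Lemma sin_ge_cubic (t : R) : 0 <= t -> t - t * t * t / 6 <= sin t.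
Proof.
  intros H.
  assert (K : sin 0 - 0 + 0 * 0 * 0 / 6 <= sin t - t + t * t * t / 6).
  { apply (monotone_of_derive (fun t => sin t - t + t * t * t / 6) (fun t => cos t - 1 + t * t / 2)); auto.
    intros; auto_derive; auto; field.
    intros x Hx. generalize (one_minus_cos_le x ltac:(lra)). lra. }
  rewrite sin_0 in K. lra.
Qed.

Lemma sin_le_id (t : R) : 0 <= t -> sin t <= t.
Proof.
  intros H. destruct (Req_dec t 0) as [->|N]. rewrite sin_0; lra.
  generalize (sin_lt_x t ltac:(lra)); lra.
Qed.

Lemma sin_tcos_upper (t : R) : 0 <= t -> sin t - t * cos t <= t * t * t / 2.
Proof.
  intros H. generalize (sin_le_id t H) (one_minus_cos_le t H). nra.
Qed.

Lemma sin_tcos_lower (t : R) : 0 <= t <= 1 -> t * t * t / 4 <= sin t - t * cos t.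
Proof.
  intros H.
  assert (K : sin 0 - 0 * cos 0 - 0 * 0 * 0 / 4 <= sin t - t * cos t - t * t * t / 4).
  { apply (monotone_of_derive (fun t => sin t - t * cos t - t * t * t / 4)
      (fun t => t * sin t - 3 * (t * t) / 4)); [lra| |].
    intros; auto_derive; auto; field.
    intros x Hx. generalize (sin_ge_cubic x ltac:(lra)). intros A.
    assert (x * (x - x * x * x / 6) <= x * sin x) by (apply Rmult_le_compat_l; lra).
    assert (0 <= x * x) by nra. assert (x * x <= 1) by nra. nra. }
  rewrite sin_0, cos_0 in K. lra.
Qed.

(** The left side is the height of the exponent, in units of e(p) times the modulus of s, on the
    diagonal w = p + t + i (PI/2 - t) when Re zeta = La p + e p and Im zeta = (PI/2) e p. The top of
    this diagonal is the saddle, at height 0. *)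
Lemma mid_trig (t : R) : Rabs t <= 1 / 2 -> sin t - t * sin t - t * cos t <= 0.
Proof.
  intros H. apply Rabs_le_between in H.
  destruct (Rle_dec 0 t) as [L|L].
  - generalize (sin_tcos_upper t L) (sin_ge_cubic t L). intros A B.
    assert (t * (t - t * t * t / 6) <= t * sin t) by (apply Rmult_le_compat_l; lra).
    assert (0 <= t * t) by nra. assert (t * t <= 1 / 4) by nra. nra.
  - generalize (sin_tcos_lower (- t) ltac:(lra)). rewrite sin_neg, cos_neg. intros A.
    assert (C : 0 <= sin (- t)) by (generalize (sin_ge_cubic (- t) ltac:(lra)); intros;
      assert ((- t) * (- t) <= 1 / 4) by nra; nra).
    rewrite sin_neg in C. assert (0 <= (- t) * (- t) * (- t)) by (repeat apply Rmult_le_pos; lra). nra.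
Qed.

(** Mostly the choice between the upper and the lower half-plane, so that conjugate situations are
    handled by one argument. *)
Definition sign (sg : R) : Prop := sg = 1 \/ sg = -1.

Lemma cos_sign (sg y : R) : sign sg -> cos (sg * y) = cos y.
Proof.
  intros [->| ->]. f_equal; ring. rewrite <- (cos_neg y). f_equal; ring.
Qed.

Lemma sin_sign (sg y : R) : sign sg -> sin (sg * y) = sg * sin y.
Proof.
  intros [->| ->]. replace (1 * y) with y; ring.
  replace (-1 * y) with (- y) by ring. rewrite sin_neg. ring.
Qed.

Lemma Rabs_sign (sg y : R) : sign sg -> Rabs (sg * y) = Rabs y.
Proof.
  intros [->| ->]. f_equal; ring. rewrite <- (Rabs_Ropp y). f_equal; ring.
Qed.

Lemma cos_PI2_plus (t : R) : cos (PI / 2 + t) = - sin t.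
Proof. rewrite cos_plus, cos_PI2, sin_PI2. ring. Qed.

Lemma sin_PI2_plus (t : R) : sin (PI / 2 + t) = cos t.
Proof. rewrite sin_plus, cos_PI2, sin_PI2. ring. Qed.

Lemma exp_small (A eta : R) : 0 < eta -> exists L, forall x, L <= x -> exp (A - x) <= eta.
Proof.
  intros He. exists (A - ln eta). intros x Hx. rewrite <- (exp_ln eta) by auto.
  apply exp_le_compat. lra.
Qed.

(** * Paths across the imaginary direction on which the integrand is small *)

Section Rays.
Context (a0 : R) (Ps Ep Ep' : C -> C) (La e e' : R -> R) (Fr : frame a0 Ps Ep Ep' La e e').
Context (d1 : R) (Hd1 : 0 < d1 <= 1 / 10) (Hd1' : d1 <= (a0 - PI / 2) / 2).

(** On the ray at angle PI/2 + d1, at the abscissa p of a saddle lying exactly in the imaginary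
    direction, Re h is about - sig exp p * e p. The tolerance [kap] in the position of zeta
    preserves half of this. *)
Let sig := sin d1 - d1 * cos d1.
Let kap := sig / 8.

Lemma sig_bounds : 0 < sig /\ sig <= d1 * d1 * d1 / 2 /\ sig <= sin d1 /\
  9 / 10 * d1 <= sin d1 <= d1 /\ 9 / 10 <= cos d1 <= 1.
Proof.
  assert (A := sin_tcos_lower d1 ltac:(lra)). assert (B := sin_tcos_upper d1 ltac:(lra)).
  assert (S := sin_ge_cubic d1 ltac:(lra)). assert (S' := sin_le_id d1 ltac:(lra)).
  assert (K := one_minus_cos_le d1 ltac:(lra)). assert (K' := COS_bound d1).
  assert (0 < d1 * d1 * d1) by (repeat apply Rmult_lt_0_compat; lra).
  assert (d1 * d1 <= 1 / 100) by nra.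
  assert (0 <= d1 * cos d1) by nra.
  unfold sig. repeat split; try nra.
Qed.

Lemma PI_upper : PI <= 4.
Proof. generalize PI_4. lra. Qed.

Lemma B0_in : PI / 2 + d1 <= B0 a0.
Proof. unfold B0. lra. Qed.

(** At x = p the height is about - sig e(p). For x < p the term - sin d1 (La p - La x) only lowers
    it, while e(x) exceeds e(p) by at most a small multiple of La p - La x, by [e_slow]. *)
Lemma in_pointwise : exists X, 0 <= X /\ forall zeta sg p x, sign sg -> X <= x -> x <= p ->
  La p + (1 - kap) * e p <= Re zeta -> (PI / 2 - kap) * e p <= sg * Im zeta ->
  e x <= e p + (La p - La x) /\ 0 <= La p - La x /\
  Re (hz Ps zeta (x, sg * (PI / 2 + d1))) <= - (sig / 2) * (exp x * (e p + (La p - La x))).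
Proof.
  destruct sig_bounds as [s1 [s2 [s3 [s4 s5]]]]. assert (HP := PI_RGT_0). assert (HP4 := PI_upper).
  assert (d3 : d1 * d1 * d1 <= 1 / 100) by nra.
  destruct (e_slow _ _ _ _ _ _ _ Fr kap) as [X1 H1]; [unfold kap; lra|].
  destruct (Re_hz _ _ _ _ _ _ _ Fr kap) as [X2 H2]; [unfold kap; lra|].
  exists (Rmax 0 (Rmax X1 X2)). split; [apply Rmax_l|]. intros zeta sg p x Hs Hx Hp A B.
  assert (Hx' := Rle_trans _ _ _ (Rmax_r _ _) Hx).
  specialize (H1 x p (Rle_trans _ _ _ (Rmax_l _ _) Hx') Hp).
  set (J := La p - La x) in *.
  assert (HJ : 0 <= J) by (generalize (La_mono _ _ _ _ _ _ _ Fr x p Hp); unfold J; lra).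
  assert (Pp := e_pos _ _ _ _ _ _ _ Fr p). assert (Px := e_pos _ _ _ _ _ _ _ Fr x).
  apply Rabs_le_between in H1.
  assert (Ex : e x <= e p + kap * J) by lra.
  assert (k1 : 0 < kap <= 1) by (unfold kap; lra).
  split; [nra|]. split; auto.
  specialize (H2 zeta x (sg * (PI / 2 + d1)) (Rle_trans _ _ _ (Rmax_r _ _) Hx')).
  assert (Hb : Rabs (sg * (PI / 2 + d1)) <= B0 a0).
  { rewrite Rabs_sign, Rabs_pos_eq by (auto; lra). apply B0_in. }
  specialize (H2 Hb). rewrite cos_sign, sin_sign in H2 by auto.
  rewrite cos_PI2_plus, sin_PI2_plus in H2.
  apply Rle_trans with (1 := H2).
  replace (- (sig / 2) * (exp x * (e p + J))) with (exp x * (- (sig / 2) * (e p + J))) by ring.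
  apply Rmult_le_compat_l; [left; apply exp_pos|].
  replace (sg * cos d1 * (Im zeta - sg * (PI / 2 + d1) * e x)) with
    (cos d1 * (sg * Im zeta - (PI / 2 + d1) * e x)) by (destruct Hs as [-> | ->]; ring).
  set (Cc := cos d1) in *. set (S := sin d1) in *.
  assert (T1 : S * (La p + (1 - kap) * e p - La x) <= S * (Re zeta - La x)) by (apply Rmult_le_compat_l; lra).
  assert (T2 : Cc * ((PI / 2 - kap) * e p) <= Cc * (sg * Im zeta)) by (apply Rmult_le_compat_l; lra).
  assert (T3 : (Cc * (PI / 2 + d1) + kap) * e x <= (Cc * (PI / 2 + d1) + kap) * (e p + kap * J)).
  { apply Rmult_le_compat_l; auto. nra. }
  assert (T4 : Cc * (PI / 2 + d1) + kap <= 4) by nra.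
  assert (T5 : (Cc * (PI / 2 + d1) + kap) * (kap * J) <= 4 * (kap * J)) by (apply Rmult_le_compat_r; nra).
  replace (La p + (1 - kap) * e p - La x) with (J + (1 - kap) * e p) in T1 by (unfold J; ring).
  assert (T6 : (S + Cc) * kap * e p <= 2 * kap * e p) by (apply Rmult_le_compat_r; nra).
  assert (T7 : sig * J <= S * J) by (apply Rmult_le_compat_r; auto).
  unfold kap in *.
  assert (Es : sig = S - d1 * Cc) by reflexivity.
  assert (T8 : sig * e p = S * e p - d1 * Cc * e p) by (rewrite Es; ring).
  assert (0 <= sig * e p) by nra. assert (0 <= sig * J) by nra.
  nra.
Qed.

(** At x = p this ray is too high, by about sig e(p), which is of third order in d1. After the
    distance d1 the loss sin d1 (La x - La p), of second order, prevails; hence the condition p + d1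
    <= x. *)
Lemma out_pointwise : exists X, 0 <= X /\ forall zeta sg p x, sign sg -> X <= p -> p + d1 <= x ->
  Re zeta <= La p + (1 + kap) * e p -> (PI / 2 - kap) * e p <= sg * Im zeta ->
  e x <= e p + (La x - La p) /\
  Re (hz Ps zeta (x, sg * (PI / 2 - d1))) <= - (sig / 2) * (exp x * (e p + (La x - La p))).
Proof.
  destruct sig_bounds as [s1 [s2 [s3 [s4 s5]]]]. assert (HP := PI_RGT_0). assert (HP4 := PI_upper).
  assert (d3 : d1 * d1 * d1 <= 1 / 100) by nra.
  assert (HPI2 : 1 < PI / 2) by (generalize PI2_1; lra).
  destruct (e_slow _ _ _ _ _ _ _ Fr kap) as [X1 H1]; [unfold kap; lra|].
  destruct (Re_hz _ _ _ _ _ _ _ Fr kap) as [X2 H2]; [unfold kap; lra|].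
  destruct (La_local _ _ _ _ _ _ _ Fr 1 (1 / 10)) as [X3 H3]; [lra|lra|].
  exists (Rmax 0 (Rmax X1 (Rmax X2 X3))). split; [apply Rmax_l|]. intros zeta sg p x Hs Hx Hp A B.
  assert (Hx' := Rle_trans _ _ _ (Rmax_r _ _) Hx).
  assert (Hx'' := Rle_trans _ _ _ (Rmax_r _ _) Hx').
  specialize (H1 p x (Rle_trans _ _ _ (Rmax_l _ _) Hx') ltac:(lra)).
  assert (X3p := Rle_trans _ _ _ (Rmax_r _ _) Hx''). assert (X2p := Rle_trans _ _ _ (Rmax_l _ _) Hx'').
  specialize (H3 p (p + d1) X3p ltac:(lra)).
  replace (p + d1 - p) with d1 in H3 by ring. rewrite Rabs_pos_eq in H3 by lra.
  specialize (H3 ltac:(lra)). apply Rabs_le_between in H3.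
  assert (Mo := La_mono _ _ _ _ _ _ _ Fr (p + d1) x Hp).
  set (J := La x - La p) in *.
  assert (Pp := e_pos _ _ _ _ _ _ _ Fr p). assert (Px := e_pos _ _ _ _ _ _ _ Fr x).
  assert (HJ : 9 / 10 * (d1 * e p) <= J) by (unfold J; nra).
  assert (HJ0 : 0 <= J) by nra.
  apply Rabs_le_between in H1.
  assert (Ex : e x <= e p + kap * J) by lra.
  assert (k1 : 0 < kap <= 1) by (unfold kap; lra).
  split; [nra|].
  specialize (H2 zeta x (sg * (PI / 2 - d1)) ltac:(lra)).
  assert (Hb : Rabs (sg * (PI / 2 - d1)) <= B0 a0).
  { rewrite Rabs_sign, Rabs_pos_eq by (auto; lra). generalize B0_in; lra. }
  specialize (H2 Hb). rewrite cos_sign, sin_sign, cos_shift, sin_shift in H2 by auto.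
  apply Rle_trans with (1 := H2).
  replace (- (sig / 2) * (exp x * (e p + J))) with (exp x * (- (sig / 2) * (e p + J))) by ring.
  apply Rmult_le_compat_l; [left; apply exp_pos|].
  replace (sg * cos d1 * (Im zeta - sg * (PI / 2 - d1) * e x)) with
    (cos d1 * (sg * Im zeta - (PI / 2 - d1) * e x)) by (destruct Hs as [-> | ->]; ring).
  set (Cc := cos d1) in *. set (S := sin d1) in *.
  assert (T1 : S * (Re zeta - La x) <= S * ((1 + kap) * e p - J)) by (apply Rmult_le_compat_l; unfold J; lra).
  assert (T2 : Cc * ((PI / 2 - kap) * e p) <= Cc * (sg * Im zeta)) by (apply Rmult_le_compat_l; lra).
  assert (T3 : (Cc * (PI / 2 - d1) + kap) * e x <= (Cc * (PI / 2 - d1) + kap) * (e p + kap * J)).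
  { apply Rmult_le_compat_l; auto. nra. }
  assert (T4 : Cc * (PI / 2 - d1) + kap <= 4) by nra.
  assert (T5 : (Cc * (PI / 2 - d1) + kap) * (kap * J) <= 4 * (kap * J)) by (apply Rmult_le_compat_r; nra).
  assert (T6 : (S + Cc) * kap * e p <= 2 * kap * e p) by (apply Rmult_le_compat_r; nra).
  assert (Es : sig = S - d1 * Cc) by reflexivity.
  assert (T8 : sig * e p = S * e p - d1 * Cc * e p) by (rewrite Es; ring).
  assert (T9 : d1 * (9 / 10 * (d1 * e p)) <= d1 * J) by (apply Rmult_le_compat_l; lra).
  assert (T10 : sig * e p <= d1 * d1 * d1 / 2 * e p) by (apply Rmult_le_compat_r; lra).
  assert (T11 : d1 * d1 * d1 / 2 * e p <= 1 / 20 * (d1 * (d1 * e p))).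
  { replace (d1 * d1 * d1 / 2 * e p) with (d1 / 2 * (d1 * (d1 * e p))) by field.
    apply Rmult_le_compat_r; [|lra]. repeat apply Rmult_le_pos; lra. }
  assert (T12 : sig * J <= d1 * (1 / 100) * J).
  { apply Rmult_le_compat_r; auto. apply Rle_trans with (1 := s2). nra. }
  assert (T13 : 9 / 10 * d1 * J <= S * J) by (apply Rmult_le_compat_r; lra).
  unfold kap in *. nra.
Qed.

(** The start [X1] must not depend on [eta], so the ray is cut at an abscissa [Y] that does: beyond
    [Y] the tail exp(K - x) is small, and before it the integrand is small because La p - La t tends
    to infinity with p. *)
Lemma in_ray : exists X1, 0 <= X1 /\ forall eta, 0 < eta -> exists P, forall zeta F sg p x,
  P <= p -> sign sg -> log_primitive a0 Ps zeta F ->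
  La p + (1 - kap) * e p <= Re zeta -> (PI / 2 - kap) * e p <= sg * Im zeta -> X1 <= x <= p ->
  Cmod (F (x, sg * (PI / 2 + d1))%R - F (X1, sg * (PI / 2 + d1))%R)%C <= eta.
Proof.
  destruct sig_bounds as [s1 _]. assert (HP := PI_RGT_0).
  destruct in_pointwise as [X0 [HX0 H0]].
  set (k := sig / 2). assert (Hk : 0 < k) by (unfold k; lra).
  destruct (growth_linear _ _ _ _ _ _ _ Fr k 2 Hk) as [K [X2 [HX2 H2]]].
  set (X1 := Rmax X0 X2). exists X1.
  assert (X10 : X0 <= X1) by apply Rmax_l. assert (X12 : X2 <= X1) by apply Rmax_r.
  split; [lra|]. intros eta Heta.
  destruct (exp_small K (eta / 2)) as [Y0 HY0]; [lra|].
  set (Y := Rmax X1 Y0). assert (Y1 : X1 <= Y) by apply Rmax_l. assert (Y2 : Y0 <= Y) by apply Rmax_r.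
  set (kk := k * exp X1). assert (Hkk : 0 < kk) by (apply Rmult_lt_0_compat; auto; apply exp_pos).
  destruct (exp_small Y (eta / (2 * (Y - X1 + 1)))) as [L HL]; [apply Rdiv_lt_0_compat; lra|].
  destruct (fr_div _ _ _ _ _ _ _ Fr (La Y + L / kk)) as [P HP'].
  exists (Rmax P Y). intros zeta F sg p x Hp Hs HF A B Hx.
  assert (p1 := Rle_trans _ _ _ (Rmax_l _ _) Hp). assert (p2 := Rle_trans _ _ _ (Rmax_r _ _) Hp).
  specialize (HP' p p1).
  assert (Hb : Rabs (sg * (PI / 2 + d1)) <= B0 a0).
  { rewrite Rabs_sign, Rabs_pos_eq by (auto; lra). apply B0_in. }
  set (b := sg * (PI / 2 + d1)) in *.
  assert (S1 : forall y, X1 <= y <= Y -> Cmod (F (y, b) - F (X1, b))%C <= eta / 2).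
  { intros y Hy.
    apply Rle_trans with ((eta / (2 * (Y - X1 + 1))) * y - (eta / (2 * (Y - X1 + 1))) * X1).
    - apply (F_horizontal _ _ _ _ _ _ _ Fr zeta F b X1 y (fun t => (eta / (2 * (Y - X1 + 1))) * t) (fun _ => eta / (2 * (Y - X1 + 1)))); auto; try lra.
      + intros. apply Rder_eq with (eta / (2 * (Y - X1 + 1)) * 1); [|ring]. apply Rder_scal, Rder_id.
      + intros t Ht. destruct (H0 zeta sg p t Hs ltac:(lra) ltac:(lra) A B) as [_ [C2 C3]]. fold b in C3.
        apply Rle_trans with (exp (Y - L)); [|apply HL; lra]. apply exp_le_compat.
        assert (D1 : La t <= La Y) by (apply (La_mono _ _ _ _ _ _ _ Fr); lra).
        assert (D2 : exp X1 <= exp t) by (apply exp_le_compat; lra).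
        assert (D3 : L / kk <= La p - La t) by lra.
        assert (D4 : L <= kk * (La p - La t)).
        { apply Rle_trans with (kk * (L / kk)). right; field; lra. apply Rmult_le_compat_l; lra. }
        assert (D5 : kk * (La p - La t) <= k * (exp t * (e p + (La p - La t)))).
        { unfold kk. rewrite Rmult_assoc. apply Rmult_le_compat_l; [lra|].
          assert (Pp := e_pos _ _ _ _ _ _ _ Fr p). apply Rmult_le_compat; auto. left; apply exp_pos. lra. }
        fold k in C3. lra.
    - rewrite <- Rmult_minus_distr_l.
      apply Rle_trans with (eta / (2 * (Y - X1 + 1)) * (Y - X1 + 1)).
      apply Rmult_le_compat_l; [|lra]. apply Rlt_le, Rdiv_lt_0_compat; lra. right; field; lra. }
  destruct (Rle_dec x Y) as [Lx|Lx].
  - apply Rle_trans with (eta / 2); [|lra]. apply S1; lra.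
  - replace (F (x, b) - F (X1, b))%C with ((F (x, b) - F (Y, b)) + (F (Y, b) - F (X1, b)))%C by ring.
    apply Rle_trans with (1 := Cmod_triangle _ _).
    assert (S2 := S1 Y ltac:(lra)).
    assert (S3 : Cmod (F (x, b) - F (Y, b))%C <= - exp (K - x) - - exp (K - Y)).
    { apply (F_horizontal _ _ _ _ _ _ _ Fr zeta F b Y x (fun t => - exp (K - t)) (fun t => exp (K - t))); auto; try lra.
      - intros. auto_derive; auto. unfold Rminus. ring.
      - intros t Ht. destruct (H0 zeta sg p t Hs ltac:(lra) ltac:(lra) A B) as [C1 [C2 C3]]. fold b in C3.
        apply exp_le_compat. specialize (H2 t ltac:(lra)). fold k in C3.
        assert (k * (exp t * e t) <= k * (exp t * (e p + (La p - La t)))).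
        { apply Rmult_le_compat_l; [lra|]. apply Rmult_le_compat_l; auto. left; apply exp_pos. }
        lra. }
    specialize (HY0 Y Y2). generalize (exp_pos (K - x)). lra.
Qed.

Lemma out_ray (eta : R) : 0 < eta -> exists P, forall zeta F sg p x,
  P <= p -> sign sg -> log_primitive a0 Ps zeta F ->
  Re zeta <= La p + (1 + kap) * e p -> (PI / 2 - kap) * e p <= sg * Im zeta -> p + d1 <= x ->
  Cmod (F (x, sg * (PI / 2 - d1))%R - F (p + d1, sg * (PI / 2 - d1))%R)%C <= eta.
Proof.
  destruct sig_bounds as [s1 _]. assert (HP := PI_RGT_0).
  assert (HPI2 : 1 < PI / 2) by (generalize PI2_1; lra).
  destruct out_pointwise as [X0 [HX0 H0]]. intros Heta.
  set (k := sig / 2). assert (Hk : 0 < k) by (unfold k; lra).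
  destruct (growth_linear _ _ _ _ _ _ _ Fr k 2 Hk) as [K [X2 [HX2 H2]]].
  destruct (exp_small K eta) as [Y0 HY0]; [lra|].
  exists (Rmax X0 (Rmax X2 Y0)). intros zeta F sg p x Hp Hs HF A B Hx.
  assert (p1 := Rle_trans _ _ _ (Rmax_l _ _) Hp). assert (p2 := Rle_trans _ _ _ (Rmax_r _ _) Hp).
  assert (p3 := Rle_trans _ _ _ (Rmax_l _ _) p2). assert (p4 := Rle_trans _ _ _ (Rmax_r _ _) p2).
  assert (Hb : Rabs (sg * (PI / 2 - d1)) <= B0 a0).
  { rewrite Rabs_sign, Rabs_pos_eq by (auto; lra). generalize B0_in; lra. }
  set (b := sg * (PI / 2 - d1)) in *.
  assert (S3 : Cmod (F (x, b) - F (p + d1, b)%R)%C <= - exp (K - x) - - exp (K - (p + d1))).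
  { apply (F_horizontal _ _ _ _ _ _ _ Fr zeta F b (p + d1) x (fun t => - exp (K - t)) (fun t => exp (K - t))); auto; try lra.
    - intros. auto_derive; auto. unfold Rminus. ring.
    - intros t Ht. destruct (H0 zeta sg p t Hs p1 ltac:(lra) A B) as [C1 C3]. fold b in C3.
      apply exp_le_compat. specialize (H2 t ltac:(lra)). fold k in C3.
      assert (k * (exp t * e t) <= k * (exp t * (e p + (La t - La p)))).
      { apply Rmult_le_compat_l; [lra|]. apply Rmult_le_compat_l; auto. left; apply exp_pos. }
      lra. }
  specialize (HY0 (p + d1) ltac:(lra)). generalize (exp_pos (K - x)). lra.
Qed.

(** By [mid_trig] the diagonal would reach height 0 at d = 0. The excess d of Im zeta / e(p) over
    PI/2 lowers it by at least 9/10 d, while the approximations together cost a few multiples of q =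
    d / 40. *)
Lemma mid_segment (d eta : R) : 0 < d <= 1 -> 0 < eta -> exists P, forall zeta F sg p,
  P <= p -> sign sg -> log_primitive a0 Ps zeta F ->
  Rabs (Re zeta - La p - e p) <= d / 40 * e p -> (PI / 2 + d) * e p <= sg * Im zeta ->
  Cmod (F (p + d1, sg * (PI / 2 - d1))%R - F (p - d1, sg * (PI / 2 + d1))%R)%C <= eta.
Proof.
  intros Hd Heta. assert (HP := PI_RGT_0). assert (HP4 := PI_upper).
  assert (HPI2 : 1 < PI / 2) by (generalize PI2_1; lra).
  set (q := d / 40). assert (Hq : 0 < q <= 1 / 40) by (unfold q; lra).
  destruct (e_local _ _ _ _ _ _ _ Fr 1 q) as [X1 H1]; [lra|lra|].
  destruct (La_local _ _ _ _ _ _ _ Fr 1 q) as [X2 H2]; [lra|lra|].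
  destruct (Re_hz _ _ _ _ _ _ _ Fr q) as [X3 H3]; [lra|].
  destruct (growth_linear _ _ _ _ _ _ _ Fr (d / 8) 2 ltac:(lra)) as [K [X4 [HX4 H4]]].
  destruct (exp_small (K + 1) eta) as [Y0 HY0]; [lra|].
  exists (Rmax (Rmax X1 X2) (Rmax X3 (Rmax X4 Y0)) + 1). intros zeta F sg p Hp Hs HF A B.
  assert (M1 := Rmax_l (Rmax X1 X2) (Rmax X3 (Rmax X4 Y0))). assert (M2 := Rmax_r (Rmax X1 X2) (Rmax X3 (Rmax X4 Y0))).
  assert (M3 := Rmax_l X1 X2). assert (M4 := Rmax_r X1 X2). assert (M5 := Rmax_l X3 (Rmax X4 Y0)).
  assert (M6 := Rmax_r X3 (Rmax X4 Y0)). assert (M7 := Rmax_l X4 Y0). assert (M8 := Rmax_r X4 Y0).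
  set (h := (2 * d1, - sg * (2 * d1)) : C).
  replace (F (p + d1, sg * (PI / 2 - d1))%R) with (F ((p - d1, sg * (PI / 2 + d1))%R + h)%C).
  2:{ f_equal. apply Ceq; unfold h; simpl; ring. }
  assert (Q : forall t : R, ((p - d1, sg * (PI / 2 + d1))%R + t * h)%C =
    (p + (- d1 + t * (2 * d1)), sg * (PI / 2 - (- d1 + t * (2 * d1))))).
  { intros t. apply Ceq; unfold h; simpl; ring. }
  assert (Hh : Cmod h <= 1).
  { apply Rle_trans with (1 := Cmod_le_abs _). unfold h; cbn [Re Im fst snd].
    replace (- sg * (2 * d1)) with (sg * (- (2 * d1))) by ring. rewrite (Rabs_sign sg), Rabs_Ropp, Rabs_pos_eq by (auto; lra). lra. }
  apply Rle_trans with (Cmod h * exp (K + 1 - p)).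
  2:{ apply Rle_trans with (1 * exp (K + 1 - p)). apply Rmult_le_compat_r; auto. left; apply exp_pos.
      rewrite Rmult_1_l. apply HY0. lra. }
  assert (Hb : forall t, 0 <= t <= 1 -> Rabs (sg * (PI / 2 - (- d1 + t * (2 * d1)))) <= B0 a0).
  { intros t Ht. rewrite Rabs_sign by auto. generalize B0_in. intros. apply Rabs_le. nra. }
  apply (F_segment a0 Ps zeta F); auto.
  - intros t Ht. rewrite Q. apply (strip_of_B0 _ _ _ _ _ _ _ Fr); auto.
  - intros t Ht. rewrite Q. cbn [Re fst].
    specialize (Hb t Ht).
    set (u := - d1 + t * (2 * d1)) in *.
    assert (Hu : Rabs u <= 1 / 10) by (unfold u; apply Rabs_le; nra).
    assert (Hu' := Hu). apply Rabs_le_between in Hu'.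
    specialize (H1 p (p + u) ltac:(lra) ltac:(lra)). specialize (H2 p (p + u) ltac:(lra) ltac:(lra)).
    replace (p + u - p) with u in H1, H2 by ring.
    specialize (H1 ltac:(lra)). specialize (H2 ltac:(lra)).
    specialize (H3 zeta (p + u) _ ltac:(lra) Hb).
    rewrite cos_sign, sin_sign, cos_shift, sin_shift in H3 by auto.
    replace (sg * cos u * (Im zeta - sg * (PI / 2 - u) * e (p + u))) with
      (cos u * (sg * Im zeta - (PI / 2 - u) * e (p + u))) in H3 by (destruct Hs as [-> | ->]; ring).
    assert (Pp := e_pos _ _ _ _ _ _ _ Fr p).
    apply Rabs_le_between in H1. fold q in A. apply Rabs_le_between in A.
    assert (Eu : e (p + u) <= (1 + q) * e p) by lra.
    assert (Cu : 9 / 10 <= cos u <= 1).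
    { split; [|apply COS_bound]. replace (cos u) with (cos (Rabs u)).
      generalize (one_minus_cos_le (Rabs u) (Rabs_pos u)) (Rabs_pos u). nra.
      unfold Rabs. destruct (Rcase_abs u); auto. apply cos_neg. }
    assert (Su : Rabs (sin u) <= 1) by (apply Rabs_le, SIN_bound).
    assert (Mt := mid_trig u ltac:(lra)).
    set (r := (Re zeta - La p - e p) - (La (p + u) - La p - u * e p)).
    assert (Hr : Rabs r <= 2 * q * e p).
    { unfold r. apply Rle_trans with (1 := Rabs_triang _ _). rewrite Rabs_Ropp.
      assert (q * e p * Rabs u <= q * e p * 1) by (apply Rmult_le_compat_l; nra).
      assert (Rabs (Re zeta - La p - e p) <= q * e p) by (apply Rabs_le; lra). lra. }
    replace (Re zeta - La (p + u)) with ((1 - u) * e p + r) in H3 by (unfold r; ring).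
    assert (T1 : sin u * r <= 2 * q * e p).
    { apply Rle_trans with (1 := Rle_abs _). rewrite Rabs_mult.
      apply Rle_trans with (1 * Rabs r); [|lra]. apply Rmult_le_compat_r; auto. apply Rabs_pos. }
    assert (T2 : cos u * ((PI / 2 + d) * e p) <= cos u * (sg * Im zeta)) by (apply Rmult_le_compat_l; lra).
    assert (T3 : cos u * ((PI / 2 - u) * e (p + u)) <= cos u * ((PI / 2 - u) * ((1 + q) * e p))).
    { apply Rmult_le_compat_l; [lra|]. apply Rmult_le_compat_l; lra. }
    assert (T4 : cos u * ((PI / 2 - u) * (q * e p)) <= 1 * (3 * (q * e p))).
    { apply Rmult_le_compat; try lra. repeat apply Rmult_le_pos; lra. apply Rmult_le_compat_r; nra. }
    assert (T5 : q * e (p + u) <= 2 * q * e p) by nra.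
    assert (T6 : (sin u - u * sin u - u * cos u) * e p <= 0) by nra.
    assert (T7 : 9 / 10 * (d * e p) <= cos u * (d * e p)) by (apply Rmult_le_compat_r; nra).
    assert (Hbr : sin u * ((1 - u) * e p + r) - cos u * (sg * Im zeta - (PI / 2 - u) * e (p + u)) + q * e (p + u)
       <= - (d / 4) * e p).
    { assert (Eq : q = d / 40) by reflexivity.
      assert (0 < d * e p) by nra.
      assert (T8 : q * e p = 1 / 40 * (d * e p)) by (rewrite Eq; field).
      nra. }
    assert (Ee : exp p <= 2 * exp (p + u)).
    { rewrite exp_plus. generalize (exp_ineq1_le u) (exp_pos p). nra. }
    assert (H5 : Re (hz Ps zeta (p + u, sg * (PI / 2 - u))) <= - (d / 8) * (exp p * e p)).
    { apply Rle_trans with (1 := H3).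
      apply Rle_trans with (exp (p + u) * (- (d / 4) * e p)).
      apply Rmult_le_compat_l; auto. left; apply exp_pos.
      assert (exp p * (d * e p) <= 2 * exp (p + u) * (d * e p)) by (apply Rmult_le_compat_r; nra). lra. }
    specialize (H4 p ltac:(lra)). lra.
Qed.

(** For fixed zeta the growth of La makes Re h very negative throughout the closed subsector of the
    right half-plane. [X] may depend on zeta, since the end of the path goes to infinity for each z
    separately. *)
Lemma arc_at_infinity (zeta : C) (F : C -> C) (d eta : R) : 0 < d < PI / 2 -> 0 < eta ->
  log_primitive a0 Ps zeta F ->
  exists X, forall x b, X <= x -> Rabs b <= PI / 2 - d -> Cmod (F (x, b) - F (x, 0))%C <= eta.
Proof.
  intros Hd Heta HF. clear - Fr Hd Heta HF. assert (Ha := fr_a0 _ _ _ _ _ _ _ Fr). assert (HP := PI_RGT_0). assert (HP4 := PI_upper).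
  destruct (fr_bounded _ _ _ _ _ _ _ Fr) as [M HM].
  assert (PM : 0 < M) by (apply Rlt_le_trans with (2 := HM 0); apply (e_pos _ _ _ _ _ _ _ Fr)).
  destruct (Re_hz _ _ _ _ _ _ _ Fr 1 Rlt_0_1) as [X1 H1].
  assert (Sd : 0 < sin d) by (apply sin_gt_0; lra).
  destruct (fr_div _ _ _ _ _ _ _ Fr (Re zeta + (Rabs (Im zeta) + 4 * M + 2) / sin d)) as [X2 H2].
  destruct (exp_small 0 (eta / 4)) as [Y0 HY0]; [lra|].
  exists (Rmax (Rmax X1 X2) (Rmax Y0 0)). intros x b Hx Hb.
  assert (x0 := Rle_trans _ _ _ (Rmax_l _ _) Hx). assert (x1 := Rle_trans _ _ _ (Rmax_l _ _) x0).
  assert (x2 := Rle_trans _ _ _ (Rmax_r _ _) x0). assert (x3 := Rle_trans _ _ _ (Rmax_r _ _) Hx).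
  assert (x4 := Rle_trans _ _ _ (Rmax_l _ _) x3). assert (x5 := Rle_trans _ _ _ (Rmax_r _ _) x3).
  specialize (H2 x x2).
  replace (F (x, b)) with (F ((x, 0) + (0, b))%C) by (f_equal; apply Ceq; simpl; ring).
  assert (Q : forall t : R, ((x, 0) + t * (0, b))%C = (x, (t * b)%R)) by (intros t; apply Ceq; simpl; ring).
  assert (Hh : Cmod (0, b) = Rabs b).
  { replace ((0, b) : C) with (Ci * b)%C by (apply Ceq; simpl; ring).
    rewrite Cmod_mult, Cmod_Ci, Cmod_R. ring. }
  assert (Hb' : forall t, 0 <= t <= 1 -> Rabs (t * b) <= PI / 2 - d).
  { intros t Ht. rewrite Rabs_mult, (Rabs_pos_eq t) by lra. generalize (Rabs_pos b). nra. }
  apply Rle_trans with (Cmod (0, b) * exp (0 - x)).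
  - apply (F_segment a0 Ps zeta F); auto.
    + intros t Ht. rewrite Q. apply (strip_of_B0 _ _ _ _ _ _ _ Fr). generalize (Hb' t Ht). unfold B0. lra.
    + intros t Ht. rewrite Q. cbn [Re fst]. specialize (Hb' t Ht).
      specialize (H1 zeta x (t * b) x1 ltac:(unfold B0; lra)).
      set (y := t * b) in *.
      assert (Cy : sin d <= cos y).
      { replace (cos y) with (cos (Rabs y)).
        rewrite <- (cos_shift d). apply cos_decr_1; try lra. apply Rabs_pos.
        unfold Rabs. destruct (Rcase_abs y); auto. apply cos_neg. }
      assert (Sy : Rabs (sin y) <= 1) by (apply Rabs_le, SIN_bound).
      assert (Px := e_pos _ _ _ _ _ _ _ Fr x). specialize (HM x).
      assert (A1 : - (sin y * (Im zeta - y * e x)) <= Rabs (Im zeta) + 2 * M).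
      { apply Rle_trans with (1 := Rle_abs _). rewrite Rabs_Ropp, Rabs_mult.
        apply Rle_trans with (1 * Rabs (Im zeta - y * e x)). apply Rmult_le_compat_r; auto. apply Rabs_pos.
        rewrite Rmult_1_l. apply Rle_trans with (1 := Rabs_triang _ _). apply Rplus_le_compat_l.
        rewrite Rabs_Ropp, Rabs_mult, (Rabs_pos_eq (e x)) by lra. apply Rmult_le_compat; try apply Rabs_pos; lra. }
      assert (A2 : cos y * (Re zeta - La x) <= - (Rabs (Im zeta) + 4 * M + 2)).
      { assert (Z : 0 <= (Rabs (Im zeta) + 4 * M + 2) / sin d).
        { apply Rlt_le, Rdiv_lt_0_compat; auto. generalize (Rabs_pos (Im zeta)). lra. }
        apply Rle_trans with (sin d * (Re zeta - La x)). nra.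
        apply Rle_trans with (sin d * - ((Rabs (Im zeta) + 4 * M + 2) / sin d)).
        apply Rmult_le_compat_l; lra. right; field; lra. }
      assert (A3 : Re (hz Ps zeta (x, y)) <= exp x * (- 2)).
      { apply Rle_trans with (1 := H1). apply Rmult_le_compat_l. left; apply exp_pos. lra. }
      generalize (exp_ineq1_le x). lra.
  - rewrite Hh. specialize (HY0 x x4).
    apply Rle_trans with (4 * (eta / 4)); [|lra]. apply Rmult_le_compat; try lra. apply Rabs_pos. left; apply exp_pos.
Qed.

(** The path consists of the ray at PI/2 + d1, the diagonal, the ray at PI/2 - d1 and an arc back to
    the real axis. The bound d <= sig / 4 puts the deviation d / 40 of Re zeta within the tolerance
    [kap] of both rays. *)
Lemma off_saddle : exists X1, 0 <= X1 /\ forall d eta, 0 < d <= sig / 4 -> 0 < eta ->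
  exists P, forall zeta F sg p,
  P <= p -> sign sg -> log_primitive a0 Ps zeta F ->
  Rabs (Re zeta - La p - e p) <= d / 40 * e p -> (PI / 2 + d) * e p <= sg * Im zeta ->
  exists X, forall x, X <= x -> Cmod (F (x, 0) - F (X1, sg * (PI / 2 + d1))%R)%C <= eta.
Proof.
  destruct sig_bounds as [s1 [s2 _]]. assert (d3 : d1 * d1 * d1 <= 1 / 100) by nra.
  assert (HPI2 : 1 < PI / 2) by (generalize PI2_1; lra).
  destruct in_ray as [X1 [HX1 H1]]. exists X1. split; auto. intros d eta Hd Heta.
  destruct (H1 (eta / 4)) as [P1 K1]; [lra|]. destruct (out_ray (eta / 4)) as [P2 K2]; [lra|].
  destruct (mid_segment d (eta / 4)) as [P3 K3]; [lra|lra|].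
  exists (Rmax (Rmax P1 P2) (Rmax P3 (X1 + d1))). intros zeta F sg p Hp Hs HF A B.
  assert (p0 := Rle_trans _ _ _ (Rmax_l _ _) Hp). assert (p1 := Rle_trans _ _ _ (Rmax_l _ _) p0).
  assert (p2 := Rle_trans _ _ _ (Rmax_r _ _) p0). assert (p3 := Rle_trans _ _ _ (Rmax_r _ _) Hp).
  assert (p4 := Rle_trans _ _ _ (Rmax_l _ _) p3). assert (p5 := Rle_trans _ _ _ (Rmax_r _ _) p3).
  destruct (arc_at_infinity zeta F d1 (eta / 4)) as [X HX]; [lra|lra|auto|].
  exists (Rmax X (p + d1)). intros x Hx.
  assert (x1 := Rle_trans _ _ _ (Rmax_l _ _) Hx). assert (x2 := Rle_trans _ _ _ (Rmax_r _ _) Hx).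
  assert (Pp := e_pos _ _ _ _ _ _ _ Fr p). assert (A' := A). apply Rabs_le_between in A'.
  assert (B' : (PI / 2 - kap) * e p <= sg * Im zeta).
  { apply Rle_trans with (2 := B). apply Rmult_le_compat_r; unfold kap; lra. }
  specialize (K1 zeta F sg p (p - d1) p1 Hs HF ltac:(unfold kap; nra) B' ltac:(lra)).
  specialize (K2 zeta F sg p x p2 Hs HF ltac:(unfold kap; nra) B' x2).
  specialize (K3 zeta F sg p p4 Hs HF A B).
  specialize (HX x (sg * (PI / 2 - d1)) x1 ltac:(rewrite Rabs_sign, Rabs_pos_eq by (auto; lra); lra)).
  rewrite Cmod_sym in HX.
  replace (F (x, 0) - F (X1, sg * (PI / 2 + d1))%R)%C with
    ((F (x, 0) - F (x, sg * (PI / 2 - d1))%R) + ((F (x, sg * (PI / 2 - d1))%R - F (p + d1, sg * (PI / 2 - d1))%R)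
     + ((F (p + d1, sg * (PI / 2 - d1))%R - F (p - d1, sg * (PI / 2 + d1))%R)
     + (F (p - d1, sg * (PI / 2 + d1))%R - F (X1, sg * (PI / 2 + d1))%R))))%C by ring.
  apply Rle_trans with (1 := Cmod_triangle _ _).
  apply Rle_trans with (eta / 4 + (eta / 4 + (eta / 4 + eta / 4))); [|lra].
  apply Rplus_le_compat; auto. apply Rle_trans with (1 := Cmod_triangle _ _).
  apply Rplus_le_compat; auto. apply Rle_trans with (1 := Cmod_triangle _ _).
  apply Rplus_le_compat; auto.
Qed.

End Rays.

(** * The Gaussian integral *)

(** The error integral as an entire function: the two halves of a saddle contribution are its values
    at complex points, so no integral over an unbounded range occurs. *)
Definition gauss_primitive (P : C -> C) : Prop :=
  (forall w, cder P w (Cexp (- (w * w) / 2))%C) /\ P 0%C = 0%C.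

Lemma gauss_primitive_exists : exists P, gauss_primitive P.
Proof.
  destruct (primitive_star (fun _ => True) 0%C (fun w => Cexp (- (w * w) / 2))%C) as [P HP].
  - intros z _. exists 1. split; [lra|auto].
  - intros z t _ _. exact I.
  - exact I.
  - apply smooth_comp with (fun _ => True); auto. apply smooth_Cexp.
    apply (smooth_mult 1 _ (fun w => - (w * w))%C (fun _ => / 2)%C).
    apply smooth_opp, smooth_mult; apply smooth_id. apply smooth_const.
  - exists (fun w => P w - P 0)%C. split; [|ring]. intros w.
    eapply der_eq. apply der_minus. apply HP; exact I. apply der_const. ring.
Qed.

Lemma gauss_primitive_odd (P : C -> C) (w : C) : gauss_primitive P -> P (- w)%C = (- P w)%C.
Proof.
  intros [D Z].
  assert (E : (P (0 + 1 * w) + P (0 + 1 * - w))%C = (P (0 + 0 * w) + P (0 + 0 * - w))%C).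
  { apply (constant_of_derive (fun t => P (0 + t * w) + P (0 + t * - w))%C 0 1); [lra|].
    intros t _. eapply der_eq.
    apply (der_plus _ (fun z => P (0 + Re z * w)%C) (fun z => P (0 + Re z * - w)%C)).
    apply (rder_comp P (fun t => 0 + t * w)%C). apply D. apply rder_affine.
    apply (rder_comp P (fun t => 0 + t * - w)%C). apply D. apply rder_affine.
    replace ((0 + t * - w) * (0 + t * - w))%C with ((0 + t * w) * (0 + t * w))%C by ring. ring. }
  replace (0 + 1 * w)%C with w in E by ring. replace (0 + 1 * - w)%C with (- w)%C in E by ring.
  replace (0 + 0 * w)%C with (RtoC 0) in E by ring. replace (0 + 0 * - w)%C with (RtoC 0) in E by ring.
  rewrite Z in E. replace (P (- w)%C) with ((P w + P (- w)) - P w)%C by ring. rewrite E. ring.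
Qed.

Lemma gauss_real_line (P : C -> C) (x : R) : gauss_primitive P ->
  rder (fun x => P (RtoC x)) x (RtoC (exp (- (x * x) / 2))).
Proof.
  intros [D _]. eapply der_eq. apply (rder_comp P RtoC). apply D.
  apply (rder_RtoC (fun x => x)). apply Rder_id.
  rewrite <- RtoC_mult, <- RtoC_opp, <- RtoC_div, Cexp_RtoC; [ring|lra].
Qed.

Lemma gauss_real (P : C -> C) (x : R) : gauss_primitive P -> 0 <= x ->
  Im (P (RtoC x)) = 0 /\ 0 <= Re (P (RtoC x)).
Proof.
  intros HP Hx. assert (Z := proj2 HP). split.
  - assert (E : RtoC (Im (P (RtoC x))) = RtoC (Im (P (RtoC 0)))).
    { apply (constant_of_derive (fun t => RtoC (Im (P (RtoC t)))) 0 x); auto. intros t _.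
      apply (rder_RtoC (fun t => Im (P (RtoC t)))).
      exact (proj2 (rder_components _ _ _ (gauss_real_line P t HP))). }
    apply RtoC_inj in E. rewrite E, Z. reflexivity.
  - replace 0 with (Re (P (RtoC 0))) by (rewrite Z; reflexivity).
    apply (monotone_of_derive (fun t => Re (P (RtoC t))) (fun t => exp (- (t * t) / 2))); auto.
    intros t _. exact (proj1 (rder_components _ _ _ (gauss_real_line P t HP))).
    intros; left; apply exp_pos.
Qed.

(* P(x)^2 plus the integral of 2 exp(-x^2(1+t^2)/2)/(1+t^2) over [0,1] does not depend on x. *)
Lemma gauss_square (P : C -> C) (x : R) : gauss_primitive P -> 0 <= x ->
  Cmod (P (RtoC x) * P (RtoC x) - (PI / 2)%R)%C <= 4 * exp (- (x * x) / 2).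
Proof.
  intros HP Hx.
  set (q := fun u t : R => (- (u * u) * (1 + t * t) / 2)%C).
  set (F := fun u t : R => (2 * Cexp (q u t) * / (1 + t * t))%C).
  set (F' := fun u t : R => (- (2) * u * Cexp (q u t))%C).
  assert (Nz : forall t : R, (1 + t * t)%C <> 0%C).
  { intros t E. assert (K : Re (1 + t * t)%C = 0) by (rewrite E; reflexivity). revert K. Csimpl. nra. }
  assert (cq : forall u t, cont2 q u t).
  { intros u t. unfold q. apply (cont2_mult (fun u t => - (u * u) * (1 + t * t))%C (fun _ _ => / 2)%C).
    2: apply cont2_const.
    apply (cont2_mult (fun u t => - (u * u))%C (fun u t => 1 + t * t)%C).
    - apply (cont2_comp Copp (fun u t => u * u)%C). apply (der_cont _ _ _ (- (1))%C). apply (der_opp _ (fun w => w)), der_id.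
      apply (cont2_mult (fun u t => RtoC u) (fun u t => RtoC u)); apply cont2_fst.
    - apply (cont2_plus (fun u t => 1%C) (fun u t => t * t)%C). apply cont2_const.
      apply (cont2_mult (fun u t => RtoC t) (fun u t => RtoC t)); apply cont2_snd. }
  assert (cEq : forall u t, cont2 (fun u t => Cexp (q u t)) u t).
  { intros u t. apply (cont2_comp Cexp q); auto. eapply der_cont, cder_Cexp. }
  assert (cF : forall u t, cont2 F u t).
  { intros u t. unfold F. apply (cont2_mult (fun u t => 2 * Cexp (q u t))%C (fun u t => / (1 + t * t))%C).
    apply (cont2_mult (fun _ _ => RtoC 2) (fun u t => Cexp (q u t))); auto. apply cont2_const.
    apply (cont2_comp Cinv (fun u t => 1 + t * t)%C). eapply der_cont, cder_inv; auto.
    apply (cont2_plus (fun u t => 1%C) (fun u t => t * t)%C). apply cont2_const.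
    apply (cont2_mult (fun u t => RtoC t) (fun u t => RtoC t)); apply cont2_snd. }
  assert (cF' : forall u t, cont2 F' u t).
  { intros u t. unfold F'. apply (cont2_mult (fun u t => - (2) * u)%C (fun u t => Cexp (q u t))); auto.
    apply (cont2_mult (fun _ _ => - (2))%C (fun u t => RtoC u)). apply cont2_const. apply cont2_fst. }
  assert (EF' : forall u, CInt (F' u) 0 1 = (- (2) * Cexp (- (u * u) / 2) * P u)%C).
  { intros u.
    rewrite (CInt_ext _ (fun t => (- (2) * Cexp (- (u * u) / 2)) * (u * Cexp (- ((0 + t * u) * (0 + t * u)) / 2)))%C); [|lra|].
    2:{ intros t _. unfold F', q.
        replace (- (u * u) * (1 + t * t) / 2)%C with (- (u * u) / 2 + - ((0 + t * u) * (0 + t * u)) / 2)%C by field.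
        rewrite Cexp_plus. ring. }
    rewrite (CInt_FTC (fun t => (- (2) * Cexp (- (u * u) / 2)) * P (0 + t * u))%C); [| lra | |].
    - replace (0 + 1 * u)%C with (RtoC u) by ring. replace (0 + 0 * u)%C with (RtoC 0) by ring.
      rewrite (proj2 HP). ring.
    - intros t _. apply (der_scal _ _ (fun z => P (0 + Re z * u)%C)).
      apply (rder_comp P (fun t => 0 + t * u)%C). apply HP. apply rder_affine.
    - intros t _. eapply (der_cont _ _ _ _).
      apply (der_scal _ _ (fun z => u * Cexp (- ((0 + Re z * u) * (0 + Re z * u)) / 2))%C).
      apply (der_scal _ _ (fun z => Cexp (- ((0 + Re z * u) * (0 + Re z * u)) / 2))%C).
      apply (der_Cexp _ (fun z => - ((0 + Re z * u) * (0 + Re z * u)) / 2)%C).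
      apply (der_mult _ (fun z => - ((0 + Re z * u) * (0 + Re z * u)))%C (fun _ => / 2)%C).
      apply (der_opp _ (fun z => ((0 + Re z * u) * (0 + Re z * u)))%C).
      apply (der_mult _ (fun z => (0 + Re z * u))%C (fun z => (0 + Re z * u))%C); apply rder_affine.
      apply der_const. }
  assert (EK : (P x * P x + CInt (F x) 0 1)%C = (P 0 * P 0 + CInt (F 0) 0 1)%C).
  { apply (constant_of_derive (fun u => P u * P u + CInt (F u) 0 1)%C 0 x); auto.
    intros u Hu. eapply der_eq.
    - apply (der_plus _ (fun z => P (Re z) * P (Re z))%C (fun z => CInt (F (Re z)) 0 1)).
      apply (der_mult _ (fun z => P (Re z)) (fun z => P (Re z))); apply (gauss_real_line P u HP).
      apply (CInt_param F F' 0 1 u 1); auto; try lra.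
      intros v t _ _. unfold F, F'. eapply der_eq.
      apply (der_mult _ (fun z => 2 * Cexp (q (Re z) t))%C (fun _ => / (1 + t * t))%C); [|apply der_const].
      apply (der_scal _ _ (fun z => Cexp (q (Re z) t))%C).
      apply (der_Cexp _ (fun z => q (Re z) t)). unfold q.
      apply (der_mult _ (fun z => - (Re z * Re z) * (1 + t * t))%C (fun _ => / 2)%C); [|apply der_const].
      apply (der_mult _ (fun z => - (Re z * Re z))%C (fun _ => 1 + t * t)%C); [|apply der_const].
      apply (der_opp _ (fun z => Re z * Re z)%C).
      apply (der_mult _ (fun z => RtoC (Re z)) (fun z => RtoC (Re z))); apply (rder_RtoC (fun x => x)), Rder_id.
      rewrite Re_RtoC. field; auto.
    - rewrite EF'. rewrite Re_RtoC.
      replace (Cexp (- (u * u) / 2)) with (RtoC (exp (- (u * u) / 2))). ring.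
      rewrite <- RtoC_mult, <- RtoC_opp, <- RtoC_div, Cexp_RtoC; [auto|lra]. }
  rewrite (proj2 HP) in EK.
  assert (E0 : CInt (F 0) 0 1 = RtoC (PI / 2)).
  { rewrite (CInt_FTC (fun t => RtoC (2 * atan t))); [| lra | |].
    - rewrite atan_1, atan_0, <- RtoC_minus. f_equal. field.
    - intros t _. eapply der_eq. apply (rder_RtoC (fun t => 2 * atan t)). apply Rder_scal.
      apply is_derive_atan.
      unfold F, q. replace (- (0 * 0) * (1 + t * t) / 2)%C with (RtoC 0) by field. rewrite Cexp_0.
      rewrite RtoC_mult, RtoC_inv, RtoC_plus. unfold Rsqr.
      rewrite RtoC_mult. ring. unfold Rsqr. nra.
    - intros t _. apply cont2_rcont; auto. }
  rewrite E0 in EK.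
  replace (P x * P x - (PI / 2)%R)%C with (- CInt (F x) 0 1)%C.
  2:{ transitivity (P x * P x - (0 * 0 + (PI / 2)%R))%C; [|ring]. rewrite <- EK. ring. }
  rewrite Cmod_opp.
  replace (4 * exp (- (x * x) / 2)) with (2 * ((1 - 0) * (2 * exp (- (x * x) / 2)))) by ring.
  apply CInt_le; [lra| |].
  - intros; apply cont2_rcont; auto.
  - intros t Ht. unfold F. rewrite !Cmod_mult, Cmod_inv, Cmod_Cexp, Cmod_RtoC_pos by (auto; lra).
    assert (A : 1 <= Cmod (1 + t * t)%C).
    { apply Rle_trans with (2 := Re_le_Cmod _). Csimpl. nra. }
    assert (B : / Cmod (1 + t * t)%C <= / 1) by (apply Rinv_le_contravar; lra).
    rewrite Rinv_1 in B.
    assert (B' : 0 < / Cmod (1 + t * t)%C) by (apply Rinv_0_lt_compat; lra).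
    assert (D : exp (Re (q x t)) <= exp (- (x * x) / 2)).
    { apply exp_le_compat. unfold q. rewrite <- !RtoC_mult, <- RtoC_opp, <- (RtoC_plus 1), <- RtoC_mult, <- RtoC_div, Re_RtoC by lra.
      assert (0 <= (x * x) * (t * t)) by (apply Rmult_le_pos; apply Rle_0_sqr). lra. }
    assert (G := exp_pos (Re (q x t))).
    apply Rle_trans with (2 * exp (Re (q x t)) * 1); [|lra]. apply Rmult_le_compat_l; lra.
Qed.

(** The hypothesis keeps u away from the lines |arg u| = PI/4, where the Gaussian stops decaying.
    The problem is moved to the real point |u|, where [gauss_square] and the sign of P select the
    positive root. *)
Lemma gauss_sector_limit (P : C -> C) (c eta : R) : gauss_primitive P -> 0 < c -> 0 < eta ->
  exists R0, forall u : C, c * (Cmod u * Cmod u) <= Re (u * u)%C -> R0 <= Cmod u -> 0 < Re u ->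
  Cmod (P u - sqrt (PI / 2))%C <= eta.
Proof.
  intros HP Hc Heta. assert (HPI := PI_RGT_0).
  assert (S1 : 1 <= sqrt (PI / 2)).
  { rewrite <- sqrt_1. apply sqrt_le_1_alt. generalize PI2_1; lra. }
  assert (SS : sqrt (PI / 2) * sqrt (PI / 2) = PI / 2) by (apply sqrt_sqrt; lra).
  set (c' := Rmin c 1).
  assert (Hc' : 0 < c') by (apply Rmin_pos; lra). assert (c1 : c' <= c) by apply Rmin_l.
  assert (c2 : c' <= 1) by apply Rmin_r.
  (* r^2 exp(-c' r^2/2) is at most 16 / (c'^2 r^2) *)
  exists (1 + 64 / (c' * c' * eta)).
  assert (Hq : 0 < 64 / (c' * c' * eta)).
  { apply Rdiv_lt_0_compat; [lra|]. repeat apply Rmult_lt_0_compat; auto. }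
  intros u Hu Hr Pu.
  set (r := Cmod u) in *. assert (r1 : 1 <= r) by lra.
  assert (Ex : r * exp (- (c' * (r * r)) / 2) <= eta / 8).
  { assert (A := exp_ge_quadratic_aux (c' * (r * r) / 2)) || idtac.
    assert (B : c' * (r * r) / 2 * (c' * (r * r) / 2) / 2 <= exp (c' * (r * r) / 2)).
    { set (y := c' * (r * r) / 2). assert (0 <= y) by (unfold y; nra).
      assert (H1 : exp 0 - 0 * 0 / 2 - 0 <= exp y - y * y / 2 - y).
      { apply (monotone_of_derive (fun t => exp t - t * t / 2 - t) (fun t => exp t - t - 1)); auto.
        intros. auto_derive; auto. field. intros t Ht. generalize (exp_ineq1_le t). lra. }
      rewrite exp_0 in H1. lra. }
    replace (- (c' * (r * r)) / 2) with (- (c' * (r * r) / 2)) by field. rewrite exp_Ropp.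
    assert (Pe := exp_pos (c' * (r * r) / 2)).
    apply Rmult_le_reg_r with (exp (c' * (r * r) / 2)); auto.
    rewrite Rmult_assoc, Rinv_l, Rmult_1_r by lra.
    apply Rle_trans with (eta / 8 * (c' * (r * r) / 2 * (c' * (r * r) / 2) / 2)); [|apply Rmult_le_compat_l; lra].
    assert (K : 64 <= c' * c' * eta * r).
    { apply Rle_trans with (c' * c' * eta * (64 / (c' * c' * eta))). right. field. lra.
      apply Rmult_le_compat_l. repeat apply Rmult_le_pos; lra. lra. }
    replace (eta / 8 * (c' * (r * r) / 2 * (c' * (r * r) / 2) / 2)) with (c' * c' * eta * r * (r * r * r) / 64) by field.
    assert (r <= r * r * r) by nra. assert (0 < r * r * r) by nra. nra. }
  (* from u to |u| along a segment on which Re(v^2) >= c r^2 *)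
  assert (A1 : Cmod (P (u + (r - u)) - P u)%C <= eta / 2).
  { replace (P (u + (r - u)) - P u)%C with (P (u + 1 * (r - u)) - P (u + 0 * (r - u)))%C.
    2:{ replace (u + 1 * (r - u))%C with (u + (r - u))%C by ring.
        replace (u + 0 * (r - u))%C with u by ring. reflexivity. }
    replace (eta / 2) with (eta / 2 * (1 - 0)) by ring.
    apply (mean_value_lipschitz (fun t => P (u + t * (r - u))%C)
      (fun t => (r - u) * Cexp (- ((u + t * (r - u)) * (u + t * (r - u))) / 2))%C); [lra| |].
    - intros t _. apply (rder_comp P (fun t => u + t * (r - u))%C). apply HP. apply rder_affine.
    - intros t Ht. set (v := (u + t * (r - u))%C).
      assert (Rv : Re u <= Re v). { unfold v. Csimpl. generalize (Re_le_Cmod u). fold r. nra. }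
      assert (Iv : Rabs (Im v) <= Rabs (Im u)).
      { replace (Im v) with ((1 - t) * Im u) by (unfold v; Csimpl; ring). rewrite Rabs_mult, (Rabs_pos_eq (1 - t)) by lra.
        generalize (Rabs_pos (Im u)). nra. }
      assert (Sq : Im v * Im v <= Im u * Im u).
      {  assert (T : forall y, y * y = Rabs y * Rabs y) by (intros y; unfold Rabs; destruct (Rcase_abs y); ring).
        rewrite (T (Im v)), (T (Im u)). generalize (Rabs_pos (Im v)). nra. }
      assert (Rv2 : c' * (r * r) <= Re (v * v)%C).
      { revert Hu. Csimpl. intros Hu. assert (c' * (r * r) <= c * (r * r)) by (apply Rmult_le_compat_r; nra). nra. }
      rewrite Cmod_mult, Cmod_Cexp.
      apply Rle_trans with (2 * r * exp (- (c' * (r * r)) / 2)); [|lra].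
      apply Rmult_le_compat. apply Cmod_ge_0. left; apply exp_pos.
      apply Rle_trans with (1 := Cmod_minus_triangle _ _). rewrite Cmod_RtoC_pos by lra. fold r. lra.
      apply exp_le_compat. replace (Re (- (v * v) / 2)%C) with (- Re (v * v)%C / 2). lra.
      replace (- (v * v) / 2)%C with ((- / 2)%R * (v * v))%C. Csimpl. field.
      rewrite RtoC_opp, RtoC_inv by lra. field. }
  replace (u + (r - u))%C with (RtoC r) in A1 by ring.
  assert (A2 : Cmod (P r - sqrt (PI / 2))%C <= eta / 2).
  { destruct (gauss_real P r HP ltac:(lra)) as [I1 I2].
    assert (G := gauss_square P r HP ltac:(lra)).
    replace (P r * P r - (PI / 2)%R)%C with ((P r - sqrt (PI / 2)) * (P r + sqrt (PI / 2)))%C in G.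
    2:{ transitivity (P r * P r - (sqrt (PI / 2) * sqrt (PI / 2))%R)%C; [|rewrite SS; reflexivity].
        rewrite RtoC_mult. ring. }
    rewrite Cmod_mult in G.
    assert (L : 1 <= Cmod (P r + sqrt (PI / 2))%C).
    { apply Rle_trans with (2 := Re_le_Cmod _). Csimpl. lra. }
    assert (Cg := Cmod_ge_0 (P r - sqrt (PI / 2))%C).
    (* 4 exp(-r^2/2) is bounded through the same estimate; c' <= 1 *)
    assert (E2 : exp (- (r * r) / 2) <= r * exp (- (c' * (r * r)) / 2)).
    { assert (exp (- (r * r) / 2) <= exp (- (c' * (r * r)) / 2)) by (apply exp_le_compat; nra).
      generalize (exp_pos (- (c' * (r * r)) / 2)). nra. }
    nra. }
  rewrite Cmod_sym in A1.
  replace (P u - sqrt (PI / 2))%C with ((P u - P r) + (P r - sqrt (PI / 2)))%C by ring.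
  apply Rle_trans with (1 := Cmod_triangle _ _). lra.
Qed.

(** * Gaussian approximation at a saddle point *)

Lemma exp_le_2 (x : R) : x <= 1 / 2 -> exp x <= 2.
Proof.
  intros H. assert (A := exp_ineq1_le (- x)). rewrite exp_Ropp in A. assert (P := exp_pos x).
  apply Rmult_le_reg_r with (/ exp x). apply Rinv_0_lt_compat; auto. rewrite Rinv_r; lra.
Qed.

(** The right side is the derivative of a multiple of arctan, so the errors of the Gaussian
    approximation can be integrated over ranges of any length. The reason is T <= (3/c) exp(c T / 3)
    for T = 1 + y^2, cubed. *)
Lemma cube_exp_bound (c : R) : 0 < c -> exists K, 0 < K /\
  forall y, (1 + y * y) * (1 + y * y) * exp (- (c * (y * y))) <= K / (1 + y * y).
Proof.
  intros Hc. exists (exp c * ((3 / c) * (3 / c) * (3 / c))).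
  assert (Pc : 0 < 3 / c) by (apply Rdiv_lt_0_compat; lra).
  split; [apply Rmult_lt_0_compat; [apply exp_pos|exact (Rmult_lt_0_compat _ _ (Rmult_lt_0_compat _ _ Pc Pc) Pc)]|].
  intros y. set (T := 1 + y * y). assert (HT : 1 <= T) by (unfold T; generalize (Rle_0_sqr y); unfold Rsqr; lra).
  set (E := exp (c * T / 3)).
  assert (HE : c * T / 3 <= E) by (generalize (exp_ineq1_le (c * T / 3)); unfold E; lra).
  assert (HE' : T <= 3 / c * E).
  { apply Rle_trans with (3 / c * (c * T / 3)). right; field; lra. apply Rmult_le_compat_l; lra. }
  assert (EE : exp c * exp (- (c * (y * y))) * (E * E * E) = exp c * exp c).
  { unfold E. rewrite <- !exp_plus. f_equal. unfold T. field. }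
  assert (PE : 0 < E) by apply exp_pos.
  assert (EK : exp c * exp (- (c * (y * y))) = exp c * exp c / (E * E * E)).
  { rewrite <- EE. field. lra. }
  assert (Ec := exp_pos c).
  assert (EK2 : exp (- (c * (y * y))) = exp c / (E * E * E)).
  { apply Rmult_eq_reg_l with (exp c); [|lra]. rewrite EK. field. lra. }
  rewrite EK2.
  assert (T3 : T * T * T <= (3 / c * E) * (3 / c * E) * (3 / c * E)).
  { apply Rmult_le_compat; try lra. nra. apply Rmult_le_compat; lra. }
  apply Rmult_le_reg_r with (T * (E * E * E)). repeat apply Rmult_lt_0_compat; lra.
  replace (T * T * (exp c / (E * E * E)) * (T * (E * E * E))) with (exp c * (T * T * T)) by (field; lra).
  replace (exp c * (3 / c * (3 / c) * (3 / c)) / T * (T * (E * E * E))) with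
    (exp c * ((3 / c * E) * (3 / c * E) * (3 / c * E))) by (field; lra).
  apply Rmult_le_compat_l; lra.
Qed.

Section Saddle.
Context (a0 : R) (Ps Ep Ep' : C -> C) (La e e' : R -> R) (Fr : frame a0 Ps Ep Ep' La e e').

Let PH := Ph Ps Ep.
Let HZ := hz Ps.

(* s z^s / gamma(s) at s = e^(p + i th), with zeta = log z. *)
Definition amplitude (zeta : C) (p th : R) : C := Cexp ((p, th) + hz Ps zeta (p, th))%C.

(** Up to a factor 1 + o(1), exp p * e p is the modulus of the second derivative of the exponent in
    w at the saddle; its square root is the inverse width of the Gaussian. *)
Definition rootN (p : R) : R := sqrt (exp p * e p).

Lemma rootN_pos (p : R) : 0 < rootN p /\ rootN p * rootN p = exp p * e p.
Proof.
  assert (H : 0 < exp p * e p).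
  { apply Rmult_lt_0_compat. apply exp_pos. apply (e_pos _ _ _ _ _ _ _ Fr). }
  unfold rootN. split. apply sqrt_lt_R0; auto. apply sqrt_sqrt; lra.
Qed.

Lemma rootN_large (K : R) : exists X, forall p, X <= p -> K <= rootN p.
Proof.
  destruct (N_large _ _ _ _ _ _ _ Fr (K * K)) as [X HX]. exists X. intros p Hp.
  destruct (rootN_pos p) as [H1 H2]. specialize (HX p Hp). rewrite <- H2 in HX.
  apply Rnot_lt_le. intros L. nra.
Qed.

(** The derivative e^w (zeta - Phi) of the exponent is integrated from the saddle. The error 2 t |w|
    comes from the factor e^w, the error [eta1] from replacing the increment of Phi by a linear one;
    both are relative to exp p * e p, hence uniform in p and th. *)
Lemma saddle_exponent (c1 eta1 : R) : 0 < c1 <= 1 -> 0 < eta1 <= c1 / 24 -> exists X, forall zeta p th w t,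
  X <= p -> zeta = PH (p, th) -> Rabs th <= B0 a0 -> Rabs (th + Im w) <= B0 a0 -> Cmod w <= c1 / 8 ->
  0 <= t <= 1 ->
  Cmod (HZ zeta ((p, th) + t * w) - HZ zeta (p, th) + (exp p * e p)%R * (Cexp (Ci * th) * (w * w)) * (t * t / 2)%R)%C
  <= exp p * e p * (Cmod w * Cmod w) * (t * t) * (2 * (t * Cmod w) + eta1).
Proof.
  intros Hc He.
  destruct (Ph_local _ _ _ _ _ _ _ Fr 1 eta1) as [X HX]; [lra|lra|].
  exists X. intros zeta p th w t Hp Hz Hth Hth' Hw Ht.
  set (N := exp p * e p). set (W := Cmod w) in *.
  assert (HW : 0 <= W) by apply Cmod_ge_0.
  assert (Pp := e_pos _ _ _ _ _ _ _ Fr p). assert (Px := exp_pos p).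
  assert (HN : 0 < N) by (unfold N; nra).
  set (lam := (Cexp (Ci * th) * (w * w))%C).
  set (w0 := ((p, th) : C)).
  assert (Iw : forall u, 0 <= u <= 1 -> Rabs (Im (w0 + u * w)%C) <= B0 a0).
  { intros u Hu. Csimpl. replace (Im w0 + (u * Im w + 0 * Re w)) with ((1 - u) * th + u * (th + Im w)) by (unfold w0; simpl; ring).
    apply Rle_trans with (1 := Rabs_triang _ _). rewrite !Rabs_mult, (Rabs_pos_eq u), (Rabs_pos_eq (1 - u)) by lra. nra. }
  assert (Rw : forall u, 0 <= u <= 1 -> Rabs (Re (u * w)%C) <= 1).
  { intros u Hu. apply Rle_trans with (1 := re_le _). rewrite Cmod_mult, Cmod_RtoC_pos by lra. fold W. nra. }
  assert (Ew0 : Cexp w0 = (exp p * Cexp (Ci * th))%C) by (apply Cexp_polar).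
  replace (HZ zeta (w0 + t * w) - HZ zeta w0 + N * lam * (t * t / 2)%R)%C with
    ((HZ zeta (w0 + t * w) + N * lam * (t * t / 2)%R) - (HZ zeta (w0 + 0 * w) + N * lam * (0 * 0 / 2)%R))%C.
  2:{ replace (w0 + 0 * w)%C with w0 by ring. replace (0 * 0 / 2) with 0 by field. ring. }
  assert (Dsq : forall x, is_derive (fun t => t * t / 2) x x) by (intros; auto_derive; auto; field).
  apply Rle_trans with ((4 * N * W * W * W) * (t * t * t / 3) + (N * eta1 * W * W) * (t * t / 2) -
     ((4 * N * W * W * W) * (0 * 0 * 0 / 3) + (N * eta1 * W * W) * (0 * 0 / 2))).
  - apply (mean_value_le (fun u => HZ zeta (w0 + u * w) + N * lam * (u * u / 2)%R)%C
      (fun u => w * (Cexp (w0 + u * w) * (zeta - PH (w0 + u * w))) + N * lam * u)%C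
      (fun t => (4 * N * W * W * W) * (t * t * t / 3) + (N * eta1 * W * W) * (t * t / 2))
      (fun t => (4 * N * W * W * W) * (t * t) + (N * eta1 * W * W) * t)); [lra| | |].
    + intros u Hu. apply (der_plus _ (fun z => HZ zeta (w0 + Re z * w)%C) (fun z => N * lam * (Re z * Re z / 2)%R)%C).
      * apply (rder_comp (HZ zeta) (fun u => w0 + u * w)%C).
        apply (hz_derive _ _ _ _ _ _ _ Fr). generalize (Iw u ltac:(lra)) (B0_bounds _ _ _ _ _ _ _ Fr). lra.
        apply rder_affine.
      * apply (der_scal _ (N * lam)%C (fun z => RtoC (Re z * Re z / 2))). apply (rder_RtoC (fun t => t * t / 2)). apply Dsq.
    + intros u Hu. apply Rder_plus. apply Rder_scal. auto_derive; auto; field. apply Rder_scal, Dsq.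
    + intros u Hu.
      set (D := (PH (w0 + u * w) - PH w0)%C).
      assert (HD : Cmod (D - u * w * e p)%C <= eta1 * e p * (u * W)).
      { unfold D. specialize (HX p w0 (u * w)%C Hp). replace (u * W) with (Cmod (u * w)%C) by (rewrite Cmod_mult, Cmod_RtoC_pos by lra; reflexivity).
        apply HX; auto.
        - unfold w0; simpl. rewrite Rminus_diag, Rabs_R0. lra.
        - apply Rw; lra.
        - apply Iw; lra. }
      assert (HD2 : Cmod D <= 2 * (u * W) * e p).
      { replace D with ((D - u * w * e p) + u * w * e p)%C by ring. apply Rle_trans with (1 := Cmod_triangle _ _).
        rewrite !Cmod_mult, !Cmod_RtoC_pos by lra. fold W. assert (0 <= e p * (u * W)) by (repeat apply Rmult_le_pos; lra). nra. }
      assert (HE : Cmod (Cexp (u * w) - 1)%C <= 2 * (u * W)).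
      { apply Rle_trans with (1 := Cexp_bound _). rewrite Cmod_mult, Cmod_RtoC_pos by lra. fold W.
        rewrite Rmult_comm. apply Rmult_le_compat_r. apply Rmult_le_pos; lra. apply exp_le_2. nra. }
      replace (w * (Cexp (w0 + u * w) * (zeta - PH (w0 + u * w))) + N * lam * u)%C with
        (- (w * Cexp w0 * ((Cexp (u * w) - 1) * D + (D - u * w * e p))))%C.
      2:{ rewrite Hz. fold w0. rewrite Cexp_plus. unfold D, lam, N. rewrite RtoC_mult, Ew0. ring. }
      rewrite Cmod_opp, !Cmod_mult, Cmod_Cexp. change (Re w0) with p. fold W.
      apply Rle_trans with (W * exp p * (2 * (u * W) * (2 * (u * W) * e p) + eta1 * e p * (u * W))).
      * apply Rmult_le_compat_l. apply Rmult_le_pos; lra.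
        apply Rle_trans with (1 := Cmod_triangle _ _). apply Rplus_le_compat; auto.
        rewrite Cmod_mult. apply Rmult_le_compat; auto; apply Cmod_ge_0.
      * right. unfold N. ring.
  - replace (4 * N * W * W * W * (0 * 0 * 0 / 3) + N * eta1 * W * W * (0 * 0 / 2)) with 0 by field.
    assert (A : 0 <= N * (W * W) * (t * t)) by (repeat apply Rmult_le_pos; lra).
    assert (0 <= t * W) by (apply Rmult_le_pos; lra).
    replace (4 * N * W * W * W * (t * t * t / 3) + N * eta1 * W * W * (t * t / 2) - 0) with
      (N * (W * W) * (t * t) * (4 / 3 * (t * W) + eta1 / 2)) by field.
    apply Rmult_le_compat_l; lra.
Qed.

(** With u = rootN(p) e^(i th/2) w the segment from the saddle to its neighbour becomes [0, u], and
    F is compared with a multiple of P there. The condition on Re(e^(i th) w^2) says that u^2 lies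
    well inside the right half-plane, and [ts] tells which of u, -u has positive real part. With |w|
    <= c1 / 16 the cubic error takes at most half of the Gaussian decay. The second conclusion
    measures how far the exponent has fallen at the end point. *)
Lemma saddle_half (P : C -> C) (c1 m eta : R) : gauss_primitive P -> 0 < c1 <= 1 -> 0 < m -> 0 < eta ->
  exists X, forall zeta F p th w ts, X <= p -> log_primitive a0 Ps zeta F -> zeta = PH (p, th) ->
  Rabs th <= B0 a0 -> Rabs (th + Im w) <= B0 a0 -> Cmod w <= c1 / 16 -> m <= Cmod w ->
  c1 * (Cmod w * Cmod w) <= Re (Cexp (Ci * th) * (w * w))%C ->
  sign ts -> 0 < ts * Re (Cexp (Ci * (th / 2)%R) * w)%C ->
  Cmod (F ((p, th) + w) - F (p, th) -
    amplitude zeta p th * / rootN p * Cexp (- (Ci * (th / 2)%R)) * (ts * sqrt (PI / 2)))%C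
   <= eta * (Cmod (amplitude zeta p th) / rootN p) /\
  Re (HZ zeta ((p, th) + w)%C) <= Re (HZ zeta (p, th)) - c1 * (m * m) / 4 * (exp p * e p).
Proof.
  intros HP Hc Hm Heta.
  destruct (cube_exp_bound (c1 / 4)) as [K [HK HKb]]; [lra|].
  set (eta1 := Rmin (c1 / 24) (eta / (32 * K))).
  assert (He1 : 0 < eta1) by (apply Rmin_pos; [lra|apply Rdiv_lt_0_compat; lra]).
  assert (He2 : eta1 <= c1 / 24) by apply Rmin_l. assert (He3 : eta1 <= eta / (32 * K)) by apply Rmin_r.
  destruct (saddle_exponent c1 eta1 Hc ltac:(lra)) as [X1 H1].
  destruct (gauss_sector_limit P c1 (eta / 2) HP ltac:(lra) ltac:(lra)) as [R0 HR].
  destruct (rootN_large (Rmax (Rmax 1 (R0 / m)) (32 * K / eta))) as [X2 H2].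
  exists (Rmax X1 X2). intros zeta F p th w ts Hp HF Hz Hth Hth' Hw Hmw Hlam Hts Hsg.
  specialize (H1 zeta p th w). assert (H1' := fun t => H1 t (Rle_trans _ _ _ (Rmax_l _ _) Hp) Hz Hth Hth' ltac:(lra)). clear H1.
  specialize (H2 p (Rle_trans _ _ _ (Rmax_r _ _) Hp)).
  assert (N3 := Rle_trans _ _ _ (Rmax_r _ _) H2). assert (N12 := Rle_trans _ _ _ (Rmax_l _ _) H2).
  assert (N1 := Rle_trans _ _ _ (Rmax_l _ _) N12). assert (N2 := Rle_trans _ _ _ (Rmax_r _ _) N12).
  destruct (rootN_pos p) as [sN0 sN2].
  set (sN := rootN p) in *. set (N := exp p * e p) in *. set (W := Cmod w) in *.
  set (A0 := amplitude zeta p th). set (w0 := ((p, th) : C)) in *.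
  set (lam := (Cexp (Ci * th) * (w * w))%C) in *.
  assert (HN : 0 < N) by (rewrite <- sN2; nra).
  assert (HW : 0 < W) by lra.
  assert (Hlm : Cmod lam = W * W) by (unfold lam; rewrite !Cmod_mult, Cmod_Cexp_i; unfold W; ring).
  set (q := fun t : R => (HZ zeta (w0 + t * w) - HZ zeta w0)%C).
  assert (Hq : forall t, 0 <= t <= 1 -> Cmod (q t + N * lam * (t * t / 2)%R)%C <= N * (W * W) * (t * t) * (2 * (t * W) + eta1)).
  { intros t Ht. exact (H1' t Ht). }
  assert (Rb : forall t, Re (N * lam * (t * t / 2)%R)%C = N * (t * t) / 2 * Re lam).
  { intros t. Csimpl. field. }
  split.
  2:{ specialize (Hq 1 ltac:(lra)). apply Rle_trans with (Re (q 1 + N * lam * (1 * 1 / 2)%R)%C + Re (HZ zeta w0) - N * (1 * 1) / 2 * Re lam).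
      right. rewrite Re_plus, Rb. unfold q. rewrite Re_minus. replace (w0 + 1 * w)%C with (w0 + w)%C by ring. ring.
      generalize (Re_le_Cmod (q 1 + N * lam * (1 * 1 / 2)%R)%C). intros A.
      assert (B : N * (W * W) * (1 * 1) * (2 * (1 * W) + eta1) <= N * (W * W) * (c1 / 6)).
      { rewrite Rmult_1_r, Rmult_1_r. apply Rmult_le_compat_l; [|lra]. apply Rmult_le_pos; [lra|nra]. }
      assert (C : N * (c1 * (W * W)) <= N * Re lam) by (apply Rmult_le_compat_l; lra).
      assert (D : N * (c1 * (m * m)) <= N * (c1 * (W * W))).
      { apply Rmult_le_compat_l; [lra|]. apply Rmult_le_compat_l; [lra|]. nra. }
      assert (E : 0 <= N * (c1 * (m * m))).
      { apply Rmult_le_pos; [lra|]. apply Rmult_le_pos; nra. }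
      lra. }
  set (u := (sN * Cexp (Ci * (th / 2)%R) * w)%C).
  assert (Eh : (Cexp (Ci * (th / 2)%R) * Cexp (Ci * (th / 2)%R))%C = Cexp (Ci * th)).
  { rewrite <- Cexp_plus. f_equal. rewrite <- Cmult_plus_distr_l, <- RtoC_plus. do 2 f_equal. field. }
  assert (Eu2 : (u * u)%C = (N * lam)%C).
  { unfold u, lam. rewrite <- Eh. fold N. rewrite <- sN2, RtoC_mult. ring. }
  assert (Mu : Cmod u = sN * W).
  { unfold u. rewrite !Cmod_mult, Cmod_Cexp_i, Cmod_RtoC_pos by lra. fold W; ring. }
  (* The relative error at one Gaussian width from the saddle: / sN from the cubic term and the
     factor ds, eta1 from the variation of epsilon. *)
  set (kk := / sN + eta1).
  assert (Hkk : 0 < kk <= eta / (16 * K)).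
  { assert (0 < / sN) by (apply Rinv_0_lt_compat; lra). split; [unfold kk; lra|].
    assert (/ sN <= eta / (32 * K)).
    { apply Rmult_le_reg_r with sN; auto. rewrite Rinv_l by lra.
      apply Rle_trans with (eta / (32 * K) * (32 * K / eta)). right; field; lra.
      apply Rmult_le_compat_l; auto. apply Rlt_le, Rdiv_lt_0_compat; lra. }
    replace (eta / (16 * K)) with (eta / (32 * K) + eta / (32 * K)) by (field; lra). unfold kk; lra. }
  set (cst := (A0 * / sN * Cexp (- (Ci * (th / 2)%R)))%C).
  assert (Main : Cmod ((F (w0 + w) - cst * P u) - (F w0 - cst * P 0))%C <= eta / 2 * (Cmod A0 / sN)).
  { replace ((F (w0 + w) - cst * P u) - (F w0 - cst * P 0))%C with
      ((F (w0 + 1 * w) - cst * P (0 + 1 * u)) - (F (w0 + 0 * w) - cst * P (0 + 0 * u)))%C.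
    2:{ replace (w0 + 1 * w)%C with (w0 + w)%C by ring. replace (w0 + 0 * w)%C with w0 by ring.
        replace (0 + 1 * u)%C with u by ring. replace (0 + 0 * u)%C with (RtoC 0) by ring. ring. }
    set (M := Cmod A0 * (4 * kk * K) / sN).
    assert (HM : 0 <= M).
    { unfold M. apply Rmult_le_pos. apply Rmult_le_pos. apply Cmod_ge_0. repeat apply Rmult_le_pos; lra.
      left; apply Rinv_0_lt_compat; auto. }
    (* The argument of the arctangent is the distance from the saddle in Gaussian widths, so the
       total error is bounded however many widths the segment contains. *)
    apply Rle_trans with (M * atan (sN * W * 1) - M * atan (sN * W * 0)).
    2:{ rewrite Rmult_0_r, atan_0. generalize (atan_bound (sN * W * 1)) PI_4. intros [_ A1] A2.
        apply Rle_trans with (M * 2). nra.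
        unfold M. replace (eta / 2 * (Cmod A0 / sN)) with (Cmod A0 * (eta / 2) / sN) by (field; lra).
        replace (Cmod A0 * (4 * kk * K) / sN * 2) with (Cmod A0 * (8 * kk * K) / sN) by (field; lra).
        apply Rmult_le_compat_r. left; apply Rinv_0_lt_compat; auto. apply Rmult_le_compat_l. apply Cmod_ge_0.
        apply Rle_trans with (8 * (eta / (16 * K)) * K). apply Rmult_le_compat_r; lra. right; field; lra. }
    apply (mean_value_le (fun t => F (w0 + t * w) - cst * P (0 + t * u))%C
      (fun t => w * Cexp (w0 + t * w + HZ zeta (w0 + t * w)) - cst * (u * Cexp (- ((0 + t * u) * (0 + t * u)) / 2)))%C
      (fun t => M * atan (sN * W * t)) (fun t => M * (sN * W * / (1 + (sN * W * t) * (sN * W * t))))); [lra| | |].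
    - intros t Ht. apply (der_minus _ (fun z => F (w0 + Re z * w)%C) (fun z => cst * P (0 + Re z * u))%C).
      + apply (F_line a0 Ps); auto. Csimpl.
        replace (Im w0 + (t * Im w + 0 * Re w)) with ((1 - t) * th + t * (th + Im w)) by (unfold w0; simpl; ring).
        apply Rle_lt_trans with (1 := Rabs_triang _ _). rewrite !Rabs_mult, (Rabs_pos_eq t), (Rabs_pos_eq (1 - t)) by lra.
        generalize (B0_bounds _ _ _ _ _ _ _ Fr). nra.
      + apply (der_scal _ cst (fun z => P (0 + Re z * u)%C)).
        apply (rder_comp P (fun t => 0 + t * u)%C). apply HP. apply rder_affine.
    - intros t Ht. apply Rder_scal. eapply Rder_eq. apply (is_derive_comp atan (fun t => sN * W * t)).
      apply is_derive_atan. apply Rder_scal, Rder_id. change (sN * W * 1 * / (1 + Rsqr (sN * W * t)) = sN * W * / (1 + sN * W * t * (sN * W * t))).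
      unfold Rsqr. ring.
    - intros t Ht. specialize (Hq t Ht).
      (* [b] is the Gaussian part of the exponent and [dl] all the rest, including t w from ds = e^w
         dw. *)
      set (b := (- (N * lam * (t * t / 2)%R))%C).
      set (dl := (t * w + (q t + N * lam * (t * t / 2)%R))%C).
      replace (w * Cexp (w0 + t * w + HZ zeta (w0 + t * w)) - cst * (u * Cexp (- ((0 + t * u) * (0 + t * u)) / 2)))%C
        with (w * A0 * Cexp b * (Cexp dl - 1))%C.
      2:{ assert (E1 : Cexp (w0 + t * w + HZ zeta (w0 + t * w))%C = (A0 * (Cexp b * Cexp dl))%C).
          { unfold A0, amplitude. rewrite <- !Cexp_plus. f_equal. unfold b, dl, q. unfold HZ, w0. ring. }
          assert (E2 : (- ((0 + t * u) * (0 + t * u)) / 2)%C = b).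
          { unfold b. replace ((0 + t * u) * (0 + t * u))%C with (t * t * (u * u))%C by ring. rewrite Eu2.
            rewrite RtoC_div, RtoC_mult by lra. field. }
          assert (E3 : (cst * u)%C = (w * A0)%C).
          { unfold cst, u. rewrite Cexp_opp. field. split. apply Cexp_neq_0.
            intros E. apply RtoC_inj in E. lra. }
          rewrite E1, E2. transitivity (w * A0 * (Cexp b * Cexp dl) - (cst * u) * Cexp b)%C; [|ring]. rewrite E3. ring. }
      set (y := sN * W * t).
      assert (Hy : 0 <= y) by (unfold y; repeat apply Rmult_le_pos; lra).
      assert (Ey : N * (W * W) * (t * t) = y * y) by (unfold y; rewrite <- sN2; ring).
      assert (EtW : t * W = y * / sN) by (unfold y; field; lra).
      rewrite Ey in Hq.
      assert (HtW : 0 <= t * W <= c1 / 16) by nra.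
      assert (Hdl : Cmod dl <= y * / sN + y * y * (2 * (y * / sN) + eta1)).
      { unfold dl. apply Rle_trans with (1 := Cmod_triangle _ _). rewrite Cmod_mult, Cmod_RtoC_pos by lra. fold W.
        rewrite EtW in Hq |- *. lra. }
      assert (Hdl2 : Cmod dl <= 1 / 2 + y * y * (c1 / 4)).
      { apply Rle_trans with (1 := Hdl). rewrite <- EtW. assert (0 <= y * y) by nra. nra. }
      assert (Hdl3 : Cmod dl <= 2 * ((1 + y * y) * (1 + y * y)) * kk).
      { apply Rle_trans with (1 := Hdl). unfold kk.
        assert (0 < / sN) by (apply Rinv_0_lt_compat; lra).
        assert (y + 2 * (y * y * y) <= 2 * ((1 + y * y) * (1 + y * y))).
        { assert (0 <= (y - 1) * (y - 1)) by apply Rle_0_sqr. assert (0 <= y * y) by nra. nra. }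
        assert (y * y <= 2 * ((1 + y * y) * (1 + y * y))) by (assert (0 <= y * y) by nra; nra).
        replace (y * / sN + y * y * (2 * (y * / sN) + eta1)) with ((y + 2 * (y * y * y)) * / sN + y * y * eta1) by ring.
        rewrite Rmult_plus_distr_l. apply Rplus_le_compat; apply Rmult_le_compat_r; lra. }
      assert (HRb : Re b <= - (c1 / 2) * (y * y)).
      { unfold b. rewrite Re_opp, Rb, <- Ey.
        assert (N * (t * t) / 2 * (c1 * (W * W)) <= N * (t * t) / 2 * Re lam).
        { apply Rmult_le_compat_l; auto. assert (0 <= N * (t * t)) by (apply Rmult_le_pos; [lra|nra]). lra. }
        lra. }
      rewrite !Cmod_mult, Cmod_Cexp. fold W.
      assert (X : exp (Re b) * Cmod (Cexp dl - 1)%C <= 2 * (2 * kk * (K / (1 + y * y)))).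
      { apply Rle_trans with (exp (Re b) * (Cmod dl * exp (Cmod dl))).
        apply Rmult_le_compat_l. left; apply exp_pos. apply Cexp_bound.
        replace (exp (Re b) * (Cmod dl * exp (Cmod dl))) with (Cmod dl * exp (Re b + Cmod dl)) by (rewrite exp_plus; ring).
        apply Rle_trans with (2 * ((1 + y * y) * (1 + y * y)) * kk * (2 * exp (- (c1 / 4 * (y * y))))).
        - apply Rmult_le_compat; auto. apply Cmod_ge_0. left; apply exp_pos.
          apply Rle_trans with (exp (1 / 2 + - (c1 / 4 * (y * y)))). apply exp_le_compat. lra.
          rewrite exp_plus. apply Rmult_le_compat_r. left; apply exp_pos. apply exp_le_2; lra.
        - specialize (HKb y).
          replace (2 * ((1 + y * y) * (1 + y * y)) * kk * (2 * exp (- (c1 / 4 * (y * y))))) with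
            (4 * kk * ((1 + y * y) * (1 + y * y) * exp (- (c1 / 4 * (y * y))))) by ring.
          replace (2 * (2 * kk * (K / (1 + y * y)))) with (4 * kk * (K / (1 + y * y))) by ring.
          apply Rmult_le_compat_l; lra. }
      assert (PA : 0 <= W * Cmod A0) by (apply Rmult_le_pos; [lra|apply Cmod_ge_0]).
      rewrite Rmult_assoc.
      apply Rle_trans with (W * Cmod A0 * (2 * (2 * kk * (K / (1 + y * y))))).
      apply Rmult_le_compat_l; auto.
      right. unfold M. fold y. assert (0 <= y * y) by nra. field. split; lra. }
  rewrite (proj2 HP) in Main.
  (* Oddness of P reduces the incoming half, where -u has positive real part, to the sector of
     [gauss_sector_limit]. *)
  assert (Pu : Cmod (P u - ts * sqrt (PI / 2))%C <= eta / 2).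
  { assert (Pos : P (ts * u)%C = (ts * P u)%C).
    { destruct Hts as [-> | ->].
      - replace (1 * u)%C with u by ring. ring.
      - replace (RtoC (-1)) with (- (1))%C by (apply Ceq; simpl; ring).
        replace (- (1) * u)%C with (- u)%C by ring. rewrite gauss_primitive_odd by auto. ring. }
    assert (ts2 : (ts * ts)%R = 1) by (destruct Hts as [-> | ->]; ring).
    assert (Ats : Rabs ts = 1) by (destruct Hts as [-> | ->]; unfold Rabs; destruct (Rcase_abs _); lra).
    replace (P u - ts * sqrt (PI / 2))%C with (ts * (P (ts * u) - sqrt (PI / 2)))%C.
    2:{ rewrite Pos. transitivity ((ts * ts)%R * P u - ts * sqrt (PI / 2))%C. rewrite RtoC_mult; ring. rewrite ts2; ring. }
    rewrite Cmod_mult, Cmod_R, Ats, Rmult_1_l. apply HR.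
    - rewrite Cmod_mult, Cmod_R, Ats, Rmult_1_l, Mu.
      replace (ts * u * (ts * u))%C with ((ts * ts)%R * (u * u))%C by (rewrite RtoC_mult; ring).
      rewrite ts2, Eu2. replace (Re (1 * (N * lam))%C) with (N * Re lam) by (Csimpl; ring).
      replace (c1 * (sN * W * (sN * W))) with (N * (c1 * (W * W))) by (rewrite <- sN2; ring).
      apply Rmult_le_compat_l; lra.
    - rewrite Cmod_mult, Cmod_R, Ats, Rmult_1_l, Mu.
      apply Rle_trans with (R0 / m * m). right; field; lra.
      apply Rle_trans with (sN * m). apply Rmult_le_compat_r; lra. apply Rmult_le_compat_l; lra.
    - unfold u. replace (ts * (sN * Cexp (Ci * (th / 2)%R) * w))%C with ((ts * sN)%R * (Cexp (Ci * (th / 2)%R) * w))%C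
        by (rewrite RtoC_mult; ring).
      rewrite Re_mult, Re_RtoC, Im_RtoC. nra. }
  change (amplitude zeta p th) with A0.
  fold cst.
  replace (F (w0 + w) - F w0 - cst * (ts * sqrt (PI / 2)))%C with
    (((F (w0 + w) - cst * P u) - (F w0 - cst * 0)) + cst * (P u - ts * sqrt (PI / 2)))%C by ring.
  apply Rle_trans with (1 := Cmod_triangle _ _).
  assert (Mc : Cmod cst = Cmod A0 / sN).
  { unfold cst. rewrite !Cmod_mult, Cmod_inv, Cmod_RtoC_pos, Cmod_Cexp by (try lra; intros E; apply RtoC_inj in E; lra).
    replace (Re (- (Ci * (th / 2)%R))%C) with 0 by (simpl; ring). rewrite exp_0. unfold Rdiv; ring. }
  rewrite (Cmod_mult cst), Mc.
  assert (0 <= Cmod A0 / sN). { apply Rmult_le_pos. apply Cmod_ge_0. left; apply Rinv_0_lt_compat; auto. }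
  nra.
Qed.

End Saddle.

(** * Increments from a fixed start point to infinity through a saddle *)

Section SaddleRays.
Context (a0 : R) (Ps Ep Ep' : C -> C) (La e e' : R -> R) (Fr : frame a0 Ps Ep Ep' La e e').

Let PH := Ph Ps Ep.
Let HZ := hz Ps.
Let amp := amplitude Ps.
Let rN := rootN e.

(** This locates zeta for a saddle p + i th: Re zeta is about La p + e p, and the angle th is read
    off from Im zeta / e(p). *)
Lemma Ph_vertical (eta : R) : 0 < eta -> exists X, forall p th, X <= p -> Rabs th <= B0 a0 ->
  Cmod (PH (p, th) - ((La p + e p)%R, (th * e p)%R))%C <= eta * e p.
Proof.
  intros He. assert (HB := B0_bounds _ _ _ _ _ _ _ Fr). assert (P := PI_RGT_0).
  destruct (Ph_local _ _ _ _ _ _ _ Fr 1 (eta / B0 a0) Rlt_0_1) as [X HX]. apply Rdiv_lt_0_compat; lra.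
  exists X. intros p th Hp Hth. assert (Pp := e_pos _ _ _ _ _ _ _ Fr p).
  specialize (HX p (RtoC p) (0, th) Hp).
  replace (PH (p, th) - ((La p + e p)%R, (th * e p)%R))%C with
    (Ph Ps Ep (p + (0, th)) - Ph Ps Ep p - (0, th) * e p)%C.
  2:{ replace (p + (0, th))%C with ((p, th) : C) by (apply Ceq; simpl; ring).
      unfold PH. unfold Ph at 2. rewrite (fr_Ps_real _ _ _ _ _ _ _ Fr), (fr_Ep_real _ _ _ _ _ _ _ Fr).
      generalize (Ph Ps Ep (p, th)). intros [u v]. apply Ceq; simpl; ring. }
  apply Rle_trans with (eta / B0 a0 * e p * Cmod (0, th)).
  - apply HX.
    + rewrite Re_RtoC, Rminus_diag, Rabs_R0. lra.
    + simpl. rewrite Rabs_R0; lra.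
    + rewrite Im_RtoC, Rabs_R0. lra.
    + rewrite Im_plus, Im_RtoC, Rplus_0_l. exact Hth.
  - replace (Cmod (0, th)) with (Rabs th).
    2:{ replace ((0, th) : C) with (Ci * th)%C by (apply Ceq; simpl; ring).
        rewrite Cmod_mult, Cmod_Ci, Cmod_R. ring. }
    apply Rle_trans with (eta / B0 a0 * e p * B0 a0).
    apply Rmult_le_compat_l; auto. apply Rmult_le_pos; [|lra]. apply Rlt_le, Rdiv_lt_0_compat; lra.
    right. field. lra.
Qed.

(* The main term of the theorem with eps(s) replaced by eps(|s|) under the square root, s = e^(p + i th). *)
Definition leading (zeta : C) (p th : R) : C :=
  (amp zeta p th * / rN p * Cexp (- (Ci * (th / 2)%R)) * sqrt (2 * PI))%C.

Lemma sqrt_2PI : sqrt (2 * PI) = 2 * sqrt (PI / 2).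
Proof.
  assert (P := PI_RGT_0).
  replace (2 * PI) with (2 * 2 * (PI / 2)) by field. rewrite sqrt_mult by lra.
  rewrite sqrt_square by lra. ring.
Qed.

Lemma Cexp_Ci (t : R) : Cexp (Ci * t) = (cos t, sin t).
Proof.
  unfold Cexp. replace (Re (Ci * t)%C) with 0 by (simpl; ring).
  replace (Im (Ci * t)%C) with t by (simpl; ring). rewrite exp_0. apply Ceq; simpl; ring.
Qed.

(** The path of [off_saddle] with its diagonal replaced by two segments meeting at the saddle. Their
    directions are near +-(1 - i sg), whose square -2 i sg is turned by e^(i th), close to i sg,
    into a positive number; so both are almost directions of steepest descent. *)
Lemma near_imaginary_ray (P : C -> C) (d1 : R) : gauss_primitive P -> 0 < d1 <= 1 / 100 ->
  d1 <= (a0 - PI / 2) / 4 ->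
  exists X1 d2, 0 <= X1 /\ 0 < d2 <= d1 / 10 /\ forall eta, 0 < eta -> exists X, forall zeta F sg p th, X <= p ->
  sign sg -> log_primitive a0 Ps zeta F -> zeta = PH (p, th) -> Rabs (sg * th - PI / 2) <= d2 ->
  exists Y, forall x, Y <= x ->
  Cmod (F (x, 0) - F (X1, sg * (PI / 2 + d1))%R - leading zeta p th)%C
    <= eta * (1 + Cmod (amp zeta p th) / rN p).
Proof.
  intros HP Hd1 Hd1a. assert (HPI := PI_RGT_0). assert (HPI2 : 1 < PI / 2) by (generalize PI2_1; lra).
  destruct (in_ray _ _ _ _ _ _ _ Fr d1) as [X1 [HX1 Hin]]; [lra|lra|].
  destruct (sig_bounds d1 ltac:(lra)) as [s1 [s2 _]].
  set (kap := (sin d1 - d1 * cos d1) / 8) in *.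
  assert (Hk : 0 < kap) by (unfold kap; lra).
  assert (Hk2 : kap <= d1 / 10) by (unfold kap; nra).
  (* Half of the tolerance [kap] of the rays is left to th, the other half to the error of
     [Ph_vertical]. *)
  exists X1, (kap / 2). split; auto. split; [lra|]. intros eta Heta.
  destruct (Hin (eta / 3)) as [Xi Ki]; [lra|]. clear Hin.
  destruct (out_ray _ _ _ _ _ _ _ Fr d1 ltac:(lra) ltac:(lra) (eta / 3)) as [Xo Ko]; [lra|].
  fold kap in Ki, Ko.
  destruct (Ph_vertical (kap / 2)) as [Xv Kv]; [lra|].
  (* On the two segments Re(e^(i th) w^2) is nearly |w|^2; the constant 1/2 leaves room for the
     deviation [v]. *)
  destruct (saddle_half _ _ _ _ _ _ _ Fr P (1 / 2) d1 (eta / 2) HP) as [Xs Ks]; [lra|lra|lra|].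
  exists (Rmax (Rmax Xi Xo) (Rmax (Rmax Xv Xs) (X1 + d1))). intros zeta F sg p th Hp Hs HF Hz Hth.
  assert (pa := Rle_trans _ _ _ (Rmax_l _ _) Hp). assert (pb := Rle_trans _ _ _ (Rmax_r _ _) Hp).
  assert (pi := Rle_trans _ _ _ (Rmax_l _ _) pa). assert (po := Rle_trans _ _ _ (Rmax_r _ _) pa).
  assert (pc := Rle_trans _ _ _ (Rmax_l _ _) pb). assert (px := Rle_trans _ _ _ (Rmax_r _ _) pb).
  assert (pv := Rle_trans _ _ _ (Rmax_l _ _) pc). assert (ps := Rle_trans _ _ _ (Rmax_r _ _) pc).
  set (v := sg * th - PI / 2) in *. assert (Hv := Hth). apply Rabs_le_between in Hv.
  assert (Eth : th = sg * (PI / 2 + v)).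
  { unfold v. destruct Hs as [-> | ->]; ring. }
  assert (Bth : Rabs th <= B0 a0).
  { rewrite Eth, Rabs_sign by auto. rewrite Rabs_pos_eq by lra. unfold B0. lra. }
  assert (Pp := e_pos _ _ _ _ _ _ _ Fr p).
  specialize (Kv p th pv Bth). rewrite <- Hz in Kv.
  assert (V1 := Rle_trans _ _ _ (re_le _) Kv). assert (V2 := Rle_trans _ _ _ (im_le _) Kv).
  rewrite Re_minus in V1. rewrite Im_minus in V2. cbn [Re Im fst snd] in V1, V2.
  change (fst zeta) with (Re zeta) in V1. change (snd zeta) with (Im zeta) in V2.
  apply Rabs_le_between in V1. apply Rabs_le_between in V2.
  assert (C1 : La p + (1 - kap) * e p <= Re zeta) by nra.
  assert (C2 : Re zeta <= La p + (1 + kap) * e p) by nra.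
  assert (C3 : (PI / 2 - kap) * e p <= sg * Im zeta).
  { assert (A : sg * Im zeta = sg * (Im zeta - th * e p) + (PI / 2 + v) * e p).
    { rewrite Eth. destruct Hs as [-> | ->]; ring. }
    assert (B : - (kap / 2 * e p) <= sg * (Im zeta - th * e p)) by (destruct Hs as [-> | ->]; lra).
    rewrite A. nra. }
  destruct (arc_at_infinity _ _ _ _ _ _ _ Fr zeta F d1 (eta / 3)) as [Y HY]; [lra|lra|auto|].
  exists (Rmax Y (p + d1)). intros x Hx.
  assert (xa := Rle_trans _ _ _ (Rmax_l _ _) Hx). assert (xb := Rle_trans _ _ _ (Rmax_r _ _) Hx).
  set (bi := sg * (PI / 2 + d1)). set (bo := sg * (PI / 2 - d1)).
  specialize (Ki zeta F sg p (p - d1) pi Hs HF C1 C3 ltac:(lra)). fold bi in Ki.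
  specialize (Ko zeta F sg p x po Hs HF C2 C3 xb). fold bo in Ko.
  specialize (HY x bo xa ltac:(unfold bo; rewrite Rabs_sign, Rabs_pos_eq by (auto; lra); lra)).
  rewrite Cmod_sym in HY.
  assert (Sv : Rabs (sin v) <= d1 / 10).
  { apply Rle_trans with (Rabs v); [|lra].
    assert (T : forall y, 0 <= y <= 1 -> Rabs (sin y) <= Rabs y).
    { intros y Hy. rewrite Rabs_pos_eq, Rabs_pos_eq by (try apply sin_ge_0; lra). apply sin_le_id; lra. }
    destruct (Rle_dec 0 v). apply T; lra.
    rewrite <- (Rabs_Ropp (sin v)), <- (Rabs_Ropp v), <- sin_neg. apply T; lra. }
  assert (Cv : 9 / 10 <= cos v <= 1).
  { split; [|apply COS_bound]. replace (cos v) with (cos (Rabs v)).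
    generalize (one_minus_cos_le (Rabs v) (Rabs_pos v)) (Rabs_pos v). nra.
    unfold Rabs. destruct (Rcase_abs v); auto. apply cos_neg. }
  assert (Ecth : cos th = - sin v) by (rewrite Eth, cos_sign by auto; apply cos_PI2_plus).
  assert (Esth : sin th = sg * cos v) by (rewrite Eth, sin_sign by auto; rewrite sin_PI2_plus; auto).
  apply Rabs_le_between in Sv.
  assert (Half : cos (th / 2) = cos (PI / 4 + v / 2) /\ sin (th / 2) = sg * sin (PI / 4 + v / 2)).
  { replace (th / 2) with (sg * (PI / 4 + v / 2)) by (rewrite Eth; field).
    rewrite cos_sign, sin_sign by auto. auto. }
  assert (Pc : 0 < cos (PI / 4 + v / 2)) by (apply cos_gt_0; lra).
  assert (Psn : 0 < sin (PI / 4 + v / 2)) by (apply sin_gt_0; lra).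
  assert (sg2 : sg * sg = 1) by (destruct Hs as [-> | ->]; ring).
  assert (Msg : forall y z : R, Cmod (y, - sg * z) <= Rabs y + Rabs z).
  { intros y z. apply Rle_trans with (1 := Cmod_le_abs _). cbn [Re Im fst snd].
    replace (- sg * z) with (sg * - z) by ring. rewrite (Rabs_sign sg), Rabs_Ropp by auto. lra. }
  assert (Msq : forall y z : R, Cmod (y, - sg * z) * Cmod (y, - sg * z) = y * y + z * z).
  { intros y z. generalize (Cmod2_alt (y, - sg * z)). cbn [Re Im fst snd]. simpl. intros A.
    transitivity (y * y + sg * sg * (z * z)). rewrite <- (Rmult_1_r (Cmod _ * _)). nra. rewrite sg2; ring. }
  (* [y] is the displacement in abscissa and [z] the one in angle towards the real axis; ts = 1 is
     the outgoing half and ts = -1 the incoming one. *)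
  assert (Dir : forall (y z ts : R), sign ts -> Rabs y = d1 -> 9 / 10 * d1 <= ts * z <= 11 / 10 * d1 -> ts * y = d1 ->
    Cmod (F ((p, th) + (y, - sg * z)%R) - F (p, th) -
     amplitude Ps zeta p th * / rootN e p * Cexp (- (Ci * (th / 2)%R)) * (ts * sqrt (PI / 2)))%C
    <= eta / 2 * (Cmod (amplitude Ps zeta p th) / rootN e p)).
  { intros y z ts Hts Hy Hzz Hty.
    assert (ts2 : ts * ts = 1) by (destruct Hts as [-> | ->]; ring).
    assert (Rz : Rabs z <= 11 / 10 * d1).
    { rewrite <- (Rabs_sign ts) by auto. rewrite Rabs_pos_eq by nra. lra. }
    assert (yz : y * z = d1 * (ts * z)).
    { rewrite <- Hty. transitivity ((ts * ts) * (y * z)). rewrite ts2; ring. ring. }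
    assert (yy : y * y = d1 * d1).
    { rewrite <- Hty. transitivity ((ts * ts) * (y * y)). rewrite ts2; ring. ring. }
    assert (zz : z * z = (ts * z) * (ts * z)).
    { transitivity ((ts * ts) * (z * z)). rewrite ts2; ring. ring. }
    set (w := ts * z) in *.
    apply (Ks zeta F p th (y, - sg * z) ts); auto.
    - cbn [Im snd]. rewrite Eth. replace (sg * (PI / 2 + v) + - sg * z) with (sg * (PI / 2 + v - z)) by ring.
      rewrite Rabs_sign by auto. apply Rabs_le_between in Rz. apply Rabs_le. unfold B0. lra.
    - apply Rle_trans with (1 := Msg y z). lra.
    - apply Rnot_lt_le. intros L. assert (A := Msq y z). assert (B := Cmod_ge_0 (y, - sg * z)). nra.
    - rewrite Msq, Cexp_Ci, Ecth, Esth. Csimpl. cbn [Re Im fst snd].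
      replace (- sin v * (y * y - - sg * z * (- sg * z)) - sg * cos v * (y * (- sg * z) + - sg * z * y)) with
        (- sin v * (y * y - (sg * sg) * (z * z)) + (sg * sg) * (2 * cos v * (y * z))) by ring.
      rewrite sg2, yz, yy, zz.
      assert (A : - (d1 / 10) * (d1 * d1) <= - sin v * (d1 * d1 - 1 * (w * w))).
      { assert (Rabs (- sin v * (d1 * d1 - 1 * (w * w))) <= d1 / 10 * (d1 * d1)).
        { rewrite Rabs_mult, Rabs_Ropp. apply Rmult_le_compat; try apply Rabs_pos. apply Rabs_le; lra.
          apply Rabs_le. nra. }
        apply Rabs_le_between in H. lra. }
      assert (B : 9 / 10 * (d1 * (9 / 10 * d1)) <= cos v * (d1 * w)).
      { apply Rmult_le_compat; try lra. nra. apply Rmult_le_compat_l; lra. }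
      assert (w * w <= 11 / 10 * d1 * (11 / 10 * d1)) by (apply Rmult_le_compat; lra).
      assert (0 < d1 * d1) by nra. nra.
    - rewrite Cexp_Ci. Csimpl. cbn [Re Im fst snd]. destruct Half as [-> ->].
      replace (ts * (cos (PI / 4 + v / 2) * y - sg * sin (PI / 4 + v / 2) * (- sg * z))) with
        (cos (PI / 4 + v / 2) * (ts * y) + (sg * sg) * sin (PI / 4 + v / 2) * (ts * z)) by ring.
      rewrite sg2, Hty. fold w. nra. }
  assert (Hout := Dir d1 (d1 + v) 1 (or_introl eq_refl) (Rabs_pos_eq d1 ltac:(lra)) ltac:(lra) ltac:(ring)).
  assert (Hinn := Dir (- d1) (- (d1 - v)) (-1) (or_intror eq_refl) ltac:(rewrite Rabs_Ropp; apply Rabs_pos_eq; lra) ltac:(lra) ltac:(ring)).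
  replace ((p, th) + (d1, - sg * (d1 + v))%R)%C with ((p + d1, bo)%R : C) in Hout.
  2:{ rewrite Eth. unfold bo. apply Ceq; simpl; ring. }
  replace ((p, th) + (- d1, - sg * - (d1 - v))%R)%C with ((p - d1, bi)%R : C) in Hinn.
  2:{ rewrite Eth. unfold bi. apply Ceq; simpl; ring. }
  fold amp rN in Hout, Hinn.
  set (A := amp zeta p th) in *. set (cc := Cexp (- (Ci * (th / 2)%R))%C) in *.
  set (iN := (/ rN p)%C) in *.
  assert (EL : leading zeta p th = (A * iN * cc * (1 * sqrt (PI / 2)) - A * iN * cc * ((-1) * sqrt (PI / 2)))%C).
  { unfold leading. fold A iN cc. rewrite sqrt_2PI, RtoC_mult.
    replace (RtoC (-1)) with (- (1))%C by (apply Ceq; simpl; ring). ring. }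
  rewrite EL.
  set (m1 := (A * iN * cc * (1 * sqrt (PI / 2)))%C) in *.
  set (m2 := (A * iN * cc * ((-1) * sqrt (PI / 2)))%C) in *.
  replace (F (x, 0) - F (X1, bi) - (m1 - m2))%C with
    ((F (x, 0) - F (x, bo)) + ((F (x, bo) - F (p + d1, bo)%R) + ((F (p + d1, bo)%R - F (p, th) - m1)
      + (- (F (p - d1, bi)%R - F (p, th) - m2) + (F (p - d1, bi)%R - F (X1, bi))))))%C by ring.
  apply Rle_trans with (1 := Cmod_triangle _ _).
  apply Rle_trans with (eta / 3 + (eta / 3 + (eta / 2 * (Cmod A / rN p) + (eta / 2 * (Cmod A / rN p) + eta / 3)))); [|lra].
  apply Rplus_le_compat; auto. apply Rle_trans with (1 := Cmod_triangle _ _).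
  apply Rplus_le_compat; auto. apply Rle_trans with (1 := Cmod_triangle _ _).
  apply Rplus_le_compat; auto. apply Rle_trans with (1 := Cmod_triangle _ _).
  apply Rplus_le_compat; auto. rewrite Cmod_opp. auto.
Qed.

(** Along the ray through the saddle Re h increases up to p and decreases afterwards. Outside a
    window of fixed logarithmic size it has dropped by a multiple of exp p * e p, which also beats
    the factor / rootN, so the error is purely relative to the amplitude. *)
Lemma near_real_ray (P : C -> C) (d : R) : gauss_primitive P -> 0 < d < PI / 2 ->
  exists X1, 0 <= X1 /\ forall eta, 0 < eta -> exists X, forall zeta F p th, X <= p ->
  log_primitive a0 Ps zeta F -> zeta = PH (p, th) -> Rabs th <= PI / 2 - d ->
  exists Y, forall x, Y <= x ->
  Cmod (F (x, 0) - F (X1, th) - leading zeta p th)%C <= eta * (Cmod (amp zeta p th) / rN p).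
Proof.
  intros HP Hd. assert (HPI := PI_RGT_0).
  set (c1 := sin d). assert (Sd : 0 < c1) by (apply sin_gt_0; lra). assert (Sd1 : c1 <= 1) by apply SIN_bound.
  set (y0 := c1 / 16).
  destruct (Ph_horizontal _ _ _ _ _ _ _ Fr (c1 / 2)) as [Xh Hh]; [lra|].
  exists (Rmax 0 Xh). split; [apply Rmax_l|]. intros eta Heta. set (X1 := Rmax 0 Xh).
  assert (X1h : Xh <= X1) by apply Rmax_r.
  destruct (saddle_half _ _ _ _ _ _ _ Fr P c1 y0 (eta / 4) HP) as [Xs Ks]; [lra|unfold y0; lra|lra|].
  destruct (La_local _ _ _ _ _ _ _ Fr 1 (1 / 2)) as [Xl Hl]; [lra|lra|].
  (* [c' * N] is the drop of Re h over the window. [c2] is chosen so that c2 N >= 2 forces a descent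
     of slope at least 2 beyond it, more than the growth of the Jacobian. *)
  set (c' := c1 * (y0 * y0) / 4). assert (Hc' : 0 < c').
  { unfold c', y0. assert (0 < c1 * (c1 * c1)) by (repeat apply Rmult_lt_0_compat; auto). lra. }
  set (c2 := c1 * y0 / 4). assert (Hc2 : 0 < c2).
  { unfold c2, y0. assert (0 < c1 * c1) by (apply Rmult_lt_0_compat; auto). lra. }
  destruct (rootN_large _ _ _ _ _ _ _ Fr (Rmax (16 / (c' * eta)) (1 + 2 / c2))) as [Xn Hn].
  exists (Rmax (Rmax (X1 + 1) Xs) (Rmax Xl Xn)). intros zeta F p th Hp HF Hz Hth.
  assert (pa := Rle_trans _ _ _ (Rmax_l _ _) Hp). assert (pb := Rle_trans _ _ _ (Rmax_r _ _) Hp).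
  assert (p1 := Rle_trans _ _ _ (Rmax_l _ _) pa). assert (ps := Rle_trans _ _ _ (Rmax_r _ _) pa).
  assert (pl := Rle_trans _ _ _ (Rmax_l _ _) pb). assert (pn := Rle_trans _ _ _ (Rmax_r _ _) pb).
  specialize (Hn p pn).
  assert (N1 := Rle_trans _ _ _ (Rmax_l _ _) Hn). assert (N2 := Rle_trans _ _ _ (Rmax_r _ _) Hn).
  destruct (rootN_pos _ _ _ _ _ _ _ Fr p) as [sN0 sN2]. fold rN in N1, N2, sN0, sN2.
  set (sN := rN p) in *. set (N := exp p * e p) in *.
  assert (Pp := e_pos _ _ _ _ _ _ _ Fr p). assert (Px := exp_pos p).
  assert (HN : 2 <= c2 * N).
  { rewrite <- sN2. assert (2 / c2 <= sN * sN). { assert (0 < 2 / c2) by (apply Rdiv_lt_0_compat; lra). nra. }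
    apply Rle_trans with (c2 * (2 / c2)). right; field; lra. apply Rmult_le_compat_l; lra. }
  assert (Bth : Rabs th <= B0 a0) by (generalize (B0_bounds _ _ _ _ _ _ _ Fr); lra).
  assert (Cth : c1 <= cos th <= 1).
  { split; [|apply COS_bound]. replace (cos th) with (cos (Rabs th)).
    unfold c1. rewrite <- (cos_shift d). apply cos_decr_1; try lra. apply Rabs_pos.
    unfold Rabs. destruct (Rcase_abs th); auto. apply cos_neg. }
  assert (Cth2 : 0 < cos (th / 2)).
  { apply Rabs_le_between in Hth. apply cos_gt_0; lra. }
  assert (Hy0 : 0 < y0) by (unfold y0; lra).
  assert (Dir : forall ts, sign ts ->
    Cmod (F (p + ts * y0, th)%R - F (p, th) -
     amplitude Ps zeta p th * / rootN e p * Cexp (- (Ci * (th / 2)%R)) * (ts * sqrt (PI / 2)))%C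
    <= eta / 4 * (Cmod (amplitude Ps zeta p th) / rootN e p) /\
    Re (HZ zeta (p + ts * y0, th)%R) <= Re (HZ zeta (p, th)) - c' * N).
  { intros ts Hts. assert (ts2 : ts * ts = 1) by (destruct Hts as [-> | ->]; ring).
    assert (Mt : Cmod (ts * y0)%R = y0).
    { rewrite Cmod_R, Rabs_sign by auto. apply Rabs_pos_eq; lra. }
    replace ((p + ts * y0, th)%R : C) with ((p, th) + (ts * y0)%R)%C by (apply Ceq; simpl; ring).
    apply (Ks zeta F p th (RtoC (ts * y0)) ts); auto.
    - rewrite Im_RtoC, Rplus_0_r. auto.
    - rewrite Mt. unfold y0. lra.
    - rewrite Mt. lra.
    - rewrite Mt, <- RtoC_mult, Re_mult, Re_RtoC, Im_RtoC, Cexp_Ci. cbn [Re fst].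
      replace (cos th * (ts * y0 * (ts * y0)) - Im (cos th, sin th) * 0) with (cos th * ((ts * ts) * (y0 * y0))) by ring.
      rewrite ts2. nra.
    - rewrite Re_mult, Re_RtoC, Im_RtoC, Cexp_Ci. cbn [Re fst].
      replace (ts * (cos (th / 2) * (ts * y0) - Im (cos (th / 2), sin (th / 2)) * 0)) with ((ts * ts) * (cos (th / 2) * y0)) by ring.
      rewrite ts2, Rmult_1_l. apply Rmult_lt_0_compat; auto. }
  destruct (Dir 1 (or_introl eq_refl)) as [Do Ho]. destruct (Dir (-1) (or_intror eq_refl)) as [Di Hi].
  replace (p + 1 * y0) with (p + y0) in Do, Ho by ring. replace (p + -1 * y0) with (p - y0) in Di, Hi by ring.
  fold amp rN in Do, Di. fold sN in Do, Di.
  assert (Dh : forall x : R, is_derive (fun x : R => Re (HZ zeta (x, th))) x (Re (Cexp (x, th) * (zeta - PH (x, th)))%C)).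
  { intros x.
    assert (T : rder (fun x => HZ zeta (x, th)) x (Cexp (x, th) * (zeta - PH (x, th)))%C).
    { apply (der_ext _ (fun z => HZ zeta ((0, th) + Re z * 1)%C)).
      intros z. f_equal. apply Ceq; simpl; ring.
      eapply der_eq. apply (rder_comp (HZ zeta) (fun t => (0, th) + t * 1)%C). apply (hz_derive _ _ _ _ _ _ _ Fr).
      replace (Im ((0, th) + x * 1)%C) with th by (simpl; ring). generalize (B0_bounds _ _ _ _ _ _ _ Fr); lra.
      apply rder_affine. replace ((0, th) + x * 1)%C with ((x, th) : C) by (apply Ceq; simpl; ring). unfold PH. ring. }
    exact (proj1 (rder_components _ _ _ T)). }
  (* This decides the sign of the derivative of Re h: zeta - Phi is close to the real number La p -
     La x, and a rotation by th with cos th >= c1 preserves the sign of its real part. *)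
  assert (Sgn : forall (x J : R) (r : C), Cmod (r - J)%C <= c1 / 2 * J -> 0 <= J ->
     exp x * (c1 / 2 * J) <= Re (Cexp (x, th) * r)%C).
  { intros x J r Hr HJ. rewrite Cexp_polar.
    replace (exp x * Cexp (Ci * th) * r)%C with (exp x * (Cexp (Ci * th) * J + Cexp (Ci * th) * (r - J)))%C by ring.
    rewrite Re_mult, Re_RtoC, Im_RtoC, Rmult_0_l, Rminus_0_r. apply Rmult_le_compat_l. left; apply exp_pos.
    rewrite Re_plus.
    assert (A : - (c1 / 2 * J) <= Re (Cexp (Ci * th) * (r - J))%C).
    { assert (B := re_le (Cexp (Ci * th) * (r - J))%C). rewrite Cmod_mult, Cmod_Cexp_i, Rmult_1_l in B.
      apply Rabs_le_between in B. lra. }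
    assert (B : Re (Cexp (Ci * th) * J)%C = cos th * J).
    { rewrite Re_mult, Re_RtoC, Im_RtoC, Cexp_Ci. cbn [Re fst]. ring. }
    rewrite B. assert (c1 * J <= cos th * J) by (apply Rmult_le_compat_r; lra). lra. }
  assert (Hl1 := Hl p (p + y0) pl ltac:(lra)). replace (p + y0 - p) with y0 in Hl1 by ring.
  rewrite Rabs_pos_eq in Hl1 by lra. specialize (Hl1 ltac:(unfold y0; lra)). apply Rabs_le_between in Hl1.
  set (A := amp zeta p th) in *.
  assert (MA : Cmod A = exp (p + Re (HZ zeta (p, th)))).
  { unfold A, amp, amplitude. rewrite Cmod_Cexp. reflexivity. }
  assert (Hexp : exp (- (c' * N)) <= eta / 16 / sN).
  { rewrite exp_Ropp. assert (c' * N <= exp (c' * N)) by (generalize (exp_ineq1_le (c' * N)); lra).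
    assert (0 < c' * N) by (rewrite <- sN2; repeat apply Rmult_lt_0_compat; lra).
    apply Rle_trans with (/ (c' * N)). apply Rinv_le_contravar; auto.
    assert (0 < c' * eta) by (apply Rmult_lt_0_compat; lra).
    assert (K : 16 <= c' * eta * sN).
    { apply Rle_trans with (c' * eta * (16 / (c' * eta))). right; field; lra. apply Rmult_le_compat_l; lra. }
    rewrite <- sN2. apply Rmult_le_reg_r with (c' * (sN * sN) * 16). repeat apply Rmult_lt_0_compat; lra.
    replace (/ (c' * (sN * sN)) * (c' * (sN * sN) * 16)) with 16 by (field; lra).
    replace (eta / 16 / sN * (c' * (sN * sN) * 16)) with (c' * eta * sN) by (field; lra). lra. }
  assert (PA : 0 <= Cmod A) by apply Cmod_ge_0.
  assert (Inn : Cmod (F (p - y0, th)%R - F (X1, th))%C <= eta / 8 * (Cmod A / sN)).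
  { set (M := Re (HZ zeta (p - y0, th)%R)) in *.
    assert (y01 : y0 <= 1) by (unfold y0; lra).
    apply Rle_trans with (exp (p - y0 + M) - exp (X1 + M)).
    - apply (F_horizontal _ _ _ _ _ _ _ Fr zeta F th X1 (p - y0) (fun t => exp (t + M)) (fun t => exp (t + M))); auto; [lra| |].
      + intros. auto_derive; auto. ring.
      + intros t Ht. apply exp_le_compat. apply Rplus_le_compat_l. unfold M.
        apply (monotone_of_derive (fun x => Re (HZ zeta (x, th))) (fun x => Re (Cexp (x, th) * (zeta - PH (x, th)))%C)); [lra|auto|].
        intros x Hx. assert (Mo := La_mono _ _ _ _ _ _ _ Fr x p ltac:(lra)).
        apply Rle_trans with (exp x * (c1 / 2 * (La p - La x))).
        apply Rmult_le_pos. left; apply exp_pos. apply Rmult_le_pos; lra.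
        apply Sgn; [|lra]. rewrite Hz. apply Hh; auto; lra.
    - apply Rle_trans with (Cmod A * exp (- (c' * N))).
      + rewrite MA, <- exp_plus. apply Rle_trans with (exp (p - y0 + M)). generalize (exp_pos (X1 + M)); lra.
        apply exp_le_compat. lra.
      + replace (eta / 8 * (Cmod A / sN)) with (Cmod A * (2 * (eta / 16 / sN))) by (field; lra).
        apply Rmult_le_compat_l; auto. generalize (exp_pos (- (c' * N))); lra. }
  assert (Out : forall x, p + y0 <= x -> Cmod (F (x, th) - F (p + y0, th)%R)%C <= eta / 8 * (Cmod A / sN)).
  { intros x Hx. set (M := Re (HZ zeta (p + y0, th)%R)) in *.
    assert (Dec : forall t, p + y0 <= t -> Re (HZ zeta (t, th)) <= M - 2 * (t - (p + y0))).
    { intros t Ht.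
      assert (- M - 2 * (p + y0) <= - Re (HZ zeta (t, th)) - 2 * t); [|lra].
      apply (monotone_of_derive (fun x => - Re (HZ zeta (x, th)) - 2 * x)
        (fun x => - Re (Cexp (x, th) * (zeta - PH (x, th)))%C - 2)); [lra| |].
      - intros y Hy. apply Rder_minus. apply (is_derive_opp (fun x => Re (HZ zeta (x, th)))). apply Dh.
        apply Rder_eq with (2 * 1); [|ring]. apply Rder_scal, Rder_id.
      - intros y Hy. rewrite <- Re_opp.
        replace (- (Cexp (y, th) * (zeta - PH (y, th))))%C with (Cexp (y, th) * (PH (y, th) - zeta))%C by ring.
        assert (Mo := La_mono _ _ _ _ _ _ _ Fr (p + y0) y ltac:(lra)).
        assert (HJ : y0 / 2 * e p <= La y - La p) by lra.
        assert (HJ0 : 0 <= La y - La p). { assert (0 <= y0 / 2 * e p) by (apply Rmult_le_pos; lra). lra. }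
        assert (S := Sgn y (La y - La p) (PH (y, th) - zeta)%C).
        rewrite Hz in S at 1. specialize (S (Hh p y th ltac:(lra) ltac:(lra) Bth) HJ0).
        assert (exp p <= exp y) by (apply exp_le_compat; lra).
        assert (c2 * N <= exp y * (c1 / 2 * (La y - La p))).
        { unfold c2, N. replace (c1 * y0 / 4 * (exp p * e p)) with (exp p * (c1 / 2 * (y0 / 2 * e p))) by field.
          apply Rmult_le_compat; try lra. apply Rmult_le_pos; [lra|]. apply Rmult_le_pos; lra.
          apply Rmult_le_compat_l; lra. }
        lra. }
    apply Rle_trans with (- exp (M + 2 * (p + y0) - x) - - exp (M + 2 * (p + y0) - (p + y0))).
    - apply (F_horizontal _ _ _ _ _ _ _ Fr zeta F th (p + y0) x (fun t => - exp (M + 2 * (p + y0) - t)) (fun t => exp (M + 2 * (p + y0) - t))); auto.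
      + intros. auto_derive; auto. unfold Rminus. ring.
      + intros t Ht. apply exp_le_compat. specialize (Dec t ltac:(lra)). change (hz Ps) with HZ. lra.
    - apply Rle_trans with (exp (M + p + y0)).
      + replace (M + 2 * (p + y0) - (p + y0)) with (M + p + y0) by ring. generalize (exp_pos (M + 2 * (p + y0) - x)). lra.
      + apply Rle_trans with (Cmod A * (exp (- (c' * N)) * 2)).
        * rewrite MA. apply Rle_trans with (exp (p + Re (HZ zeta (p, th))) * (exp (- (c' * N)) * exp y0)).
          rewrite <- !exp_plus. apply exp_le_compat. lra.
          apply Rmult_le_compat_l. left; apply exp_pos. apply Rmult_le_compat_l. left; apply exp_pos.
          apply exp_le_2. unfold y0; lra.
        * replace (eta / 8 * (Cmod A / sN)) with (Cmod A * (eta / 16 / sN * 2)) by (field; lra).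
          apply Rmult_le_compat_l; auto. lra. }
  assert (Pos : 0 < Cmod A / sN).
  { rewrite MA. apply Rdiv_lt_0_compat; auto. apply exp_pos. }
  destruct (arc_at_infinity _ _ _ _ _ _ _ Fr zeta F d (eta / 4 * (Cmod A / sN)) Hd) as [Y HY]; [nra|auto|].
  exists (Rmax Y (p + y0)). intros x Hx.
  assert (xa := Rle_trans _ _ _ (Rmax_l _ _) Hx). assert (xb := Rle_trans _ _ _ (Rmax_r _ _) Hx).
  specialize (HY x th xa Hth). rewrite Cmod_sym in HY. specialize (Out x xb).
  set (cc := Cexp (- (Ci * (th / 2)%R))%C) in *.
  set (iN := (/ sN)%C) in *.
  assert (EL : leading zeta p th = (A * iN * cc * (1 * sqrt (PI / 2)) - A * iN * cc * ((-1) * sqrt (PI / 2)))%C).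
  { unfold leading. fold A iN cc. rewrite sqrt_2PI, RtoC_mult. fold sN. fold iN.
    replace (RtoC (-1)) with (- (1))%C by (apply Ceq; simpl; ring). ring. }
  rewrite EL.
  set (m1 := (A * iN * cc * (1 * sqrt (PI / 2)))%C) in *.
  set (m2 := (A * iN * cc * ((-1) * sqrt (PI / 2)))%C) in *.
  replace (F (x, 0) - F (X1, th) - (m1 - m2))%C with
    ((F (x, 0) - F (x, th)) + ((F (x, th) - F (p + y0, th)%R) + ((F (p + y0, th)%R - F (p, th) - m1)
      + (- (F (p - y0, th)%R - F (p, th) - m2) + (F (p - y0, th)%R - F (X1, th))))))%C by ring.
  apply Rle_trans with (1 := Cmod_triangle _ _).
  set (B := Cmod A / sN) in *.
  apply Rle_trans with (eta / 4 * B + (eta / 8 * B + (eta / 4 * B + (eta / 4 * B + eta / 8 * B)))); [|lra].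
  apply Rplus_le_compat; auto. apply Rle_trans with (1 := Cmod_triangle _ _).
  apply Rplus_le_compat; auto. apply Rle_trans with (1 := Cmod_triangle _ _).
  apply Rplus_le_compat; auto. apply Rle_trans with (1 := Cmod_triangle _ _).
  apply Rplus_le_compat; auto. rewrite Cmod_opp. auto.
Qed.

End SaddleRays.

(** * Solving the saddle-point equation *)

(** The iterates are partial sums of a telescoping series with a geometric majorant, which also
    keeps them in the disc. *)
Lemma contraction (T : C -> C) (w0 : C) (r : R) : 0 < r ->
  (forall w w', Cmod (w - w0)%C <= r -> Cmod (w' - w0)%C <= r ->
    Cmod (T w - T w')%C <= / 2 * Cmod (w - w')%C) ->
  Cmod (T w0 - w0)%C <= r / 2 -> exists w, Cmod (w - w0)%C <= r /\ T w = w.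
Proof.
  intros Hr HT H0.
  set (w := fun n => Nat.iter n T w0).
  assert (I : forall n, Cmod (w n - w0)%C <= r * (1 - (/ 2) ^ n) /\
    Cmod (w (S n) - w n)%C <= r / 2 * (/ 2) ^ n).
  { induction n as [|n [I1 I2]].
    - change (w 0%nat) with w0. change (w 1%nat) with (T w0). split.
      replace (w0 - w0)%C with (RtoC 0) by ring. rewrite Cmod_0. simpl. lra. simpl. lra.
    - assert (P : 0 < (/ 2) ^ n) by (apply pow_lt; lra).
      assert (A : Cmod (w (S n) - w0)%C <= r * (1 - (/ 2) ^ S n)).
      { replace (w (S n) - w0)%C with ((w (S n) - w n) + (w n - w0))%C by ring.
        apply Rle_trans with (1 := Cmod_triangle _ _). rewrite <- tech_pow_Rmult.
        set (q := (/ 2) ^ n) in *. lra. }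
      split; auto. assert (P' : 0 < (/ 2) ^ S n) by (apply pow_lt; lra).
      change (w (S (S n))) with (T (w (S n))). change (w (S n)) with (T (w n)) at 2.
      apply Rle_trans with (1 := HT (w (S n)) (w n) ltac:(nra) ltac:(nra)). rewrite <- tech_pow_Rmult.
      set (q := (/ 2) ^ n) in *. lra. }
  assert (Ir : forall n, Cmod (w n - w0)%C <= r).
  { intros n. destruct (I n) as [I1 _]. assert (P : 0 < (/ 2) ^ n) by (apply pow_lt; lra). nra. }
  destruct (ex_cser_le (fun n => w (S n) - w n)%C (fun n => r / 2 * (/ 2) ^ n)) as [l Hl].
  { intros n; apply I. }
  { apply (ex_series_scal (K := R_AbsRing) (V := R_NormedModule) (r / 2)). apply ex_series_geom. rewrite Rabs_pos_eq; lra. }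
  assert (Sum : forall n, csum (fun n => w (S n) - w n)%C n = (w (S n) - w0)%C).
  { induction n. rewrite csum_0. reflexivity. rewrite csum_S, IHn. ring. }
  rewrite cser_eps in Hl.
  set (v := (w0 + l)%C).
  assert (Lim : forall eps, 0 < eps -> exists N, forall n, (N <= n)%nat -> Cmod (w n - v)%C < eps).
  { intros eps He. destruct (Hl eps He) as [N HN]. exists (S N). intros n Hn. destruct n as [|n]; [lia|].
    specialize (HN n ltac:(lia)). rewrite Sum in HN.
    replace (w (S n) - v)%C with (w (S n) - w0 - l)%C by (unfold v; ring). auto. }
  assert (Vr : Cmod (v - w0)%C <= r).
  { apply Rnot_lt_le. intros L. destruct (Lim (Cmod (v - w0)%C - r)) as [N HN]; [lra|].
    specialize (HN N ltac:(lia)). rewrite Cmod_sym in HN. specialize (Ir N).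
    generalize (Cmod_triangle (v - w N) (w N - w0)). replace (v - w N + (w N - w0))%C with (v - w0)%C by ring. lra. }
  exists v. split; auto.
  assert (Z : Cmod (T v - v)%C = 0).
  { apply Rle_antisym; [|apply Cmod_ge_0]. apply Rnot_lt_le. intros L.
    destruct (Lim (Cmod (T v - v)%C / 2)) as [N HN]; [lra|].
    assert (A := HN N ltac:(lia)). assert (B := HN (S N) ltac:(lia)).
    assert (D := HT v (w N) Vr (Ir N)). change (T (w N)) with (w (S N)) in D.
    rewrite (Cmod_sym v) in D.
    generalize (Cmod_triangle (T v - w (S N)) (w (S N) - v)).
    replace (T v - w (S N) + (w (S N) - v))%C with (T v - v)%C by ring. lra. }
  apply Cmod_eq_0 in Z. replace (T v) with (T v - v + v)%C by ring. rewrite Z. ring.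
Qed.

(** Newton's iteration with the derivative of Phi frozen at e(p), started at p + i Im zeta / e(p):
    by [Ph_local] it contracts by 1/2 on a disc of radius r, and by [Ph_vertical] the first step is
    at most r / 2. The gap between delta / 2 and delta holds the disc. *)
Lemma saddle_point_exists (a0 : R) (Ps Ep Ep' : C -> C) (La e e' : R -> R) (delta : R) :
  frame a0 Ps Ep Ep' La e e' -> 0 < delta -> PI / 2 + delta <= B0 a0 ->
  exists X, forall p zeta, X <= p -> Re zeta = La p + e p -> Rabs (Im zeta) <= (PI / 2 + delta / 2) * e p ->
  exists w, Rabs (Re w - p) <= 1 /\ Rabs (Im w) < PI / 2 + delta /\ Ph Ps Ep w = zeta.
Proof.
  intros Fr Hd HB. assert (HPI := PI_RGT_0).
  set (r := Rmin (delta / 4) 1). assert (Hr : 0 < r) by (apply Rmin_pos; lra).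
  assert (r1 : r <= delta / 4) by apply Rmin_l. assert (r2 : r <= 1) by apply Rmin_r.
  destruct (Ph_local _ _ _ _ _ _ _ Fr 2 (/ 2)) as [X1 H1]; [lra|lra|].
  destruct (Ph_vertical _ _ _ _ _ _ _ Fr (r / 2)) as [X2 H2]; [lra|].
  exists (Rmax X1 X2). intros p zeta Hp HR HI.
  assert (p1 := Rle_trans _ _ _ (Rmax_l _ _) Hp). assert (p2 := Rle_trans _ _ _ (Rmax_r _ _) Hp).
  assert (Pp := e_pos _ _ _ _ _ _ _ Fr p).
  set (th := Im zeta / e p).
  assert (Eth : th * e p = Im zeta) by (unfold th; field; lra).
  assert (Hth : Rabs th <= PI / 2 + delta / 2).
  { unfold th, Rdiv. rewrite Rabs_mult, Rabs_inv, (Rabs_pos_eq (e p)) by lra.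
    apply Rmult_le_reg_r with (e p); auto. rewrite Rmult_assoc, Rinv_l by lra. lra. }
  set (w0 := (p, th) : C).
  assert (Ez : zeta = ((La p + e p)%R, (th * e p)%R)) by (apply Ceq; simpl; auto).
  assert (Nb : forall w, Cmod (w - w0)%C <= r -> Rabs (Re w - p) <= 1 /\ Rabs (Im w) <= PI / 2 + 3 * delta / 4).
  { intros w Hw. assert (A := re_le (w - w0)%C). assert (B := im_le (w - w0)%C).
    rewrite Re_minus in A. rewrite Im_minus in B. change (Re w0) with p in A. change (Im w0) with th in B.
    split; [lra|]. replace (Im w) with ((Im w - th) + th) by ring. apply Rle_trans with (1 := Rabs_triang _ _). lra. }
  assert (Ne : RtoC (e p) <> 0%C) by (intros E; apply RtoC_inj in E; lra).
  assert (Me : Cmod (/ e p)%C = / e p) by (rewrite Cmod_inv, Cmod_RtoC_pos by (auto; lra); auto).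
  destruct (contraction (fun w => w - (Ph Ps Ep w - zeta) / e p)%C w0 r Hr) as [w [Hw Ew]].
  - intros w w' Hw Hw'. destruct (Nb w Hw) as [A1 A2]. destruct (Nb w' Hw') as [B1 B2].
    replace (w - (Ph Ps Ep w - zeta) / e p - (w' - (Ph Ps Ep w' - zeta) / e p))%C with
      (- (/ e p) * (Ph Ps Ep (w' + (w - w')) - Ph Ps Ep w' - (w - w') * e p))%C.
    2:{ replace (w' + (w - w'))%C with w by ring. field; auto. }
    rewrite Cmod_mult, Cmod_opp, Me.
    apply Rle_trans with (/ e p * (/ 2 * e p * Cmod (w - w')%C)).
    + apply Rmult_le_compat_l. left; apply Rinv_0_lt_compat; auto.
      apply H1; auto; try lra.
      * rewrite Re_minus. apply Rabs_le_between in A1. apply Rabs_le_between in B1. apply Rabs_le. lra.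
      * replace (w' + (w - w'))%C with w by ring. lra.
    + right. field. lra.
  - replace (w0 - (Ph Ps Ep w0 - zeta) / e p - w0)%C with (- (/ e p) * (Ph Ps Ep w0 - zeta))%C by (field; auto).
    rewrite Cmod_mult, Cmod_opp, Me.
    apply Rle_trans with (/ e p * (r / 2 * e p)).
    apply Rmult_le_compat_l. left; apply Rinv_0_lt_compat; auto. rewrite Ez at 1. apply H2; auto. lra.
    right. field. lra.
  - exists w. destruct (Nb w Hw) as [A1 A2]. split; auto. split; [lra|].
    assert (E : ((Ph Ps Ep w - zeta) / e p)%C = 0%C).
    { replace ((Ph Ps Ep w - zeta) / e p)%C with (w - (w - (Ph Ps Ep w - zeta) / e p))%C by ring.
      rewrite Ew. ring. }
    replace (Ph Ps Ep w) with ((Ph Ps Ep w - zeta) / e p * e p + zeta)%C by (field; auto).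
    rewrite E. ring.
Qed.

(** * Difference quotients *)

Lemma taylor_second (f f' : C -> C) (m f2 : C) (r : R) : 0 < r ->
  (forall h, Cmod h < r -> cder f (m + h)%C (f' (m + h)%C)) -> cder f' m f2 ->
  forall e, 0 < e -> exists d, 0 < d /\ d <= r /\ forall h, Cmod h < d ->
    Cmod (f' (m + h) - f' m - h * f2)%C <= e * Cmod h /\
    Cmod (f (m + h) - f m - h * f' m - h * h * f2 / 2)%C <= e * (Cmod h * Cmod h).
Proof.
  intros Hr Df Df' e He. destruct (Df' e He) as [d [Hd K]].
  exists (Rmin r d). split; [apply Rmin_pos; auto|]. split; [apply Rmin_l|]. intros h Hh.
  assert (h1 := Rlt_le_trans _ _ _ Hh (Rmin_l _ _)). assert (h2 := Rlt_le_trans _ _ _ Hh (Rmin_r _ _)).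
  split; [apply K; auto|].
  assert (Hp := Cmod_ge_0 h).
  assert (Th : forall t, 0 <= t <= 1 -> Cmod (t * h)%C <= Cmod h).
  { intros t Ht. rewrite Cmod_mult, Cmod_RtoC_pos by lra. nra. }
  replace (f (m + h) - f m - h * f' m - h * h * f2 / 2)%C with
    ((f (m + 1 * h) - (1 * (h * f' m) + (1 * 1)%R * (h * h * f2 / 2))) -
     (f (m + 0 * h) - (0 * (h * f' m) + (0 * 0)%R * (h * h * f2 / 2))))%C.
  2:{ replace (m + 1 * h)%C with (m + h)%C by ring. replace (m + 0 * h)%C with m by ring.
      rewrite !Rmult_0_l, Rmult_1_l. field. }
  replace (e * (Cmod h * Cmod h)) with (e * (Cmod h * Cmod h) * (1 - 0)) by ring.
  apply (mean_value_lipschitz (fun t => f (m + t * h) - (t * (h * f' m) + (t * t)%R * (h * h * f2 / 2)))%C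
    (fun t => h * f' (m + t * h) - (h * f' m + (2 * t)%R * (h * h * f2 / 2)))%C); [lra| |].
  - intros t Ht. apply (der_minus _ (fun z => f (m + Re z * h)%C) (fun z => Re z * (h * f' m) + (Re z * Re z)%R * (h * h * f2 / 2))%C).
    + apply (rder_comp f (fun t => m + t * h)%C). apply Df. specialize (Th t Ht); lra. apply rder_affine.
    + apply (der_plus _ (fun z => Re z * (h * f' m))%C (fun z => (Re z * Re z)%R * (h * h * f2 / 2))%C).
      * apply (der_ext _ (fun x => 0 + Re x * (h * f' m))%C). intros; ring. apply (rder_affine 0 (h * f' m)).
      * eapply der_eq. apply (der_mult _ (fun z => RtoC (Re z * Re z)) (fun _ => h * h * f2 / 2)%C).
        apply (rder_RtoC (fun t => t * t) t (2 * t)). auto_derive; auto; ring. apply der_const. ring.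
  - intros t Ht.
    replace (h * f' (m + t * h) - (h * f' m + (2 * t)%R * (h * h * f2 / 2)))%C with
      (h * (f' (m + t * h) - f' m - t * h * f2))%C by (rewrite RtoC_mult; field).
    rewrite Cmod_mult. specialize (Th t Ht).
    assert (A := K (t * h)%C Logic.I ltac:(lra)).
    apply Rle_trans with (Cmod h * (e * Cmod h)); [|lra]. apply Rmult_le_compat_l; auto.
    apply Rle_trans with (1 := A). apply Rmult_le_compat_l; lra.
Qed.

Lemma ccont_ext_loc (f g : C -> C) (z : C) (r : R) : 0 < r ->
  (forall h, Cmod h < r -> f (z + h)%C = g (z + h)%C) -> ccont f z -> ccont g z.
Proof.
  intros Hr E H e He. destruct (H e He) as [d [Hd K]]. exists (Rmin d r). split; [apply Rmin_pos; auto|].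
  intros h _ Hh.
  assert (h1 := Rlt_le_trans _ _ _ Hh (Rmin_l _ _)). assert (h2 := Rlt_le_trans _ _ _ Hh (Rmin_r _ _)).
  assert (E0 := E 0%C ltac:(rewrite Cmod_0; auto)). replace (z + 0)%C with z in E0 by ring.
  rewrite <- E, <- E0; auto.
Qed.

(** A removable singularity, filled with f'(m) and derivative f''(m) / 2. One order of
    differentiability is spent, and what remains is just what [primitive_star] asks for. *)
Lemma slope_smooth (D : C -> Prop) (f : C -> C) (m : C) : copen D -> D m -> smooth 2 D f ->
  exists F, smooth 1 D F /\ (forall s, s <> m -> F s = (f s - f m) / (s - m))%C /\ cder f m (F m).
Proof.
  intros Op Dm [f' [Df [f'' [Df' Cf'']]]].
  set (F := fun s => if excluded_middle_informative (s = m) then f' m else ((f s - f m) / (s - m))%C).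
  set (F' := fun s => if excluded_middle_informative (s = m) then (f'' m / 2)%C
     else ((f' s * (s - m) - (f s - f m)) / ((s - m) * (s - m)))%C).
  assert (EF : forall s, s <> m -> F s = ((f s - f m) / (s - m))%C).
  { intros s N. unfold F. destruct (excluded_middle_informative (s = m)); [contradiction|auto]. }
  assert (EFm : F m = f' m).
  { unfold F. destruct (excluded_middle_informative (m = m)) as [_|N]; [auto|exfalso; auto]. }
  assert (EF' : forall s, s <> m -> F' s = ((f' s * (s - m) - (f s - f m)) / ((s - m) * (s - m)))%C).
  { intros s N. unfold F'. destruct (excluded_middle_informative (s = m)); [contradiction|auto]. }
  assert (EFm' : F' m = (f'' m / 2)%C).
  { unfold F'. destruct (excluded_middle_informative (m = m)) as [_|N]; [auto|exfalso; auto]. }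
  exists F. split; [|split; [exact EF|rewrite EFm; auto]].
  exists F'.
  assert (Away : forall s, s <> m -> 0 < Cmod (s - m)%C /\ forall h, Cmod h < Cmod (s - m)%C -> (s + h)%C <> m).
  { intros s N. assert (P : 0 < Cmod (s - m)%C).
    { apply Cmod_gt_0. intros E. apply N. replace s with (s - m + m)%C by ring. rewrite E. ring. }
    split; auto. intros h Hh E. assert (E2 : (s - m)%C = (- h)%C) by (rewrite <- E; ring).
    rewrite E2, Cmod_opp in Hh. lra. }
  assert (Nz : forall s, s <> m -> (s - m)%C <> 0%C).
  { intros s N E. apply N. replace s with (s - m + m)%C by ring. rewrite E. ring. }
  destruct (Op m Dm) as [r [Hr Kr]].
  assert (Tay := taylor_second f f' m (f'' m) r Hr (fun h Hh => Df _ (Kr h Hh)) (Df' m Dm)).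
  assert (NzH : forall h : C, h <> 0%C -> (m + h)%C <> m).
  { intros h N E. apply N. replace h with (m + h - m)%C by ring. rewrite E. ring. }
  split.
  - intros s Ds. destruct (excluded_middle_informative (s = m)) as [->|N].
    + intros e He. destruct (Tay e He) as [d [Hd [_ K]]]. exists d; split; auto. intros h _ Hh.
      destruct (excluded_middle_informative (h = (RtoC 0))) as [->|Nh].
      * replace (F (m + 0) - F m - 0 * F' m)%C with (RtoC 0).
        rewrite Cmod_0, Rmult_0_r; lra. replace (m + 0)%C with m by ring. ring.
      * rewrite EF, EFm, EFm' by auto. destruct (K h Hh) as [_ K2].
        assert (P : 0 < Cmod h) by (apply Cmod_gt_0; auto).
        replace ((f (m + h) - f m) / (m + h - m) - f' m - h * (f'' m / 2))%C with
          (/ h * (f (m + h) - f m - h * f' m - h * h * f'' m / 2))%C.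
        2:{ replace (m + h - m)%C with h by ring. field; auto. }
        rewrite Cmod_mult, Cmod_inv by auto. apply Rmult_le_reg_l with (Cmod h); auto.
        rewrite <- Rmult_assoc, Rinv_r, Rmult_1_l by lra. lra.
    + destruct (Away s N) as [P A]. rewrite EF' by auto.
      apply (der_ext_loc _ (fun s => (f s - f m) / (s - m))%C F s _ (Cmod (s - m)%C)); auto.
      intros h _ Hh. rewrite EF; auto. rewrite EF; auto.
      eapply der_eq. apply (der_mult _ (fun s => f s - f m)%C (fun s => / (s - m))%C).
      apply der_minus. apply Df; auto. apply der_const.
      apply (der_inv _ (fun s => s - m)%C). apply Nz; auto. apply der_minus. apply der_id. apply der_const.
      field. apply Nz; auto.
  - intros s Ds. destruct (excluded_middle_informative (s = m)) as [->|N].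
    + intros e He. destruct (Tay (e / 3)) as [d [Hd [_ K]]]; [lra|]. exists d; split; auto. intros h _ Hh.
      destruct (excluded_middle_informative (h = 0%C)) as [->|Nh].
      * replace (m + 0)%C with m by ring. replace (F' m - F' m)%C with (RtoC 0) by ring. rewrite Cmod_0; auto.
      * rewrite EF', EFm' by auto. destruct (K h Hh) as [K1 K2].
        assert (P : 0 < Cmod h) by (apply Cmod_gt_0; auto).
        replace ((f' (m + h) * (m + h - m) - (f (m + h) - f m)) / ((m + h - m) * (m + h - m)) - f'' m / 2)%C with
          (/ (h * h) * (h * (f' (m + h) - f' m - h * f'' m) - (f (m + h) - f m - h * f' m - h * h * f'' m / 2)))%C.
        2:{ replace (m + h - m)%C with h by ring. field; auto. }
        rewrite Cmod_mult, Cmod_inv, Cmod_mult by (apply Cmult_neq_0; auto).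
        apply Rmult_lt_reg_l with (Cmod h * Cmod h). nra.
        rewrite <- Rmult_assoc, Rinv_r, Rmult_1_l by nra.
        apply Rle_lt_trans with (1 := Cmod_minus_triangle _ _). rewrite Cmod_mult.
        assert (Cmod h * Cmod (f' (m + h) - f' m - h * f'' m)%C <= Cmod h * (e / 3 * Cmod h)) by (apply Rmult_le_compat_l; lra).
        assert (0 < Cmod h * Cmod h * e) by (repeat apply Rmult_lt_0_compat; auto). nra.
    + destruct (Away s N) as [P A].
      apply (ccont_ext_loc (fun s => (f' s * (s - m) - (f s - f m)) / ((s - m) * (s - m)))%C F' s (Cmod (s - m)%C)); auto.
      intros h Hh. rewrite EF'; auto.
      eapply der_cont.
      apply (der_mult _ (fun s => (f' s * (s - m) - (f s - f m)))%C (fun s => / ((s - m) * (s - m)))%C).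
      apply (der_minus _ (fun s => f' s * (s - m))%C (fun s => f s - f m)%C).
      apply (der_mult _ f' (fun s => s - m)%C). apply Df'; auto. apply der_minus. apply der_id. apply der_const.
      apply der_minus. apply Df; auto. apply der_const.
      apply (der_inv _ (fun s => (s - m) * (s - m))%C). apply Cmult_neq_0; apply Nz; auto.
      apply (der_mult _ (fun s => s - m)%C (fun s => s - m)%C); (apply der_minus; [apply der_id|apply der_const]).
Qed.

(** * The Abel-Plana formula *)

(* The Abel-Plana denominators for the upper ([sg = 1]) and lower ([sg = -1]) half-planes. *)
Definition kden (sg : R) (s : C) : C := (Cexp (- (2 * PI * sg)%R * Ci * s) - 1)%C.
Definition kern (sg : R) (s : C) : C := (/ kden sg s)%C.

Lemma kden_exponent (sg : R) (s : C) : (- (2 * PI * sg)%R * Ci * s)%C =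
  (2 * PI * sg * Im s, - (2 * PI * sg * Re s)).
Proof. destruct s as [x y]. apply Ceq; cbn; ring. Qed.

Lemma kden_zero (sg : R) (s : C) : sign sg -> kden sg s = 0%C -> exists k : Z, s = RtoC (IZR k).
Proof.
  intros Hs H. assert (HPI := PI_RGT_0).
  assert (E : Cexp (- (2 * PI * sg)%R * Ci * s)%C = 1%C).
  { replace (Cexp (- (2 * PI * sg)%R * Ci * s))%C with (kden sg s + 1)%C by (unfold kden; ring). rewrite H. ring. }
  assert (E1 := f_equal Cmod E). rewrite Cmod_Cexp, Cmod_1, kden_exponent in E1. cbn [Re fst] in E1.
  assert (E2 : 2 * PI * sg * Im s = 0).
  { rewrite <- exp_0 in E1. apply exp_inv in E1. auto. }
  assert (I0 : Im s = 0).
  { destruct Hs as [-> | ->]; nra. }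
  rewrite kden_exponent in E. unfold Cexp in E. cbn [Re Im fst snd] in E. rewrite E2, exp_0 in E.
  apply (f_equal Re) in E. cbn [Re fst] in E. change (Re 1) with 1 in E.
  rewrite cos_neg in E.
  replace (2 * PI * sg * Re s) with (sg * (2 * (PI * Re s))) in E by ring. rewrite cos_sign in E by auto.
  rewrite cos_2a_sin in E.
  assert (S0 : sin (PI * Re s) = 0) by nra.
  destruct (sin_eq_0_0 _ S0) as [k Hk]. exists k. apply Ceq; simpl; auto.
  change (fst s) with (Re s). nra.
Qed.

Lemma kden_integer (sg : R) (m : nat) : sign sg -> kden sg (RtoC (INR m)) = 0%C.
Proof.
  intros Hs. unfold kden. rewrite kden_exponent, Re_RtoC, Im_RtoC, Rmult_0_r.
  unfold Cexp. cbn [Re Im fst snd]. rewrite exp_0.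
  replace (- (2 * PI * sg * INR m)) with (sg * - (2 * INR m * PI)) by ring.
  rewrite cos_sign, sin_sign, cos_neg, sin_neg by auto.
  rewrite <- (Rplus_0_l (2 * INR m * PI)), cos_period, sin_period, cos_0, sin_0.
  apply Ceq; simpl; ring.
Qed.

Lemma kden_derive (sg : R) (s : C) :
  cder (kden sg) s (- (2 * PI * sg)%R * Ci * Cexp (- (2 * PI * sg)%R * Ci * s))%C.
Proof.
  unfold kden. eapply der_eq. apply der_minus. apply (der_Cexp _ (fun s => - (2 * PI * sg)%R * Ci * s)%C).
  apply der_scal, der_id. apply der_const. ring.
Qed.

Lemma kden_smooth (n : nat) (D : C -> Prop) (sg : R) : smooth n D (kden sg).
Proof.
  unfold kden. apply smooth_minus; [|apply smooth_const]. apply smooth_comp with (fun _ => True); auto.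
  apply smooth_Cexp. apply smooth_mult. apply smooth_const. apply smooth_id.
Qed.

Lemma kden_periodic (sg : R) (s : C) : sign sg -> kden sg (s + 1)%C = kden sg s.
Proof.
  intros Hs. unfold kden. replace (- (2 * PI * sg)%R * Ci * (s + 1))%C with
    (- (2 * PI * sg)%R * Ci * s + - (2 * PI * sg)%R * Ci * INR 1)%C by (simpl INR; ring).
  rewrite Cexp_plus. assert (E := kden_integer sg 1 Hs). unfold kden in E.
  replace (Cexp (- (2 * PI * sg)%R * Ci * INR 1)) with (RtoC 1). ring.
  transitivity (Cexp (- (2 * PI * sg)%R * Ci * INR 1) - 1 + 1)%C; [rewrite E|]; ring.
Qed.

(** With E the exponential, 1/(E - 1) + 1/(1/E - 1) = -1. This is what turns the two kernel
    increments along the real axis into an increment of G. *)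
Lemma kern_sum (s : C) : kden 1 s <> 0%C -> kden (-1) s <> 0%C -> (kern 1 s + kern (-1) s)%C = (- (1))%C.
Proof.
  intros H1 H2. unfold kern.
  set (E := Cexp (- (2 * PI * 1)%R * Ci * s)).
  assert (E1 : kden 1 s = (E - 1)%C) by reflexivity.
  assert (NE : E <> 0%C) by apply Cexp_neq_0.
  assert (E2 : kden (-1) s = (/ E - 1)%C).
  { unfold kden, E. rewrite <- Cexp_opp. f_equal. f_equal. replace (2 * PI * -1) with (- (2 * PI * 1)) by ring.
    rewrite RtoC_opp. ring. }
  rewrite E1 in H1 |- *. rewrite E2 in H2 |- *.
  assert (H3 : (1 - E)%C <> 0%C) by (intros A; apply H1; replace (E - 1)%C with (- (1 - E))%C by ring; rewrite A; ring).
  field. repeat split; auto.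
Qed.

Lemma kern_top (sg M x : R) : sign sg -> 0 < M -> Cmod (kern sg (x, sg * M)) <= 2 * exp (- (2 * PI * M)) * (1 + / M).
Proof.
  intros Hs HM. assert (HPI := PI_RGT_0).
  assert (A : exp (2 * PI * M) - 1 <= Cmod (kden sg (x, sg * M))).
  { unfold kden. rewrite kden_exponent. cbn [Re Im fst snd].
    apply Rle_trans with (2 := Cmod_minus_le _ _). rewrite Cmod_Cexp, Cmod_1. cbn [Re fst].
    replace (2 * PI * sg * (sg * M)) with (2 * PI * M). lra. destruct Hs as [-> | ->]; ring. }
  assert (P1 : 1 < PI) by (generalize PI2_1; lra).
  set (E := exp (2 * PI * M)) in *.
  assert (B : 1 + 2 * PI * M <= E) by apply exp_ineq1_le.
  assert (HE : M < E - 1) by nra.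
  assert (Hk : kden sg (x, sg * M) <> 0%C) by (intros Z; rewrite Z, Cmod_0 in A; lra).
  unfold kern. rewrite Cmod_inv by auto.
  apply Rle_trans with (/ (E - 1)). apply Rinv_le_contravar; lra.
  rewrite exp_Ropp. fold E.
  apply Rmult_le_reg_r with ((E - 1) * E * M). repeat apply Rmult_lt_0_compat; lra.
  replace (/ (E - 1) * ((E - 1) * E * M)) with (E * M) by (field; lra).
  replace (2 * / E * (1 + / M) * ((E - 1) * E * M)) with (2 * (E - 1) * (M + 1)) by (field; lra).
  nra.
Qed.

Definition vstrip (A B : R) (s : C) : Prop := A < Re s < B.

Lemma vstrip_open (A B : R) : copen (vstrip A B).
Proof.
  intros s [H1 H2]. exists (Rmin (Re s - A) (B - Re s)). split; [apply Rmin_pos; lra|]. intros h Hh.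
  assert (h1 := Rlt_le_trans _ _ _ Hh (Rmin_l _ _)). assert (h2 := Rlt_le_trans _ _ _ Hh (Rmin_r _ _)).
  assert (R := re_le h). apply Rabs_le_between in R. unfold vstrip. rewrite Re_plus. lra.
Qed.

Lemma vstrip_star (A B : R) (a : C) : vstrip A B a -> star (vstrip A B) a.
Proof.
  intros [H1 H2] z t [H3 H4] Ht. unfold vstrip.
  replace (Re (a + t * (z - a))%C) with ((1 - t) * Re a + t * Re z) by (Csimpl; ring).
  split.
  - destruct (Rle_dec t (1 / 2)); nra.
  - destruct (Rle_dec t (1 / 2)); nra.
Qed.

Section AbelPlana.
Context (c cp : R) (f G : C -> C) (hcp : 0 < cp < 1) (hcpc : cp < c)
  (Sf : smooth 2 (fun s => - c < Re s) f)
  (DG : forall s, - c < Re s -> cder G s (f s)).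

(** The strip between [left j] and j contains the line Re s = j - cp, contains no integer and lies
    in the domain of f; the maximum with - c matters for j = 0 only. *)
Let left (j : nat) : R := Rmax (INR j - 1) (- c).

Lemma left_lt (j : nat) : - c <= left j /\ INR j - 1 <= left j /\ left j < INR j - cp.
Proof.
  unfold left. assert (H := pos_INR j). split; [apply Rmax_r|split; [apply Rmax_l|]].
  apply Rmax_lub_lt; lra.
Qed.

Lemma vertical_primitive (sg : R) (j : nat) : sign sg -> exists K : C -> C,
  forall s, vstrip (left j) (INR j) s -> cder K s (f s * kern sg s)%C.
Proof.
  intros Hs. assert (L := left_lt j).
  apply (primitive_star (vstrip (left j) (INR j)) (RtoC (INR j - cp))).
  - apply vstrip_open.
  - apply vstrip_star. split; rewrite Re_RtoC; lra.
  - split; rewrite Re_RtoC; lra.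
  - apply smooth_mult.
    + apply smooth_S. apply smooth_sub with (2 := Sf). intros z [Hz _]. lra.
    + apply smooth_inv; [|apply kden_smooth]. intros z [H1 H2] Z.
      destruct (kden_zero sg z Hs Z) as [k ->]. rewrite Re_RtoC in H1, H2.
      assert (H3 : INR j - 1 < IZR k) by lra. rewrite INR_IZR_INZ in H2, H3.
      rewrite <- minus_IZR in H3. apply lt_IZR in H2. apply lt_IZR in H3. lia.
Qed.

(** Subtracting f(m) removes the pole at m: the integrand is the quotient of the slope functions of
    [f] and [kden sg] at m, and the latter has no zero in the strip. *)
Lemma strip_primitive (sg : R) (m : nat) (d : C) : sign sg -> cder f (RtoC (INR m)) d ->
  exists Q : C -> C,
  (forall s, vstrip (left m) (INR m + 1) s -> s <> RtoC (INR m) -> cder Q s ((f s - f (INR m)) * kern sg s)%C) /\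
  cder Q (RtoC (INR m)) (d / (- (2 * PI * sg)%R * Ci))%C.
Proof.
  intros Hs Hd. assert (L := left_lt m). assert (HPI := PI_RGT_0).
  set (D := vstrip (left m) (INR m + 1)).
  assert (Dm : D (RtoC (INR m))) by (split; rewrite Re_RtoC; lra).
  assert (Op : copen D) by apply vstrip_open.
  destruct (slope_smooth D f (INR m) Op Dm) as [F [SF [EF DF]]].
  { apply smooth_sub with (2 := Sf). intros z [Hz _]. lra. }
  destruct (slope_smooth D (kden sg) (INR m) Op Dm (kden_smooth 2 D sg)) as [H [SH [EH DH]]].
  assert (EFm : F (INR m) = d) by (apply (der_unique f (INR m)); auto).
  assert (EHm : H (INR m) = (- (2 * PI * sg)%R * Ci)%C).
  { apply (der_unique (kden sg) (INR m)); auto. eapply der_eq. apply kden_derive.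
    assert (Z := kden_integer sg m Hs). unfold kden in Z.
    replace (Cexp (- (2 * PI * sg)%R * Ci * INR m)) with (RtoC 1). ring.
    transitivity (Cexp (- (2 * PI * sg)%R * Ci * INR m) - 1 + 1)%C; [rewrite Z|]; ring. }
  assert (NzC : (- (2 * PI * sg)%R * Ci)%C <> 0%C).
  { apply Cmod_gt_0. rewrite Cmod_mult, Cmod_opp, Cmod_Ci, Cmod_R, Rmult_1_r. apply Rabs_pos_lt.
    destruct Hs as [-> | ->]; lra. }
  assert (Nz : forall s, s <> RtoC (INR m) -> (s - INR m)%C <> 0%C).
  { intros s N E. apply N. replace s with (s - INR m + INR m)%C by ring. rewrite E. ring. }
  assert (NK : forall s, D s -> s <> RtoC (INR m) -> kden sg s <> 0%C).
  { intros s [H1 H2] N Z. destruct (kden_zero sg s Hs Z) as [k E]. rewrite E, Re_RtoC in H1, H2.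
    apply N. rewrite E. f_equal. rewrite INR_IZR_INZ. f_equal.
    assert (H3 : INR m - 1 < IZR k) by lra. rewrite INR_IZR_INZ in H2, H3.
    rewrite <- minus_IZR in H3. rewrite <- plus_IZR in H2. apply lt_IZR in H2. apply lt_IZR in H3. lia. }
  assert (NH : forall s, D s -> H s <> 0%C).
  { intros s Ds. destruct (excluded_middle_informative (s = RtoC (INR m))) as [->|N].
    - rewrite EHm; auto.
    - rewrite EH, kden_integer by auto. intros Z. apply (NK s Ds N).
      replace (kden sg s) with ((kden sg s - 0) / (s - INR m) * (s - INR m))%C by (field; apply Nz; auto).
      rewrite Z. ring. }
  destruct (primitive_star D (INR m) (fun s => F s / H s)%C) as [Q HQ]; auto.
  - apply vstrip_star; auto.
  - apply smooth_div; auto.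
  - exists Q. split.
    + intros s Ds N. eapply der_eq. apply HQ; auto. rewrite EF, EH, kden_integer by auto. unfold kern.
      replace (kden sg s - 0)%C with (kden sg s) by ring. field. split; auto.
    + eapply der_eq. apply HQ; auto. rewrite EFm, EHm. auto.
Qed.

Lemma rder_vertical (Q : C -> C) (l : C) (x sg t : R) : cder Q (x, sg * t) l ->
  rder (fun t => Q (x, sg * t)) t (Ci * sg * l)%C.
Proof.
  intros H.
  assert (E : forall t : R, (x + t * (Ci * sg))%C = (x, sg * t)) by (intros; apply Ceq; simpl; ring).
  apply (der_ext _ (fun z => Q (x + Re z * (Ci * sg))%C)). intros z; rewrite E; auto.
  eapply der_eq. apply (rder_comp Q (fun t => x + t * (Ci * sg))%C). rewrite E. exact H. apply rder_affine. ring.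
Qed.

Lemma rder_horizontal (Q : C -> C) (l : C) (x y : R) : cder Q (x, y) l ->
  rder (fun x => Q (x, y)) x l.
Proof.
  intros H.
  assert (E : forall t : R, ((0, y) + t * 1)%C = (t, y)) by (intros; apply Ceq; simpl; ring).
  apply (der_ext _ (fun z => Q ((0, y) + Re z * 1)%C)). intros z; rewrite E; auto.
  eapply der_eq. apply (rder_comp Q (fun t => (0, y) + t * 1)%C). rewrite E. exact H. apply rder_affine. ring.
Qed.

(** On the real segment of length 1 around m the kernels add up to -1, so Q1 + Q2 + G - x f(m) is
    constant there, and f(m) becomes a sum of increments. Each increment of Q is then raised to
    height M: the parts of the vertical sides due to the constant f(m) cancel because the kernel has
    period 1, and [T1], [T2] are the top sides. *)
Lemma abel_plana_strip (K1 K2 : nat -> C -> C) (m : nat) :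
  (forall j s, vstrip (left j) (INR j) s -> cder (K1 j) s (f s * kern 1 s)%C) ->
  (forall j s, vstrip (left j) (INR j) s -> cder (K2 j) s (f s * kern (-1) s)%C) ->
  exists T1 T2 : R -> C,
  (forall M, 0 <= M -> f (INR m) =
    (G (INR m + 1 - cp)%R - G (INR m - cp)%R
     + (K1 m (INR m - cp, 1 * M)%R - K1 m (INR m - cp)%R)
     - (K1 (S m) (INR m + 1 - cp, 1 * M)%R - K1 (S m) (INR m + 1 - cp)%R)
     + (K2 m (INR m - cp, -1 * M)%R - K2 m (INR m - cp)%R)
     - (K2 (S m) (INR m + 1 - cp, -1 * M)%R - K2 (S m) (INR m + 1 - cp)%R)
     + T1 M + T2 M)%C) /\
  (forall M B, 0 < M -> (forall x, INR m - cp <= x <= INR m + 1 - cp ->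
      Cmod (f (x, 1 * M)%R * kern 1 (x, 1 * M)%R)%C <= B /\ Cmod (f (INR m) * kern 1 (x, 1 * M)%R)%C <= B) ->
    Cmod (T1 M) <= 2 * B) /\
  (forall M B, 0 < M -> (forall x, INR m - cp <= x <= INR m + 1 - cp ->
      Cmod (f (x, -1 * M)%R * kern (-1) (x, -1 * M)%R)%C <= B /\ Cmod (f (INR m) * kern (-1) (x, -1 * M)%R)%C <= B) ->
    Cmod (T2 M) <= 2 * B).
Proof.
  intros HK1 HK2. assert (L := left_lt m). assert (L' := left_lt (S m)). assert (HPI := PI_RGT_0).
  assert (HSm : INR (S m) = INR m + 1) by apply S_INR.
  assert (LS : left (S m) = INR m).
  { unfold left. rewrite HSm. rewrite Rmax_left. ring. generalize (pos_INR m); lra. }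
  assert (Ex : exists d, cder f (INR m) d).
  { destruct Sf as [f' [Df _]]. exists (f' (INR m)). apply Df. rewrite Re_RtoC. lra. }
  destruct Ex as [d Hd].
  set (a := INR m - cp) in *. set (b := INR m + 1 - cp) in *.
  assert (ab : b = a + 1) by (unfold a, b; ring).
  assert (Hab : left m < a /\ a < INR m /\ INR m < b /\ b < INR m + 1) by (unfold a, b in *; lra).
  assert (P : forall sg, sign sg -> forall K : nat -> C -> C,
    (forall j s, vstrip (left j) (INR j) s -> cder (K j) s (f s * kern sg s)%C) ->
    exists Q : C -> C,
      (forall s, vstrip (left m) (INR m + 1) s -> s <> RtoC (INR m) -> cder Q s ((f s - f (INR m)) * kern sg s)%C) /\
      cder Q (RtoC (INR m)) (d / (- (2 * PI * sg)%R * Ci))%C /\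
      (forall M, 0 <= M -> (Q b - Q a)%C =
        ((K m (a, sg * M)%R - K m a) - (K (S m) (b, sg * M)%R - K (S m) b) + (Q (b, sg * M)%R - Q (a, sg * M)%R))%C) /\
      (forall M B, 0 < M -> (forall x, a <= x <= b ->
        Cmod (f (x, sg * M)%R * kern sg (x, sg * M)%R)%C <= B /\ Cmod (f (INR m) * kern sg (x, sg * M)%R)%C <= B) ->
        Cmod (Q (b, sg * M)%R - Q (a, sg * M)%R)%C <= 2 * B)).
  { intros sg Hs K HK. destruct (strip_primitive sg m d Hs Hd) as [Q [Q1 Q2]]. exists Q. split; auto. split; auto. split.
    - intros M HM.
      assert (E : (Q (a, sg * M)%R - Q (b, sg * M)%R - K m (a, sg * M)%R + K (S m) (b, sg * M)%R)%C =
                  (Q (a, sg * 0)%R - Q (b, sg * 0)%R - K m (a, sg * 0)%R + K (S m) (b, sg * 0)%R)%C).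
      { apply (constant_of_derive (fun t => Q (a, sg * t)%R - Q (b, sg * t)%R - K m (a, sg * t)%R + K (S m) (b, sg * t)%R)%C 0 M); auto.
        intros t _.
        assert (Va : vstrip (left m) (INR m) (a, sg * t)) by (unfold vstrip; cbn [Re fst]; lra).
        assert (Vb : vstrip (left (S m)) (INR (S m)) (b, sg * t)) by (unfold vstrip; rewrite LS, HSm; cbn [Re fst]; lra).
        assert (Va' : vstrip (left m) (INR m + 1) (a, sg * t)) by (unfold vstrip; cbn [Re fst]; lra).
        assert (Vb' : vstrip (left m) (INR m + 1) (b, sg * t)) by (unfold vstrip; cbn [Re fst]; lra).
        eapply der_eq.
        - apply (der_plus _ (fun z => Q (a, sg * Re z)%R - Q (b, sg * Re z)%R - K m (a, sg * Re z)%R)%C (fun z => K (S m) (b, sg * Re z)%R)).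
          apply (der_minus _ (fun z => Q (a, sg * Re z)%R - Q (b, sg * Re z)%R)%C (fun z => K m (a, sg * Re z)%R)).
          apply (der_minus _ (fun z => Q (a, sg * Re z)%R) (fun z => Q (b, sg * Re z)%R)).
          apply rder_vertical. apply Q1; auto. intros E. apply (f_equal Re) in E. rewrite Re_RtoC in E. cbn [Re fst] in E. lra.
          apply rder_vertical. apply Q1; auto. intros E. apply (f_equal Re) in E. rewrite Re_RtoC in E. cbn [Re fst] in E. lra.
          apply rder_vertical. apply HK; auto.
          apply rder_vertical. apply HK; auto.
        - assert (Ek : kern sg (b, sg * t) = kern sg (a, sg * t)).
          { unfold kern. replace ((b, sg * t) : C) with ((a, sg * t)%R + 1)%C by (rewrite ab; apply Ceq; simpl; ring).
            rewrite kden_periodic; auto. }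
          rewrite Ek. ring. }
      rewrite Rmult_0_r in E. change ((a, 0) : C) with (RtoC a) in E. change ((b, 0) : C) with (RtoC b) in E.
      transitivity (Q (b, sg * M)%R - Q (a, sg * M)%R + K m (a, sg * M)%R - K (S m) (b, sg * M)%R
        + (Q (a, sg * M)%R - Q (b, sg * M)%R - K m (a, sg * M)%R + K (S m) (b, sg * M)%R) + (Q b - Q a))%C; [ring|].
      rewrite E. ring.
    - intros M B HM HB.
      replace (2 * B) with (2 * B * (b - a)) by (rewrite ab; ring).
      apply (mean_value_lipschitz (fun x => Q (x, sg * M)%R) (fun x => (f (x, sg * M)%R - f (INR m)) * kern sg (x, sg * M)%R)%C); [lra| |].
      + intros x Hx. apply rder_horizontal. apply Q1. unfold vstrip; cbn [Re fst]. lra.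
        intros E. apply (f_equal Im) in E. rewrite Im_RtoC in E. cbn [Im snd] in E. destruct Hs as [-> | ->]; lra.
      + intros x Hx. destruct (HB x Hx) as [B1 B2].
        replace ((f (x, sg * M)%R - f (INR m)) * kern sg (x, sg * M)%R)%C with
          (f (x, sg * M)%R * kern sg (x, sg * M)%R - f (INR m) * kern sg (x, sg * M)%R)%C by ring.
        apply Rle_trans with (1 := Cmod_minus_triangle _ _). lra. }
  destruct (P 1 (or_introl eq_refl) K1 HK1) as [Q1 [A1 [B1 [C1 D1]]]].
  destruct (P (-1) (or_intror eq_refl) K2 HK2) as [Q2 [A2 [B2 [C2 D2]]]].
  exists (fun M => Q1 (b, 1 * M)%R - Q1 (a, 1 * M)%R)%C, (fun M => Q2 (b, -1 * M)%R - Q2 (a, -1 * M)%R)%C.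
  split; [|split; auto].
  intros M HM.
  assert (E : (Q1 b + Q2 b + G b - b * f (INR m))%C = (Q1 a + Q2 a + G a - a * f (INR m))%C).
  { apply (constant_of_derive (fun x => Q1 (RtoC x) + Q2 (RtoC x) + G (RtoC x) - x * f (INR m))%C a b); [lra|].
    intros x Hx.
    assert (R : forall (H : C -> C) l, cder H (RtoC x) l -> rder (fun x => H (RtoC x)) x l) by (intros; apply (rder_horizontal H l x 0); auto).
    assert (V : vstrip (left m) (INR m + 1) (RtoC x)) by (unfold vstrip; rewrite Re_RtoC; lra).
    assert (HG : cder G (RtoC x) (f x)) by (apply DG; rewrite Re_RtoC; lra).
    assert (T : forall l1 l2, cder Q1 (RtoC x) l1 -> cder Q2 (RtoC x) l2 -> (l1 + l2 + f x - f (INR m) = 0)%C ->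
      rder (fun x => Q1 (RtoC x) + Q2 (RtoC x) + G (RtoC x) - x * f (INR m))%C x 0%C).
    { intros l1 l2 H1 H2 E0. eapply der_eq.
      - apply (der_minus _ (fun z => Q1 (RtoC (Re z)) + Q2 (RtoC (Re z)) + G (RtoC (Re z)))%C (fun z => Re z * f (INR m))%C).
        apply (der_plus _ (fun z => Q1 (RtoC (Re z)) + Q2 (RtoC (Re z)))%C (fun z => G (RtoC (Re z)))).
        apply (der_plus _ (fun z => Q1 (RtoC (Re z)))%C (fun z => Q2 (RtoC (Re z)))).
        exact (R Q1 l1 H1). exact (R Q2 l2 H2). exact (R G _ HG).
        apply (der_ext _ (fun x => 0 + Re x * (f (INR m)))%C). intros; ring. apply (rder_affine 0 (f (INR m))).
      - exact E0. }
    (* At m itself, where the kernels are undefined, the derivatives of Q1 and Q2 are opposite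
       multiples of f'(m) and cancel. *)
    destruct (Req_dec x (INR m)) as [->|N].
    - eapply T; [exact B1|exact B2|].
      replace (2 * PI * -1) with (- (2 * PI * 1)) by ring. rewrite RtoC_opp. field.
      split; intros Z. apply (f_equal Im) in Z; simpl in Z; lra. apply RtoC_inj in Z. lra.
    - assert (Nx : RtoC x <> RtoC (INR m)) by (intros Z; apply N, RtoC_inj; auto).
      eapply T; [apply A1; auto|apply A2; auto|].
      assert (NK : forall sg, sign sg -> kden sg (RtoC x) <> 0%C).
      { intros sg Hs Z. destruct (kden_zero sg _ Hs Z) as [k Hk]. apply RtoC_inj in Hk.
        apply N. rewrite Hk, INR_IZR_INZ. f_equal.
        assert (H3 : INR m - 1 < IZR k) by lra. assert (H2 : IZR k < INR m + 1) by lra. rewrite INR_IZR_INZ in H2, H3.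
        rewrite <- minus_IZR in H3. rewrite <- plus_IZR in H2. apply lt_IZR in H2. apply lt_IZR in H3. lia. }
      assert (KS := kern_sum x (NK 1 (or_introl eq_refl)) (NK (-1) (or_intror eq_refl))).
      transitivity ((f x - f (INR m)) * (kern 1 x + kern (-1) x) + f x - f (INR m))%C; [ring|]. rewrite KS. ring. }
  specialize (C1 M HM). specialize (C2 M HM).
  assert (E2 : f (INR m) = (G b - G a + (Q1 b - Q1 a) + (Q2 b - Q2 a))%C).
  { assert (bm : (b * f (INR m) - a * f (INR m))%C = f (INR m)) by (rewrite ab, RtoC_plus; ring).
    transitivity (b * f (INR m) - a * f (INR m) + ((Q1 b + Q2 b + G b - b * f (INR m)) - (Q1 a + Q2 a + G a - a * f (INR m))))%C.
    rewrite bm, E; ring. ring. }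
  rewrite E2, C1, C2. ring.
Qed.

Lemma vertical_bound (sg A kappa M x : R) (K : C -> C) : sign sg -> 0 < kappa -> 0 <= M ->
  (forall t, 0 <= t -> cder K (x, sg * t) (f (x, sg * t)%R * kern sg (x, sg * t)%R)%C) ->
  (forall t, 0 <= t -> Cmod (f (x, sg * t)%R * kern sg (x, sg * t)%R)%C <= A * exp (- kappa * t)) ->
  Cmod (K (x, sg * M)%R - K x)%C <= A / kappa.
Proof.
  intros Hs Hk HM D H.
  assert (HA : 0 <= A).
  { specialize (H 0 (Rle_refl 0)). rewrite !Rmult_0_r, exp_0 in H. generalize (Cmod_ge_0 (f (x, 0)%R * kern sg (x, 0)%R)%C). lra. }
  change (RtoC x) with ((x, 0) : C). replace ((x, 0) : C) with ((x, sg * 0) : C) by (rewrite Rmult_0_r; auto).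
  apply Rle_trans with (- (A / kappa) * exp (- kappa * M) - - (A / kappa) * exp (- kappa * 0)).
  - apply (mean_value_le (fun t => K (x, sg * t)%R) (fun t => Ci * sg * (f (x, sg * t)%R * kern sg (x, sg * t)%R))%C
      (fun t => - (A / kappa) * exp (- kappa * t)) (fun t => A * exp (- kappa * t))); auto.
    + intros t Ht. apply rder_vertical. apply D; lra.
    + intros t Ht. auto_derive; auto. field. lra.
    + intros t Ht. rewrite Cmod_mult, Cmod_mult, Cmod_Ci, Cmod_R.
      replace (Rabs sg) with 1. rewrite !Rmult_1_l. apply H; lra.
      destruct Hs as [-> | ->]; unfold Rabs; destruct (Rcase_abs _); lra.
  - rewrite Rmult_0_r, exp_0.
    assert (0 <= A / kappa * exp (- kappa * M)).
    { apply Rmult_le_pos. apply Rmult_le_pos; auto. left; apply Rinv_0_lt_compat; auto. left; apply exp_pos. }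
    lra.
Qed.

(** Summation over m telescopes the vertical sides, so only the two outermost lines remain; the top
    sides vanish as M tends to infinity with N fixed. *)
Theorem abel_plana_bound (N : nat) (A B kappa : R) : 0 < kappa ->
  (forall sg t, sign sg -> 0 <= t ->
    Cmod (f (- cp, sg * t)%R * kern sg (- cp, sg * t)%R)%C <= A * exp (- kappa * t)) ->
  (forall sg t, sign sg -> 0 <= t ->
    Cmod (f (INR (S N) - cp, sg * t)%R * kern sg (INR (S N) - cp, sg * t)%R)%C <= B * exp (- kappa * t)) ->
  (forall m eta, 0 < eta -> exists M0, forall M sg x, M0 <= M -> sign sg -> INR m - cp <= x <= INR m + 1 - cp ->
    Cmod (f (x, sg * M)%R * kern sg (x, sg * M)%R)%C <= eta) ->
  Cmod (csum (fun m => f (INR m)) N - (G (INR (S N) - cp)%R - G (- cp)%R))%C <= 2 * (A + B) / kappa.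
Proof.
  intros Hk HA HB HT.
  assert (K1e := fun j => vertical_primitive 1 j (or_introl eq_refl)).
  assert (K2e := fun j => vertical_primitive (-1) j (or_intror eq_refl)).
  destruct (choice _ K1e) as [K1 HK1]. destruct (choice _ K2e) as [K2 HK2]. clear K1e K2e.
  set (Sd := (csum (fun m => f (INR m)) N - (G (INR (S N) - cp)%R - G (- cp)%R))%C).
  assert (Id : forall n eta, 0 < eta -> exists M0, 0 < M0 /\ forall M, M0 <= M ->
    Cmod (csum (fun m => f (INR m)) n - (G (INR (S n) - cp)%R - G (- cp)%R)
      - ((K1 0%nat (- cp, 1 * M)%R - K1 0%nat (- cp)%R) - (K1 (S n) (INR (S n) - cp, 1 * M)%R - K1 (S n) (INR (S n) - cp)%R)
        + (K2 0%nat (- cp, -1 * M)%R - K2 0%nat (- cp)%R) - (K2 (S n) (INR (S n) - cp, -1 * M)%R - K2 (S n) (INR (S n) - cp)%R)))%C <= eta).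
  { assert (Tp : forall m eta, 0 < eta -> exists M0, 0 < M0 /\ forall M sg x, M0 <= M -> sign sg -> INR m - cp <= x <= INR m + 1 - cp ->
      Cmod (f (x, sg * M)%R * kern sg (x, sg * M)%R)%C <= eta /\ Cmod (f (INR m) * kern sg (x, sg * M)%R)%C <= eta).
    { intros m eta He. destruct (HT m eta He) as [M1 HM1].
      set (Fm := Cmod (f (INR m))). assert (HF : 0 <= Fm) by apply Cmod_ge_0.
      exists (Rmax M1 (Rmax 1 (4 * Fm / eta))). split.
      apply Rlt_le_trans with 1; [lra|]. apply Rle_trans with (2 := Rmax_r _ _). apply Rmax_l.
      intros M sg x HM Hs Hx. split. apply HM1; auto. apply Rle_trans with (2 := HM); apply Rmax_l.
      assert (H1 := Rle_trans _ _ _ (Rmax_r _ _) HM). assert (H2 := Rle_trans _ _ _ (Rmax_l _ _) H1).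
      assert (H3 := Rle_trans _ _ _ (Rmax_r _ _) H1).
      rewrite Cmod_mult. fold Fm. assert (Kt := kern_top sg M x Hs ltac:(lra)).
      assert (Im1 : / M <= / 1) by (apply Rinv_le_contravar; lra). rewrite Rinv_1 in Im1.
      assert (Ee : exp (- (2 * PI * M)) <= / M).
      { rewrite exp_Ropp. apply Rinv_le_contravar; [lra|]. generalize (exp_ineq1_le (2 * PI * M)) PI2_1. nra. }
      assert (Pe := exp_pos (- (2 * PI * M))).
      assert (Im0 : 0 < / M) by (apply Rinv_0_lt_compat; lra).
      assert (Kt2 : Cmod (kern sg (x, sg * M)) <= 4 * / M) by nra.
      apply Rle_trans with (Fm * (4 * / M)). apply Rmult_le_compat_l; auto.
      apply Rmult_le_reg_r with M; [lra|]. replace (Fm * (4 * / M) * M) with (4 * Fm) by (field; lra).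
      apply Rle_trans with (eta * (4 * Fm / eta)). right; field; lra. apply Rmult_le_compat_l; lra. }
    induction n as [|n IH]; intros eta He.
    - destruct (abel_plana_strip K1 K2 0 HK1 HK2) as [T1 [T2 [E [B1 B2]]]].
      destruct (Tp 0%nat (eta / 4)) as [M0 [HM0 HM]]; [lra|]. exists M0; split; auto. intros M HMM.
      rewrite csum_0. rewrite (E M) by lra.
      assert (D1 := B1 M (eta / 4) ltac:(lra) (fun x Hx => HM M 1 x HMM (or_introl eq_refl) Hx)).
      assert (D2 := B2 M (eta / 4) ltac:(lra) (fun x Hx => HM M (-1) x HMM (or_intror eq_refl) Hx)).
      change (INR 1) with 1. change (INR 0) with 0.
      replace (0 - cp) with (- cp) by ring. replace (0 + 1 - cp) with (1 - cp) by ring.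
      match goal with |- Cmod ?z <= _ => replace z with (T1 M + T2 M)%C by ring end.
      apply Rle_trans with (1 := Cmod_triangle _ _). lra.
    - destruct (abel_plana_strip K1 K2 (S n) HK1 HK2) as [T1 [T2 [E [B1 B2]]]].
      destruct (Tp (S n) (eta / 8)) as [M0 [HM0 HM]]; [lra|].
      destruct (IH (eta / 2)) as [M1 [HM1 HI]]; [lra|].
      exists (Rmax M0 M1); split. apply Rlt_le_trans with (1 := HM0). apply Rmax_l. intros M HMM.
      assert (HMM0 := Rle_trans _ _ _ (Rmax_l _ _) HMM). assert (HMM1 := Rle_trans _ _ _ (Rmax_r _ _) HMM).
      rewrite csum_S. rewrite (E M) by lra. specialize (HI M HMM1).
      assert (D1 := B1 M (eta / 8) ltac:(lra) (fun x Hx => HM M 1 x HMM0 (or_introl eq_refl) Hx)).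
      assert (D2 := B2 M (eta / 8) ltac:(lra) (fun x Hx => HM M (-1) x HMM0 (or_intror eq_refl) Hx)).
      rewrite (S_INR (S n)).
      match type of HI with Cmod ?y <= _ =>
        match goal with |- Cmod ?z <= _ => replace z with (y + (T1 M + T2 M))%C by ring end end.
      apply Rle_trans with (1 := Cmod_triangle _ _). generalize (Cmod_triangle (T1 M) (T2 M)). lra. }
  apply Rnot_lt_le. intros Lt.
  destruct (Id N ((Cmod Sd - 2 * (A + B) / kappa) / 2)) as [M0 [HM0 HM]]; [lra|].
  specialize (HM M0 (Rle_refl _)). fold Sd in HM.
  assert (LN := left_lt (S N)). assert (L0 := left_lt 0). change (INR 0) with 0 in L0.
  assert (V0 : forall sg t, vstrip (left 0) (INR 0) (- cp, sg * t)) by (intros; unfold vstrip; change (INR 0) with 0; cbn [Re fst]; lra).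
  assert (VN : forall sg t, vstrip (left (S N)) (INR (S N)) (INR (S N) - cp, sg * t)) by (intros; unfold vstrip; cbn [Re fst]; lra).
  assert (b1 := vertical_bound 1 A kappa M0 (- cp) (K1 0%nat) (or_introl eq_refl) Hk ltac:(lra) (fun t _ => HK1 _ _ (V0 1 t)) (fun t Ht => HA 1 t (or_introl eq_refl) Ht)).
  assert (b2 := vertical_bound (-1) A kappa M0 (- cp) (K2 0%nat) (or_intror eq_refl) Hk ltac:(lra) (fun t _ => HK2 _ _ (V0 (-1) t)) (fun t Ht => HA (-1) t (or_intror eq_refl) Ht)).
  assert (b3 := vertical_bound 1 B kappa M0 (INR (S N) - cp) (K1 (S N)) (or_introl eq_refl) Hk ltac:(lra) (fun t _ => HK1 _ _ (VN 1 t)) (fun t Ht => HB 1 t (or_introl eq_refl) Ht)).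
  assert (b4 := vertical_bound (-1) B kappa M0 (INR (S N) - cp) (K2 (S N)) (or_intror eq_refl) Hk ltac:(lra) (fun t _ => HK2 _ _ (VN (-1) t)) (fun t Ht => HB (-1) t (or_intror eq_refl) Ht)).
  set (u1 := (K1 0%nat (- cp, 1 * M0)%R - K1 0%nat (- cp)%R)%C) in *.
  set (u2 := (K2 0%nat (- cp, -1 * M0)%R - K2 0%nat (- cp)%R)%C) in *.
  set (u3 := (K1 (S N) (INR (S N) - cp, 1 * M0)%R - K1 (S N) (INR (S N) - cp)%R)%C) in *.
  set (u4 := (K2 (S N) (INR (S N) - cp, -1 * M0)%R - K2 (S N) (INR (S N) - cp)%R)%C) in *.
  assert (Tr : Cmod Sd <= Cmod (Sd - (u1 - u3 + u2 - u4))%C + (Cmod u1 + (Cmod u3 + (Cmod u2 + Cmod u4)))).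
  { replace Sd with ((Sd - (u1 - u3 + u2 - u4)) + (u1 - (u3 - (u2 - u4))))%C at 1 by ring.
    apply Rle_trans with (1 := Cmod_triangle _ _). apply Rplus_le_compat_l.
    apply Rle_trans with (1 := Cmod_minus_triangle _ _). apply Rplus_le_compat_l.
    apply Rle_trans with (1 := Cmod_minus_triangle _ _). apply Rplus_le_compat_l.
    apply Cmod_minus_triangle. }
  replace (2 * (A + B) / kappa) with (A / kappa + (B / kappa + (A / kappa + B / kappa))) in * by (field; lra). lra.
Qed.

End AbelPlana.

(** * Comparison of the series with a primitive *)

(** The gauge at a point is taken at most 1 / (|U| + 1), so the uniform lower bound d that
    compactness gives for the gauge bounds |U| by 1 / d. *)
Lemma bounded_rectangle (U : R -> R -> R) (a b a' b' : R) :
  (forall x y, a <= x <= b -> a' <= y <= b' -> exists d, 0 < d /\ forall u v,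
     Rabs (u - x) < d -> Rabs (v - y) < d -> Rabs (U u v - U x y) < 1) ->
  exists M, forall x y, a <= x <= b -> a' <= y <= b' -> Rabs (U x y) <= M.
Proof.
  intros H.
  assert (Hd : forall x y, exists d : posreal, a <= x <= b -> a' <= y <= b' ->
    d * (Rabs (U x y) + 1) <= 1 /\
    forall u v, Rabs (u - x) < d -> Rabs (v - y) < d -> Rabs (U u v - U x y) < 1).
  { intros x y. destruct (classic ((a <= x <= b) /\ (a' <= y <= b'))) as [[Hx Hy]|N].
    - destruct (H x y Hx Hy) as [d [Hd Q]]. assert (HU := Rabs_pos (U x y)).
      assert (Hi : 0 < / (Rabs (U x y) + 1)) by (apply Rinv_0_lt_compat; lra).
      assert (Hm : 0 < Rmin d (/ (Rabs (U x y) + 1))) by (apply Rmin_pos; auto).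
      exists (mkposreal _ Hm). intros _ _. simpl. split.
      + apply Rle_trans with (/ (Rabs (U x y) + 1) * (Rabs (U x y) + 1)).
        apply Rmult_le_compat_r. lra. apply Rmin_r. rewrite Rinv_l; lra.
      + intros u v Hu Hv. assert (M1 := Rmin_l d (/ (Rabs (U x y) + 1))). apply Q; lra.
    - exists (mkposreal 1 Rlt_0_1). intros Hx Hy. exfalso; auto. }
  set (dl := fun x y => proj1_sig (constructive_indefinite_description _ (Hd x y))).
  assert (Q : forall x y, a <= x <= b -> a' <= y <= b' -> dl x y * (Rabs (U x y) + 1) <= 1 /\
    forall u v, Rabs (u - x) < dl x y -> Rabs (v - y) < dl x y -> Rabs (U u v - U x y) < 1).
  { intros x y. exact (proj2_sig (constructive_indefinite_description _ (Hd x y))). }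
  destruct (compactness_value_2d a b a' b' dl) as [d Hc]. exists (/ d).
  intros x y Hx Hy. apply NNPP. intros C. apply (Hc x y Hx Hy). intros [u [v [Hu [Hv [H1 [H2 H3]]]]]].
  apply C. destruct (Q u v Hu Hv) as [Q1 Q2]. specialize (Q2 x y H1 H2).
  assert (T := Rabs_triang_inv (U x y) (U u v)). assert (Hp := cond_pos d). assert (HU := Rabs_pos (U u v)).
  assert (B : d * (Rabs (U u v) + 1) <= 1) by nra.
  apply Rmult_le_reg_l with d; auto. rewrite Rinv_r by lra. nra.
Qed.

Lemma bounded_on_curve (u : C -> R) (f : C -> C) (g : R -> C) (a b : R) :
  (forall s, Rabs (u s) <= Cmod (f s)) ->
  (forall t, a <= t <= b -> ccont f (g t) /\ rcont g t) ->
  exists M, forall t, a <= t <= b -> u (g t) <= M.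
Proof.
  intros Hu H.
  destruct (bounded_rectangle (fun t _ => Cmod (f (g t))) a b 0 0) as [M HM].
  - intros x y Hx _. destruct (H x Hx) as [H1 H2].
    destruct (cont_comp (fun h => Im h = 0) (fun z => g (Re z)) f (RtoC x) H1 H2 1 Rlt_0_1) as [d [Hd Q]].
    exists d. split; auto. intros t _ Ht _. specialize (Q (RtoC (t - x)) (Im_RtoC _)).
    rewrite Cmod_R in Q. specialize (Q Ht). rewrite Re_plus, !Re_RtoC in Q.
    replace (x + (t - x)) with t in Q by ring.
    eapply Rle_lt_trans; [|exact Q]. apply Rabs_le_between.
    assert (T1 := Cmod_triangle (f (g t) - f (g x))%C (f (g x))).
    assert (T2 := Cmod_triangle (- (f (g t) - f (g x)))%C (f (g t))). rewrite Cmod_opp in T2.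
    replace (f (g t) - f (g x) + f (g x))%C with (f (g t)) in T1 by ring.
    replace (- (f (g t) - f (g x)) + f (g t))%C with (f (g x)) in T2 by ring. lra.
  - exists M. intros t Ht. assert (Q := HM t 0 Ht (conj (Rle_refl _) (Rle_refl _))).
    apply Rle_trans with (Rabs (u (g t))). apply Rle_abs.
    apply Rle_trans with (Cmod (f (g t))). apply Hu. eapply Rle_trans. apply Rle_abs. exact Q.
Qed.

Lemma Cexp_Clog (z : C) : z <> 0%C -> Cexp (Clog z) = z.
Proof.
  intros Hz. assert (Hm : 0 < Cmod z) by (apply Cmod_gt_0; auto).
  destruct (Re_div_Cmod_bound z Hz) as [L1 L2].
  assert (S : sin (acos (Re z / Cmod z)) = Rabs (Im z) / Cmod z).
  { rewrite sin_acos by lra. replace (1 - Rsqr (Re z / Cmod z)) with (Rsqr (Rabs (Im z) / Cmod z)).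
    apply sqrt_Rsqr. apply Rdiv_le_0_compat; auto. apply Rabs_pos.
    rewrite !Rsqr_div' by lra. rewrite <- Rsqr_abs.
    assert (Q : Rsqr (Cmod z) = Rsqr (Re z) + Rsqr (Im z)).
    { unfold Cmod. rewrite Rsqr_sqrt. unfold Rsqr, Re, Im; ring. nra. }
    assert (Q2 : Rsqr (Cmod z) <> 0) by (unfold Rsqr; nra). field_simplify_eq; auto. lra. }
  assert (Co : cos (acos (Re z / Cmod z)) = Re z / Cmod z) by (apply cos_acos; lra).
  unfold Cexp, Clog, Carg. cbn [Re Im fst snd]. rewrite exp_ln by auto.
  destruct (Rle_dec 0 (Im z)) as [Hp|Hn]; apply Ceq; cbn [Re Im fst snd].
  - fold (Re z) (Im z). rewrite Co. field. lra.
  - fold (Re z) (Im z). rewrite S, Rabs_right by lra. field. lra.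
  - rewrite cos_neg, Co. fold (Re z). field. lra.
  - rewrite sin_neg, S, Rabs_left by lra. fold (Im z). field. lra.
Qed.

Lemma lim_sup_eventually (f : R -> R) (q : R) : Rbar_lt (LimSup_p_infty f) q ->
  exists q' r, q' < q /\ forall x, r < x -> f x <= q'.
Proof.
  intros H. unfold LimSup_p_infty in H.
  set (S := fun y : Rbar => exists r : R, y = Lub_Rbar (fun v : R => exists x : R, r < x /\ v = f x)) in *.
  assert (G2 := proj2 (proj2_sig (Rbar_ex_glb S))).
  assert (Ex : exists y, S y /\ Rbar_lt y q).
  { apply NNPP. intros N. assert (Hle : Rbar_le q (Rbar_glb S)).
    { apply G2. intros y Hy. apply Rbar_not_lt_le. intros Hlt. apply N. exists y; auto. }
    apply Rbar_le_not_lt in Hle. auto. }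
  destruct Ex as [y [[r Hr] Hy]].
  assert (Lc := Lub_Rbar_correct (fun v : R => exists x : R, r < x /\ v = f x)). rewrite <- Hr in Lc.
  destruct Lc as [Lc _].
  assert (B : forall x, r < x -> Rbar_le (f x) y). { intros x Hx. apply Lc. exists x; auto. }
  destruct y as [y| |].
  - exists y, r. split. exact Hy. intros x Hx. exact (B x Hx).
  - destruct Hy.
  - exfalso. exact (B (r + 1) ltac:(lra)).
Qed.

(** On the line Re s = m - cp the exponential in the denominator has argument 2 PI cp up to sign,
    which keeps it away from 1 even at t = 0. The bound cp <= 1/4 makes the sine of this angle
    positive, and periodicity makes the constant independent of m. *)
Lemma kern_line (cp : R) : 0 < cp <= 1/4 -> exists Ck, 0 < Ck /\ forall (m : nat) sg t, sign sg -> 0 <= t ->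
  Cmod (kern sg (INR m - cp, sg * t)) <= Ck * exp (- (2 * PI * t)).
Proof.
  intros Hc. assert (HPI := PI_RGT_0).
  assert (Hs : 0 < sin (2 * PI * cp)). { assert (PI * cp <= PI * (1/4)) by nra. assert (0 < PI * cp) by (apply Rmult_lt_0_compat; lra). apply sin_gt_0; lra. }
  exists (/ sin (2 * PI * cp)). split. apply Rinv_0_lt_compat; auto.
  intros m sg t Hsg Ht. set (s := (INR m - cp, sg * t)).
  assert (K : exp (2 * PI * t) * sin (2 * PI * cp) <= Cmod (kden sg s)).
  { apply Rle_trans with (Rabs (Im (kden sg s))); [|apply im_le].
    unfold kden. rewrite kden_exponent. unfold Cexp, s. cbn [Re Im fst snd]. rewrite Im_minus. cbn [Im snd].
    change (Im 1) with 0. rewrite Rminus_0_r.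
    replace (2 * PI * sg * (sg * t)) with (2 * PI * t) by (destruct Hsg as [-> | ->]; ring).
    replace (- (2 * PI * sg * (INR m - cp))) with (sg * (2 * PI * cp - 2 * INR m * PI)) by ring.
    rewrite (sin_sign sg) by auto.
    replace (sin (2 * PI * cp - 2 * INR m * PI)) with (sin (2 * PI * cp)).
    2:{ rewrite <- (sin_period (2 * PI * cp - 2 * INR m * PI) m). f_equal. ring. }
    assert (He := exp_pos (2 * PI * t)).
    rewrite !Rabs_mult. replace (Rabs sg) with 1 by (symmetry; destruct Hsg as [-> | ->]; [apply Rabs_right|rewrite Rabs_left]; lra).
    rewrite (Rabs_right (exp _)), (Rabs_right (sin _)) by lra. nra. }
  assert (He := exp_pos (2 * PI * t)).
  assert (Hpos : 0 < exp (2 * PI * t) * sin (2 * PI * cp)) by nra.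
  unfold kern. rewrite Cmod_inv.
  2:{ intros E. rewrite E, Cmod_0 in K. lra. }
  rewrite exp_Ropp. rewrite <- Rinv_mult. apply Rinv_le_contravar. nra. lra.
Qed.

Lemma Cpow_Cexp (w : C) (n : nat) : Cpow (Cexp w) n = Cexp (INR n * w).
Proof.
  induction n.
  - simpl. replace (0 * w)%C with (RtoC 0) by ring. rewrite Cexp_0. auto.
  - rewrite S_INR. replace (RtoC (INR n + 1) * w)%C with (w + INR n * w)%C by (rewrite RtoC_plus; ring).
    rewrite Cexp_plus, <- IHn. reflexivity.
Qed.

(** * The size of the main term *)

Section Height.
Context (a0 : R) (Ps Ep Ep' : C -> C) (La e e' : R -> R) (Fr : frame a0 Ps Ep Ep' La e e').

(** The right side is s eps(s) = s^2 L'(s) / L(s), the exponent in the theorem. *)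
Lemma hz_saddle (w : C) : hz Ps (Ph Ps Ep w) w = (Cexp w * Ep w)%C.
Proof using. unfold hz, Ph. ring. Qed.

Lemma saddle_height (eta : R) : 0 < eta -> exists X, forall p th, X <= p -> Rabs th <= B0 a0 ->
  Rabs (Re (hz Ps (Ph Ps Ep (p, th)) (p, th)) - cos th * (exp p * e p)) <= eta * (exp p * e p).
Proof using Fr.
  intros He. assert (HB := B0_bounds _ _ _ _ _ _ _ Fr).
  destruct (fr_uniform _ _ _ _ _ _ _ Fr (a0 - B0 a0) eta ltac:(lra) He) as [X HX].
  exists X. intros p th Hp Hth. specialize (HX p th Hp ltac:(lra)). rewrite hz_saddle.
  replace (Re (Cexp (p, th) * Ep (p, th)) - cos th * (exp p * e p))
    with (Re (Cexp (p, th) * (Ep (p, th) - e p))%C).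
  2:{ rewrite Re_mult, Re_minus, Im_minus, Re_mult, Re_RtoC, Im_RtoC. unfold Cexp. cbn [Re Im fst snd]. ring. }
  eapply Rle_trans. apply re_le. rewrite Cmod_mult, Cmod_Cexp. cbn [Re fst].
  assert (Hp0 := exp_pos p). nra.
Qed.

Lemma Ph_real_bounds : exists X, forall p th, X <= p -> Rabs th <= B0 a0 ->
  La p <= Re (Ph Ps Ep (p, th)) <= La p + 2 * e p.
Proof using Fr.
  destruct (Ph_vertical _ _ _ _ _ _ _ Fr 1 Rlt_0_1) as [X HX]. exists X. intros p th Hp Hth.
  specialize (HX p th Hp Hth). assert (H := re_le (Ph Ps Ep (p, th) - ((La p + e p)%R, (th * e p)%R))%C).
  rewrite Re_minus in H. cbn [Re fst] in H. apply Rabs_le_between in H. unfold Re at 1 2. unfold Re in H. lra.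
Qed.

(** Here cos th < 0, so the main term is itself o(1), although such saddles still belong to points
    of [Omega]. *)
Lemma amplitude_small (d eta : R) : 0 < d < PI / 2 -> 0 < eta -> exists X, forall p th, X <= p ->
  Rabs th <= B0 a0 -> PI / 2 + d <= Rabs th -> Rabs th <= PI ->
  Cmod (amplitude Ps (Ph Ps Ep (p, th)) p th) / rootN e p <= eta.
Proof using Fr.
  intros Hd Heta. assert (Hs : 0 < sin d) by (apply sin_gt_0; lra).
  destruct (saddle_height (sin d / 2)) as [X1 H1]. lra.
  destruct (growth_linear _ _ _ _ _ _ _ Fr (sin d / 4) 1) as [K [X2 [_ H2]]]. lra.
  destruct (N_large _ _ _ _ _ _ _ Fr ((K - ln eta) / (sin d / 4))) as [X3 H3].
  destruct (rootN_large _ _ _ _ _ _ _ Fr 1) as [X4 H4].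
  exists (Rmax (Rmax X1 X2) (Rmax X3 X4)). intros p th Hp Hth1 Hth2 Hth3.
  assert (Q1 := Rmax_l (Rmax X1 X2) (Rmax X3 X4)). assert (Q2 := Rmax_r (Rmax X1 X2) (Rmax X3 X4)).
  assert (Q3 := Rmax_l X1 X2). assert (Q4 := Rmax_r X1 X2). assert (Q5 := Rmax_l X3 X4). assert (Q6 := Rmax_r X3 X4).
  specialize (H1 p th ltac:(lra) Hth1). specialize (H2 p ltac:(lra)). specialize (H3 p ltac:(lra)).
  specialize (H4 p ltac:(lra)). set (N := exp p * e p) in *.
  assert (HN : 0 < N). { apply Rmult_lt_0_compat. apply exp_pos. apply (fr_pos _ _ _ _ _ _ _ Fr). }
  assert (Hc : cos th <= - sin d).
  { rewrite <- cos_PI2_plus. replace (cos th) with (cos (Rabs th)).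
    2:{ destruct (Rcase_abs th); [rewrite Rabs_left, cos_neg | rewrite Rabs_right]; auto. }
    apply cos_decr_1; lra. }
  assert (H3' : K - ln eta <= N * (sin d / 4)).
  { apply Rmult_le_compat_r with (r := sin d / 4) in H3; [|lra]. unfold Rdiv in H3 at 1.
    rewrite Rmult_assoc, Rinv_l in H3 by lra. lra. }
  unfold amplitude. rewrite Cmod_Cexp, Re_plus. cbn [Re fst]. set (h := Re (hz Ps (Ph Ps Ep (p, th)) (p, th))) in *.
  apply Rabs_le_between in H1.
  assert (Hh : p + h <= ln eta). { assert (cos th * N <= - sin d * N) by (apply Rmult_le_compat_r; lra). nra. }
  apply exp_le_compat in Hh. rewrite exp_ln in Hh by auto.
  apply Rmult_le_reg_r with (rootN e p). lra. unfold Rdiv. rewrite Rmult_assoc, Rinv_l by lra.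
  unfold h, Re in *. nra.
Qed.

(** The left side is a fixed power of |z|, hence at most exponential in p, whereas the logarithm of
    the amplitude is at least a multiple of exp p * e p, which grows exponentially. *)
Lemma amplitude_large (d A B eta : R) : 0 < d < PI / 2 -> 0 < A -> 0 < B -> 0 < eta -> exists X, forall p th, X <= p ->
  Rabs th <= PI / 2 - d ->
  B * exp (A * Re (Ph Ps Ep (p, th))) <= eta * (Cmod (amplitude Ps (Ph Ps Ep (p, th)) p th) / rootN e p).
Proof using Fr.
  intros Hd HA HB Heta. assert (Hs : 0 < sin d) by (apply sin_gt_0; lra).
  assert (HB0 := B0_bounds _ _ _ _ _ _ _ Fr). assert (HPI := PI_RGT_0).
  destruct (La_upper _ _ _ _ _ _ _ Fr) as [M [HM QM]].
  destruct (saddle_height (sin d / 2)) as [X1 H1]. lra.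
  destruct (growth_linear _ _ _ _ _ _ _ Fr (sin d / 4) (A * M)) as [K [X2 [HX2 H2]]]. lra.
  set (c1 := K + A * (La 0 + 2 * M) + ln (B * (1 + M) / eta)).
  destruct (N_large _ _ _ _ _ _ _ Fr (c1 / (sin d / 4))) as [X3 H3].
  destruct Ph_real_bounds as [X4 H4].
  exists (Rmax (Rmax X1 X2) (Rmax X3 X4)). intros p th Hp Hth.
  assert (Q1 := Rmax_l (Rmax X1 X2) (Rmax X3 X4)). assert (Q2 := Rmax_r (Rmax X1 X2) (Rmax X3 X4)).
  assert (Q3 := Rmax_l X1 X2). assert (Q4 := Rmax_r X1 X2). assert (Q5 := Rmax_l X3 X4). assert (Q6 := Rmax_r X3 X4).
  specialize (H1 p th ltac:(lra) ltac:(lra)). specialize (H2 p ltac:(lra)). specialize (H3 p ltac:(lra)).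
  specialize (H4 p th ltac:(lra) ltac:(lra)). destruct (QM p ltac:(lra)) as [QM1 QM2].
  set (N := exp p * e p) in *.
  assert (Hep := fr_pos _ _ _ _ _ _ _ Fr p).
  assert (HN : 0 < N). { apply Rmult_lt_0_compat. apply exp_pos. auto. }
  assert (Hc : sin d <= cos th).
  { rewrite <- cos_shift. replace (cos th) with (cos (Rabs th)).
    2:{ destruct (Rcase_abs th); [rewrite Rabs_left, cos_neg | rewrite Rabs_right]; auto. }
    assert (Hp0 := Rabs_pos th). apply cos_decr_1; lra. }
  assert (H3' : c1 <= N * (sin d / 4)).
  { apply Rmult_le_compat_r with (r := sin d / 4) in H3; [|lra]. unfold Rdiv in H3 at 1.
    rewrite Rmult_assoc, Rinv_l in H3 by lra. lra. }
  assert (HrN : rootN e p <= exp p * (1 + M)).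
  { destruct (rootN_pos _ _ _ _ _ _ _ Fr p) as [R1 R2]. assert (E1 : 1 <= exp p).
    { rewrite <- exp_0. apply exp_le_compat. lra. }
    apply Rsqr_incr_0_var; [|nra]. unfold Rsqr. rewrite R2.
    assert (exp p * e p <= exp p * M) by (apply Rmult_le_compat_l; lra).
    assert (exp p * M <= exp p * (1 + M) * 1) by nra.
    assert (exp p * (1 + M) * 1 <= exp p * (1 + M) * (exp p * (1 + M))) by (apply Rmult_le_compat_l; nra). lra. }
  unfold amplitude. rewrite Cmod_Cexp, Re_plus.
  set (h := Re (hz Ps (Ph Ps Ep (p, th)) (p, th))) in *. set (r := Re (Ph Ps Ep (p, th))) in *.
  change (Re (p, th)) with p.
  apply Rabs_le_between in H1. rewrite exp_plus.
  assert (Hh : A * r + ln (B * (1 + M) / eta) <= h).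
  { assert (sin d * N <= cos th * N) by (apply Rmult_le_compat_r; lra).
    assert (A * r <= A * (La 0 + M * p + 2 * M)) by (apply Rmult_le_compat_l; lra). unfold c1 in H3'. nra. }
  apply exp_le_compat in Hh. rewrite exp_plus, exp_ln in Hh by (apply Rdiv_lt_0_compat; nra).
  apply Rle_trans with (eta * (exp h / (1 + M))).
  - apply Rmult_le_compat_l with (r := eta / (1 + M)) in Hh; [|apply Rlt_le, Rdiv_lt_0_compat; lra].
    replace (eta / (1 + M) * (exp (A * r) * (B * (1 + M) / eta))) with (B * exp (A * r)) in Hh by (field; lra).
    replace (eta * (exp h / (1 + M))) with (eta / (1 + M) * exp h) by (field; lra). lra.
  - apply Rmult_le_compat_l. lra. destruct (rootN_pos _ _ _ _ _ _ _ Fr p) as [R1 R2].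
    assert (Hp1 := exp_pos p). assert (Hh1 := exp_pos h).
    apply Rmult_le_reg_r with (rootN e p * (1 + M)). nra.
    replace (exp h / (1 + M) * (rootN e p * (1 + M))) with (exp h * rootN e p) by (field; lra).
    replace (exp p * exp h / rootN e p * (rootN e p * (1 + M))) with (exp h * (exp p * (1 + M))) by (field; lra).
    apply Rmult_le_compat_l; lra.
Qed.

Lemma saddle_abscissa (X : R) : exists Xi, forall xi, Xi <= xi -> exists p, X <= p /\ La p + e p = xi.
Proof using Fr.
  exists (La X + e X). intros xi Hxi. destruct (fr_div _ _ _ _ _ _ _ Fr xi) as [Y HY].
  set (b := Rmax X Y). assert (Hb1 := Rmax_l X Y). assert (Hb2 := Rmax_r X Y). fold b in Hb1, Hb2.
  assert (Hxb := HY b Hb2). assert (Heb := fr_pos _ _ _ _ _ _ _ Fr b).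
  destruct (IVT_gen (fun x => La x + e x) X b xi) as [p [Hp Hv]].
  - intros x. apply derivable_continuous_pt. apply ex_derive_Reals_0. exists (e x + e' x).
    apply (is_derive_plus La e); [apply (La_derive _ _ _ _ _ _ _ Fr) | apply (e_derive _ _ _ _ _ _ _ Fr)].
  - split. eapply Rle_trans. apply Rmin_l. auto. eapply Rle_trans; [|apply Rmax_r]. lra.
  - exists p. rewrite Rmin_left in Hp by auto. split. lra. auto.
Qed.
Lemma Cmod_leading (zeta : C) (p th : R) :
  Cmod (leading Ps e zeta p th) = sqrt (2 * PI) * (Cmod (amplitude Ps zeta p th) / rootN e p).
Proof using Fr.
  assert (HPI := PI_RGT_0). destruct (rootN_pos _ _ _ _ _ _ _ Fr p) as [HrN _].
  assert (Hs2 : 0 < sqrt (2 * PI)) by (apply sqrt_lt_R0; lra).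
  unfold leading. rewrite !Cmod_mult, Cmod_inv, Cmod_R, Cmod_Cexp.
  2:{ intros E0. apply (f_equal Re) in E0. rewrite !Re_RtoC in E0. lra. }
  replace (Re (- (Ci * (th / 2)%R))) with 0 by (rewrite Re_opp, Re_mult, Re_RtoC, Im_RtoC; simpl; ring).
  rewrite exp_0, Rmult_1_r, Cmod_R, (Rabs_right (rootN e p)), (Rabs_right (sqrt _)) by lra. unfold Rdiv. ring.
Qed.
End Height.

(** * Growth of the summand on vertical lines *)

Section HalfPlane.
Context (alpha0 c : R) (halpha0 : PI / 2 < alpha0 <= PI) (hc : 0 < c).
Context (lg phi Ps Ep Ep' : C -> C) (La e e' : R -> R) (Fr : frame alpha0 Ps Ep Ep' La e e').
Context (Dlg : forall s, wedge alpha0 c s -> cder lg s (phi s)).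
Context (Sphi : forall n, smooth n (wedge alpha0 c) phi).
Context (HPs : forall w, Ps w = (lg (Cexp w) * Cexp (- w))%C).
Context (q X0 cp : R) (Hq : 0 < q < 2) (He : forall x, X0 <= x -> e x <= q).
Context (Hcp : 0 < cp <= 1/4) (Hcpc : cp < c).
(** Against the kernel there remains the decay exp(-(PI - q PI / 2) t) = exp(- PI kappa t) on
    vertical lines. Of this rate 2 kappa is kept after the errors of [half_plane_bound], and one
    kappa is later spent on the growth of log L on the line Re s = - cp. *)
Let kappa := (2 - q) / 2.

Lemma hz_Clog (zeta s : C) : s <> 0%C -> hz Ps zeta (Clog s) = (s * zeta - lg s)%C.
Proof using HPs.
  intros Hs. unfold hz. rewrite HPs. rewrite (Cexp_Clog s Hs) at 1. rewrite (Cexp_Clog s Hs).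
  rewrite Cexp_opp, (Cexp_Clog s Hs). field. auto.
Qed.

(** [Re_hz] at zeta = 0: Re log gamma(s) is about x La(ln |s|) - Im s * arg s * eps, and |arg s| is
    at most PI/2 + eta when Re s >= - cp and |s| is large. *)
Lemma half_plane_bound : exists R1, 1 <= R1 /\ forall x sg t, sign sg -> - cp <= x -> 0 <= t ->
  R1 <= Cmod (x, sg * t) ->
  - Re (lg (x, sg * t)) <= - x * La (ln (Cmod (x, sg * t))) + (PI - 2 * kappa) * t + Rabs x.
Proof using halpha0 Fr HPs Hq He Hcp.
  clear Dlg Sphi.
  assert (HPI := PI_RGT_0). assert (H32 := PI2_3_2).
  (* The first bound keeps the loss 2 eta q below (PI - 2) kappa, the second keeps eta q below 1,
     and the third keeps the angle PI/2 + eta within [B0]. *)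
  set (eta := Rmin ((2 - q) / 16) (Rmin (1/2) ((alpha0 - PI / 2) / 2))).
  assert (Heta : 0 < eta /\ eta <= (2 - q) / 16 /\ eta <= 1/2 /\ eta <= (alpha0 - PI / 2) / 2).
  { unfold eta. assert (A1 := Rmin_l ((2 - q) / 16) (Rmin (1/2) ((alpha0 - PI / 2) / 2))).
    assert (A2 := Rmin_r ((2 - q) / 16) (Rmin (1/2) ((alpha0 - PI / 2) / 2))).
    assert (A3 := Rmin_l (1/2) ((alpha0 - PI / 2) / 2)). assert (A4 := Rmin_r (1/2) ((alpha0 - PI / 2) / 2)).
    repeat split; try lra. repeat apply Rmin_glb_lt; lra. }
  destruct Heta as [E0 [E1 [E2 E3]]].
  assert (Hsin : 0 < sin eta) by (apply sin_gt_0; lra).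
  destruct (Re_hz _ _ _ _ _ _ _ Fr eta E0) as [X HX].
  set (Y := Rmax 0 (Rmax X X0)).
  assert (Y1 := Rmax_l 0 (Rmax X X0)). assert (Y2 := Rmax_r 0 (Rmax X X0)).
  assert (Y3 := Rmax_l X X0). assert (Y4 := Rmax_r X X0). fold Y in Y1, Y2.
  exists (Rmax (exp Y) (/ sin eta)). split.
  { apply Rle_trans with (exp Y); [|apply Rmax_l]. rewrite <- exp_0. apply exp_le_compat. lra. }
  intros x sg t Hsg Hx Ht Hm. set (s := ((x, sg * t) : C)) in *.
  assert (M1 := Rle_trans _ _ _ (Rmax_l _ _) Hm). assert (M2 := Rle_trans _ _ _ (Rmax_r _ _) Hm).
  assert (Hpos := exp_pos Y). assert (Hs0 : s <> 0%C). { intros Eq. rewrite Eq, Cmod_0 in M1. lra. }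
  assert (M3 : 1 <= Cmod s * sin eta).
  { apply Rmult_le_compat_r with (r := sin eta) in M2; [|lra]. rewrite Rinv_l in M2; lra. }
  assert (HB : Rabs (Carg s) < PI / 2 + eta).
  { apply Rabs_Carg_lt; auto. lra. rewrite cos_PI2_plus. unfold s at 2. cbn [Re fst]. lra. }
  assert (HL : Y <= ln (Cmod s)).
  { rewrite <- (ln_exp Y). apply ln_le; auto. }
  assert (HR := HX 0%C (ln (Cmod s)) (Carg s) ltac:(lra) ltac:(unfold B0; lra)).
  change (ln (Cmod s), Carg s) with (Clog s) in HR. rewrite hz_Clog in HR by auto.
  rewrite exp_ln in HR by lra.
  assert (CE := Cexp_Clog s Hs0). unfold Cexp, Clog in CE. cbn [Re Im fst snd] in CE. rewrite exp_ln in CE by lra.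
  assert (CR : Cmod s * cos (Carg s) = x) by exact (f_equal fst CE).
  assert (CI : Cmod s * sin (Carg s) = sg * t) by exact (f_equal snd CE).
  replace (s * 0 - lg s)%C with (- lg s)%C in HR by ring. rewrite Re_opp, Re_RtoC, Im_RtoC in HR.
  assert (He1 := He (ln (Cmod s)) ltac:(lra)). assert (He0 := fr_pos _ _ _ _ _ _ _ Fr (ln (Cmod s))).
  set (lam := La (ln (Cmod s))) in *. set (ee := e (ln (Cmod s))) in *.
  replace (Cmod s * (cos (Carg s) * (0 - lam) - sin (Carg s) * (0 - Carg s * ee) + eta * ee))
    with (- (Cmod s * cos (Carg s)) * lam + (Cmod s * sin (Carg s)) * Carg s * ee + eta * ee * Cmod s) in HR by ring.
  rewrite CR, CI in HR.
  assert (T1 : sg * t * Carg s <= t * (PI / 2 + eta)).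
  { apply Rabs_lt_between in HB. destruct Hsg as [-> | ->]; nra. }
  assert (T2 : Cmod s <= Rabs x + t).
  { replace (Rabs x + t) with (Rabs (Re s) + Rabs (Im s)). apply Cmod_le_abs. unfold s. cbn [Re Im fst snd].
    f_equal. destruct Hsg as [-> | ->]; [rewrite Rabs_right | rewrite Rabs_left1]; lra. }
  assert (T3 : sg * t * Carg s * ee <= t * (PI / 2 + eta) * q).
  { apply Rle_trans with (t * (PI / 2 + eta) * ee). apply Rmult_le_compat_r; lra.
    apply Rmult_le_compat_l; auto. apply Rmult_le_pos; lra. }
  assert (T4 : eta * ee * Cmod s <= eta * q * (Rabs x + t)).
  { assert (Hc0 := Cmod_ge_0 s). apply Rmult_le_compat; auto. nra. apply Rmult_le_compat_l; lra. }
  assert (Hax := Rabs_pos x). unfold kappa.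
  assert (T5 : eta * q * Rabs x <= Rabs x).
  { assert (eta * q <= 1) by nra. nra. }
  assert (T6 : t * ((PI / 2 + eta) * q + eta * q) <= t * (PI - 2 * ((2 - q) / 2))).
  { apply Rmult_le_compat_l; auto. assert (eta * q <= (2 - q) / 16 * 2) by nra. nra. }
  nra.
Qed.

Lemma La_log_bound (k : R) : 0 < k -> exists K, 0 <= K /\ forall r, 1 <= r -> La (ln r) <= K + k * r.
Proof using Fr.
  intros Hk. destruct (La_upper _ _ _ _ _ _ _ Fr) as [M [HM Q]].
  set (K := La 0 + M * (- ln (k / M))).
  exists (Rmax 0 K). split. apply Rmax_l. intros r Hr.
  assert (L0 : 0 <= ln r). { rewrite <- ln_1. apply ln_le; lra. }
  destruct (Q (ln r) L0) as [Q1 _].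
  assert (HkM : 0 < k / M) by (apply Rdiv_lt_0_compat; auto).
  assert (L1 : ln r <= k / M * r - ln (k / M)).
  { assert (E := exp_ineq1_le (ln (k / M * r))). rewrite exp_ln in E by nra.
    rewrite ln_mult in E by lra. lra. }
  assert (L2 : M * ln r <= k * r + M * (- ln (k / M))).
  { apply Rmult_le_compat_l with (r := M) in L1; [|lra]. replace (k * r) with (M * (k / M * r)) by (field; lra). lra. }
  assert (K1 := Rmax_r 0 K). unfold K in K1 at 1. lra.
Qed.

(** z^s / gamma(s) on the principal branch, as zeta will be [Clog z]. *)
Definition summand (zeta s : C) : C := Cexp (s * zeta - lg s)%C.

Lemma summand_smooth (n : nat) (zeta : C) : smooth (S n) (wedge alpha0 c) (summand zeta).
Proof using Dlg Sphi.
  clear Fr He. unfold summand. apply smooth_comp with (fun _ => True); auto. apply smooth_Cexp.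
  apply smooth_minus. apply smooth_mult. apply smooth_id. apply smooth_const.
  exists phi. split; auto.
Qed.

Lemma summand_bound (zeta : C) (x sg t : R) : sign sg -> 0 <= t -> Rabs (Im zeta) <= PI ->
  Cmod (summand zeta (x, sg * t)) <= exp (x * Re zeta + PI * t - Re (lg (x, sg * t))).
Proof using.
  intros Hsg Ht Hz. unfold summand. rewrite Cmod_Cexp. apply exp_le_compat.
  rewrite Re_minus, Re_mult. cbn [Re Im fst snd]. fold (Re zeta) (Im zeta). apply Rabs_le_between in Hz.
  destruct Hsg as [-> | ->]; nra.
Qed.

(** Left of 0 the term - x La(ln |s|) of [half_plane_bound] has the wrong sign, but since e is
    bounded it is logarithmic in t and costs no more than one kappa. Small t are covered by
    compactness. *)
Lemma vertical_line_bound : exists M0, forall sg t, sign sg -> 0 <= t ->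
  - Re (lg (- cp, sg * t)) <= M0 + (PI - kappa) * t.
Proof using halpha0 Fr HPs Hq He Hcp Dlg Hcpc.
  assert (HPI := PI_RGT_0). assert (H32 := PI2_3_2).
  destruct half_plane_bound as [R1 [HR1 Q]].
  assert (Hk : 0 < kappa < 1) by (unfold kappa; lra).
  destruct (La_log_bound kappa) as [K [HK QK]]. lra.
  assert (BC : forall sg, exists M, forall t, 0 <= t <= R1 -> - Re (lg (- cp, sg * t)) <= M).
  { intros sg. apply (bounded_on_curve (fun s => - Re (lg s)) lg (fun t => (- cp, sg * t))).
    - intros s. rewrite Rabs_Ropp. apply re_le.
    - intros t Ht. split.
      + apply (der_cont _ _ _ (phi (- cp, sg * t))), Dlg. apply wedge_halfplane; auto. cbn [Re fst]. lra.
      + eapply (der_cont _ _ _ (0, sg)). eapply der_ext; [|apply (rder_affine (- cp, 0) (0, sg) t)].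
        intros h. apply Ceq; simpl; ring. }
  destruct (BC 1) as [M1 HM1]. destruct (BC (-1)) as [M2 HM2].
  exists (Rmax (K + 2) (Rmax M1 M2)).
  assert (X1 := Rmax_l (K + 2) (Rmax M1 M2)). assert (X2 := Rmax_r (K + 2) (Rmax M1 M2)).
  assert (X3 := Rmax_l M1 M2). assert (X4 := Rmax_r M1 M2).
  intros sg t Hsg Ht. destruct (Rle_dec R1 t) as [Hl|Hl].
  - set (s := ((- cp, sg * t) : C)).
    assert (At : Rabs (sg * t) = t). { destruct Hsg as [-> | ->]; [rewrite Rabs_right | rewrite Rabs_left1]; lra. }
    assert (S1 : t <= Cmod s). { rewrite <- At. apply (im_le s). }
    assert (S2 : Cmod s <= cp + t).
    { eapply Rle_trans. apply Cmod_le_abs. unfold s. cbn [Re Im fst snd]. rewrite At, Rabs_left1; lra. }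
    assert (B := Q (- cp) sg t Hsg ltac:(lra) Ht ltac:(fold s; lra)). fold s in B.
    assert (L := QK (Cmod s) ltac:(lra)). rewrite Rabs_left1 in B by lra. fold s.
    assert (cp * La (ln (Cmod s)) <= cp * (K + kappa * (cp + t))). { apply Rmult_le_compat_l. lra. nra. }
    assert (cp * (K + kappa * (cp + t)) <= 1 * (K + kappa * (cp + t))). { apply Rmult_le_compat_r. nra. lra. }
    assert (kappa * cp <= 1) by nra. nra.
  - assert (0 <= (PI - kappa) * t) by (apply Rmult_le_pos; lra).
    destruct Hsg as [-> | ->]. specialize (HM1 t ltac:(lra)). lra. specialize (HM2 t ltac:(lra)). lra.
Qed.

(** The factor exp(- cp * Re zeta) = |z|^(-cp) is the reason for placing the first line to the left
    of 0: it makes this contribution o(1). *)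
Lemma left_line : exists A0, 0 <= A0 /\ forall zeta sg t, sign sg -> 0 <= t -> Rabs (Im zeta) <= PI ->
  Cmod (summand zeta (- cp, sg * t) * kern sg (- cp, sg * t)) <=
    A0 * exp (- cp * Re zeta) * exp (- kappa * t).
Proof using halpha0 Fr HPs Hq He Hcp Dlg Hcpc.
  destruct vertical_line_bound as [M0 HM]. destruct (kern_line cp Hcp) as [Ck [HC QC]].
  exists (Ck * exp M0). split. assert (Hp := exp_pos M0). nra.
  intros zeta sg t Hsg Ht Hz. rewrite Cmod_mult.
  assert (B1 := summand_bound zeta (- cp) sg t Hsg Ht Hz).
  assert (B2 := QC O sg t Hsg Ht). simpl INR in B2. rewrite Rminus_0_l in B2.
  assert (B3 := HM sg t Hsg Ht).
  apply Rle_trans with (exp (- cp * Re zeta + PI * t + M0 + (PI - kappa) * t) * (Ck * exp (- (2 * PI * t)))).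
  - apply Rmult_le_compat; auto; try apply Cmod_ge_0. eapply Rle_trans. exact B1. apply exp_le_compat. lra.
  - right. replace (exp (- cp * Re zeta + PI * t + M0 + (PI - kappa) * t) * (Ck * exp (- (2 * PI * t))))
      with (Ck * (exp (- cp * Re zeta + PI * t + M0 + (PI - kappa) * t) * exp (- (2 * PI * t)))) by ring.
    replace (Ck * exp M0 * exp (- cp * Re zeta) * exp (- kappa * t))
      with (Ck * (exp M0 * exp (- cp * Re zeta) * exp (- kappa * t))) by ring.
    rewrite <- !exp_plus. f_equal. f_equal. ring.
Qed.

(** For zeta bounded above, log L exceeds Re zeta + 2 far out, which gives the decay exp(-Re s) as N
    tends to infinity. *)
Lemma right_line : exists Ck, 0 <= Ck /\ forall xi, exists N0, forall (N : nat) zeta sg t, (N0 <= N)%nat ->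
  sign sg -> 0 <= t -> Rabs (Im zeta) <= PI -> Re zeta <= xi ->
  Cmod (summand zeta (INR N - cp, sg * t)) <= exp (- (INR N - cp)) * exp (PI * t) * exp ((PI - 2 * kappa) * t) /\
  Cmod (summand zeta (INR N - cp, sg * t) * kern sg (INR N - cp, sg * t)) <=
    Ck * exp (- (INR N - cp)) * exp (- kappa * t).
Proof using halpha0 Fr HPs Hq He Hcp.
  destruct half_plane_bound as [R1 [HR1 Q]]. destruct (kern_line cp Hcp) as [Ck [HC QC]].
  exists Ck. split. lra. intros xi. destruct (fr_div _ _ _ _ _ _ _ Fr (xi + 2)) as [X HX].
  destruct (INR_unbounded (R1 + exp X + 1)) as [N0 HN0]. exists N0.
  intros N zeta sg t HN Hsg Ht Hz Hxi. apply le_INR in HN. assert (Hp := exp_pos X).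
  set (x := INR N - cp). assert (Hx : R1 + exp X <= x) by (unfold x; lra).
  set (s := ((x, sg * t) : C)).
  assert (S1 : x <= Cmod s). { eapply Rle_trans. apply (Rle_abs x). apply (re_le s). }
  assert (HL : X <= ln (Cmod s)). { rewrite <- (ln_exp X). apply ln_le; auto. lra. }
  assert (Hla := HX _ HL).
  assert (B := Q x sg t Hsg ltac:(lra) Ht ltac:(fold s; lra)). fold s in B. rewrite Rabs_right in B by lra.
  assert (B1 := summand_bound zeta x sg t Hsg Ht Hz). fold s in B1. fold s.
  assert (B4 : Cmod (summand zeta s) <= exp (- x) * exp (PI * t) * exp ((PI - 2 * kappa) * t)).
  { rewrite <- !exp_plus. eapply Rle_trans. exact B1. apply exp_le_compat.
    assert (x * (xi + 2) <= x * La (ln (Cmod s))) by (apply Rmult_le_compat_l; lra).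
    assert (x * Re zeta <= x * xi) by (apply Rmult_le_compat_l; lra). lra. }
  split. exact B4.
  rewrite Cmod_mult. assert (B2 := QC N sg t Hsg Ht). fold x s in B2.
  eapply Rle_trans.
  { apply Rmult_le_compat; [apply Cmod_ge_0 | apply Cmod_ge_0 | exact B4 | exact B2]. }
  rewrite <- !exp_plus, <- Rmult_assoc, (Rmult_comm _ Ck), !Rmult_assoc, <- !exp_plus.
  apply Rmult_le_compat_l. lra. apply exp_le_compat. assert (0 < kappa) by (unfold kappa; lra). nra.
Qed.

Lemma top_side (zeta : C) (m : nat) (eta : R) : Rabs (Im zeta) <= PI -> 0 < eta -> exists M0, forall M sg x,
  M0 <= M -> sign sg -> INR m - cp <= x <= INR m + 1 - cp ->
  Cmod (summand zeta (x, sg * M) * kern sg (x, sg * M)) <= eta.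
Proof using halpha0 Fr HPs Hq He Hcp.
  assert (HPI := PI_RGT_0). assert (H32 := PI2_3_2).
  intros Hz Heta. destruct half_plane_bound as [R1 [HR1 Q]].
  assert (Hk : 0 < kappa < 1) by (unfold kappa; lra).
  destruct (La_log_bound kappa) as [K [HK QK]]. lra.
  destruct (fr_div _ _ _ _ _ _ _ Fr 0) as [X HX].
  set (D := INR m + 2). assert (Hm := pos_INR m).
  set (K1 := D * (Rabs (Re zeta) + 2) + K).
  set (M1 := (ln 4 + K1 - ln eta) / kappa).
  exists (Rmax (exp X) (Rmax R1 M1)). intros M sg x HM Hsg Hx.
  assert (G1 := Rmax_l (exp X) (Rmax R1 M1)). assert (G2 := Rmax_r (exp X) (Rmax R1 M1)).
  assert (G3 := Rmax_l R1 M1). assert (G4 := Rmax_r R1 M1).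
  set (s := ((x, sg * M) : C)).
  assert (At : Rabs (sg * M) = M). { destruct Hsg as [-> | ->]; [rewrite Rabs_right | rewrite Rabs_left1]; lra. }
  assert (Ax : Rabs x <= D). { apply Rabs_le. unfold D. lra. }
  assert (S1 : M <= Cmod s). { rewrite <- At. apply (im_le s). }
  assert (S2 : Cmod s <= D + M).
  { eapply Rle_trans. apply Cmod_le_abs. unfold s. cbn [Re Im fst snd]. rewrite At. lra. }
  assert (HL : X <= ln (Cmod s)). { rewrite <- (ln_exp X). apply ln_le. apply exp_pos. lra. }
  assert (B := Q x sg M Hsg ltac:(lra) ltac:(lra) ltac:(fold s; lra)). fold s in B.
  assert (L := QK (Cmod s) ltac:(lra)). assert (Hla := HX _ HL).
  assert (B1 := summand_bound zeta x sg M Hsg ltac:(lra) Hz). fold s in B1.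
  assert (B2 := kern_top sg M x Hsg ltac:(lra)). fold s in B2.
  assert (C1 : - x * La (ln (Cmod s)) <= K + kappa * (D + M)).
  { apply Rle_trans with (1 * La (ln (Cmod s))). apply Rmult_le_compat_r; lra. nra. }
  assert (C2 : x * Re zeta <= D * Rabs (Re zeta)).
  { eapply Rle_trans. apply Rle_abs. rewrite Rabs_mult. apply Rmult_le_compat_r; auto. apply Rabs_pos. }
  assert (C3 : Cmod (kern sg s) <= 4 * exp (- (2 * PI * M))).
  { eapply Rle_trans. exact B2. assert (Hp := exp_pos (- (2 * PI * M))).
    assert (/ M <= 1). { rewrite <- Rinv_1. apply Rinv_le_contravar; lra. } nra. }
  fold s. rewrite Cmod_mult.
  apply Rle_trans with (exp (2 * PI * M + (K1 - kappa * M)) * (4 * exp (- (2 * PI * M)))).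
  { apply Rmult_le_compat; auto; try apply Cmod_ge_0. eapply Rle_trans. exact B1. apply exp_le_compat.
    unfold K1. assert (kappa * D <= 1 * D) by (apply Rmult_le_compat_r; unfold D; lra). lra. }
  replace (exp (2 * PI * M + (K1 - kappa * M)) * (4 * exp (- (2 * PI * M))))
    with (4 * (exp (2 * PI * M + (K1 - kappa * M)) * exp (- (2 * PI * M)))) by ring.
  rewrite <- exp_plus. rewrite <- (exp_ln 4), <- exp_plus, <- (exp_ln eta) by lra. apply exp_le_compat.
  assert (M1 * kappa <= M * kappa) by (apply Rmult_le_compat_r; lra).
  assert (M1 * kappa = ln 4 + K1 - ln eta) by (unfold M1; field; lra). lra.
Qed.

Lemma summand_integer (zeta : C) : exists N0 : nat, forall m : nat, (N0 <= m)%nat ->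
  Cmod (summand zeta (INR m)) <= exp (- INR m).
Proof using halpha0 Fr HPs Hq He Hcp.
  clear Dlg Sphi.
  destruct half_plane_bound as [R1 [HR1 Q]].
  destruct (fr_div _ _ _ _ _ _ _ Fr (Re zeta + 2)) as [X HX].
  destruct (INR_unbounded (R1 + exp X)) as [N0 HN0]. exists N0. intros m Hm. apply le_INR in Hm.
  assert (Hp := exp_pos X).
  assert (E0 : (INR m, 1 * 0) = RtoC (INR m)) by (unfold RtoC; f_equal; ring).
  assert (Em : Cmod (INR m, 1 * 0) = INR m). { rewrite E0, Cmod_RtoC_pos; auto. lra. }
  assert (B := Q (INR m) 1 0 (or_introl eq_refl) ltac:(lra) ltac:(lra) ltac:(rewrite Em; lra)).
  rewrite Em, E0, Rabs_right in B by lra.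
  assert (HL : X <= ln (INR m)). { rewrite <- (ln_exp X). apply ln_le; auto. lra. }
  assert (Hla := HX _ HL).
  unfold summand. rewrite Cmod_Cexp. apply exp_le_compat. rewrite Re_minus, Re_mult, Re_RtoC, Im_RtoC.
  assert (INR m * (Re zeta + 2) <= INR m * La (ln (INR m))) by (apply Rmult_le_compat_l; lra). lra.
Qed.

(** * The series and its comparison with a primitive *)

Context (gamma : C -> C) (Hgam : forall s, wedge alpha0 c s -> Cexp (lg s) = gamma s).

Lemma series_sum (z : C) : z <> 0%C ->
  cser (fun m => summand (Clog z) (INR m)) (z * E gamma z + 1 / gamma (RtoC 0))%C.
Proof using halpha0 hc Fr HPs Hq He Hcp Hcpc Hgam.
  clear Dlg Sphi.
  intros Hz. set (zeta := Clog z). set (f := fun m : nat => summand zeta (INR m)).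
  assert (F1 : forall n, f n = (Cpow z n / gamma (RtoC (INR n)))%C).
  { intros n. unfold f, summand. unfold Cminus. rewrite Cexp_plus, Cexp_opp, Hgam.
    2:{ apply wedge_real; auto. assert (H := pos_INR n). lra. }
    rewrite <- Cpow_Cexp. unfold zeta. rewrite Cexp_Clog by auto. reflexivity. }
  destruct (summand_integer zeta) as [N0 HN0].
  assert (Ex : exists l, cser f l).
  { apply (ex_series_incr_n (K := C_AbsRing) (V := C_NormedModule) f N0).
    apply ex_cser_le with (fun k => exp (- 1) ^ k).
    - intros k. eapply Rle_trans. apply HN0. lia.
      replace (exp (- 1) ^ k) with (exp (- INR k)).
      2:{ clear. induction k. simpl. rewrite Ropp_0. apply exp_0. rewrite S_INR, <- tech_pow_Rmult, <- IHk, <- exp_plus.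
          f_equal. ring. }
      apply exp_le_compat.
      rewrite plus_INR. assert (H := pos_INR N0). lra.
    - apply ex_series_geom. assert (Hp := exp_pos (-1)). rewrite Rabs_right by lra.
      rewrite <- exp_0. apply exp_increasing. lra. }
  destruct Ex as [S HS].
  assert (E1 : cser (fun n => f (Datatypes.S n)) (S - f O)%C).
  { apply (is_series_incr_1 (K := C_AbsRing) (V := C_NormedModule) f (S - f O)%C).
    refine (eq_ind S (fun l => is_series (K := C_AbsRing) (V := C_NormedModule) f l) HS _ _). change (S = (S - f O + f O)%C). ring. }
  assert (E2 : cser (fun n => (Cpow z n / gamma (RtoC (INR (n + 1))))%C) (/ z * (S - f O))%C).
  { eapply is_series_ext; [|exact (is_series_scal (K := C_AbsRing) (V := C_NormedModule) (/ z)%C _ _ E1)].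
    intros n. change (/ z * f (Datatypes.S n) = Cpow z n / gamma (RtoC (INR (n + 1))))%C. rewrite F1.
    replace (n + 1)%nat with (Datatypes.S n) by lia.
    change (z ^ Datatypes.S n)%C with (z * z ^ n)%C. unfold Cdiv.
    replace (/ z * (z * z ^ n * / gamma (INR (Datatypes.S n))))%C
      with ((/ z * z) * (z ^ n * / gamma (INR (Datatypes.S n))))%C by ring.
    rewrite Cinv_l by auto. ring. }
  assert (E3 : E gamma z = (/ z * (S - f O))%C).
  { apply (iota_unique (V := C_CompleteNormedModule) (fun l => cser (fun n => (Cpow z n / gamma (RtoC (INR (n + 1))))%C) l)); auto.
    intros y Hy. exact (cser_unique _ _ _ Hy E2). }
  rewrite E3. replace (z * (/ z * (S - f O)) + 1 / gamma 0)%C with S. exact HS.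
  rewrite F1. simpl INR. replace (z * (/ z * (S - z ^ 0 / gamma 0)))%C with ((z * / z) * (S - z ^ 0 / gamma 0))%C by ring.
  rewrite Cinv_r by auto. simpl. ring.
Qed.

(** The left line contributes O(|z|^(-cp)); the right line is removed by taking N large after z. *)
Lemma sum_minus_primitive (eta : R) : 0 < eta -> exists Xi, forall (z : C) (G : C -> C),
  z <> 0%C -> Xi <= ln (Cmod z) ->
  (forall s, wedge alpha0 c s -> cder G s (summand (Clog z) s)) ->
  exists N0, forall N, (N0 <= N)%nat ->
    Cmod (z * E gamma z + 1 / gamma (RtoC 0) - (G (RtoC (INR (S N) - cp)) - G (RtoC (- cp)))) <= eta.
Proof using halpha0 hc Fr HPs Hq He Hcp Dlg Hcpc Hgam Sphi.
  intros Heta. destruct left_line as [A0 [HA0 QA]]. destruct right_line as [Ck [HC QC]].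
  assert (Hk : 0 < kappa) by (unfold kappa; lra).
  (* The two lines then contribute 2 (e1 + e1) / kappa = eta / 2. *)
  set (e1 := eta * kappa / 8). assert (He1 : 0 < e1) by (unfold e1; nra).
  exists (ln ((A0 + 1) / e1) / cp). intros z G Hz HXi DG.
  assert (HIm : Rabs (Im (Clog z)) <= PI).
  { unfold Clog. cbn [Im snd]. rewrite Rabs_Carg. apply acos_bound. }
  set (xi := ln (Cmod z)) in *. change (ln (Cmod z)) with (Re (Clog z)) in xi.
  destruct (QC xi) as [N1 HN1].
  destruct (INR_unbounded (1 + ln ((Ck + 1) / e1))) as [N2 HN2].
  destruct (proj1 (cser_eps _ _) (series_sum z Hz) (eta / 2) ltac:(lra)) as [N3 HN3].
  exists (N1 + N2 + N3)%nat. intros N HN.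
  assert (EA : A0 * exp (- cp * xi) <= e1).
  { assert (L : ln ((A0 + 1) / e1) <= xi * cp).
    { apply Rmult_le_compat_r with (r := cp) in HXi; [|lra].
      replace (ln ((A0 + 1) / e1) / cp * cp) with (ln ((A0 + 1) / e1)) in HXi by (field; lra). exact HXi. }
    assert (Hpos : 0 < (A0 + 1) / e1) by (apply Rdiv_lt_0_compat; lra).
    apply exp_le_compat in L. rewrite exp_ln in L by auto.
    replace (- cp * xi) with (- (xi * cp)) by ring. rewrite exp_Ropp.
    apply Rmult_le_reg_r with (exp (xi * cp)). apply exp_pos. rewrite Rmult_assoc, Rinv_l by (apply Rgt_not_eq, exp_pos).
    apply Rmult_le_compat_r with (r := e1) in L; [|lra].
    replace ((A0 + 1) / e1 * e1) with (A0 + 1) in L by (field; lra). lra. }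
  assert (EB : Ck * exp (- (INR (S N) - cp)) <= e1).
  { set (y := INR (S N) - cp). assert (Hy : ln ((Ck + 1) / e1) <= y).
    { unfold y. rewrite S_INR. assert (H := le_INR _ _ HN). rewrite !plus_INR in H.
      assert (H1 := pos_INR N1). assert (H3 := pos_INR N3). lra. }
    assert (Hpos : 0 < (Ck + 1) / e1) by (apply Rdiv_lt_0_compat; lra).
    apply exp_le_compat in Hy. rewrite exp_ln in Hy by auto. rewrite exp_Ropp.
    apply Rmult_le_reg_r with (exp y). apply exp_pos. rewrite Rmult_assoc, Rinv_l by (apply Rgt_not_eq, exp_pos).
    apply Rmult_le_compat_r with (r := e1) in Hy; [|lra].
    replace ((Ck + 1) / e1 * e1) with (Ck + 1) in Hy by (field; lra). lra. }
  assert (AP := abel_plana_bound c cp (summand (Clog z)) G ltac:(lra) Hcpc).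
  specialize (AP ltac:(apply smooth_sub with (wedge alpha0 c);
    [intros s Hs; apply wedge_halfplane; auto | apply summand_smooth])).
  specialize (AP ltac:(intros s Hs; apply DG, wedge_halfplane; auto)).
  specialize (AP N (A0 * exp (- cp * xi)) (Ck * exp (- (INR (S N) - cp))) kappa Hk).
  specialize (AP ltac:(intros sg t Hsg Ht; apply QA; auto)).
  specialize (AP ltac:(intros sg t Hsg Ht; apply (proj2 (HN1 (S N) (Clog z) sg t ltac:(lia) Hsg Ht HIm (Rle_refl _))))).
  specialize (AP ltac:(intros m eta' He'; apply (top_side (Clog z) m eta' HIm He'))).
  specialize (HN3 N ltac:(lia)). rewrite Cmod_sym in HN3.
  set (W := (z * E gamma z + 1 / gamma (RtoC 0))%C) in *.
  set (cs := csum (fun m : nat => summand (Clog z) (INR m)) N) in *.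
  set (dG := (G (RtoC (INR (S N) - cp)) - G (RtoC (- cp)))%C) in *.
  replace (W - dG)%C with ((W - cs) + (cs - dG))%C by ring.
  eapply Rle_trans. apply Cmod_triangle.
  assert (AP2 : 2 * (A0 * exp (- cp * xi) + Ck * exp (- (INR (S N) - cp))) / kappa <= eta / 2).
  { apply Rmult_le_reg_r with kappa; auto. unfold Rdiv at 1. rewrite Rmult_assoc, Rinv_l by lra. unfold e1 in *. lra. }
  lra.
Qed.

Lemma summand_log_primitive (zeta : C) (G : C -> C) :
  (forall s, wedge alpha0 c s -> cder G s (summand zeta s)) ->
  log_primitive alpha0 Ps zeta (fun w => G (Cexp w)).
Proof using halpha0 hc HPs.
  intros DG w Hw. eapply der_eq.
  { apply (cder_comp G Cexp). apply DG, wedge_Cexp; auto. apply cder_Cexp. }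
  unfold summand, hz. rewrite <- Cexp_plus, HPs. f_equal.
  replace (Cexp w * (zeta - lg (Cexp w) * Cexp (- w)))%C
    with (Cexp w * zeta - lg (Cexp w) * (Cexp w * Cexp (- w)))%C by ring.
  rewrite Cexp_opp. field. apply Cexp_neq_0.
Qed.

Lemma Im_Clog_bound (z : C) : Rabs (Im (Clog z)) <= PI.
Proof using. unfold Clog. cbn [Im snd]. rewrite Rabs_Carg. apply acos_bound. Qed.

Let W (z : C) : C := (z * E gamma z + 1 / gamma (RtoC 0))%C.

(** The interface to the path estimates: [a] is the value of G at the start of the path, [D] the
    expected increment and [b] its error. What remains is the increment from - cp to the start,
    treated by [start_left] and [start_right]. *)
Lemma sum_near_primitive (eta : R) : 0 < eta -> exists Xi, forall (z : C) (G : C -> C) (a D : C) (b Y : R),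
  z <> 0%C -> Xi <= ln (Cmod z) ->
  (forall s, wedge alpha0 c s -> cder G s (summand (Clog z) s)) ->
  (forall x, Y <= x -> Cmod (G (Cexp (x, 0)) - a - D) <= b) ->
  Cmod (W z - D) <= eta + b + Cmod (a - G (RtoC (- cp))).
Proof using halpha0 hc Fr HPs Hq He Hcp Dlg Hcpc Hgam Sphi.
  intros Heta. destruct (sum_minus_primitive eta Heta) as [Xi Q]. exists Xi.
  intros z G a D b Y Hz HXi DG Hb. destruct (Q z G Hz HXi DG) as [N0 HN0].
  destruct (INR_unbounded (exp Y + 1)) as [N1 HN1]. assert (HY := exp_pos Y).
  specialize (HN0 (N0 + N1)%nat ltac:(lia)). set (y := INR (S (N0 + N1)) - cp) in *.
  assert (Hy : exp Y <= y). { unfold y. rewrite S_INR, plus_INR. assert (H := pos_INR N0). lra. }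
  assert (Hb1 := Hb (ln y) ltac:(rewrite <- (ln_exp Y); apply ln_le; auto)).
  change (ln y, 0) with (RtoC (ln y)) in Hb1. rewrite Cexp_RtoC, exp_ln in Hb1 by lra.
  fold (W z) in HN0. set (g0 := G (RtoC (- cp))) in *. set (gy := G (RtoC y)) in *.
  replace (W z - D)%C with ((W z - (gy - g0)) + ((gy - a - D) + (a - g0)))%C by ring.
  eapply Rle_trans. apply Cmod_triangle. rewrite Rplus_assoc. apply Rplus_le_compat; auto.
  eapply Rle_trans. apply Cmod_triangle. lra.
Qed.

(** * The increment up to the start of the path *)

(** On the segment |z^s| is at most |z|^m up to a constant, and 1/gamma is bounded by compactness;
    so a negative [m] gives decay and a positive one a fixed power of |z|. *)
Lemma segment_growth (a h : C) (m : R) :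
  (forall t, 0 <= t <= 1 -> wedge alpha0 c (a + t * h)%C /\ Re (a + t * h)%C <= m) ->
  exists M, forall (zeta : C) (G : C -> C), Rabs (Im zeta) <= PI -> 0 <= Re zeta ->
    (forall s, wedge alpha0 c s -> cder G s (summand zeta s)) ->
    Cmod (G (a + h)%C - G a) <= M * exp (m * Re zeta).
Proof using Dlg.
  intros H.
  destruct (bounded_on_curve (fun s => - Re (lg s)) lg (fun t => (a + t * h)%C) 0 1) as [M1 HM1].
  - intros s. rewrite Rabs_Ropp. apply re_le.
  - intros t Ht. split. apply (der_cont _ _ _ (phi (a + t * h)%C)), Dlg, H; auto.
    apply (der_cont _ _ _ h), (rder_affine a h t).
  - set (b := Rabs (Im a) + Rabs (Im h)). exists (exp (PI * b + M1) * Cmod h).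
    intros zeta G Hz Hxi DG.
    assert (I := segment_increment G (summand zeta) a h 0 (exp (m * Re zeta + (PI * b + M1)))).
    replace (G (a + h)%C - G a)%C with (G (a + h)%C - G a - h * 0)%C by ring.
    replace (exp (PI * b + M1) * Cmod h * exp (m * Re zeta)) with (exp (m * Re zeta + (PI * b + M1)) * Cmod h)
      by (rewrite exp_plus; ring).
    apply I. { intros t Ht. apply DG, H; auto. }
    intros t Ht. replace (summand zeta (a + t * h) - 0)%C with (summand zeta (a + t * h)%C) by ring.
    unfold summand. rewrite Cmod_Cexp. apply exp_le_compat.
    assert (HM := HM1 t Ht). destruct (H t Ht) as [_ Hre]. set (s := (a + t * h)%C) in *. rewrite Re_minus, Re_mult.
    assert (Hb : Rabs (Im s) <= b).
    { unfold s, b. rewrite Im_plus, Im_mult, Re_RtoC, Im_RtoC. eapply Rle_trans. apply Rabs_triang.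
      apply Rplus_le_compat_l. replace (t * Im h + 0 * Re h) with (t * Im h) by ring. rewrite Rabs_mult, (Rabs_right t) by lra.
      assert (Hp := Rabs_pos (Im h)). nra. }
    assert (T1 : Re s * Re zeta <= m * Re zeta) by (apply Rmult_le_compat_r; auto).
    assert (T2 : - (Im s * Im zeta) <= PI * b).
    { eapply Rle_trans. apply Rle_abs. rewrite Rabs_Ropp, Rabs_mult, Rmult_comm.
      apply Rmult_le_compat; auto; apply Rabs_pos. }
    lra.
Qed.

(** Both end points have negative real part, hence so does the segment between them, and z^s is
    O(|z|^(-m0)) on it. Star shape of the angle about - cp keeps the segment in the domain. *)
Lemma start_left (X1 d1 eta : R) : 0 < d1 -> PI / 2 + d1 < alpha0 -> 0 < eta ->
  exists Xi, forall (zeta : C) (G : C -> C) (sg : R), Xi <= Re zeta -> Rabs (Im zeta) <= PI -> sign sg ->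
    (forall s, wedge alpha0 c s -> cder G s (summand zeta s)) ->
    Cmod (G (Cexp (X1, sg * (PI / 2 + d1))) - G (RtoC (- cp))) <= eta.
Proof using halpha0 hc Dlg Hcp Hcpc.
  intros Hd1 Hd1' Heta. assert (HPI := PI_RGT_0).
  assert (Hs : 0 < sin d1) by (apply sin_gt_0; lra). assert (HX := exp_pos X1).
  set (m0 := Rmin cp (exp X1 * sin d1)).
  assert (Hm0 : 0 < m0) by (apply Rmin_pos; nra).
  assert (Q1 := Rmin_l cp (exp X1 * sin d1)). assert (Q2 := Rmin_r cp (exp X1 * sin d1)). fold m0 in Q1, Q2.
  assert (SG : forall sg, sign sg -> exists M, forall (zeta : C) (G : C -> C), Rabs (Im zeta) <= PI -> 0 <= Re zeta ->
    (forall s, wedge alpha0 c s -> cder G s (summand zeta s)) ->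
    Cmod (G (Cexp (X1, sg * (PI / 2 + d1))) - G (RtoC (- cp))) <= M * exp (- m0 * Re zeta)).
  { intros sg Hsg. set (s1 := Cexp (X1, sg * (PI / 2 + d1))).
    assert (R1 : Re s1 = - (exp X1 * sin d1)).
    { unfold s1, Cexp. cbn [Re Im fst snd]. rewrite (cos_sign sg), cos_PI2_plus by auto. ring. }
    destruct (segment_growth (RtoC (- cp)) (s1 - RtoC (- cp))%C (- m0)) as [M HM].
    - intros t Ht. split.
      + apply (wedge_star alpha0 c halpha0 (- cp)); [lra | | auto]. apply wedge_Cexp; auto. cbn [Im snd]. rewrite Rabs_mult.
        replace (Rabs sg) with 1 by (symmetry; destruct Hsg as [-> | ->]; [apply Rabs_right|rewrite Rabs_left]; lra).
        rewrite Rabs_right; lra.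
      + rewrite Re_plus, Re_mult, Re_minus, !Re_RtoC, Im_RtoC, R1. nra.
    - exists M. intros zeta G Hi Hr DG. specialize (HM zeta G Hi Hr DG).
      replace (RtoC (- cp) + (s1 - RtoC (- cp)))%C with s1 in HM by ring. exact HM. }
  destruct (SG 1 (or_introl eq_refl)) as [Ma HMa]. destruct (SG (-1) (or_intror eq_refl)) as [Mb HMb].
  set (M := Rmax 1 (Rmax Ma Mb)).
  assert (M0 := Rmax_l 1 (Rmax Ma Mb)). assert (M1 := Rmax_r 1 (Rmax Ma Mb)).
  assert (M2 := Rmax_l Ma Mb). assert (M3 := Rmax_r Ma Mb). fold M in M0, M1.
  exists (Rmax 0 (ln (M / eta) / m0)). intros zeta G sg Hxi Hi Hsg DG.
  assert (X2 := Rmax_l 0 (ln (M / eta) / m0)). assert (X3 := Rmax_r 0 (ln (M / eta) / m0)).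
  apply Rle_trans with (M * exp (- m0 * Re zeta)).
  - assert (Hp := exp_pos (- m0 * Re zeta)).
    destruct Hsg as [-> | ->]; [eapply Rle_trans; [apply HMa|]|eapply Rle_trans; [apply HMb|]]; auto; try lra;
    apply Rmult_le_compat_r; lra.
  - assert (L : ln (M / eta) <= m0 * Re zeta).
    { replace (ln (M / eta)) with (m0 * (ln (M / eta) / m0)) by (field; lra). apply Rmult_le_compat_l; lra. }
    apply exp_le_compat in L. rewrite exp_ln in L by (apply Rdiv_lt_0_compat; lra).
    replace (- m0 * Re zeta) with (- (m0 * Re zeta)) by ring. rewrite exp_Ropp.
    apply Rmult_le_reg_r with (exp (m0 * Re zeta)). apply exp_pos. rewrite Rmult_assoc, Rinv_l by (apply Rgt_not_eq, exp_pos).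
    apply Rmult_le_compat_r with (r := eta) in L; [|lra].
    replace (M / eta * eta) with M in L by (field; lra). lra.
Qed.

(** A real segment followed by an arc of radius A = exp X1 stays in Re s <= A, so the cost is a
    fixed power of |z|, which [amplitude_large] makes negligible against the main term. *)
Lemma start_right (X1 : R) : exists A B, 0 < A /\ 0 < B /\ forall (zeta : C) (G : C -> C) (th : R),
  0 <= Re zeta -> Rabs (Im zeta) <= PI -> Rabs th <= PI / 2 ->
  (forall s, wedge alpha0 c s -> cder G s (summand zeta s)) ->
  Cmod (G (Cexp (X1, th)) - G (RtoC (- cp))) <= B * exp (A * Re zeta).
Proof using halpha0 hc HPs Dlg Hcp Hcpc.
  assert (HPI := PI_RGT_0). assert (HA := exp_pos X1). set (A := exp X1) in *.
  destruct (segment_growth (RtoC (- cp)) (RtoC A - RtoC (- cp))%C A) as [M HM].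
  { intros t Ht. split. apply (wedge_star alpha0 c halpha0 (- cp)); [lra | | auto]. apply wedge_real; auto. lra.
    rewrite Re_plus, Re_mult, Re_minus, !Re_RtoC, Im_RtoC. nra. }
  destruct (bounded_on_curve (fun s => - Re (lg s)) lg (fun b => Cexp (X1, b)) (- (PI / 2)) (PI / 2)) as [M1 HM1].
  - intros s. rewrite Rabs_Ropp. apply re_le.
  - intros t Ht. split.
    + apply (der_cont _ _ _ (phi (Cexp (X1, t)))), Dlg, wedge_Cexp; auto. cbn [Im snd].
      apply Rabs_def1; lra.
    + eapply der_cont. apply (rder_comp Cexp (fun b => (X1, b))). apply cder_Cexp.
      eapply der_ext; [|apply (rder_affine (X1, 0) (0, 1) t)]. intros h. apply Ceq; simpl; ring.
  - exists A, (Rmax 1 M + PI / 2 * exp (X1 + A * PI + M1)).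
    assert (Hm := Rmax_l 1 M). assert (Hm' := Rmax_r 1 M). assert (He1 := exp_pos (X1 + A * PI + M1)).
    split; auto. split. nra.
    intros zeta G th Hxi Hi Hth DG.
    assert (B1 := HM zeta G Hi Hxi DG). replace (RtoC (- cp) + (RtoC A - RtoC (- cp)))%C with (RtoC A) in B1 by ring.
    assert (B2 := F_segment alpha0 Ps zeta (fun w => G (Cexp w)) (X1, 0) (0, th) (A * Re zeta + (X1 + A * PI + M1))
      (summand_log_primitive zeta G DG)).
    assert (Eq : forall t : R, ((X1, 0) + t * (0, th))%C = (X1, t * th)) by (intros t; apply Ceq; simpl; ring).
    assert (Hth' : forall t : R, 0 <= t <= 1 -> Rabs (t * th) <= PI / 2).
    { intros t Ht. rewrite Rabs_mult, (Rabs_right t) by lra. assert (Hp := Rabs_pos th). nra. }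
    assert (Bd : forall t : R, 0 <= t <= 1 -> Rabs (Im ((X1, 0) + t * (0, th))%C) < alpha0).
    { intros t Ht. rewrite Eq. cbn [Im snd]. specialize (Hth' t Ht). lra. }
    specialize (B2 Bd).
    cbv beta in B2. replace ((X1, 0) + (0, th))%C with ((X1, th) : C) in B2 by (apply Ceq; simpl; ring).
    change (X1, 0) with (RtoC X1) in B2 at 3. rewrite Cexp_RtoC in B2. fold A in B2.
    replace (G (Cexp (X1, th)) - G (RtoC (- cp)))%C
      with ((G (Cexp (X1, th)) - G (RtoC A)) + (G (RtoC A) - G (RtoC (- cp))))%C by ring.
    eapply Rle_trans. apply Cmod_triangle. rewrite Rmult_plus_distr_r, Rplus_comm. apply Rplus_le_compat.
    + eapply Rle_trans. exact B1. apply Rmult_le_compat_r; auto. left; apply exp_pos.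
    + eapply Rle_trans.
      { apply B2. intros t Ht. rewrite Eq. specialize (Hth' t Ht). cbn [Re fst].
        assert (HM2 := HM1 (t * th) ltac:(apply Rabs_le_between in Hth'; lra)).
        assert (Eh : forall w, hz Ps zeta w = (Cexp w * zeta - lg (Cexp w))%C).
        { intros w. unfold hz. rewrite HPs, Cexp_opp. field. apply Cexp_neq_0. }
        rewrite Eh, Re_minus, Re_mult. unfold Cexp at 1 2. cbn [Re Im fst snd]. fold A.
        assert (C1 := COS_bound (t * th)). assert (C2 := SIN_bound (t * th)).
        assert (T1 : cos (t * th) * Re zeta <= Re zeta) by nra.
        assert (T2 : - (sin (t * th) * Im zeta) <= PI).
        { eapply Rle_trans. apply Rle_abs. rewrite Rabs_Ropp, Rabs_mult.
          assert (T3 : Rabs (sin (t * th)) <= 1) by (apply Rabs_le; lra).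
          assert (T4 := Rabs_pos (sin (t * th))). assert (T5 := Rabs_pos (Im zeta)). nra. }
        cbn [Re Im fst snd] in *.
        assert (A * (cos (t * th) * Re zeta) <= A * Re zeta) by (apply Rmult_le_compat_l; lra).
        assert (A * - (sin (t * th) * Im zeta) <= A * PI) by (apply Rmult_le_compat_l; lra).
        unfold Re, Im in *. lra. }
      rewrite exp_plus. replace (Cmod (0, th)) with (Rabs th).
      * assert (Hp := exp_pos (A * Re zeta)). rewrite (Rmult_comm (exp (A * Re zeta))), <- Rmult_assoc.
        apply Rmult_le_compat_r. lra. apply Rmult_le_compat_r; lra.
      * unfold Cmod. simpl. rewrite Rmult_0_l, Rplus_0_l, Rmult_1_r. symmetry. apply sqrt_Rsqr_abs.
Qed.

Lemma primitive_exists (zeta : C) : exists G, forall s, wedge alpha0 c s -> cder G s (summand zeta s).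
Proof using halpha0 hc Dlg Sphi.
  apply primitive_star with (RtoC 0).
  - apply wedge_open; auto.
  - apply wedge_star; auto. lra.
  - apply wedge_real; auto. lra.
  - apply summand_smooth.
Qed.

(** * The sum near saddle points and away from them *)

Lemma far_from_saddle (d1 d eta : R) : 0 < d1 <= 1 / 10 -> d1 <= (alpha0 - PI / 2) / 2 ->
  0 < d <= (sin d1 - d1 * cos d1) / 4 -> 0 < eta ->
  exists P, forall (z : C) (sg p : R), z <> 0%C -> P <= p -> sign sg ->
    Rabs (Re (Clog z) - La p - e p) <= d / 40 * e p ->
    (PI / 2 + d) * e p <= sg * Im (Clog z) -> Cmod (W z) <= eta.
Proof using halpha0 hc Fr HPs Hq He Hcp Dlg Hcpc Hgam Sphi.
  intros Hd1 Hd1' Hd Heta.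
  destruct (off_saddle _ _ _ _ _ _ _ Fr d1 Hd1 Hd1') as [X1 [_ HO]].
  destruct (HO d (eta / 3) Hd ltac:(lra)) as [P HP].
  destruct (sum_near_primitive (eta / 3) ltac:(lra)) as [Xi HXi].
  destruct (start_left X1 d1 (eta / 3) ltac:(lra) ltac:(lra) ltac:(lra)) as [Xi2 HXi2].
  destruct (fr_div _ _ _ _ _ _ _ Fr (Rmax Xi Xi2)) as [P2 HP2].
  assert (S := sig_bounds d1 Hd1).
  assert (M1 := Rmax_l Xi Xi2). assert (M2 := Rmax_r Xi Xi2).
  exists (Rmax P P2). intros z sg p Hz Hp Hsg Hr Hi.
  assert (P3 := Rmax_l P P2). assert (P4 := Rmax_r P P2). specialize (HP2 p ltac:(lra)).
  destruct (primitive_exists (Clog z)) as [G DG].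
  destruct (HP (Clog z) (fun w => G (Cexp w)) sg p ltac:(lra) Hsg (summand_log_primitive _ G DG) Hr Hi) as [Y HY].
  assert (He0 := fr_pos _ _ _ _ _ _ _ Fr p).
  assert (Hre : Rmax Xi Xi2 <= Re (Clog z)).
  { apply Rabs_le_between in Hr. assert (d / 40 * e p <= 1 * e p).
    { apply Rmult_le_compat_r. lra. destruct S as [S1 [S2 [S3 [S4 S5]]]]. lra. } lra. }
  assert (A := HXi z G (G (Cexp (X1, sg * (PI / 2 + d1)))) 0%C (eta / 3) Y Hz).
  change (ln (Cmod z)) with (Re (Clog z)) in A. specialize (A ltac:(lra) DG).
  assert (B := HXi2 (Clog z) G sg ltac:(lra) (Im_Clog_bound z) Hsg DG).
  replace (W z - 0)%C with (W z) in A by ring.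
  eapply Rle_trans. apply A.
  - intros x Hx. specialize (HY x Hx). cbv beta in HY. set (u := (G (Cexp (x, 0)) - G (Cexp (X1, (sg * (PI / 2 + d1))%R)))%C) in *.
    replace (u - 0)%C with u by ring. exact HY.
  - lra.
Qed.

Lemma near_imaginary_saddle (d1 : R) : 0 < d1 <= 1 / 100 -> d1 <= (alpha0 - PI / 2) / 4 ->
  exists d2, 0 < d2 <= d1 / 10 /\ forall eta, 0 < eta -> exists X, forall (z : C) (sg p th : R),
    z <> 0%C -> X <= p -> sign sg -> Clog z = Ph Ps Ep (p, th) -> Rabs (sg * th - PI / 2) <= d2 ->
    Cmod (W z - leading Ps e (Clog z) p th) <= eta * (1 + Cmod (amplitude Ps (Clog z) p th) / rootN e p).
Proof using halpha0 hc Fr HPs Hq He Hcp Dlg Hcpc Hgam Sphi.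
  intros Hd1 Hd1'. destruct gauss_primitive_exists as [P HP].
  destruct (near_imaginary_ray _ _ _ _ _ _ _ Fr P d1 HP Hd1 Hd1') as [X1 [d2 [_ [Hd2 HI]]]].
  exists d2. split; auto. intros eta Heta.
  destruct (HI (eta / 3) ltac:(lra)) as [X HX].
  destruct (sum_near_primitive (eta / 3) ltac:(lra)) as [Xi HXi].
  destruct (start_left X1 d1 (eta / 3) ltac:(lra) ltac:(lra) ltac:(lra)) as [Xi2 HXi2].
  destruct (fr_div _ _ _ _ _ _ _ Fr (Rmax Xi Xi2)) as [P2 HP2].
  destruct (Ph_real_bounds _ _ _ _ _ _ _ Fr) as [P5 HP5].
  assert (M1 := Rmax_l Xi Xi2). assert (M2 := Rmax_r Xi Xi2).
  exists (Rmax X (Rmax P2 P5)). intros z sg p th Hz Hp Hsg Hc Hth.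
  assert (P3 := Rmax_l X (Rmax P2 P5)). assert (P4 := Rmax_r X (Rmax P2 P5)).
  assert (P6 := Rmax_l P2 P5). assert (P7 := Rmax_r P2 P5).
  specialize (HP2 p ltac:(lra)).
  assert (Hth2 : Rabs th <= B0 alpha0).
  { unfold B0. replace (Rabs th) with (Rabs (sg * th)).
    2:{ rewrite Rabs_mult. replace (Rabs sg) with 1 by (symmetry; destruct Hsg as [-> | ->]; [apply Rabs_right|rewrite Rabs_left]; lra). ring. }
    assert (HPI := PI_RGT_0). apply Rabs_le_between in Hth. rewrite Rabs_right; lra. }
  specialize (HP5 p th ltac:(lra) Hth2). rewrite <- Hc in HP5.
  destruct (primitive_exists (Clog z)) as [G DG].
  destruct (HX (Clog z) (fun w => G (Cexp w)) sg p th ltac:(lra) Hsg (summand_log_primitive _ G DG) Hc Hth) as [Y HY].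
  assert (A := fun b => HXi z G (G (Cexp (X1, sg * (PI / 2 + d1)))) (leading Ps e (Clog z) p th) b Y Hz).
  change (ln (Cmod z)) with (Re (Clog z)) in A. specialize (A _ ltac:(lra) DG HY).
  assert (B := HXi2 (Clog z) G sg ltac:(lra) (Im_Clog_bound z) Hsg DG).
  eapply Rle_trans. apply A.
  assert (R0 : 0 <= Cmod (amplitude Ps (Clog z) p th) / rootN e p).
  { apply Rdiv_le_0_compat. apply Cmod_ge_0. apply (rootN_pos _ _ _ _ _ _ _ Fr). }
  set (rr := Cmod (amplitude Ps (Clog z) p th) / rootN e p) in *. nra.
Qed.

Lemma near_real_saddle (d eta : R) : 0 < d < PI / 2 -> 0 < eta -> exists X, forall (z : C) (p th : R),
    z <> 0%C -> X <= p -> Clog z = Ph Ps Ep (p, th) -> Rabs th <= PI / 2 - d ->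
    Cmod (W z - leading Ps e (Clog z) p th) <= eta * (1 + Cmod (amplitude Ps (Clog z) p th) / rootN e p).
Proof using halpha0 hc Fr HPs Hq He Hcp Dlg Hcpc Hgam Sphi.
  intros Hd Heta. destruct gauss_primitive_exists as [P HP].
  destruct (near_real_ray _ _ _ _ _ _ _ Fr P d HP Hd) as [X1 [_ HI]].
  destruct (HI (eta / 2) ltac:(lra)) as [X HX].
  destruct (sum_near_primitive eta Heta) as [Xi HXi].
  destruct (start_right X1) as [A [B [HA [HB HS]]]].
  destruct (amplitude_large _ _ _ _ _ _ _ Fr d A B (eta / 2) Hd HA HB ltac:(lra)) as [X2 HX2].
  destruct (fr_div _ _ _ _ _ _ _ Fr (Rmax Xi 0)) as [P2 HP2].
  destruct (Ph_real_bounds _ _ _ _ _ _ _ Fr) as [P5 HP5].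
  assert (M1 := Rmax_l Xi 0). assert (M2 := Rmax_r Xi 0).
  exists (Rmax (Rmax X X2) (Rmax P2 P5)). intros z p th Hz Hp Hc Hth.
  assert (Q1 := Rmax_l (Rmax X X2) (Rmax P2 P5)). assert (Q2 := Rmax_r (Rmax X X2) (Rmax P2 P5)).
  assert (Q3 := Rmax_l X X2). assert (Q4 := Rmax_r X X2). assert (Q5 := Rmax_l P2 P5). assert (Q6 := Rmax_r P2 P5).
  specialize (HP2 p ltac:(lra)). assert (HPI := PI_RGT_0).
  specialize (HP5 p th ltac:(lra) ltac:(unfold B0; lra)). specialize (HX2 p th ltac:(lra) Hth). rewrite <- Hc in HP5, HX2.
  destruct (primitive_exists (Clog z)) as [G DG].
  destruct (HX (Clog z) (fun w => G (Cexp w)) p th ltac:(lra) (summand_log_primitive _ G DG) Hc Hth) as [Y HY].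
  assert (Q := fun b => HXi z G (G (Cexp (X1, th))) (leading Ps e (Clog z) p th) b Y Hz).
  change (ln (Cmod z)) with (Re (Clog z)) in Q. specialize (Q _ ltac:(lra) DG HY).
  assert (S := HS (Clog z) G th ltac:(lra) (Im_Clog_bound z) ltac:(lra) DG).
  eapply Rle_trans. apply Q. lra.
Qed.

(** Three ranges of |th|: up to PI/2 - d2 a single ray is used, within d2 of PI/2 the path across
    the imaginary direction, and beyond PI/2 + d2 both sides of the formula are small. The width
    [d2] comes from the second range and fixes the others. *)
Lemma at_saddle (delta eta : R) : 0 < delta -> PI / 2 + delta <= B0 alpha0 -> 0 < eta -> exists X, forall (z : C) (p th : R),
    z <> 0%C -> X <= p -> Clog z = Ph Ps Ep (p, th) -> Rabs th <= PI / 2 + delta ->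
    Cmod (W z - leading Ps e (Clog z) p th) <= eta * (1 + Cmod (amplitude Ps (Clog z) p th) / rootN e p).
Proof using halpha0 hc Fr HPs Hq He Hcp Dlg Hcpc Hgam Sphi.
  intros Hdelta HB Heta. assert (HPI := PI_RGT_0). assert (H32 := PI2_3_2).
  set (d1 := Rmin (1/100) ((alpha0 - PI / 2) / 4)).
  assert (D1 := Rmin_l (1/100) ((alpha0 - PI / 2) / 4)). assert (D2 := Rmin_r (1/100) ((alpha0 - PI / 2) / 4)).
  assert (D3 : 0 < d1) by (apply Rmin_pos; lra). fold d1 in D1, D2.
  destruct (near_imaginary_saddle d1 ltac:(lra) D2) as [d2 [Hd2 HI]].
  destruct (HI eta Heta) as [X1 H1].
  destruct (near_real_saddle d2 eta ltac:(lra) Heta) as [X2 H2].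
  destruct (sig_bounds d1 ltac:(lra)) as [Sg _].
  (* The gap between d and d2 absorbs the error d / 40 with which [Ph_vertical] relates th to Im
     (log z) / e(p). *)
  set (d := Rmin (d2 / 2) ((sin d1 - d1 * cos d1) / 4)).
  assert (D4 := Rmin_l (d2 / 2) ((sin d1 - d1 * cos d1) / 4)). assert (D5 := Rmin_r (d2 / 2) ((sin d1 - d1 * cos d1) / 4)).
  assert (D6 : 0 < d) by (apply Rmin_pos; lra). fold d in D4, D5.
  destruct (far_from_saddle d1 d (eta / 2) ltac:(lra) ltac:(lra) ltac:(lra) ltac:(lra)) as [X3 H3].
  destruct (amplitude_small _ _ _ _ _ _ _ Fr d2 (eta / 2 / sqrt (2 * PI)) ltac:(lra)) as [X4 H4].
  { apply Rdiv_lt_0_compat. lra. apply sqrt_lt_R0. lra. }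
  destruct (Ph_vertical _ _ _ _ _ _ _ Fr (d / 40) ltac:(lra)) as [X5 H5].
  set (Y1 := Rmax X1 X2). set (Y2 := Rmax X3 (Rmax X4 X5)). exists (Rmax Y1 Y2). intros z p th Hz Hp Hc Hth.
  assert (Q1 := Rmax_l Y1 Y2). assert (Q2 := Rmax_r Y1 Y2). assert (Q3 := Rmax_l X1 X2). assert (Q4 := Rmax_r X1 X2).
  assert (Q5 := Rmax_l X3 (Rmax X4 X5)). assert (Q6 := Rmax_r X3 (Rmax X4 X5)).
  assert (Q7 := Rmax_l X4 X5). assert (Q8 := Rmax_r X4 X5). fold Y1 in Q3, Q4. fold Y2 in Q5, Q6.
  assert (R0 : 0 <= Cmod (amplitude Ps (Clog z) p th) / rootN e p).
  { apply Rdiv_le_0_compat. apply Cmod_ge_0. apply (rootN_pos _ _ _ _ _ _ _ Fr). }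
  destruct (Rle_dec (Rabs th) (PI / 2 - d2)) as [Ha|Ha]. { apply H2; auto. lra. }
  assert (Sd : exists sg, sign sg /\ sg * th = Rabs th).
  { destruct (Rcase_abs th). exists (-1). split. right; auto. rewrite Rabs_left; lra.
    exists 1. split. left; auto. rewrite Rabs_right; lra. }
  destruct Sd as [sg [Hsg Es]].
  destruct (Rle_dec (Rabs th) (PI / 2 + d2)) as [Hb|Hb].
  { apply H1 with sg; auto. lra. rewrite Es. apply Rabs_le. lra. }
  assert (HpB : B0 alpha0 <= PI) by (unfold B0; lra).
  specialize (H4 p th ltac:(lra) ltac:(lra) ltac:(lra) ltac:(lra)).
  specialize (H5 p th ltac:(lra) ltac:(lra)). rewrite <- Hc in H4, H5.
  assert (Hre := re_le (Clog z - ((La p + e p)%R, (th * e p)%R))%C).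
  assert (Him := im_le (Clog z - ((La p + e p)%R, (th * e p)%R))%C).
  rewrite Re_minus in Hre. rewrite Im_minus in Him.
  change (Re ((La p + e p)%R, (th * e p)%R)) with (La p + e p) in Hre.
  change (Im ((La p + e p)%R, (th * e p)%R)) with (th * e p) in Him.
  assert (He0 := fr_pos _ _ _ _ _ _ _ Fr p).
  assert (HW : Cmod (W z) <= eta / 2).
  { apply H3 with sg p; auto. lra.
    - replace (Re (Clog z) - La p - e p) with (Re (Clog z) - (La p + e p)) by ring. lra.
    - assert (T : Rabs (Im (Clog z) - th * e p) <= d / 40 * e p) by lra. apply Rabs_le_between in T.
      assert (T2 : sg * th * e p - d / 40 * e p <= sg * Im (Clog z)). { destruct Hsg as [-> | ->]; lra. }
      rewrite Es in T2. assert ((PI / 2 + d2) * e p <= Rabs th * e p) by (apply Rmult_le_compat_r; lra). nra. }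
  assert (HLd : Cmod (leading Ps e (Clog z) p th) <= eta / 2).
  { rewrite (Cmod_leading _ _ _ _ _ _ _ Fr). assert (Hs2 : 0 < sqrt (2 * PI)) by (apply sqrt_lt_R0; lra).
    apply Rmult_le_compat_l with (r := sqrt (2 * PI)) in H4; [|lra].
    replace (sqrt (2 * PI) * (eta / 2 / sqrt (2 * PI))) with (eta / 2) in H4 by (field; lra). exact H4. }
  unfold Cminus. eapply Rle_trans. apply Cmod_triangle. rewrite Cmod_opp.
  set (rr := Cmod (amplitude Ps (Clog z) p th) / rootN e p) in *. nra.
Qed.

(** Let p satisfy La p + e p = ln |z|. If |Im log z| were at most (PI/2 + delta/2) e(p),
    [saddle_point_exists] would give a saddle within 1 of p, hence to the right of [X1]. So the
    angle is larger, and [far_from_saddle] applies. *)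
Lemma away_from_saddles (delta eta X1 : R) : 0 < delta -> PI / 2 + delta <= B0 alpha0 -> 0 < eta ->
  exists M, forall z : C, M < Cmod z ->
    (forall w, X1 <= Re w -> Rabs (Im w) < PI / 2 + delta -> Ph Ps Ep w <> Clog z) -> Cmod (W z) <= eta.
Proof using halpha0 hc Fr HPs Hq He Hcp Dlg Hcpc Hgam Sphi.
  intros Hdelta HB Heta. assert (HPI := PI_RGT_0).
  set (d1 := Rmin (1/10) ((alpha0 - PI / 2) / 2)).
  assert (D1 := Rmin_l (1/10) ((alpha0 - PI / 2) / 2)). assert (D2 := Rmin_r (1/10) ((alpha0 - PI / 2) / 2)).
  assert (D3 : 0 < d1) by (apply Rmin_pos; lra). fold d1 in D1, D2.
  destruct (sig_bounds d1 ltac:(lra)) as [Sg _].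
  set (d := Rmin (delta / 2) ((sin d1 - d1 * cos d1) / 4)).
  assert (D4 := Rmin_l (delta / 2) ((sin d1 - d1 * cos d1) / 4)).
  assert (D5 := Rmin_r (delta / 2) ((sin d1 - d1 * cos d1) / 4)).
  assert (D6 : 0 < d) by (apply Rmin_pos; lra). fold d in D4, D5.
  destruct (far_from_saddle d1 d eta ltac:(lra) ltac:(lra) ltac:(lra) Heta) as [P HP].
  destruct (saddle_point_exists _ _ _ _ _ _ _ delta Fr Hdelta HB) as [X2 HX2].
  destruct (saddle_abscissa _ _ _ _ _ _ _ Fr (Rmax P (Rmax X2 (X1 + 1)))) as [Xi HXi].
  assert (Q1 := Rmax_l P (Rmax X2 (X1 + 1))). assert (Q2 := Rmax_r P (Rmax X2 (X1 + 1))).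
  assert (Q3 := Rmax_l X2 (X1 + 1)). assert (Q4 := Rmax_r X2 (X1 + 1)).
  exists (exp Xi). intros z Hz Hw. assert (HeXi := exp_pos Xi).
  assert (Hz0 : z <> 0%C). { intros Eq. rewrite Eq, Cmod_0 in Hz. lra. }
  destruct (HXi (ln (Cmod z))) as [p [Hp Hv]]. { rewrite <- (ln_exp Xi). apply ln_le; lra. }
  change (ln (Cmod z)) with (Re (Clog z)) in Hv.
  assert (He0 := fr_pos _ _ _ _ _ _ _ Fr p).
  destruct (Rle_dec (Rabs (Im (Clog z))) ((PI / 2 + delta / 2) * e p)) as [Hi|Hi].
  - exfalso. destruct (HX2 p (Clog z) ltac:(lra) ltac:(lra) Hi) as [w [W1 [W2 W3]]].
    apply (Hw w); auto. apply Rabs_le_between in W1. lra.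
  - assert (Sd : exists sg, sign sg /\ sg * Im (Clog z) = Rabs (Im (Clog z))).
    { destruct (Rcase_abs (Im (Clog z))). exists (-1). split. right; auto. rewrite Rabs_left; lra.
      exists 1. split. left; auto. rewrite Rabs_right; lra. }
    destruct Sd as [sg [Hsg Es]]. apply HP with sg p; auto. lra.
    + replace (Re (Clog z) - La p - e p) with 0 by lra. rewrite Rabs_R0. nra.
    + rewrite Es. assert ((PI / 2 + d) * e p <= (PI / 2 + delta / 2) * e p) by (apply Rmult_le_compat_r; lra). lra.
Qed.
End HalfPlane.

(** * The main term *)

Lemma Rabs_Carg_Cexp (p th : R) : Rabs th <= PI -> Rabs (Carg (Cexp (p, th))) = Rabs th.
Proof.
  intros Hth. rewrite Rabs_Carg, Cmod_Cexp. unfold Cexp. cbn [Re Im fst snd].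
  replace (exp p * cos th / exp p) with (cos th) by (field; apply Rgt_not_eq, exp_pos).
  replace (cos th) with (cos (Rabs th)).
  - apply acos_cos. split; auto. apply Rabs_pos.
  - destruct (Rcase_abs th); [rewrite Rabs_left, cos_neg | rewrite Rabs_right]; auto.
Qed.

Lemma rcont_continuity_pt (u : R -> C) (t : R) : rcont u t -> continuity_pt (fun x => Re (u x)) t.
Proof.
  intros H eps He. destruct (H eps He) as [d [Hd Q]]. exists d. split; auto.
  change (forall x : R, D_x no_cond t x /\ Rabs (x - t) < d -> Rabs (Re (u x) - Re (u t)) < eps). intros x [_ Hx].
  specialize (Q (RtoC (x - t)) (Im_RtoC _)). rewrite Cmod_R, Re_plus, !Re_RtoC in Q.
  replace (t + (x - t)) with x in Q by ring. specialize (Q Hx).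
  rewrite <- Re_minus. eapply Rle_lt_trans. apply re_le. exact Q.
Qed.

(* The continuous square root cannot cross the imaginary axis, where its square is negative. *)
Lemma sqrt_near_one (u : R -> C) (eta : R) : eta <= 1 / 2 ->
  (forall t, 0 <= t <= 1 -> rcont u t) -> 0 < Re (u 0) ->
  (forall t, 0 <= t <= 1 -> Cmod (u t * u t - 1) <= eta) -> Cmod (u 1 - 1) <= eta.
Proof.
  intros He Hc H0 Hs.
  assert (Nz : forall t, 0 <= t <= 1 -> Re (u t) <> 0).
  { intros t Ht Hz. specialize (Hs t Ht). assert (H := re_le (u t * u t - 1)%C).
    rewrite Re_minus, Re_mult, Hz in H. change (Re 1) with 1 in H. apply Rabs_le_between in H. nra. }
  assert (H1 : 0 < Re (u 1)).
  { destruct (Rlt_dec 0 (Re (u 1))) as [Hp|Hn]; auto. exfalso.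
    assert (N1 := Nz 1 ltac:(lra)).
    destruct (IVT_interv (fun t => - Re (u t)) 0 1) as [t [Ht Hv]]; try lra.
    - intros t Ht. apply continuity_pt_opp, rcont_continuity_pt, Hc; auto.
    - apply (Nz t Ht). lra. }
  specialize (Hs 1 ltac:(lra)).
  replace (u 1 * u 1 - 1)%C with ((u 1 - 1) * (u 1 + 1))%C in Hs by ring. rewrite Cmod_mult in Hs.
  assert (H2 : 1 <= Cmod (u 1 + 1)%C).
  { eapply Rle_trans; [|apply re_le]. rewrite Re_plus. change (Re 1) with 1. rewrite Rabs_right; lra. }
  assert (H3 := Cmod_ge_0 (u 1 - 1)%C). nra.
Qed.

Section MainTerm.
Context (alpha0 c : R) (halpha0 : PI / 2 < alpha0 <= PI) (hc : 0 < c).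
Context (lg phi Ps Ep Ep' : C -> C) (La e e' : R -> R) (Fr : frame alpha0 Ps Ep Ep' La e e').
Context (Dlg : forall s, wedge alpha0 c s -> cder lg s (phi s)).
Context (HPs : forall w, Ps w = (lg (Cexp w) * Cexp (- w))%C).
Context (HEp : forall w, Ep w = (phi (Cexp w) - Ps w)%C).

Lemma log_derivative_at (w : C) : Rabs (Im w) < alpha0 ->
  (C_derive (L lg) (Cexp w) / L lg (Cexp w))%C = (Ep w / Cexp w)%C /\ Phi lg (Cexp w) = Ph Ps Ep w.
Proof using halpha0 hc Dlg HPs HEp.
  intros Hw. destruct (L_log_derivative alpha0 c lg phi (Cexp w) Dlg) as [Q1 [_ Q3]].
  - apply wedge_Cexp; auto.
  - apply Cexp_neq_0.
  - rewrite Q1, Q3. unfold Ph. rewrite HEp, HPs, Cexp_opp. split. unfold Cdiv. ring. ring.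
Qed.

(** The ratio of the given branch to the root in [leading] is followed along the arc from the
    positive axis to s. Its square is e(p) / Ep, close to 1 by (C), and it is positive at the start,
    so by continuity it stays close to 1. *)
Lemma sqrt_branch_main (delta rho0 eta : R) (sq : C -> C) : 0 < delta -> PI / 2 + delta <= B0 alpha0 ->
  0 < rho0 -> 0 < eta -> is_sqrt_branch lg (PI / 2 + delta) rho0 sq ->
  exists X, forall p th, X <= p -> Rabs th < PI / 2 + delta ->
    Cmod (sq (Cexp (p, th)) * Cexp (hz Ps (Ph Ps Ep (p, th)) (p, th)) - leading Ps e (Ph Ps Ep (p, th)) p th)
      <= eta * Cmod (leading Ps e (Ph Ps Ep (p, th)) p th).
Proof using halpha0 hc Fr Dlg HPs HEp.
  intros Hd HB Hrho Heta Hsq. assert (HPI := PI_RGT_0).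
  assert (HB0 := B0_bounds _ _ _ _ _ _ _ Fr).
  assert (HBP : B0 alpha0 <= PI) by (unfold B0; lra).
  set (eta1 := Rmin eta (1/2)).
  assert (E1 := Rmin_l eta (1/2)). assert (E2 := Rmin_r eta (1/2)).
  assert (E3 : 0 < eta1) by (apply Rmin_pos; lra). fold eta1 in E1, E2.
  destruct (fr_uniform _ _ _ _ _ _ _ Fr (alpha0 - B0 alpha0) (eta1 / 2) ltac:(lra) ltac:(lra)) as [X HX].
  exists (Rmax X (ln rho0 + 1)). intros p th Hp Hth.
  assert (M1 := Rmax_l X (ln rho0 + 1)). assert (M2 := Rmax_r X (ln rho0 + 1)).
  assert (Hrp : rho0 < exp p). { rewrite <- (exp_ln rho0) by auto. apply exp_increasing. lra. }
  assert (Hxp := exp_pos p). assert (Hep := fr_pos _ _ _ _ _ _ _ Fr p).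
  destruct (rootN_pos _ _ _ _ _ _ _ Fr p) as [N1 N2]. set (rN := rootN e p) in *.
  set (S := sqrt (2 * PI)). assert (S1 : 0 < S) by (apply sqrt_lt_R0; lra).
  assert (S2 : S * S = 2 * PI) by (apply sqrt_sqrt; lra).
  (* The normalization for which (sq(s) e^(-i b/2) k)^2 = e(p) / Ep(p + i b) at s = e^(p + i b). *)
  set (k := rN / (S * exp p)).
  assert (Hk : 0 < k). { apply Rdiv_lt_0_compat; auto. apply Rmult_lt_0_compat; auto. }
  assert (Hk2 : k * k = e p / (2 * PI * exp p)).
  { unfold k. replace (rN / (S * exp p) * (rN / (S * exp p))) with ((rN * rN) / ((S * S) * exp p * exp p)) by (field; lra).
    rewrite N2, S2. field. lra. }
  assert (Sec : forall b, Rabs b < PI / 2 + delta -> sectorS (PI / 2 + delta) rho0 (Cexp (p, b))).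
  { intros b Hb. split. rewrite Rabs_Carg_Cexp; lra. rewrite Cmod_Cexp. exact Hrp. }
  assert (Half : forall b : R, (Cexp (- (Ci * (b / 2)%R)) * Cexp (- (Ci * (b / 2)%R)) * Cexp (Ci * b))%C = 1%C).
  { intros b. rewrite <- !Cexp_plus, <- Cexp_0. f_equal.
    replace (RtoC b) with (RtoC (b / 2) + RtoC (b / 2))%C by (rewrite <- RtoC_plus; f_equal; field). ring. }
  assert (Hs : forall t, 0 <= t <= 1 -> Rabs (t * th) <= Rabs th).
  { intros t Ht. rewrite Rabs_mult, (Rabs_right t) by lra. assert (H := Rabs_pos th). nra. }
  set (u := fun t : R => (sq (Cexp (p, (t * th)%R)) * Cexp (- (Ci * (t * th / 2)%R)) * RtoC k)%C).
  assert (U : Cmod (u 1 - 1) <= eta1).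
  { apply sqrt_near_one; auto.
    - intros t Ht. specialize (Hs t Ht).
      assert (D : rder (fun t => (p, (t * th)%R)) t (0, th)).
      { eapply der_ext; [|apply (rder_affine (p, 0) (0, th) t)]. intros h. apply Ceq; simpl; ring. }
      assert (D2 : rder (fun t => (- (Ci * (t * th / 2)%R))%C) t (0, - (th / 2))).
      { eapply der_ext; [|apply (rder_affine 0 (0, - (th / 2)) t)]. intros h. apply Ceq; simpl; field. }
      unfold u. apply (cont_mult (fun h => Im h = 0) (fun z => sq (Cexp (p, (Re z * th)%R)) * Cexp (- (Ci * (Re z * th / 2)%R)))%C (fun _ => RtoC k)).
      apply (cont_mult (fun h => Im h = 0) (fun z => sq (Cexp (p, (Re z * th)%R))) (fun z => Cexp (- (Ci * (Re z * th / 2)%R)))).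
      + apply (cont_comp (fun h => Im h = 0) (fun z => Cexp (p, (Re z * th)%R)) sq).
        * apply continuous_ccont, (sq_continuous _ _ _ _ Hsq), Sec. rewrite Re_RtoC. lra.
        * eapply der_cont. apply (rder_comp Cexp (fun t => (p, (t * th)%R))). apply cder_Cexp. exact D.
      + eapply der_cont. apply (rder_comp Cexp (fun t => (- (Ci * (t * th / 2)%R))%C)). apply cder_Cexp. exact D2.
      + eapply der_cont. apply der_const.
    - unfold u. rewrite Rmult_0_l. change (p, 0) with (RtoC p). rewrite Cexp_RtoC.
      replace (- (Ci * (0 / 2)%R))%C with (RtoC 0) by (apply Ceq; simpl; field). rewrite Cexp_0.
      destruct (sq_positive _ _ _ _ Hsq (exp p) Hrp) as [P1 P2].
      rewrite !Re_mult, !Re_RtoC, !Im_RtoC. nra.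
    - intros t Ht. specialize (Hs t Ht). set (b := t * th) in *. set (s := Cexp (p, b)).
      specialize (HX p b ltac:(lra) ltac:(lra)).
      destruct (log_derivative_at (p, b) ltac:(cbn [Im snd]; lra)) as [LD _]. fold s in LD.
      assert (Q := sq_square _ _ _ _ Hsq s (Sec b ltac:(lra))).
      assert (HL : L lg s <> 0%C) by (apply Cexp_neq_0). assert (Hs0 : s <> 0%C) by apply Cexp_neq_0.
      assert (HE : e p / 2 <= Cmod (Ep (p, b))).
      { rewrite Cmod_sym in HX. assert (T := Cmod_triangle (RtoC (e p) - Ep (p, b)) (Ep (p, b))).
        replace (RtoC (e p) - Ep (p, b) + Ep (p, b))%C with (RtoC (e p)) in T by ring.
        rewrite Cmod_RtoC_pos in T by lra. nra. }
      assert (HE0 : Ep (p, b) <> 0%C). { intros Eq. rewrite Eq, Cmod_0 in HE. lra. }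
      set (D := C_derive (L lg) s) in *.
      assert (ED : D = (L lg s * (Ep (p, b) / s))%C). { rewrite <- LD. field. auto. }
      assert (EQ : (L lg s / D)%C = (s / Ep (p, b))%C). { rewrite ED. field. auto. }
      rewrite EQ in Q.
      assert (Eu : (u t * u t)%C = (RtoC (e p) / Ep (p, b))%C).
      { unfold u. fold b s. set (H := Cexp (- (Ci * (b / 2)%R))).
        replace (sq s * H * k * (sq s * H * k))%C with ((sq s * sq s) * (H * H) * (RtoC k * RtoC k))%C by ring.
        rewrite Q. replace (RtoC k * RtoC k)%C with (RtoC (e p / (2 * PI * exp p))) by (rewrite <- RtoC_mult, Hk2; auto).
        unfold s. rewrite Cexp_polar.
        replace (2 * PI * (exp p * Cexp (Ci * b) / Ep (p, b)) * (H * H) * RtoC (e p / (2 * PI * exp p)))%C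
          with (RtoC (2 * PI * exp p * (e p / (2 * PI * exp p))) * (H * H * Cexp (Ci * b)) / Ep (p, b))%C.
        2:{ rewrite !RtoC_mult. unfold Cdiv. ring. }
        unfold H. rewrite Half. replace (2 * PI * exp p * (e p / (2 * PI * exp p))) with (e p) by (field; lra).
        unfold Cdiv. ring. }
      rewrite Eu. replace (e p / Ep (p, b) - 1)%C with ((RtoC (e p) - Ep (p, b)) / Ep (p, b))%C by (field; auto).
      rewrite Cmod_div by auto. rewrite Cmod_sym. apply Rmult_le_reg_r with (Cmod (Ep (p, b))). lra.
      unfold Rdiv. rewrite Rmult_assoc, Rinv_l by lra. nra. }
  set (hh := hz Ps (Ph Ps Ep (p, th)) (p, th)).
  assert (EM : (sq (Cexp (p, th)) * Cexp hh)%C = (u 1 * leading Ps e (Ph Ps Ep (p, th)) p th)%C).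
  { unfold u, leading, amplitude. fold hh rN S. rewrite Rmult_1_l, Cexp_plus.
    set (q := sq (Cexp (p, th))). rewrite Cexp_polar. set (H := Cexp (- (Ci * (th / 2)%R))).
    replace (q * H * k * (exp p * Cexp (Ci * th) * Cexp hh * / rN * H * S))%C
      with (q * Cexp hh * (H * H * Cexp (Ci * th)) * (k * exp p * / rN * S))%C by ring.
    unfold H. rewrite Half. replace (k * exp p * / rN * S)%C with (RtoC 1). ring.
    assert (HrN : RtoC rN <> 0%C). { intros Eq. apply (f_equal Re) in Eq. rewrite !Re_RtoC in Eq. lra. }
    rewrite <- RtoC_inv by lra. rewrite <- !RtoC_mult. f_equal. unfold k. field. lra. }
  rewrite EM. set (ld := leading Ps e (Ph Ps Ep (p, th)) p th).
  replace (u 1 * ld - ld)%C with ((u 1 - 1) * ld)%C by ring. rewrite Cmod_mult.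
  apply Rmult_le_compat_r. apply Cmod_ge_0. lra.
Qed.
End MainTerm.

(** * Uniformity at infinity and the conclusion *)

(** Applied to Phi, it shows that a saddle point of bounded modulus forces log z to be bounded, so
    |s_z| tends to infinity uniformly as z does. *)
Lemma bounded_annular_sector (alpha0 c : R) (halpha0 : PI / 2 < alpha0 <= PI) (hc : 0 < c) (f : C -> C) (b rho R0 : R) :
  (forall s, wedge alpha0 c s -> ccont f s) -> b < alpha0 -> 0 < rho ->
  exists M, forall s, rho <= Cmod s <= R0 -> Rabs (Carg s) <= b -> Cmod (f s) <= M.
Proof.
  intros Hf Hb Hrho.
  destruct (bounded_rectangle (fun x y => Cmod (f (Cexp (x, y)))) (ln rho) (ln R0) (- b) b) as [M HM].
  - intros x y Hx Hy.
    assert (Hc2 : cont2 (fun x y => f (Cexp (RtoC x + RtoC y * Ci))) x y).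
    { apply (cont2_comp f (fun x y => Cexp (RtoC x + RtoC y * Ci))).
      - apply Hf, wedge_Cexp; auto. rewrite Im_plus, Im_mult, Im_RtoC, Re_RtoC, Im_RtoC.
        change (Im Ci) with 1. change (Re Ci) with 0.
        replace (0 + (y * 1 + 0 * 0)) with y by ring. apply Rabs_def1; lra.
      - apply (cont2_comp Cexp (fun x y => RtoC x + RtoC y * Ci)%C). eapply der_cont, cder_Cexp.
        apply cont2_plus. apply cont2_fst. apply cont2_mult. apply cont2_snd. apply cont2_const. }
    assert (Eq : forall u v : R, (RtoC u + RtoC v * Ci)%C = (u, v)) by (intros u v; apply Ceq; simpl; ring).
    destruct (Hc2 1 Rlt_0_1) as [d [Hd Q]]. exists d. split; auto. intros u v Hu Hv.
    specialize (Q u v Hu Hv). cbv beta in Q. rewrite !Eq in Q.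
    eapply Rle_lt_trans; [|exact Q]. apply Rabs_le.
    set (a1 := f (Cexp (u, v))). set (a2 := f (Cexp (x, y))).
    assert (T1 := Cmod_triangle (a1 - a2)%C a2). assert (T2 := Cmod_triangle (- (a1 - a2))%C a1).
    rewrite Cmod_opp in T2. replace (a1 - a2 + a2)%C with a1 in T1 by ring.
    replace (- (a1 - a2) + a1)%C with a2 in T2 by ring. lra.
  - exists M. intros s [H1 H2] Ha. assert (Hs : s <> 0%C). { intros Eq. rewrite Eq, Cmod_0 in H1. lra. }
    assert (L1 : ln rho <= ln (Cmod s)) by (apply ln_le; auto).
    assert (L2 : ln (Cmod s) <= ln R0) by (apply ln_le; lra).
    apply Rabs_le_between in Ha. specialize (HM _ _ (conj L1 L2) Ha). cbv beta in HM.
    change (ln (Cmod s), Carg s) with (Clog s) in HM. rewrite (Cexp_Clog s Hs) in HM.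
    eapply Rle_trans. apply Rle_abs. exact HM.
Qed.

(* The relative error absorbs the difference where the main term is at least 1, the absolute one elsewhere. *)
Lemma split_error (A : C -> Prop) (W Mn : C -> C) :
  (forall eta, 0 < eta -> exists M, forall z, A z -> M < Cmod z -> Cmod (W z - Mn z) <= eta * (1 + Cmod (Mn z))) ->
  exists o1 o2, vanishes_at_infinity_on A o1 /\ vanishes_at_infinity_on A o2 /\
    forall z, W z = ((1 + o1 z) * Mn z + o2 z)%C.
Proof.
  intros H. exists (fun z : C => if Rle_dec 1 (Cmod (Mn z)) then ((W z - Mn z) / Mn z)%C else RtoC 0).
  exists (fun z : C => if Rle_dec 1 (Cmod (Mn z)) then RtoC 0 else (W z - Mn z)%C). repeat split.
  - intros eta He. destruct (H (eta / 4) ltac:(lra)) as [M HM]. exists M. intros z Az Hz. specialize (HM z Az Hz).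
    destruct (Rle_dec 1 (Cmod (Mn z))) as [L|L].
    + assert (N : Mn z <> 0%C). { intros E0. rewrite E0, Cmod_0 in L. lra. }
      rewrite Cmod_div by auto. apply Rle_lt_trans with (eta / 2); [|lra].
      apply Rmult_le_reg_r with (Cmod (Mn z)). lra. unfold Rdiv at 1. rewrite Rmult_assoc, Rinv_l by lra. nra.
    + rewrite Cmod_0. auto.
  - intros eta He. destruct (H (eta / 4) ltac:(lra)) as [M HM]. exists M. intros z Az Hz. specialize (HM z Az Hz).
    destruct (Rle_dec 1 (Cmod (Mn z))) as [L|L].
    + rewrite Cmod_0. auto.
    + nra.
  - intros z. destruct (Rle_dec 1 (Cmod (Mn z))) as [L|L].
    + assert (N : Mn z <> 0%C). { intros E0. rewrite E0, Cmod_0 in L. lra. } field. auto.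
    + ring.
Qed.

Theorem theorem2 (alpha0 c : R) (gamma lg : C -> C)
  (halpha0 : PI / 2 < alpha0 <= PI) (hc : 0 < c)
  (hgamma : base_function alpha0 c gamma)
  (hlg : is_real_log_branch alpha0 c gamma lg)
  (hadm : admissible alpha0 lg)
  (hlimsup : Rbar_lt (LimSup_p_infty (epsR lg)) 2) :
  exists delta0 : R, 0 < delta0 /\
    forall delta : R, 0 < delta < delta0 ->
    forall rho0 : R, 0 < rho0 ->
      univalent_on (sectorS (PI / 2 + delta) rho0) (Phi lg) ->
      (forall s : C, sectorS (PI / 2 + delta) rho0 s -> Rabs (Im (Phi lg s)) < PI) ->
      (forall sq : C -> C, is_sqrt_branch lg (PI / 2 + delta) rho0 sq ->
         exists o1 o2 : C -> C,
           vanishes_at_infinity_on (Omega lg (PI / 2 + delta) rho0) o1 /\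
           vanishes_at_infinity_on (Omega lg (PI / 2 + delta) rho0) o2 /\
           forall z s : C, saddle_point lg (PI / 2 + delta) rho0 z s ->
             (z * E gamma z + 1 / gamma (RtoC 0) =
              (1 + o1 z) * sq s * Cexp (s * s * (C_derive (L lg) s / L lg s))
              + o2 z)%C) /\
      vanishes_at_infinity_on
        (fun z : C => ~ Omega lg (PI / 2 + delta) rho0 z)
        (fun z : C => (z * E gamma z + 1 / gamma (RtoC 0))%C).
Proof.
  assert (HPI := PI_RGT_0).
  destruct (lg_derivative alpha0 c gamma lg halpha0 hgamma hlg) as [phi [Dlg Sphi]].
  set (Ps := fun w => (lg (Cexp w) * Cexp (- w))%C).
  set (Ep := fun w => (phi (Cexp w) - Ps w)%C).
  assert (HPs : forall w, Ps w = (lg (Cexp w) * Cexp (- w))%C) by auto.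
  assert (HEp : forall w, Ep w = (phi (Cexp w) - Ps w)%C) by auto.
  destruct (setup_frame alpha0 c gamma lg halpha0 hc hlg phi Ps Ep hadm Dlg Sphi HPs HEp) as [Ep' Fr].
  set (La := fun x : R => Re (Ps x)) in Fr. set (e := fun x : R => Re (Ep x)) in Fr.
  set (e' := fun x : R => Re (Ep' x)) in Fr.
  assert (Hgam : forall s, wedge alpha0 c s -> Cexp (lg s) = gamma s).
  { intros s Hs. apply (log_exp _ _ _ _ hlg), angle_wedge; auto. }
  assert (Hq : exists q X0, 0 < q < 2 /\ forall x, X0 <= x -> e x <= q).
  { destruct (lim_sup_eventually _ _ hlimsup) as [q [r [Hq2 Hr]]].
    assert (Hx : forall x, ln (Rmax r 1 + 1) <= x -> e x <= q).
    { intros x Hx. apply exp_le_compat in Hx. assert (R1 := Rmax_l r 1). assert (R2 := Rmax_r r 1).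
      rewrite exp_ln in Hx by lra. specialize (Hr (exp x) ltac:(lra)). unfold epsR in Hr.
      destruct (L_log_derivative alpha0 c lg phi (RtoC (exp x)) Dlg) as [_ [Q _]].
      - apply wedge_real; auto. assert (H := exp_pos x). lra.
      - rewrite <- Cexp_RtoC. apply Cexp_neq_0.
      - rewrite Q, <- Cexp_RtoC in Hr. unfold e. rewrite HEp, HPs, Cexp_opp. exact Hr. }
    exists q, (ln (Rmax r 1 + 1)). split; auto. split; auto.
    eapply Rlt_le_trans. apply (fr_pos _ _ _ _ _ _ _ Fr (ln (Rmax r 1 + 1))). apply Hx. lra. }
  destruct Hq as [q [X0 [Hq He]]].
  (* Below c, to stay in the domain of gamma, and at most 1/4, for [kern_line]. *)
  set (cp := Rmin (c / 2) (1/4)).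
  assert (Hcp1 := Rmin_l (c / 2) (1/4)). assert (Hcp2 := Rmin_r (c / 2) (1/4)).
  assert (Hcp : 0 < cp) by (apply Rmin_pos; lra). fold cp in Hcp1, Hcp2.
  assert (Hcp3 : 0 < cp <= 1/4) by lra. assert (Hcpc : cp < c) by lra.
  (* With this bound PI/2 + delta does not exceed [B0]. *)
  exists ((alpha0 - PI / 2) / 2). split. lra.
  intros delta Hdelta rho0 Hrho Huni _.
  assert (HB : PI / 2 + delta <= B0 alpha0) by (unfold B0; lra).
  assert (HBa := B0_bounds _ _ _ _ _ _ _ Fr).
  assert (HBP : B0 alpha0 <= PI) by (unfold B0; lra).
  split.
  - intros sq Hsq.
    (* The error functions depend on z alone, so one saddle point is chosen for each z; univalence
       identifies it with any other. *)
    assert (Hch : exists sz : C -> C, forall z s, saddle_point lg (PI / 2 + delta) rho0 z s -> s = sz z).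
    { exists (fun z => epsilon (inhabits (RtoC 0)) (saddle_point lg (PI / 2 + delta) rho0 z)).
      intros z s Hs. assert (Q := epsilon_spec (inhabits (RtoC 0)) _ (ex_intro _ s Hs)).
      destruct Hs as [_ [S1 S2]]. destruct Q as [_ [S3 S4]]. apply Huni; auto. rewrite S2; symmetry; exact S4. }
    destruct Hch as [sz Hsz].
    destruct (split_error (Omega lg (PI / 2 + delta) rho0) (fun z => (z * E gamma z + 1 / gamma (RtoC 0))%C)
      (fun z => (sq (sz z) * Cexp (sz z * sz z * (C_derive (L lg) (sz z) / L lg (sz z))))%C)) as [o1 [o2 [O1 [O2 O3]]]].
    (* The bound 1/2 gives |ld| <= 2 |Mn|, after which the errors add up to at most eta1 (1 + 4
       |Mn|). *)
    + intros eta Heta. set (eta1 := Rmin (eta / 8) (1/2)).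
      assert (T1 := Rmin_l (eta / 8) (1/2)). assert (T2 := Rmin_r (eta / 8) (1/2)).
      assert (T3 : 0 < eta1) by (apply Rmin_pos; lra). fold eta1 in T1, T2.
      destruct (at_saddle alpha0 c halpha0 hc lg phi Ps Ep Ep' La e e' Fr Dlg Sphi HPs q X0 cp Hq He Hcp3 Hcpc
        gamma Hgam delta eta1 ltac:(lra) HB T3) as [X1 H1].
      destruct (sqrt_branch_main alpha0 c halpha0 hc lg phi Ps Ep Ep' La e e' Fr Dlg HPs HEp delta rho0 eta1 sq
        ltac:(lra) HB Hrho T3 Hsq) as [X2 H2].
      destruct (bounded_annular_sector alpha0 c halpha0 hc phi (PI / 2 + delta) rho0 (exp (Rmax X1 X2)) (Sphi O)
        ltac:(lra) Hrho) as [M HM].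
      exists (exp M). intros z [s Hs] Hz. rewrite <- (Hsz z s Hs). destruct Hs as [Hz0 [[Hs1 Hs2] Hs3]].
      assert (Hs0 : s <> 0%C). { intros Eq. rewrite Eq, Cmod_0 in Hs2. lra. }
      assert (EC := Cexp_Clog s Hs0). set (p := ln (Cmod s)) in *. set (th := Carg s) in *.
      change (Clog s) with (p, th) in EC.
      destruct (log_derivative_at alpha0 c halpha0 hc lg phi Ps Ep Dlg HPs HEp (p, th)) as [LD PD].
      { cbn [Im snd]. lra. }
      rewrite EC in LD, PD.
      (* A smaller saddle would lie in the bounded part of the sector where |Phi| <= M, so that ln
         |z| <= M, against |z| > exp M. *)
      assert (Hp : Rmax X1 X2 <= p).
      { apply Rnot_lt_le. intros Hlt.
        assert (Hsm : Cmod s <= exp (Rmax X1 X2)).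
        { rewrite <- (exp_ln (Cmod s)) by lra. apply exp_le_compat. unfold p in Hlt. lra. }
        specialize (HM s ltac:(lra) ltac:(unfold th in Hs1; lra)).
        assert (EP : Phi lg s = phi s). { rewrite PD. unfold Ph. rewrite HEp, EC. ring. }
        assert (L1 : ln (Cmod z) <= M).
        { change (ln (Cmod z)) with (Re (Clog z)). rewrite <- Hs3, EP. eapply Rle_trans. apply Rle_abs.
          eapply Rle_trans. apply re_le. exact HM. }
        apply exp_le_compat in L1. rewrite exp_ln in L1. lra. apply Cmod_gt_0. exact Hz0. }
      assert (Y1 := Rmax_l X1 X2). assert (Y2 := Rmax_r X1 X2).
      specialize (H1 z p th Hz0 ltac:(lra) ltac:(congruence) ltac:(lra)). cbv beta in H1.
      specialize (H2 p th ltac:(lra) Hs1). rewrite <- PD, Hs3, EC in H2.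
      assert (EM : (s * s * (C_derive (L lg) s / L lg s))%C = hz Ps (Clog z) (p, th)).
      { rewrite <- Hs3, PD, hz_saddle, EC, LD. field. exact Hs0. }
      rewrite EM. assert (EL := Cmod_leading _ _ _ _ _ _ _ Fr (Clog z) p th).
      set (W := (z * E gamma z + 1 / gamma (RtoC 0))%C) in *. set (ld := leading Ps e (Clog z) p th) in *.
      set (Mn := (sq s * Cexp (hz Ps (Clog z) (p, th)))%C) in *.
      set (A := Cmod (amplitude Ps (Clog z) p th) / rootN e p) in *.
      assert (HA : 0 <= A).
      { apply Rdiv_le_0_compat. apply Cmod_ge_0. apply (rootN_pos _ _ _ _ _ _ _ Fr). }
      assert (S1 : 1 <= sqrt (2 * PI)). { rewrite <- sqrt_1. apply sqrt_le_1_alt. assert (H := PI2_3_2). lra. }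
      assert (AL : A <= Cmod ld) by nra.
      assert (LM : Cmod ld <= 2 * Cmod Mn).
      { assert (T := Cmod_triangle (- (Mn - ld))%C Mn). rewrite Cmod_opp in T.
        replace (- (Mn - ld) + Mn)%C with ld in T by ring. nra. }
      replace (W - Mn)%C with ((W - ld) + - (Mn - ld))%C by ring.
      eapply Rle_trans. apply Cmod_triangle. rewrite Cmod_opp.
      assert (H3 : eta1 * (1 + A) <= eta1 * (1 + 2 * Cmod Mn)) by (apply Rmult_le_compat_l; lra).
      assert (H4 : eta1 * Cmod ld <= eta1 * (2 * Cmod Mn)) by (apply Rmult_le_compat_l; lra).
      assert (H5 := Cmod_ge_0 Mn). nra.
    + exists o1, o2. split; auto. split; auto. intros z s Hs. rewrite (O3 z), <- (Hsz z s Hs). ring.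
  - intros eta Heta.
    (* A saddle with Re w >= ln rho0 + 1 has modulus above rho0 and would put z in [Omega]. *)
    destruct (away_from_saddles alpha0 c halpha0 hc lg phi Ps Ep Ep' La e e' Fr Dlg Sphi HPs q X0 cp Hq He Hcp3 Hcpc
      gamma Hgam delta (eta / 2) (ln rho0 + 1) ltac:(lra) HB ltac:(lra)) as [M HM].
    exists (Rmax M 0). intros z Hz HMz. assert (Y1 := Rmax_l M 0). assert (Y2 := Rmax_r M 0).
    apply Rle_lt_trans with (eta / 2); [|lra].
    apply HM. lra. intros w Hw1 Hw2 Hw3. apply Hz. exists (Cexp w). split; [|split].
    + intros Eq. rewrite Eq, Cmod_0 in HMz. lra.
    + destruct w as [p th]. cbn [Re Im fst snd] in Hw1, Hw2. split. rewrite Rabs_Carg_Cexp; lra.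
      rewrite Cmod_Cexp. cbn [Re fst]. rewrite <- (exp_ln rho0) by auto. apply exp_increasing. lra.
    + destruct (log_derivative_at alpha0 c halpha0 hc lg phi Ps Ep Dlg HPs HEp w ltac:(lra)) as [_ PD].
      rewrite PD. exact Hw3.
Qed.
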